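(* Let $(X,B)$ be an $F$-pure surface pair over a perfect field of positive characteristic. Let $D$ be a $\mathbb{Z}$-divisor on $X$. Then, for any proper birational morphism $f\colon Y\to X$ from a normal variety $Y$, the restriction map $$f_{*}\Omega^{[i]}_Y(\log (f^{-1}_{*}\lfloor B\rfloor+E))(f^{*}D)\hookrightarrow \Omega^{[i]}_X(\log \lfloor B\rfloor)(D)$$ is an isomorphism for all $i\geq 0$, where $E$ is the reduced $f$-exceptional divisor.
   Context: A pair $(X,B)$ consists of a normal variety $X$ and an effective $\mathbb{Q}$-divisor $B$; a surface pair is one with $\dim X=2$. $(X,B)$ is $F$-pure if for every closed point $P\in X$ and every $e>0$ the map $\mathcal{O}_{X,P}\to F^e_*\mathcal{O}_X(\lfloor (p^e-1)B\rfloor)_P$ splits as an $\mathcal{O}_{X,P}$-module homomorphism, where $F$ is the absolute Frobenius and $p$ the characteristic. For a normal variety $X$, a reduced divisor $B'$ on $X$, a $\mathbb{Q}$-divisor $D$ on $X$ and $i\ge 0$, $\Omega_X^{[i]}(\log B')(D):=j_*(\Omega_U^i(\log B')\otimes\mathcal{O}_U(\lfloor D\rfloor))$, where $j\colon U\hookrightarrow X$ is the inclusion of the log smooth locus of $(X,B')$ (the largest open subset where $X$ is smooth and $B'$ has simple normal crossing support). $f^{-1}_*$ denotes strict transform, and $f^*D$ is the pullback of a Weil divisor on a normal surface in the sense of Mumford (a $\mathbb{Q}$-divisor on $Y$). *)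

(* Defs.v *)
(* Normal varieties, divisors and reflexive logarithmic differential forms, in
   the classical language of Zariski, Chevalley and Nagata (Zariski--Samuel,
   "Commutative Algebra" II, VI.17; EGA I, 8): an integral separated scheme of
   finite type over k with function field K is the set of its local rings
   O_{X,P}, each of them a subring of K.  A point P is identified with the
   subset O_{X,P} of K; the generic point is K itself ([setT]).  A birational
   morphism Y -> X is taken to be the identity on function fields, so that Y
   and X are sets of subrings of the same K; subsheaves of constant sheaves
   are described by their stalks. *)
From HB Require Import structures.
From mathcomp Require Import all_boot all_order all_algebra.
From mathcomp Require Import boolp classical_sets functions cardinality fsbigop.

Set Implicit Arguments.
Unset Strict Implicit.
Unset Printing Implicit Defensive.

Import Order.TTheory GRing.Theory Num.Theory.
Local Open Scope classical_set_scope.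
Local Open Scope ring_scope.

Section LocalRings.
Context {K : fieldType}.
Implicit Types (A O I p : set K) (x c : K) (s : seq K).

Definition is_subring A : Prop :=
  [/\ A 1, forall x y, A x -> A y -> A (x - y)
    & forall x y, A x -> A y -> A (x * y)].

Definition prime_ideal A p : Prop :=
  [/\ p `<=` A, p 0 /\ (forall x y, p x -> p y -> p (x + y)),
      forall a x, A a -> p x -> p (a * x), ~ p 1
    & forall a b, A a -> A b -> p (a * b) -> p a \/ p b].

Definition localization A p : set K :=
  [set x | exists a b, [/\ A a, A b, ~ p b & x = a / b]].

Definition Spec A : set (set K) :=
  [set O | exists2 p, prime_ideal A p & O = localization A p].

Definition is_unit O x : Prop := [/\ x != 0, O x & O x^-1].

(* The maximal ideal of a local ring O: its non-units. *)
Definition mideal O : set K := [set x | O x /\ ~ is_unit O x].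

(* R dominates O: the inclusion O -> R is a local homomorphism. *)
Definition dominates (R O : set K) : Prop := O `<=` R /\ mideal O `<=` mideal R.

Definition valuation_ring (R : set K) : Prop :=
  is_subring R /\ forall x, x != 0 -> R x \/ R x^-1.

Definition integrally_closed O : Prop :=
  forall (q : {poly K}) x,
    q \is monic -> (forall j, O q`_j) -> root q x -> O x.

Definition principal O c : set K := [set x | exists2 a, O a & x = c * a].

Definition ideal_gen O s : set K :=
  [set x | exists2 a : 'I_(size s) -> K, forall j, O (a j)
         & x = \sum_j a j * s`_j].

(* A minimal generating sequence of the maximal ideal; when O is a regular
   local ring, this is a regular system of parameters. *)
Definition parameters O s : Prop :=
  mideal O = ideal_gen O s /\
  forall s', mideal O = ideal_gen O s' -> (size s <= size s')%N.

(* The normalized valuation of a discrete valuation ring E (0 at x = 0; for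
   conditions on sections x = 0 is treated separately). *)
Definition ord (E : set K) x : int :=
  xget 0 [set n : int | exists2 t, mideal E = principal E t
                                 & is_unit E (x / t ^ n)].

End LocalRings.

Section Derivations.
Context {k K : fieldType} (iota : {rmorphism k -> K}).

(* [M] is an O-module; only the values [act a] with [a] in O matter. *)
Record module_over (O : set K) (M : zmodType) (act : K -> M -> M) : Prop := {
  act_addr : forall a u v, O a -> act a (u + v) = act a u + act a v;
  act_addl : forall a b u, O a -> O b -> act (a + b) u = act a u + act b u;
  act_mul : forall a b u, O a -> O b -> act (a * b) u = act a (act b u);
  act_one : forall u, act 1 u = u }.

(* k-derivations O -> M. *)
Record derivation (O : set K) (M : zmodType) (act : K -> M -> M)
    (delta : K -> M) : Prop := {
  der_add : forall a b, O a -> O b -> delta (a + b) = delta a + delta b;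
  der_mul : forall a b, O a -> O b ->
    delta (a * b) = act a (delta b) + act b (delta a);
  der_base : forall c, delta (iota c) = 0 }.

(* Omega_{O/k} is free with basis dx_1, ..., dx_n for some x_j in O; this is
   expressed through Hom_O (Omega_{O/k}, M) = Der_k (O, M).  For O local, a free
   Omega_{O/k} of finite rank has a basis of this form. *)
Definition Omega_free (O : set K) (n : nat) : Prop :=
  exists2 x : 'I_n -> K, forall j, O (x j) &
  forall (M : zmodType) (act : K -> M -> M), module_over O act ->
    (forall m : 'I_n -> M,
       exists2 delta, derivation O act delta & forall j, delta (x j) = m j) /\
    (forall delta delta', derivation O act delta -> derivation O act delta' ->
       (forall j, delta (x j) = delta' (x j)) ->
       forall a, O a -> delta a = delta' a).

Definition subst {i : nat} (b : 'I_i -> K) (j : 'I_i) (x : K) : 'I_i -> K :=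
  fun l => if l == j then x else b l.

Definition alt_derivation {i : nat} {V : lmodType K} (psi : ('I_i -> K) -> V)
  : Prop :=
  (forall b j, derivation setT (fun a (v : V) => a *: v)
                 (fun x => psi (subst b j x))) /\
  (forall b j l, j != l -> b j = b l -> psi b = 0).

(* (V, dw) is Omega^i_{K/k}, the i-th exterior power over K of the module of
   Kaehler differentials, where dw b = db_1 /\ ... /\ db_i: the universal
   alternating map which is a k-derivation in each variable. *)
Definition Kaehler_forms (i : nat) (V : lmodType K) (dw : ('I_i -> K) -> V)
  : Prop :=
  alt_derivation dw /\
  forall (W : lmodType K) (psi : ('I_i -> K) -> W), alt_derivation psi ->
    (exists u : {linear V -> W}, forall b, u (dw b) = psi b) /\
    (forall u u' : {linear V -> W},
       (forall b, u (dw b) = u' (dw b)) -> forall v, u v = u' v).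

End Derivations.

Section Varieties.
Context {k K : fieldType} (iota : {rmorphism k -> K}).
Implicit Types (X Y Z U : set (set K)) (O P Q E C : set K).

(* The subring k[s] of K. *)
Definition kgen (s : seq K) : set K :=
  [set x | forall A : set K, is_subring A -> (forall c, A (iota c)) ->
     (forall y, y \in s -> A y) -> A x].

(* Integral separated schemes of finite type over k with function field K: a
   nonempty finite union of sets Spec k[s] with Frac k[s] = K, such that each
   valuation ring of K has at most one center. *)
Definition variety X : Prop :=
  (exists S : seq (seq K),
     [/\ S <> [::],
         forall s, s \in S -> forall x, exists a b,
           [/\ kgen s a, kgen s b, b != 0 & x = a / b]
       & X = [set O | exists2 s, s \in S & Spec (kgen s) O]]) /\
  (forall R O O', valuation_ring R -> X O -> X O' ->
     dominates R O -> dominates R O' -> O = O').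

Definition normal_variety X : Prop :=
  variety X /\ forall O, X O -> integrally_closed O.

(* Q is in the closure of {P} iff Q `<=` P as subrings of K, so chains of
   points are chains of irreducible closed subsets. *)
Definition has_chain X (n : nat) : Prop :=
  exists c : nat -> set K, (forall j, (j <= n)%N -> X (c j)) /\
    forall j, (j < n)%N -> c j `<` c j.+1.

Definition dimension X (n : nat) : Prop := has_chain X n /\ ~ has_chain X n.+1.

(* The Zariski topology, with basis the sets of points at which finitely many
   given rational functions are regular. *)
Definition Zariski_open X U : Prop :=
  U `<=` X /\ forall O, U O -> exists2 s : seq K,
    (forall x, x \in s -> O x) &
    forall Q, X Q -> (forall x, x \in s -> Q x) -> U Q.

Definition closed_point X P : Prop :=
  X P /\ forall Q, X Q -> Q `<=` P -> Q = P.

(* Codimension one points, i.e. generic points of prime divisors; the prime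
   divisor E passes through P iff P `<=` E. *)
Definition prime_divisor X : set (set K) :=
  [set E | [/\ X E, E <> setT
             & forall Q, X Q -> E `<=` Q -> Q = E \/ Q = setT]].

(* Omega_{X/k} is free of rank dim X at P. *)
Definition smooth_at X P : Prop :=
  exists2 n, dimension X n & Omega_free iota P n.

Definition smooth X : Prop := forall P, X P -> smooth_at X P.

(* A divisor assigns a coefficient to each prime divisor, and 0 to all other
   subsets of K. *)
Definition Qdivisor X (D : set K -> rat) : Prop :=
  finite_set [set E | D E != 0] /\ forall E, D E != 0 -> prime_divisor X E.

Definition effective (D : set K -> rat) : Prop := forall E, 0 <= D E.

(* A reduced divisor is represented by its set of prime components. *)
Definition floor_components X (B : set K -> rat) : set (set K) :=
  [set E | prime_divisor X E /\ Num.floor (B E) != 0].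

(* The stalk at P of O_X(floor D). *)
Definition divisor_stalk X (D : set K -> rat) P : set K :=
  [set g | g = 0 \/ forall E, prime_divisor X E -> P `<=` E ->
                      0 <= ord E g + Num.floor (D E)].

(* phi is a splitting of O_P -> F^e_* O_X(floor ((p^e - 1) B))_P; the O_P-module
   structure on the target is (a, g) |-> a ^+ (p ^ e) * g. *)
Definition F_pure (p : nat) X (B : set K -> rat) : Prop :=
  forall P (e : nat), closed_point X P -> (0 < e)%N ->
  let L := divisor_stalk X (fun E => (p ^ e - 1)%N%:R * B E) P in
  exists phi : K -> K,
    [/\ forall g, L g -> P (phi g),
        forall g h, L g -> L h -> phi (g + h) = phi g + phi h,
        forall a g, P a -> L g -> phi (a ^+ (p ^ e) * g) = a * phi g
      & forall a, P a -> phi (a ^+ (p ^ e)) = a].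

(* The first conjunct says that the identity of K defines a morphism Y -> X,
   sending each point of Y to the point of X that it dominates; the second is
   the valuative criterion of properness. *)
Definition proper_birational Y X : Prop :=
  (forall Q, Y Q -> exists2 P, X P & dominates Q P) /\
  (forall R P, valuation_ring R -> X P -> dominates R P ->
     exists2 Q, Y Q & dominates R Q).

Definition preimage_open Y U : set (set K) :=
  [set Q | Y Q /\ exists2 P, U P & dominates Q P].

Definition exceptional Y X : set (set K) :=
  [set E | prime_divisor Y E /\
           forall P, X P -> dominates E P -> ~ prime_divisor X P].

(* A prime divisor and its strict transform have the same local ring. *)
Definition strict_transform Y (S : set (set K)) : set (set K) :=
  S `&` prime_divisor Y.

Definition quotient_dim O (I : set K) (n : nat) : Prop :=
  exists b : 'I_n -> K,
    [/\ forall j, O (b j),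
        forall x, O x -> exists c : 'I_n -> k,
          I (x - \sum_j iota (c j) * b j)
      & forall c : 'I_n -> k, I (\sum_j iota (c j) * b j) ->
          forall j, c j = 0].

(* The ideal of the prime divisor E in the local ring at P. *)
Definition ideal_at P E : set K := P `&` mideal E.

Definition local_intersection P C E : nat :=
  xget 0%N [set n | quotient_dim P
    [set x | exists2 y, ideal_at P C y & ideal_at P E (x - y)] n].

Definition curve_intersection Z C E : nat :=
  (\sum_(P \in [set P | [/\ closed_point Z P, P `<=` C & P `<=` E]])
     local_intersection P C E)%N.

(* (N . E) on a smooth surface, for E proper over k: the degree over k of
   O_Z(N) restricted to E.  With ord_E h = 1, the divisor N - (N E) div h is
   numerically equivalent to N and does not contain E. *)
Definition intersection_number Z (N : set K -> rat) E (r : rat) : Prop :=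
  exists2 h : K, h != 0 /\ ord E h = 1 &
  r = \sum_(C \in [set C | prime_divisor Z C /\ C <> E])
        (N C - N E * (ord C h)%:~R) * (curve_intersection Z C E)%:R.

Definition pushforward Y (N : set K -> rat) : set K -> rat :=
  fun E => if `[< prime_divisor Y E >] then N E else 0.

(* Mumford's pullback along f : Y -> X: on a resolution g : Z -> Y, N is the
   divisor with strict transform part that of D and with zero intersection
   number with every curve contracted by Z -> X; then f^*D = g_*N. *)
Definition Mumford_pullback Y X (D M : set K -> rat) : Prop :=
  exists Z (N : set K -> rat),
    [/\ variety Z /\ smooth Z, proper_birational Z Y, Qdivisor Z N,
        (forall E, prime_divisor Z E -> ~ exceptional Z X E -> N E = D E) /\
        (forall E, exceptional Z X E -> intersection_number Z N E 0)
      & M = pushforward Y N].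

Definition local_equation P E (c : K) : Prop :=
  P `<=` E /\ ideal_at P E = principal P c.

(* P lies in the log smooth locus of (X, S), S a reduced divisor. *)
Definition log_smooth_at X (S : set (set K)) P : Prop :=
  smooth_at X P /\
  exists2 s, parameters P s &
    forall E, S E -> P `<=` E -> exists2 c, c \in s & local_equation P E c.

Section Forms.
Context {i : nat} {V : lmodType K} (dw : ('I_i -> K) -> V).

(* Wedge products of i factors, each of them either db with b in O_P, or
   dc / c with c a local equation at P of a component of S. *)
Definition log_generator (S : set (set K)) P : set V :=
  [set w | exists b g : 'I_i -> K,
     (forall j, (g j = 1 /\ P (b j)) \/
                (g j = (b j)^-1 /\ exists2 E, S E & local_equation P E (b j)))
     /\ w = (\prod_j g j) *: dw b].

(* The stalk at P of Omega^i(log S) (x) O(floor D), for P log smooth. *)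
Definition log_form_stalk X (S : set (set K)) (D : set K -> rat) P : set V :=
  [set w | exists n (h : 'I_n -> K) (g : 'I_n -> V),
     (forall j, divisor_stalk X D P (h j) /\ log_generator S P (g j))
     /\ w = \sum_j h j *: g j].

(* Sections over U of Omega_X^[i](log S)(D); U is meant to be nonempty. *)
Definition reflexive_log_forms X (S : set (set K)) (D : set K -> rat) U
  : set V :=
  [set w | forall P, U P -> log_smooth_at X S P -> log_form_stalk X S D P w].

End Forms.
End Varieties.

(* Main.v *)
Require Import Defs.
From HB Require Import structures.
From mathcomp Require Import all_boot all_order all_algebra.
From mathcomp Require Import boolp classical_sets functions cardinality fsbigop.
From mathcomp Require Import ring lra zify.

Set Implicit Arguments.
Unset Strict Implicit.
Unset Printing Implicit Defensive.

Import Order.TTheory GRing.Theory Num.Theory.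
Local Open Scope classical_set_scope.
Local Open Scope ring_scope.

(** F-purity at a closed point P gives a splitting [phi = Tr (c .)] of Frobenius, [Tr] being the
    trace form of a p-basis.  Through [phi] every rational form w lifts to a form sigma w with
    [lam w = Tr (lam (sigma w))] for the coordinates [lam] (an inverse Cartier operator), and
    sigma takes log forms on X with values in D to log forms with values in p D.  Along an
    exceptional E, up to a fixed multiplier, the coordinates of sigma^e w are sections of p^e D
    near P, so of order at least - p^e f^*D by negativity; [Tr] applied e times divides pole
    orders by p^e, and for large e the pole order of w in a log frame at E is at most f^*D.

    Negativity reduces to the degree zero of a rational function f / g on E: the products
    [f ^ j * g ^ (N - j)] span spaces of dimension linear in N, and comparing the slopes at the
    zeros and poles shows that there are as many of both. *)

(** On functions sigma is the p-th power, and on top forms c times the p-th power of the coordinate;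
    the obstacle is degree one. There w is read as the derivation sending g to dg /\ w over the
    volume form. Its p-th iterate is again a derivation, but not p-linear in w, so rescaling would
    create poles. The adjoint of the derivation under phi supplies a correcting multiple:
    Hochschild's formula makes the sum p-linear, and Jacobson's formula shows that phi recovers w.
    Since phi alone determines the lift, it can be checked at each prime divisor of X in coordinates
    adapted to that divisor, although the estimate at E uses one fixed frame at E.

    Adapted coordinates exist on every model because [K : K^p] = p^2 is a birational invariant:
    regular parameters at a smooth closed point, or a uniformizer and a suitable unit at a prime
    divisor, form a p-basis of the local ring.

    In the negativity argument E may be singular and k need not be algebraically closed. Degrees are
    therefore lengths over k, taken on the local rings of E itself. *)

Lemma zorn_above (T : Type) (P : set (set T)) (A0 : set T) : P A0 ->
  (forall F : set (set T), F !=set0 -> F `<=` P -> total_on F subset ->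
      P (\bigcup_(X in F) X)) ->
  exists A, [/\ P A, A0 `<=` A & forall B, P B -> A `<=` B -> B = A].
Proof.
(* [Zorn_bigcup] also ranges over the empty chain and gives no lower bound; adding [A0] to every set
   settles both. *)
move=> PA0 chain; pose Q (A : set T) := P (A0 `|` A).
have [F FQ Ftot|A [QA maxA]] := @Zorn_bigcup T Q.
  have [F0|/eqP/set0P [X0 FX0]] := pselect (F = set0).
    by rewrite F0 /Q bigcup_set0 setU0.
  rewrite /Q (_ : A0 `|` _ = \bigcup_(Y in [set A0 `|` X | X in F]) Y); last first.
    apply/seteqP; split=> [x [A0x|[X FX Xx]]|x [_ [X FX <-] [A0x|Xx]]].
    - by exists (A0 `|` X0); [exists X0|left].
    - by exists (A0 `|` X); [exists X|right].
    - by left.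
    - by right; exists X.
  apply: chain; first by exists (A0 `|` X0), X0.
    by move=> _ [X FX <-]; exact: FQ.
  move=> _ _ [X FX <-] [Y FY <-]; case: (Ftot _ _ FX FY) => XY; [left|right];
    exact: setUS.
exists (A0 `|` A); split; [exact: QA|by move=> x; left|].
move=> B PB AB; apply/seteqP; split => //.
apply: contrapT => BA; apply: (maxA B).
  by split=> [x Ax|BsA]; [apply: AB; right|apply: BA => x /BsA; right].
by rewrite /Q (_ : A0 `|` B = B) //; apply/setUidPr => x A0x; apply: AB; left.
Qed.

(** * Submodules of a field over a subring, and Noetherian subrings *)

Section Subrings.
Context {K : fieldType}.
Implicit Types (A B I J M : set K) (x y a b : K) (s : seq K).

Section Closure.
Variables (A : set K) (hA : is_subring A).

Lemma sr1 : A 1. Proof. by case: hA. Qed.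
Lemma srB x y : A x -> A y -> A (x - y). Proof. by case: hA => _ h _; exact: h. Qed.
Lemma srM x y : A x -> A y -> A (x * y). Proof. by case: hA => _ _; exact. Qed.
Lemma sr0 : A 0. Proof. by rewrite -(subrr 1); apply: srB; exact: sr1. Qed.
Lemma srN x : A x -> A (- x).
Proof. by move=> Ax; rewrite -sub0r; apply: srB => //; exact: sr0. Qed.
Lemma srD x y : A x -> A y -> A (x + y).
Proof. by move=> Ax Ay; rewrite -[y]opprK; apply: srB => //; exact: srN. Qed.
Lemma srX x n : A x -> A (x ^+ n).
Proof. by move=> Ax; elim: n => [|n IHn]; [exact: sr1|rewrite exprS; exact: srM]. Qed.
Lemma sr_sum T (r : seq T) (P : pred T) (F : T -> K) :
  (forall i, P i -> A (F i)) -> A (\sum_(i <- r | P i) F i).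
Proof. by move=> h; elim/big_ind: _ => //; [exact: sr0|exact: srD]. Qed.
Lemma sr_prod T (r : seq T) (P : pred T) (F : T -> K) :
  (forall i, P i -> A (F i)) -> A (\prod_(i <- r | P i) F i).
Proof. by move=> h; elim/big_ind: _ => //; [exact: sr1|exact: srM]. Qed.
Lemma srMn x n : A x -> A (x *+ n).
Proof. by move=> Ax; elim: n => [|n IHn]; rewrite ?mulr0n ?mulrS; [exact: sr0|exact: srD]. Qed.
Lemma sr_nat n : A n%:R. Proof. by apply: srMn; exact: sr1. Qed.

End Closure.

Definition submod A M :=
  [/\ M 0, forall x y, M x -> M y -> M (x + y) & forall a x, A a -> M x -> M (a * x)].

Definition idl A I := submod A I /\ I `<=` A.

Definition mspan A (G : set K) : set K :=
  [set x | forall M, submod A M -> G `<=` M -> M x].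

Definition noeth A := forall I, idl A I -> exists s, I = mspan A [set` s].

Section Submod.
Variables (A : set K) (hA : is_subring A).

Lemma submodN M x : submod A M -> M x -> M (- x).
Proof.
move=> [_ _ h] Mx; rewrite -mulN1r; apply: h => //.
by apply: (srN hA); exact: sr1.
Qed.

Lemma submodB M x y : submod A M -> M x -> M y -> M (x - y).
Proof. by move=> hM Mx My; case: (hM) => _ h _; apply: h => //; exact: submodN. Qed.

Lemma submod_sum M T (r : seq T) (P : pred T) (F : T -> K) : submod A M ->
  (forall i, P i -> M (F i)) -> M (\sum_(i <- r | P i) F i).
Proof. by case=> h0 hD _ h; elim/big_ind: _. Qed.

Lemma mspanS G : submod A (mspan A G).
Proof.
split=> [M [] //|x y hx hy M hM GM|a x Aa hx M hM GM].
  by case: (hM) => _ h _; apply: h; [exact: hx|exact: hy].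
by case: (hM) => _ _ h; apply: h => //; exact: hx.
Qed.

Lemma sub_mspan (G : set K) x : G x -> mspan A G x.
Proof. by move=> Gx M _; exact. Qed.

Lemma mspan_le (G H : set K) : G `<=` mspan A H -> mspan A G `<=` mspan A H.
Proof. by move=> GH x; apply => //; exact: mspanS. Qed.

Lemma mspan_sub (G M : set K) : submod A M -> G `<=` M -> mspan A G `<=` M.
Proof. by move=> hM GM x; exact. Qed.

Lemma self_idl : idl A A.
Proof.
by split=> //; split=> [|x y|a x]; [exact: sr0|exact: srD|exact: srM].
Qed.

Lemma idl1 I : idl A I -> I 1 -> I = A.
Proof.
move=> [[_ _ hI] IA] I1; apply/seteqP; split=> // x Ax.
by rewrite -(mulr1 x); exact: hI.
Qed.

Lemma principalI x : A x -> idl A (principal A x).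
Proof.
move=> Ax; split; last by move=> _ [a Aa ->]; exact: srM.
split.
- by exists 0; rewrite ?mulr0 //; exact: sr0.
- by move=> _ _ [a Aa ->] [b Ab ->]; exists (a + b); rewrite ?mulrDr //; exact: srD.
- by move=> c _ Ac [a Aa ->]; exists (c * a); [exact: srM|rewrite mulrCA].
Qed.

Definition idlD I J : set K := [set x | exists a b, [/\ I a, J b & x = a + b]].

Lemma submodD_add I J : submod A I -> submod A J -> submod A (idlD I J).
Proof.
move=> [I0 ID IM] [J0 JD JM]; split.
- by exists 0, 0; rewrite addr0.
- move=> _ _ [a [b [Ia Jb ->]]] [c [d [Ic Jd ->]]]; exists (a + c), (b + d).
  by split; [exact: ID|exact: JD|rewrite addrACA].
- move=> r _ Ar [a [b [Ia Jb ->]]]; exists (r * a), (r * b).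
  by rewrite mulrDr; split=> //; [exact: IM|exact: JM].
Qed.

Lemma idl_add I J : idl A I -> idl A J -> idl A (idlD I J).
Proof.
move=> [hI IA] [hJ JA]; split; first exact: submodD_add.
by move=> _ [a [b [/IA Aa /JA Ab ->]]]; exact: srD.
Qed.

Lemma idlDl I J : submod A J -> I `<=` idlD I J.
Proof. by case=> J0 _ _ x Ix; exists x, 0; rewrite addr0. Qed.
Lemma idlDr I J : submod A I -> J `<=` idlD I J.
Proof. by case=> I0 _ _ x Ix; exists 0, x; rewrite add0r. Qed.

Lemma mspan_cat s s' : mspan A [set` s] `<=` mspan A [set` s ++ s'].
Proof. by apply: mspan_le => x /= xs; apply: sub_mspan; rewrite /= mem_cat xs. Qed.
Lemma mspan_catr s s' : mspan A [set` s'] `<=` mspan A [set` s ++ s'].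
Proof. by apply: mspan_le => x /= xs; apply: sub_mspan; rewrite /= mem_cat xs orbT. Qed.

(** The union of a chain of ideals is finitely generated, and the finitely many generators already
    lie in one member. *)
Lemma noeth_max (F : set (set K)) (I0 : set K) : noeth A -> F I0 -> F `<=` idl A ->
  exists I, [/\ F I, I0 `<=` I & forall J, F J -> I `<=` J -> J = I].
Proof.
move=> nA FI0 Fid; apply: zorn_above FI0 _ => C [X0 CX0] CF Ctot.
have hU : idl A (\bigcup_(X in C) X).
  split; last by move=> x [X /CF/Fid [_ XA] /XA].
  split.
  - by exists X0 => //; case: (Fid _ (CF _ CX0)) => -[].
  - move=> x y [X CX Xx] [Y CY Yy]; case: (Ctot _ _ CX CY) => XY.
      by exists Y => //; case: (Fid _ (CF _ CY)) => -[_ h _] _; apply: h => //; exact: XY.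
    by exists X => //; case: (Fid _ (CF _ CX)) => -[_ h _] _; apply: h => //; exact: XY.
  - move=> a x Aa [X CX Xx]; exists X => //.
    by case: (Fid _ (CF _ CX)) => -[_ _ h] _; exact: h.
have [s es] := nA _ hU.
have [X CX sX] : exists2 X, C X & [set` s] `<=` X.
  have : [set` s] `<=` \bigcup_(X in C) X by rewrite es => x; exact: sub_mspan.
  elim: s {es} => [|a s IHs] sub; first by exists X0.
  have [|X CX sX] := IHs; first by move=> x /= xs; apply: sub; rewrite /= inE xs orbT.
  have [|Y CY Ya] := sub a; first by rewrite /= inE eqxx.
  case: (Ctot _ _ CX CY) => XY; [exists Y|exists X] => // x; rewrite /= inE => /orP[/eqP->//|/sX//].
  - exact: XY.
  - exact: XY.
suff -> : \bigcup_(X in C) X = X by exact: CF.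
apply/seteqP; split; last by move=> x Xx; exists X.
by rewrite es; apply: mspan_sub sX; case: (Fid _ (CF _ CX)).
Qed.

Lemma noeth_acc (I : nat -> set K) : noeth A -> (forall n, idl A (I n)) ->
  (forall n, I n `<=` I n.+1) -> exists n, I n.+1 = I n.
Proof.
move=> nA hI incr.
have [J [[n _ <-] _ maxJ]] := @noeth_max [set I n | n in setT] (I 0%N) nA
  (ex_intro2 _ _ 0%N Logic.I erefl) (fun _ => (fun '(ex_intro2 n _ e) =>
     eq_ind _ (idl A) (hI n) _ e)).
by exists n; apply: maxJ => //; exists n.+1.
Qed.

End Submod.
Implicit Types (p q : {poly K}).

Definition polyin A p := forall j, A p`_j.

Definition adj A x : set K := [set y | exists2 p, polyin A p & y = p.[x]].

Section Polyin.
Variables (A : set K) (hA : is_subring A).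

Lemma polyin0 : polyin A 0.
Proof. by move=> j; rewrite coef0; exact: sr0. Qed.
Lemma polyinC a : A a -> polyin A a%:P.
Proof. by move=> Aa j; rewrite coefC; case: eqP => // _; exact: sr0. Qed.
Lemma polyinD p q : polyin A p -> polyin A q -> polyin A (p + q).
Proof. by move=> Ap Aq j; rewrite coefD; exact: srD. Qed.
Lemma polyinN p : polyin A p -> polyin A (- p).
Proof. by move=> Ap j; rewrite coefN; exact: srN. Qed.
Lemma polyinB p q : polyin A p -> polyin A q -> polyin A (p - q).
Proof. by move=> Ap Aq; apply: polyinD => //; exact: polyinN. Qed.
Lemma polyinM p q : polyin A p -> polyin A q -> polyin A (p * q).
Proof. by move=> Ap Aq j; rewrite coefM; apply: sr_sum => // i _; exact: srM. Qed.
Lemma polyinXn n : polyin A 'X^n.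
Proof. by move=> j; rewrite coefXn; case: eqP => _; [exact: sr1|exact: sr0]. Qed.
Lemma polyinX : polyin A 'X.
Proof. by rewrite -['X]expr1; exact: polyinXn. Qed.
Lemma polyinE p n : polyin A p -> polyin A (p ^+ n).
Proof.
by move=> Ap; elim: n => [|n IHn]; [exact: (polyinC (sr1 hA))|rewrite exprS; exact: polyinM].
Qed.
Lemma polyinZ a p : A a -> polyin A p -> polyin A (a *: p).
Proof. by move=> Aa Ap; rewrite -mul_polyC; apply: polyinM => //; exact: polyinC. Qed.
Lemma polyin_horner p x : polyin A p -> A x -> A p.[x].
Proof.
by move=> Ap Ax; rewrite horner_coef; apply: sr_sum => // i _; apply: srM => //; exact: srX.
Qed.

Lemma adj_sr x : is_subring (adj A x).
Proof.
split.
- by exists 1; [exact: (polyinC (sr1 hA))|rewrite hornerC].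
- by move=> _ _ [p Ap ->] [q Aq ->]; exists (p - q); [exact: polyinB|rewrite hornerD hornerN].
- by move=> _ _ [p Ap ->] [q Aq ->]; exists (p * q); [exact: polyinM|rewrite hornerM].
Qed.

Lemma sub_adj x : A `<=` adj A x.
Proof. by move=> a Aa; exists a%:P; [exact: polyinC|rewrite hornerC]. Qed.

Lemma adj_gen x : adj A x x.
Proof. by exists 'X; [exact: polyinX|rewrite hornerX]. Qed.

Lemma adj_min x B : is_subring B -> A `<=` B -> B x -> adj A x `<=` B.
Proof.
move=> hB AB Bx _ [p Ap ->]; rewrite horner_coef; apply: sr_sum => // i _.
by apply: srM => //; [apply: AB|exact: srX].
Qed.

End Polyin.

(* Hilbert's basis theorem: [lc n] is the ideal of coefficients in degree n of
   the polynomials of degree at most n whose value at x is in I. *)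
Lemma noeth_adj A x : is_subring A -> noeth A -> noeth (adj A x).
Proof.
move=> hA nA I [hI IA]; have hAx := adj_sr hA x.
pose lcM (M : set K) n := [set a | exists q, [/\ polyin A q, (size q <= n.+1)%N, M q.[x] & q`_n = a]].
have lc_sub M n : submod (adj A x) M -> submod A (lcM M n).
  case=> M0 MD MM; split.
  - by exists 0; rewrite size_poly0 horner0 coef0; split=> //; exact: polyin0.
  - move=> _ _ [p [Ap sp Mp <-]] [q [Aq sq Mq <-]]; exists (p + q).
    rewrite coefD hornerD; split=> //; first exact: polyinD.
      by rewrite (leq_trans (size_polyD _ _)) // geq_max sp.
    exact: MD.
  - move=> a _ Aa [p [Ap sp Mp <-]]; exists (a *: p); rewrite coefZ hornerZ; split=> //.
    + exact: polyinZ.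
    + by rewrite (leq_trans (size_scale_leq _ _)).
    + by apply: MM => //; exact: sub_adj.
have lc_le M n : submod (adj A x) M -> lcM M n `<=` lcM M n.+1.
  case=> M0 MD MM _ [p [Ap sp Mp <-]]; exists (p * 'X); split.
  - by apply: polyinM => //; exact: polyinX.
  - by rewrite (leq_trans (size_polyMleq _ _)) // size_polyX addn2.
  - by rewrite hornerMX mulrC; apply: MM => //; exact: adj_gen.
  - by rewrite coefMX.
have lc_idl n : idl A (lcM I n).
  by split; [exact: lc_sub|move=> _ [p [Ap _ _ <-]]; exact: Ap].
have [_ [[N _ <-] _ maxN]] := @noeth_max A [set lcM I n | n in setT] (lcM I 0%N) nA
  (ex_intro2 _ _ 0%N Logic.I erefl) (fun _ => (fun '(ex_intro2 n _ e) =>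
     eq_ind _ (idl A) (lc_idl n) _ e)).
have lcN d : lcM I (N + d)%N = lcM I N.
  apply: maxN; first by exists (N + d)%N.
  elim: d => [|d IHd]; rewrite ?addn0 // addnS => a /IHd; exact: lc_le.
have gens n : exists s, [set` s] `<=` I /\ lcM I n `<=` lcM (mspan (adj A x) [set` s]) n.
  have [t et] := nA _ (lc_idl n).
  have tin : [set` t] `<=` lcM I n by rewrite et => a; exact: sub_mspan.
  suff [s [sI ts]] : exists s, [set` s] `<=` I /\
      [set` t] `<=` lcM (mspan (adj A x) [set` s]) n.
    by exists s; split=> //; rewrite et; apply: mspan_sub ts; apply: lc_sub; exact: mspanS.
  elim: t tin {et} => [|a t IHt] tin; first by exists [::]; split=> // y; rewrite /= in_nil.
  have [|s [sI ts]] := IHt; first by move=> y yt; apply: tin; rewrite /= inE yt orbT.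
  have [q [Aq sq Iq qa]] : lcM I n a by apply: tin; rewrite /= inE eqxx.
  exists (q.[x] :: s); split; first by move=> y; rewrite /= inE => /orP[/eqP->|/sI].
  move=> y; rewrite /= inE => /orP[/eqP->|/ts [q' [Aq' sq' Iq' qa']]].
    by exists q; split=> //; apply: sub_mspan; rewrite /= inE eqxx.
  exists q'; split=> //; move: Iq'; apply: mspan_le => z zs.
  by apply: sub_mspan; rewrite /= inE zs orbT.
have [s [sI hs]] : exists s, [set` s] `<=` I /\
    forall n, (n <= N)%N -> lcM I n `<=` lcM (mspan (adj A x) [set` s]) n.
  elim: N {maxN lcN} => [|N [s [sI hs]]].
    have [s [sI hs]] := gens 0%N; exists s; split=> // n; rewrite leqn0 => /eqP->//.
  have [t [tI ht]] := gens N.+1; exists (s ++ t); split.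
    by move=> y; rewrite /= mem_cat => /orP[/sI|/tI].
  have mono (u v : seq K) n : mspan (adj A x) [set` u] `<=` mspan (adj A x) [set` v] ->
      lcM (mspan (adj A x) [set` u]) n `<=` lcM (mspan (adj A x) [set` v]) n.
    by move=> uv _ [q [Aq sq Mq <-]]; exists q; split=> //; exact: uv.
  move=> n; rewrite leq_eqVlt => /orP[/eqP->|nN] a.
    by move=> /ht; apply: mono; exact: mspan_catr.
  by move=> /(hs n nN); apply: mono; exact: mspan_cat.
set M := mspan (adj A x) [set` s] in hs.
have hM : submod (adj A x) M by exact: mspanS.
have hs' n : lcM I n `<=` lcM M n.
  case: (leqP n N) => [/hs//|/ltnW/subnKC <-]; rewrite lcN => a /(hs _ (leqnn N)).
  elim: (n - N)%N => [|d IHd]; rewrite ?addn0 // addnS => /IHd; exact: lc_le.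
exists s; apply/seteqP; split; last exact: mspan_sub.
suff claim m q : (size q <= m)%N -> polyin A q -> I q.[x] -> M q.[x].
  by move=> y Iy; have [q Aq ey] := IA _ Iy; rewrite ey; apply: (claim (size q)) => //; rewrite -ey.
elim: m q => [|m IHm] q sq Aq Iq.
  by move: sq; rewrite leqn0 size_poly_eq0 => /eqP->; rewrite horner0; case: hM.
(* An element of I minus an element of M with the same coefficient in degree m is the value of a
   polynomial of smaller size. *)
have [|q' [Aq' sq' Mq' eq']] := hs' m q`_m; first by exists q.
rewrite -(subrK q' q) hornerD; case: (hM) => _ MD _; apply: (MD) => //.
apply: IHm.
- apply/leq_sizeP => j; rewrite leq_eqVlt => /orP[/eqP<-|mj].
    by rewrite coefB eq' subrr.
  by rewrite coefB !nth_default ?subrr // (leq_trans _ mj).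
- exact: polyinB.
- rewrite hornerD hornerN; apply: (submodB hAx) => //.
  by apply: mspan_sub Mq' => // z /sI.
Qed.

End Subrings.

(** * Localization at a prime ideal *)

Section Localization.
Context {K : fieldType}.
Implicit Types (A O I M p q : set K) (x y a b : K) (s : seq K).

Section Loc.
Variables (A p : set K) (hA : is_subring A) (hp : prime_ideal A p).

Lemma prime_idl : idl A p.
Proof. by case: hp => pA [p0 pD] pM _ _; split. Qed.
Lemma prime_n1 : ~ p 1. Proof. by case: hp. Qed.
Lemma prime_sub : p `<=` A. Proof. by case: hp. Qed.
Lemma prime0 : p 0. Proof. by case: hp => _ []. Qed.
Lemma primeD x y : p x -> p y -> p (x + y). Proof. by case: hp => _ [_ h] _ _ _; exact: h. Qed.
Lemma primeMl a x : A a -> p x -> p (a * x). Proof. by case: hp => _ _ h _ _; exact: h. Qed.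
Lemma primeMr a x : A a -> p x -> p (x * a). Proof. by rewrite mulrC; exact: primeMl. Qed.
Lemma primeN x : p x -> p (- x).
Proof. by move=> px; apply: (submodN hA) => //; case: prime_idl. Qed.
Lemma primeB x y : p x -> p y -> p (x - y).
Proof. by move=> px py; apply: primeD => //; exact: primeN. Qed.
Lemma primeP a b : A a -> A b -> p (a * b) -> p a \/ p b.
Proof. by case: hp => _ _ _ _ h; exact: h. Qed.
Lemma prime_nM a b : A a -> A b -> ~ p a -> ~ p b -> ~ p (a * b).
Proof. by move=> Aa Ab na nb /(primeP Aa Ab) []. Qed.
Lemma prime_nX a n : A a -> ~ p a -> ~ p (a ^+ n).
Proof.
move=> Aa na; elim: n => [|n IHn]; first exact: prime_n1.
by rewrite exprS; apply: prime_nM => //; exact: srX.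
Qed.
Lemma primeX a n : A a -> p (a ^+ n) -> p a.
Proof. by move=> Aa pan; apply: contrapT => na; exact: (prime_nX Aa na pan). Qed.
Lemma prime_nz b : ~ p b -> b != 0.
Proof. by move=> nb; apply/eqP => b0; apply: nb; rewrite b0; exact: prime0. Qed.
Lemma loc_sub : A `<=` localization A p.
Proof. by move=> a Aa; exists a, 1; rewrite divr1; split=> //; [exact: sr1|exact: prime_n1]. Qed.

Lemma loc_sr : is_subring (localization A p).
Proof.
split; first by apply: loc_sub; exact: sr1.
- move=> _ _ [a [b [Aa Ab nb ->]]] [c [d [Ac Ad nd ->]]].
  exists (a * d - c * b), (b * d); split.
  + by apply: srB => //; exact: srM.
  + exact: srM.
  + exact: prime_nM.
  + by field; rewrite !prime_nz.
- move=> _ _ [a [b [Aa Ab nb ->]]] [c [d [Ac Ad nd ->]]].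
  exists (a * c), (b * d); split.
  + exact: srM.
  + exact: srM.
  + exact: prime_nM.
  + by field; rewrite !prime_nz.
Qed.

Lemma loc_inv b : A b -> ~ p b -> localization A p b^-1.
Proof. by move=> Ab nb; exists 1, b; rewrite div1r; split=> //; exact: sr1. Qed.

Lemma loc_div a b : A a -> A b -> ~ p b -> localization A p (a / b).
Proof. by move=> Aa Ab nb; exists a, b. Qed.

Lemma loc_unitP x : is_unit (localization A p) x <->
  exists a b, [/\ A a, A b, ~ p a, ~ p b & x = a / b].
Proof.
split=> [[x0 [a [b [Aa Ab nb ex]]] [c [d [Ac Ad nd ex']]]]|[a [b [Aa Ab na nb ->]]]].
  exists a, b; split=> // pa; have : p (b * d).
    suff -> : b * d = a * c by exact: primeMr.
    have b0 := prime_nz nb; have d0 := prime_nz nd.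
    have := mulfV x0; rewrite ex' ex => /(congr1 (fun z => z * (b * d))); rewrite mul1r => <-.
    by field; rewrite ?b0 ?d0.
  exact: prime_nM.
split; [|exact: loc_div|by rewrite invf_div; exact: loc_div].
by rewrite mulf_neq0 ?invr_eq0 ?prime_nz.
Qed.

Lemma loc_mideal x : mideal (localization A p) x <->
  exists a b, [/\ p a, A b, ~ p b & x = a / b].
Proof.
split=> [[[a [b [Aa Ab nb ->]]] nu]|[a [b [pa Ab nb ex]]]].
  exists a, b; split=> //; apply: contrapT => na; apply: nu; apply/loc_unitP.
  by exists a, b.
split; first by rewrite ex; apply: loc_div => //; exact: prime_sub.
move=> /loc_unitP [c [d [Ac Ad nc nd ex']]].
apply: (prime_nM Ac Ab nc nb); suff -> : c * b = a * d by exact: primeMr.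
have b0 := prime_nz nb; have d0 := prime_nz nd.
have : a / b = c / d by rewrite -ex.
by move=> /(congr1 (fun z => z * (b * d))) e; symmetry; rewrite -[LHS]/(_) -[RHS]/(_);
   transitivity (a / b * (b * d)); [field|rewrite e; field].
Qed.

Lemma loc_midealI x : A x -> (mideal (localization A p) x <-> p x).
Proof.
move=> Ax; split=> [/loc_mideal [a [b [pa Ab nb ex]]]|px]; last first.
  apply/loc_mideal; exists x, 1; rewrite divr1; split=> //; first exact: sr1.
  exact: prime_n1.
have : p (x * b) by rewrite ex divfK // prime_nz.
by case/(primeP Ax Ab).
Qed.

Lemma noeth_loc : noeth A -> noeth (localization A p).
Proof.
move=> nA I [hI IL]; have [I0 ID IM] := hI.
have hJ : idl A (I `&` A).
  split; last by move=> x [].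
  split=> [|x y [Ix Ax] [Iy Ay]|a x Aa [Ix Ax]].
  - by split=> //; exact: sr0.
  - by split; [exact: ID|exact: srD].
  - by split; [apply: IM => //; exact: loc_sub|exact: srM].
have [s es] := nA _ hJ; exists s; apply/seteqP; split; last first.
  apply: mspan_sub => // x xs; suff [] : (I `&` A) x by [].
  by rewrite es; exact: sub_mspan.
move=> x Ix; have [a [b [Aa Ab nb ex]]] := IL _ Ix.
have : (I `&` A) a.
  split=> //; have -> : a = b * x by rewrite ex mulrC divfK // prime_nz.
  by apply: IM => //; exact: loc_sub.
have [_ _ hM] := mspanS (localization A p) [set` s].
rewrite es => has; rewrite ex mulrC; apply: hM; first exact: loc_inv.
apply: has; last by move=> y ys; exact: sub_mspan.
have [h0 hD hM'] := mspanS (localization A p) [set` s].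
by split=> // c y Ac hy; apply: hM' => //; exact: loc_sub.
Qed.

End Loc.
End Localization.

(** * Finitely generated k-algebras in K *)

Section KGen.
Context {k K : fieldType} (iota : {rmorphism k -> K}).

Definition base : set K := [set x | exists c, x = iota c].

Lemma base_sr : is_subring base.
Proof.
split; first by exists 1; rewrite rmorph1.
- by move=> _ _ [a ->] [b ->]; exists (a - b); rewrite rmorphB.
- by move=> _ _ [a ->] [b ->]; exists (a * b); rewrite rmorphM.
Qed.

Lemma base_noeth : noeth base.
Proof.
move=> I [[I0 ID IM] Ib].
have [[x [Ix x0]]|no] := pselect (exists x, I x /\ x != 0).
  exists [:: 1]; apply/seteqP; split.
    move=> y Iy; rewrite -(mulr1 y); have [_ _ hM] := mspanS (base) [set` [:: (1 : K)]].
    by apply: hM; [exact: Ib|apply: sub_mspan; rewrite /= inE].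
  apply: mspan_sub => // y; rewrite /= inE => /eqP->.
  have [c ec] := Ib _ Ix; rewrite -(mulVf x0); apply: IM => //.
  by exists c^-1; rewrite fmorphV ec.
exists [::]; apply/seteqP; split; last by apply: mspan_sub => // y; rewrite /= in_nil.
move=> x Ix; have -> : x = 0.
  by apply: contrapT => /eqP x0; apply: no; exists x.
by case: (mspanS (base) [set` ([::] : seq K)]).
Qed.

Lemma kgen_sr s : is_subring (kgen iota s).
Proof.
split=> [A hA _ _|x y hx hy A hA h1 h2|x y hx hy A hA h1 h2]; first exact: sr1.
- by apply: srB => //; [exact: hx|exact: hy].
- by apply: srM => //; [exact: hx|exact: hy].
Qed.

Lemma kgen_base s : base `<=` kgen iota s.
Proof. by move=> _ [c ->] A hA h _. Qed.

Lemma kgen_mem s x : x \in s -> kgen iota s x.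
Proof. by move=> xs A _ _; exact. Qed.

Lemma kgen_min s A : is_subring A -> base `<=` A -> {in s, forall x, A x} -> kgen iota s `<=` A.
Proof. by move=> hA bA sA x; apply => // c; apply: bA; exists c. Qed.

Lemma kgen_nil : kgen iota [::] = base.
Proof.
apply/seteqP; split; last exact: kgen_base.
by apply: kgen_min => //; exact: base_sr.
Qed.

Lemma kgen_cons x s : kgen iota (x :: s) = adj (kgen iota s) x.
Proof.
have hs := kgen_sr s; apply/seteqP; split.
  apply: kgen_min; first exact: adj_sr.
    by apply: subset_trans (sub_adj hs _); exact: kgen_base.
  move=> y; rewrite inE => /orP[/eqP->|ys]; first exact: adj_gen.
  by apply: sub_adj => //; exact: kgen_mem.
apply: adj_min; first exact: kgen_sr.
  apply: kgen_min; [exact: kgen_sr|exact: kgen_base|].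
  by move=> y ys; apply: kgen_mem; rewrite inE ys orbT.
by apply: kgen_mem; rewrite inE eqxx.
Qed.

Lemma kgen_noeth s : noeth (kgen iota s).
Proof.
elim: s => [|x s IHs]; first by rewrite kgen_nil; exact: base_noeth.
by rewrite kgen_cons; apply: noeth_adj => //; exact: kgen_sr.
Qed.

End KGen.

(** * Local rings, valuation rings and discrete valuation rings *)

Section Valuations.
Context {K : fieldType}.
Implicit Types (A C O R I J M S p : set K) (x y z a b c t : K).

Lemma exp_divr x i n : x != 0 -> (i <= n)%N -> x ^+ i * x^-1 ^+ n = x^-1 ^+ (n - i).
Proof.
by move=> x0 /subnK {1}<-; rewrite addnC exprD mulrA -exprMn divff // expr1n mul1r.
Qed.

Definition local O := is_subring O /\ submod O (mideal O).

Lemma midealW O : mideal O `<=` O. Proof. by move=> x []. Qed.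

Lemma unitVm O x : O x -> is_unit O x \/ mideal O x.
Proof. by move=> Ox; case: (pselect (is_unit O x)); [left|right]. Qed.

Lemma unitV O x : is_unit O x -> is_unit O x^-1.
Proof. by case=> x0 Ox Ox'; split; rewrite ?invr_eq0 ?invrK. Qed.

Lemma unit1 O : is_subring O -> is_unit O 1.
Proof. by move=> hO; split; rewrite ?invr1 ?oner_eq0 //; exact: sr1. Qed.

Lemma unitM O x y : is_subring O -> is_unit O x -> is_unit O y -> is_unit O (x * y).
Proof.
move=> hO [x0 Ox Ox'] [y0 Oy Oy']; split; first by rewrite mulf_neq0.
  exact: srM.
by rewrite invfM; exact: srM.
Qed.

Lemma unitN O x : is_subring O -> is_unit O x -> is_unit O (- x).
Proof. by move=> hO [x0 Ox Ox']; split; rewrite ?oppr_eq0 ?invrN //; exact: srN. Qed.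

Lemma unitX O x n : is_subring O -> is_unit O x -> is_unit O (x ^+ n).
Proof. by move=> hO hx; elim: n => [|n IHn]; rewrite ?exprS; [exact: unit1|exact: unitM]. Qed.

Lemma unit_Ml O x y : is_subring O -> O x -> O y -> is_unit O (x * y) -> is_unit O x.
Proof.
move=> hO Ox Oy [xy0 _ h]; have x0 : x != 0 by apply: contraNneq xy0 => ->; rewrite mul0r.
have y0 : y != 0 by apply: contraNneq xy0 => ->; rewrite mulr0.
split=> //; have -> : x^-1 = y * (x * y)^-1 by field; rewrite x0 y0.
exact: srM.
Qed.

Lemma mideal0 O : is_subring O -> mideal O 0.
Proof. by move=> hO; split; [exact: sr0|case; rewrite eqxx]. Qed.

Lemma mideal_n1 O : is_subring O -> ~ mideal O 1.
Proof. by move=> hO [_]; apply; exact: unit1. Qed.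

Lemma midealM O a x : is_subring O -> O a -> mideal O x -> mideal O (a * x).
Proof.
move=> hO Oa [Ox nx]; split; first exact: srM.
by rewrite mulrC => /(unit_Ml hO Ox Oa).
Qed.

Lemma unit_add O u m : local O -> is_unit O u -> mideal O m -> is_unit O (u + m).
Proof.
move=> [hO lm] hu hm; have [_ Ou _] := hu.
case: (unitVm (srD hO Ou (midealW hm))) => // h.
by have [] : mideal O u by rewrite -(addrK m u); exact: (submodB hO lm).
Qed.

Lemma local_prime O : local O -> prime_ideal O (mideal O).
Proof.
move=> [hO [m0 mD mM]]; split=> //; first exact: midealW.
  exact: mideal_n1.
move=> a b Oa Ob [_ nab]; case: (unitVm Oa) => ha; last by left.
case: (unitVm Ob) => hb; last by right.
by case: nab; exact: unitM.
Qed.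

Lemma loc_local A p : is_subring A -> prime_ideal A p -> local (localization A p).
Proof.
move=> hA hp; have hL := loc_sr hA hp; split=> //; split; first exact: mideal0.
  move=> x y /(loc_mideal hp) [a [b [pa Ab nb ->]]] /(loc_mideal hp) [c [d [pc Ad nd ->]]].
  apply/(loc_mideal hp); exists (a * d + c * b), (b * d); split.
  - by apply: (primeD hp); exact: (primeMr hp).
  - exact: srM.
  - exact: (prime_nM hp).
  - by field; rewrite (prime_nz hp nb) (prime_nz hp nd).
by move=> a x La; exact: midealM.
Qed.

Lemma loc_self O : local O -> localization O (mideal O) = O.
Proof.
move=> lO; have [hO _] := lO; have hp := local_prime lO.
apply/seteqP; split; last exact: loc_sub.
move=> _ [a [b [Oa Ob nb ->]]]; apply: srM => //.
by case: (unitVm Ob) => // -[].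
Qed.

Section ValuationRing.
Variables (R : set K) (hR : valuation_ring R).

Lemma val_sr : is_subring R. Proof. by case: hR. Qed.

Lemma val_inv x : ~ R x -> mideal R x^-1.
Proof.
have hs := val_sr => nx; have x0 : x != 0 by apply/eqP => x0; apply: nx; rewrite x0; exact: sr0.
case: hR => _ /(_ x x0) [//|Rx]; split=> // -[_ _]; by rewrite invrK.
Qed.

Lemma val_local : local R.
Proof.
have hs := val_sr; split=> //; split; first exact: mideal0; last first.
  by move=> a x Ra; exact: midealM.
move=> x y [Rx nx] [Ry ny]; split; first exact: srD.
have [->|x0] := eqVneq x 0; first by rewrite add0r.
have [->|y0] := eqVneq y 0; first by rewrite addr0.
have h z w : R z -> R w -> w != 0 -> R (z / w) -> is_unit R (z + w) -> is_unit R w.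
  move=> Rz Rw w0 Rzw; have -> : z + w = w * (z / w + 1) by field.
  by apply: unit_Ml => //; apply: srD => //; exact: sr1.
case: hR => _ /(_ (x / y)); rewrite mulf_neq0 ?invr_eq0 // => /(_ isT) [] Rxy.
  by move=> /(h x y Rx Ry y0 Rxy)/ny.
by rewrite addrC => u; apply: nx; apply: (h y x) => //; rewrite -invf_div.
Qed.

Lemma val_integral (q : {poly K}) x : q \is monic -> (1 < size q)%N -> polyin R q ->
  R q.[x] -> R x.
Proof.
have hs := val_sr => mq sq Rq Rqx; apply: contrapT => nx.
have [Rx' _] := val_inv nx.
have x0 : x != 0 by apply/eqP => x0; apply: nx; rewrite x0; exact: sr0.
apply: nx.
case eq: (size q) sq => [|[|n]] // _.
have e : q.[x] = \sum_(i < n.+1) q`_i * x ^+ i + x ^+ n.+1.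
  rewrite horner_coef eq big_ord_recr /=; congr (_ + _).
  by move/eqP: mq; rewrite lead_coefE eq /= => ->; rewrite mul1r.
have {e} -> : x = (q.[x] - \sum_(i < n.+1) q`_i * x ^+ i) * x^-1 ^+ n.
  by rewrite e addrC addKr exprS exprVn mulfK // expf_neq0.
rewrite mulrBl mulr_suml; apply: srB => //; first by apply: srM => //; exact: srX.
apply: sr_sum => // i _; rewrite -mulrA; apply: srM => //.
by rewrite exp_divr // ?leq_ord //; exact: srX.
Qed.

End ValuationRing.

Lemma mspan_adj A I x : is_subring A -> submod A I ->
  mspan (adj A x) I = [set y | exists2 p, polyin I p & y = p.[x]].
Proof.
move=> hA [I0 ID IM]; have hAx := adj_sr hA x; apply/seteqP; split.
  apply: mspan_sub; last first.
    by move=> y Iy; exists y%:P; [move=> j; rewrite coefC; case: eqP|rewrite hornerC].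
  split.
  - by exists 0; [move=> j; rewrite coef0|rewrite horner0].
  - move=> _ _ [p Ip ->] [q Iq ->]; exists (p + q); last by rewrite hornerD.
    by move=> j; rewrite coefD; exact: ID.
  - move=> _ _ [a Aa ->] [p Ip ->]; exists (a * p); last by rewrite hornerM.
    by move=> j; rewrite coefM; elim/big_ind: _ => // i _; exact: IM.
move=> _ [p Ip ->]; rewrite horner_coef; apply: (submod_sum _ (mspanS _ _)) => i _.
have [_ _ hM] := mspanS (adj A x) I; rewrite mulrC; apply: hM.
  by apply: srX => //; exact: adj_gen.
exact: sub_mspan.
Qed.

(* A maximal subring R containing C in which I does not generate the unit ideal
   is a valuation ring. *)
Lemma chevalley C I : is_subring C -> idl C I -> ~ I 1 ->
  exists R, [/\ valuation_ring R, C `<=` R & I `<=` mideal R].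
Proof.
move=> hC [hI IC] nI1.
pose P := [set R | [/\ is_subring R, C `<=` R & ~ mspan R I 1]].
have PC : P C by split=> // h; apply: nI1; exact: h.
have [F [R0 FR0] FP Ftot|R [[hR CR nR1] _ maxR]] := zorn_above PC.
  have dir x y (G H : set K) : F G -> F H -> G x -> H y -> exists2 L, F L & L x /\ L y.
    move=> FG FH Gx Hy; case: (Ftot _ _ FG FH) => GH.
      by exists H => //; split=> //; exact: GH.
    by exists G => //; split=> //; exact: GH.
  split.
  - split; first by exists R0 => //; case: (FP _ FR0) => h _ _; exact: sr1.
      move=> x y [G FG Gx] [H FH Hy]; have [L FL [Lx Ly]] := dir _ _ _ _ FG FH Gx Hy.
      by exists L => //; case: (FP _ FL) => h _ _; exact: srB.
    move=> x y [G FG Gx] [H FH Hy]; have [L FL [Lx Ly]] := dir _ _ _ _ FG FH Gx Hy.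
    by exists L => //; case: (FP _ FL) => h _ _; exact: srM.
  - by move=> x Cx; exists R0 => //; case: (FP _ FR0) => _ h _; exact: h.
  - move=> h1; suff [G FG] : (\bigcup_(G in F) mspan G I) 1 by case: (FP _ FG).
    have mono (G H : set K) : G `<=` H -> mspan G I `<=` mspan H I.
      move=> GH; apply: mspan_sub; last by move=> x; exact: sub_mspan.
      by have [h0 hD hM] := mspanS H I; split=> // a x /GH; exact: hM.
    apply: h1; last by move=> x Ix; exists R0 => //; exact: sub_mspan.
    split.
    + by exists R0 => //; case: (mspanS R0 I).
    + move=> x y [G FG Gx] [H FH Hy]; case: (Ftot _ _ FG FH) => GH; [exists H|exists G] => //.
        by case: (mspanS H I) => _ h _; apply: h => //; exact: mono Gx.
      by case: (mspanS G I) => _ h _; apply: h => //; exact: mono Hy.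
    + move=> a x [G FG Ga] [H FH Hx]; case: (Ftot _ _ FG FH) => GH; [exists H|exists G] => //.
        by case: (mspanS H I) => _ _ h; apply: h => //; exact: GH.
      by case: (mspanS G I) => _ _ h; apply: h => //; exact: mono Hx.
pose J := mspan R I.
have hJ : submod R J by exact: mspanS.
have JR : J `<=` R by apply: mspan_sub; [case: (self_idl hR)|move=> x /IC /CR].
(* Maximality of R, read through [mspan_adj]: in R[x] the ideal generated by I is the unit ideal. *)
have adj_max x : ~ R x -> exists2 p, polyin J p & p.[x] = 1.
  move=> nx; apply: contrapT => no; apply: nx.
  suff <- : adj R x = R by exact: adj_gen.
  apply: maxR; last exact: sub_adj.
  split; [exact: adj_sr|exact: subset_trans CR (sub_adj hR _)|].
  have : mspan (adj R x) I `<=` mspan (adj R x) J.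
    by move=> y; apply: mspan_le => z Iz; apply: sub_mspan; exact: sub_mspan.
  by move=> h /h; rewrite mspan_adj // => -[p Jp e]; apply: no; exists p.
have [J0 JD JM] := hJ.
(* If y = 1 / (1 - b) were outside R, clearing denominators in its relation would put a power of 1 -
   b into J; but that power is congruent to 1 modulo J. *)
have invJ b : J b -> R (1 - b)^-1.
  move=> Jb; apply: contrapT => nb; have [p Jp e] := adj_max _ nb.
  set y := (1 - b)^-1 in e.
  have b0 : 1 - b != 0.
    by apply: contraPneq nb => b0; rewrite b0 invr0; apply; exact: sr0.
  have Rb : R (1 - b) by apply: srB => //; [exact: sr1|exact: JR].
  have J1 : J ((1 - b) ^+ size p).
    have -> : (1 - b) ^+ size p = (1 - b) ^+ size p * p.[y] by rewrite e mulr1.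
    rewrite horner_coef mulr_sumr; apply: (submod_sum _ hJ) => i _.
    rewrite mulrCA (mulrC (_ ^+ _) (y ^+ i)) -[1 - b]invrK -/y.
    rewrite exp_divr ?invr_eq0 // ?(ltnW (ltn_ord i)) //.
    by rewrite invrK mulrC; apply: JM => //; exact: srX.
  apply: nR1; have : J ((1 - b) ^+ size p - 1).
    elim: (size p) {J1} => [|n IHn]; first by rewrite expr0 subrr.
    rewrite (_ : _ - 1 = ((1 - b) ^+ n - 1) + - (1 - b) ^+ n * b); last by rewrite exprSr; ring.
    by apply: JD => //; apply: JM => //; apply: srN => //; exact: srX.
  by move=> h; rewrite -/J (_ : 1 = (1 - b) ^+ size p - ((1 - b) ^+ size p - 1)); [exact: (submodB hR hJ)|ring].
(* Of two relations for x and x^-1 with coefficients in J, the shorter one, solved through the unit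
   1 - q_0 of R, removes the leading term of the longer one. *)
have no_pair N x (p q : {poly K}) : x != 0 -> polyin J p -> polyin J q -> p.[x] = 1 -> q.[x^-1] = 1 ->
    (size p + size q <= N)%N -> False.
  elim: N x p q => [|N IHN] x p q x0 Jp Jq ep eq sN.
    move: sN; rewrite leqn0 addn_eq0 => /andP[]; rewrite size_poly_eq0 => /eqP p0 _.
    by move: ep; rewrite p0 horner0 => /esym/eqP; rewrite oner_eq0.
  wlog qp : x p q x0 Jp Jq ep eq sN / (size q <= size p)%N.
    move=> wl; case: (leqP (size q) (size p)) => [|/ltnW] h; first exact: (wl x p q).
    by apply: (wl x^-1 q p); rewrite ?invrK ?invr_eq0 // addnC.
  case: (leqP (size p) 1) => [/size1_polyC p1|].
    by apply: nR1; rewrite -/J -ep p1 hornerC; exact: Jp.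
  case sp: (size p) qp sN => [|[|n]] // qp sN _.
  have Ru := invJ _ (Jq 0%N); set u := (_)^-1 in Ru.
  have b0 : 1 - q`_0 != 0.
    by apply/eqP => /eqP; rewrite subr_eq0 => /eqP h; apply: nR1; rewrite h; exact: Jq.
  pose r := \poly_(i < n.+1) q`_(n.+1 - i).
  have er : r.[x] = x ^+ n.+1 * (1 - q`_0).
    rewrite /r horner_poly -eq (horner_coef_wide (n := n.+2)) ?(leq_trans qp) //.
    rewrite [in RHS]big_ord_recl /= expr0 mulr1 addrAC subrr add0r mulr_sumr (reindex_inj rev_ord_inj) /=.
    apply: eq_bigr => i _; rewrite /bump /= add1n.
    rewrite (_ : (n.+1 - (n.+1 - i.+1) = i.+1)%N); last by rewrite subKn.
    rewrite mulrCA [x ^+ n.+1 * _]mulrC; congr (_ * _).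
    by rewrite -{3}[x]invrK exp_divr ?invr_eq0 // invrK.
  apply: (IHN x (take_poly n.+1 p + p`_n.+1 *: (u *: r)) q x0 _ Jq) => //.
  - move=> j; rewrite coefD coef_take_poly !coefZ coef_poly; apply: JD; first by case: ifP.
    case: ifP => _; last by rewrite !mulr0.
    by apply: (JM); [exact: JR|exact: JM].
  - have eu : u * (1 - q`_0) = 1 by rewrite mulVf.
    rewrite hornerD !hornerZ er (mulrCA u) eu mulr1.
    rewrite -ep [in RHS]horner_coef sp big_ord_recr /=; congr (_ + _).
    rewrite (horner_coef_wide (n := n.+1)) ?size_take_poly //; apply: eq_bigr => i _.
    by rewrite coef_take_poly ltn_ord.
  - have : (size (take_poly n.+1 p + p`_n.+1 *: (u *: r))%R <= n.+1)%N.
      rewrite (leq_trans (size_polyD _ _)) // geq_max size_take_poly.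
      by rewrite !(leq_trans (size_scale_leq _ _)) // size_poly.
    by move=> h; rewrite -ltnS (leq_trans _ sN) // addSn ltnS leq_add2r.
exists R; split=> //.
  split=> // x x0; apply: contrapT => /not_orP [nx nx'].
  have [p Jp ep] := adj_max _ nx; have [q Jq eq] := adj_max _ nx'.
  exact: (no_pair _ x p q x0 Jp Jq ep eq (leqnn _)).
move=> i Ii; split; first by apply: CR; exact: IC.
move=> [i0 _ Ri']; apply: nR1; rewrite -(mulVf i0); have [_ _ hM] := mspanS R I.
by apply: hM => //; exact: sub_mspan.
Qed.

Lemma val_dominating O : local O -> exists R, valuation_ring R /\ dominates R O.
Proof.
move=> lO; have hp := local_prime lO; have [hO _] := lO.
have [R [hR OR mR]] := chevalley hO (prime_idl hp) (prime_n1 hp).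
by exists R.
Qed.

(* An ideal maximal among those disjoint from S is prime. *)
Lemma prime_avoid A J S : is_subring A -> noeth A -> idl A J -> S 1 -> S `<=` A ->
  (forall x y, S x -> S y -> S (x * y)) -> (forall x, S x -> ~ J x) ->
  exists p, [/\ prime_ideal A p, J `<=` p & forall x, S x -> ~ p x].
Proof.
move=> hA nA hJ S1 SA SM SJ.
pose F := [set I | [/\ idl A I, J `<=` I & forall x, S x -> ~ I x]].
have [|I [[iI JI SI] _ maxI]] := @noeth_max _ A F J nA (And3 hJ (fun x h => h) SJ).
  by move=> I [].
have [hI IA] := iI; have [I0 ID IM] := hI.
exists I; split=> //; split=> //; first exact: SI.
move=> a b Aa Ab Iab; apply: contrapT => /not_orP [na nb].
have big c : A c -> ~ I c -> exists s d i, [/\ S s, A d, I i & s = i + c * d].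
  move=> Ac nc; apply: contrapT => no; apply: nc.
  have hc := principalI hA Ac.
  rewrite -(maxI (idlD I (principal A c))).
  - by apply: (idlDr hI); exists 1; [exact: sr1|rewrite mulr1].
  - split; first exact: idl_add.
      by apply: (subset_trans JI); apply: idlDl; exact: hc.1.
    move=> x Sx [i [_ [Ii [d Ad ->] ex]]]; apply: no.
    by exists x, d, i.
  - by apply: idlDl; exact: hc.1.
have [s [d [i [Ss Ad Ii es]]]] := big a Aa na.
have [s' [d' [i' [Ss' Ad' Ii' es']]]] := big b Ab nb.
apply: (SI _ (SM _ _ Ss Ss')).
have -> : s * s' = s' * i + (a * d) * i' + (d * d') * (a * b) by rewrite es es'; ring.
apply: (ID); first apply: (ID).
- by apply: (IM) => //; exact: SA.
- by apply: (IM) => //; exact: srM.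
- by apply: (IM) => //; exact: srM.
Qed.

Lemma prime_avoid_pow A J x : is_subring A -> noeth A -> idl A J -> A x ->
  (forall n, ~ J (x ^+ n)) -> exists p, [/\ prime_ideal A p, J `<=` p & ~ p x].
Proof.
move=> hA nA hJ Ax nJ.
have [||||p [hp Jp np]] := @prime_avoid A J [set y | exists n, y = x ^+ n] hA nA hJ.
- by exists 0%N.
- by move=> _ [n ->]; exact: srX.
- by move=> _ _ [m ->] [n ->]; exists (m + n)%N; rewrite exprD.
- by move=> _ [n ->].
by exists p; split=> //; apply: np; exists 1%N.
Qed.

(** Noetherian induction. A maximal counterexample J is not prime, so it contains a product a b of
    elements outside J; a prime over J contains J + (a) or J + (b), to which the induction
    applies. *)
Lemma finite_min_primes A J : is_subring A -> noeth A -> idl A J ->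
  exists F : set (set K), [/\ finite_set F, forall p, F p -> prime_ideal A p /\ J `<=` p
    & forall p, prime_ideal A p -> J `<=` p -> exists2 q, F q & q `<=` p].
Proof.
move=> hA nA; pose good J := exists F : set (set K), [/\ finite_set F, forall p, F p -> prime_ideal A p /\ J `<=` p
    & forall p, prime_ideal A p -> J `<=` p -> exists2 q, F q & q `<=` p].
move=> hJ0; apply: contrapT => bad0.
have [|J1' [[hJ bad] _ maxJ]] := @noeth_max _ A [set J | idl A J /\ ~ good J] J nA (conj hJ0 bad0).
  by move=> I [].
move: J1' hJ bad maxJ {J hJ0 bad0} => J hJ bad maxJ.
have good_big I : idl A I -> J `<=` I -> I <> J -> good I.
  by move=> hI JI nIJ; apply: contrapT => bI; apply: nIJ; apply: maxJ.
have [J1|nJ1] := pselect (J 1).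
  apply: bad; exists set0; split=> //.
  by move=> p hp Jp; case: (prime_n1 hp); exact: Jp.
have [[a [b [Aa Ab na nb Jab]]]|noab] := pselect (exists a b, [/\ A a, A b, ~ J a, ~ J b & J (a * b)]).
  have hI c : A c -> ~ J c -> good (idlD J (principal A c)).
    move=> Ac nc; have hc := principalI hA Ac; apply: good_big.
    - exact: idl_add.
    - by apply: idlDl; exact: hc.1.
    - move=> e; apply: nc; rewrite -e; apply: idlDr; first exact: hJ.1.
      by exists 1; [exact: sr1|rewrite mulr1].
  have [F [fF Fp Fmin]] := hI a Aa na; have [G [fG Gp Gmin]] := hI b Ab nb.
  have sub c : A c -> J `<=` idlD J (principal A c).
    by move=> Ac; apply: idlDl; exact: (principalI hA Ac).1.
  apply: bad; exists (F `|` G); split; first by rewrite finite_setU.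
    move=> p [/Fp|/Gp] [hp Ip]; split=> //; apply: (subset_trans _ Ip); exact: sub.
  move=> p hp Jp.
  have key c : A c -> p c -> idlD J (principal A c) `<=` p.
    move=> Ac pc _ [j [_ [Jj [d Ad ->] ->]]]; apply: (primeD hp); first exact: Jp.
    exact: (primeMr hp).
  case: (primeP hp Aa Ab (Jp _ Jab)) => pc.
    by have [q Fq qp] := Fmin p hp (key _ Aa pc); exists q => //; left.
  by have [q Gq qp] := Gmin p hp (key _ Ab pc); exists q => //; right.
apply: bad; exists [set J]; split; first exact: finite_set1.
  move=> _ ->; split=> //; case: hJ => -[J0 JD JM] JA; split=> //.
  move=> a b Aa Ab Jab; apply: contrapT => /not_orP [na nb]; apply: noab.
  by exists a, b.
by move=> p hp Jp; exists J.
Qed.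

Definition dvr O t := [/\ local O, mideal O = principal O t, t != 0 &
  forall x, x != 0 -> exists n : int, is_unit O (x / t ^ n)].

(** The principal ideals of x / t^n cannot grow forever, so an element of O can be divided by t only
    finitely often. Quotients supply the negative exponents. *)
Lemma dvr_intro O t : local O -> noeth O -> mideal O = principal O t -> t != 0 ->
  (forall x, exists a b, [/\ O a, O b, b != 0 & x = a / b]) -> dvr O t.
Proof.
move=> lO nO mO t0 frac; split=> //; have [hO _] := lO.
have nt : ~ is_unit O t.
  by have [] : mideal O t by rewrite mO; exists 1; [exact: sr1|rewrite mulr1].
have int_case x : O x -> x != 0 -> exists n : nat, is_unit O (x / t ^+ n).
  move=> Ox x0; apply: contrapT => no.
  have Odiv n : O (x / t ^+ n).
    elim: n => [|n IHn]; first by rewrite expr0 divr1.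
    have [u|[y Oy e]] : is_unit O (x / t ^+ n) \/ principal O t (x / t ^+ n).
    - by rewrite -mO; exact: unitVm.
    - by case: no; exists n.
    suff -> : x / t ^+ n.+1 = y by [].
    by rewrite exprSr invfM mulrA e mulrC mulKf.
  have [n|n] := @noeth_acc _ O (fun n => principal O (x / t ^+ n)) nO
     (fun n => principalI hO (Odiv n)).
    move=> _ [a Oa ->]; exists (t * a).
      by apply: srM => //; apply: midealW; rewrite mO; exists 1; [exact: sr1|rewrite mulr1].
    by rewrite exprSr invfM; field; rewrite t0 expf_neq0.
  move=> e; have : principal O (x / t ^+ n) (x / t ^+ n.+1).
    by rewrite -e; exists 1; [exact: sr1|rewrite mulr1].
  case=> c Oc ec; apply: nt; split=> //.
    by apply: midealW; rewrite mO; exists 1; [exact: sr1|rewrite mulr1].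
  suff -> : t^-1 = c by [].
  have h : x / t ^+ n != 0 by rewrite mulf_neq0 ?invr_eq0 ?expf_neq0.
  by apply: (mulfI h); rewrite -ec exprSr invfM mulrA.
move=> x x0; have [a [b [Oa Ob b0 ex]]] := frac x.
have a0 : a != 0 by apply: contraNneq x0 => a0; rewrite ex a0 mul0r.
have [m um] := int_case a Oa a0; have [n un] := int_case b Ob b0.
exists (m%:Z - n%:Z); rewrite expfzDr // -exprnN invfM ex.
rewrite -!exprnP (_ : _ * _ = (a / t ^+ m) * (b / t ^+ n)^-1); last first.
  by rewrite !invfM !invrK; ring.
by apply: unitM => //; exact: unitV.
Qed.

Definition frac A := forall x, exists a b, [/\ A a, A b, b != 0 & x = a / b].

Lemma frac_le A O : A `<=` O -> frac A -> frac O.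
Proof. by move=> AO fA x; have [a [b [/AO Aa /AO Ab b0 ->]]] := fA x; exists a, b. Qed.

Lemma frac_exn O x : frac O -> exists b, [/\ O b, b != 0 & O (b * x)].
Proof.
move=> fO; have [a [b [Oa Ob b0 ->]]] := fO x.
by exists b; rewrite mulrC divfK.
Qed.

(** The elements b q(y) with q of degree at most n form ideals of O. Once these stop growing,
    y^(n+1) is a polynomial of smaller degree in y, an integral equation. *)
Lemma integral_of_bounded O b y : is_subring O -> noeth O -> integrally_closed O ->
  b != 0 -> (forall n, O (b * y ^+ n)) -> O y.
Proof.
move=> hO nO iO b0 hb.
pose M n := [set z | exists q : {poly K}, [/\ polyin O q, (size q <= n.+1)%N & z = b * q.[y]]].
have hM n : idl O (M n).
  split; last first.
    move=> _ [q [Oq _ ->]]; rewrite horner_coef mulr_sumr; apply: sr_sum => // i _.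
    by rewrite mulrCA; apply: srM.
  split.
  - by exists 0; rewrite size_poly0 horner0 mulr0; split=> //; exact: polyin0.
  - move=> _ _ [q [Oq sq ->]] [r [Or sr ->]]; exists (q + r); rewrite hornerD mulrDr.
    by split=> //; [exact: polyinD|rewrite (leq_trans (size_polyD _ _)) // geq_max sq].
  - move=> c _ Oc [q [Oq sq ->]]; exists (c *: q); rewrite hornerZ mulrCA.
    by split=> //; [exact: polyinZ|rewrite (leq_trans (size_scale_leq _ _))].
have [n|n en] := noeth_acc nO hM.
  by move=> _ [q [Oq sq ->]]; exists q; split=> //; exact: leqW.
have : M n (b * y ^+ n.+1).
  by rewrite -en; exists ('X ^+ n.+1); rewrite size_polyXn hornerXn; split=> //; exact: polyinXn.
case=> q [Oq sq /(mulfI b0) e]; apply: (iO ('X^(n.+1) - q) y).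
- rewrite monicE lead_coefDl ?lead_coefXn // size_polyN size_polyXn ltnS //.
- by move=> j; apply: (polyinB hO) => //; exact: polyinXn.
- by rewrite rootE !hornerE e subrr.
Qed.

(** A maximal ideal of denominators I = (O : y), y = c x, is prime. Were I y contained in I, y would
    be integral over O; hence u y is outside I for some u in I, and u generates the maximal ideal of
    the localization at I. *)
Lemma normal_dvr O x : local O -> noeth O -> integrally_closed O -> frac O -> ~ O x ->
  exists p t, [/\ prime_ideal O p, dvr (localization O p) t & ~ localization O p x].
Proof.
move=> lO nO iO fO nx; have [hO _] := lO.
pose den y := [set d | O d /\ O (d * y)].
have hden y : idl O (den y).
  split; last by move=> d [].
  split=> [|d e [Od Ody] [Oe Oey]|a d Oa [Od Ody]]; split.
  - exact: sr0.
  - by rewrite mul0r; exact: sr0.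
  - exact: srD.
  - by rewrite mulrDl; exact: srD.
  - exact: srM.
  - by rewrite -mulrA; exact: srM.
pose F := [set I | exists c, [/\ O c, ~ O (c * x) & I = den (c * x)]].
have [||I [[c [Oc ny eI]] _ maxI]] := @noeth_max _ O F (den x) nO.
- by exists 1; rewrite mul1r; split=> //; exact: sr1.
- by move=> _ [c [_ _ ->]].
set y := c * x in ny eI; have iI : idl O I by rewrite eI.
have Iy d : I d -> O (d * y) by rewrite eI => -[].
have pI : prime_ideal O I.
  case: (iI) => -[I0 ID IM] IO; split=> //; first by move/Iy; rewrite mul1r.
  move=> a b Oa Ob Iab; apply: contrapT => /not_orP [na nb].
  apply: na; rewrite -(maxI (den (b * c * x))).
  - by split=> //; rewrite -!mulrA -/y mulrA; exact: Iy.
  - exists (b * c); split=> //; first exact: srM.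
    by rewrite -mulrA -/y => h; apply: nb; rewrite eI.
  - by move=> d Id; split; [exact: IO|rewrite -!mulrA -/y mulrCA; apply: srM => //; exact: Iy].
have [d [Od d0 Ody]] := frac_exn y fO.
have Id : I d by rewrite eI.
have [[u [Iu nu]]|no] := pselect (exists u, I u /\ ~ I (u * y)); last first.
  case: ny; apply: (integral_of_bounded hO nO iO d0) => n; apply: (prime_sub pI).
  elim: n => [|n IHn]; first by rewrite expr0 mulr1.
  by apply: contrapT => h; apply: no; exists (d * y ^+ n); rewrite -mulrA -exprSr.
set v := u * y in nu; have Ov : O v by exact: Iy.
have v0 : v != 0 by exact: (prime_nz pI).
have u0 : u != 0 by apply: contraNneq v0 => u0; rewrite /v u0 mul0r.
have y0 : y != 0 by apply: contraNneq v0 => y0; rewrite /v y0 mulr0.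
exists I, u; split=> //.
  apply: dvr_intro => //; [exact: loc_local|exact: noeth_loc| |exact: frac_le (loc_sub hO pI) fO].
  apply/seteqP; split.
    move=> z /(loc_mideal pI) [q [s [Iq Os ns ->]]]; exists ((q * y) / (v * s)).
      apply: loc_div; [exact: Iy|exact: srM|exact: (prime_nM pI)].
    by rewrite /v; field; rewrite u0 y0 (prime_nz pI ns).
  move=> _ [a La ->]; rewrite mulrC; apply: midealM => //; first exact: loc_sr.
  by case: (loc_midealI hO pI (prime_sub pI Iu)) => _; apply.
move=> [a [s [Oa Os ns ex]]]; have s0 := prime_nz pI ns.
apply: ns; rewrite eI; split=> //; rewrite /y ex mulrCA (mulrC s) divfK //.
exact: srM.
Qed.

End Valuations.

(** * Points of a variety as local rings of K *)

Section Points.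
Context {k K : fieldType} (iota : {rmorphism k -> K}).
Implicit Types (X Y Z : set (set K)) (A O P Q R E p q : set K) (s : seq K) (x : K).

Lemma kgen_prime0 s : prime_ideal (kgen iota s) [set 0].
Proof.
have hs := kgen_sr iota s; split.
- by move=> _ ->; exact: sr0.
- by split=> // x y -> ->; rewrite addr0.
- by move=> a x _ ->; rewrite mulr0.
- by move/eqP; rewrite oner_eq0.
- by move=> a b _ _ /eqP; rewrite mulf_eq0 => /orP[] /eqP; [left|right].
Qed.

Lemma loc_loc A q p : is_subring A -> prime_ideal A q -> prime_ideal (localization A q) p ->
  prime_ideal A (p `&` A) /\ localization (localization A q) p = localization A (p `&` A).
Proof.
move=> hA hq hp; have AL := loc_sub hA hq.
have hpA : prime_ideal A (p `&` A).
  split=> //.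
  - by split; [split; [exact: (prime0 hp)|exact: sr0]|move=> x y [px Ax] [py Ay]; split;
      [exact: (primeD hp)|exact: srD]].
  - by move=> a x Aa [px Ax]; split; [apply: (primeMl hp) => //; exact: AL|exact: srM].
  - by case=> /(prime_n1 hp).
  - move=> a b Aa Ab [pab _]; case: (primeP hp (AL _ Aa) (AL _ Ab) pab) => h; [left|right];
    by split.
split=> //; apply/seteqP; split.
  move=> _ [_ [_ [[a [b [Aa Ab nb ->]]] [c [d [Ac Ad nd ->]]] npd ->]]].
  have b0 := prime_nz hq nb; have d0 := prime_nz hq nd.
  have npc : ~ p c by move=> pc; apply: npd; apply: (primeMr hp) => //; exact: loc_inv.
  have nnb : ~ p b.
    move=> pb; apply: (prime_n1 hp); rewrite -(mulVf b0); apply: (primeMl hp) => //.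
    exact: loc_inv.
  have c0 : c != 0 by exact: (prime_nz hp).
  exists (a * d), (b * c); split; [exact: srM|exact: srM| |by field; rewrite c0 b0].
  by move=> [pbc _]; case: (primeP hp (AL _ Ab) (AL _ Ac) pbc).
move=> _ [a [b [Aa Ab nb ->]]]; exists a, b; split=> //; [exact: AL|exact: AL|].
by move=> pb; apply: nb.
Qed.

Lemma dominates_trans (O1 O2 O3 : set K) : dominates O1 O2 -> dominates O2 O3 -> dominates O1 O3.
Proof. by move=> [a b] [c d]; split; [exact: subset_trans a|exact: subset_trans b]. Qed.

Lemma dominates_loc O R : is_subring O -> local R -> O `<=` R ->
  prime_ideal O (mideal R `&` O) /\ dominates R (localization O (mideal R `&` O)).
Proof.
move=> hO lR OR; have [hR _] := lR; have hm := local_prime lR.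
have hp : prime_ideal O (mideal R `&` O).
  split.
  - by move=> x [].
  - by split; [split; [exact: (prime0 hm)|exact: sr0]|move=> x y [px Ax] [py Ay]; split;
      [exact: (primeD hm)|exact: srD]].
  - by move=> a x Oa [px Ox]; split; [apply: (primeMl hm) => //; exact: OR|exact: srM].
  - by case=> /(prime_n1 hm).
  - move=> a b Oa Ob [pab _]; case: (primeP hm (OR _ Oa) (OR _ Ob) pab) => h; [left|right];
    by split.
have inv b : O b -> ~ (mideal R `&` O) b -> R b^-1.
  by move=> Ob nb; case: (unitVm (OR _ Ob)) => [[]//|mb]; case: nb.
split=> //; split=> [x|x /(loc_mideal hp) [a [b [[pa Oa] Ob nb ->]]]].
  by move=> [a [b [Oa Ob nb ->]]]; apply: srM => //; [exact: OR|exact: inv].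
by apply: (primeMr hm) => //; exact: inv.
Qed.

Section VarietyPoints.
Variables (X : set (set K)) (hX : variety iota X).

Definition chart s := frac (kgen iota s) /\
  forall p, prime_ideal (kgen iota s) p -> X (localization (kgen iota s) p).

Lemma point_chart O : X O -> exists s q,
  [/\ chart s, prime_ideal (kgen iota s) q & O = localization (kgen iota s) q].
Proof.
case: (hX) => -[S [_ Sfrac eX]] _; rewrite eX => -[s sS [q hq eO]].
exists s, q; split=> //; split; first exact: Sfrac.
by move=> p hp; rewrite eX; exists s => //; exists p.
Qed.

Lemma charts_finite : exists S : seq (seq K), [/\ {in S, forall s, chart s} &
  forall O, X O -> exists2 s, s \in S & Spec (kgen iota s) O].
Proof.
case: (hX) => -[S [_ Sfrac eX]] _; exists S; split; last by rewrite {1}eX.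
move=> s sS; split; first exact: Sfrac.
by move=> p hp; rewrite eX; exists s => //; exists p.
Qed.

Lemma generic_point : X setT.
Proof.
case: (hX) => -[[|s S'] [Sn Sfrac eX]] _; first by case: Sn.
rewrite eX; exists s; first by rewrite inE eqxx.
exists [set 0]; first exact: kgen_prime0.
apply/seteqP; split=> // x _; have [|a [b [ha hb b0 ->]]] := Sfrac s _ x.
  by rewrite inE eqxx.
by exists a, b; split=> // b0'; rewrite b0' eqxx in b0.
Qed.

Section Point.
Variables (O : set K) (XO : X O).

Lemma point_local : local O.
Proof.
by have [s [q [_ hq ->]]] := point_chart XO; apply: loc_local => //; exact: kgen_sr.
Qed.

Lemma point_sr : is_subring O. Proof. by have [] := point_local. Qed.

Lemma point_noeth : noeth O.
Proof.
have [s [q [_ hq ->]]] := point_chart XO; apply: noeth_loc => //; first exact: kgen_sr.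
exact: kgen_noeth.
Qed.

Lemma point_base c : O (iota c).
Proof.
have [s [q [_ hq ->]]] := point_chart XO; apply: loc_sub => //; exact: kgen_sr.
Qed.

Lemma point_frac : frac O.
Proof.
have [s [q [[fs _] hq ->]]] := point_chart XO; apply: frac_le fs.
by apply: loc_sub => //; exact: kgen_sr.
Qed.

Lemma point_loc p : prime_ideal O p -> X (localization O p).
Proof.
have [s [q [[_ cs] hq ->]]] := point_chart XO => hp.
have [hpA ->] := loc_loc (kgen_sr iota s) hq hp; exact: cs.
Qed.

End Point.

Lemma center_unique R O O' : valuation_ring R -> X O -> X O' -> dominates R O ->
  dominates R O' -> O = O'.
Proof. by case: hX => _; exact. Qed.

Lemma chart_center s R : chart s -> valuation_ring R -> kgen iota s `<=` R ->
  X (localization (kgen iota s) (mideal R `&` kgen iota s)) /\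
  dominates R (localization (kgen iota s) (mideal R `&` kgen iota s)).
Proof.
move=> [_ cs] hR sR; have [hp dR] := dominates_loc (kgen_sr iota s) (val_local hR) sR.
by split=> //; exact: cs.
Qed.

(** A valuation ring dominating O has both O and O' as centers, and centers are unique. *)
Lemma point_dominates O O' : X O -> X O' -> dominates O O' -> O = O'.
Proof.
move=> XO XO' d; have [R [hR dR]] := val_dominating (point_local XO).
apply: (center_unique hR XO XO' dR); exact: dominates_trans d.
Qed.

(** O' dominates the localization of O at the trace of its maximal ideal. That localization is a
    point too, and domination between points is equality. *)
Lemma point_sub O O' : X O -> X O' -> O `<=` O' ->
  prime_ideal O (mideal O' `&` O) /\ O' = localization O (mideal O' `&` O).
Proof.
move=> XO XO' OO'; have [hp d] := dominates_loc (point_sr XO) (point_local XO') OO'.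
by split=> //; apply: point_dominates d => //; exact: point_loc.
Qed.

Lemma point_sub_inj O O' : X O -> X O' -> O `<=` O' -> mideal O `<=` mideal O' -> O = O'.
Proof.
move=> XO XO' OO' mm; have [hp eO'] := point_sub XO XO' OO'.
rewrite eO' -[LHS](loc_self (point_local XO)); congr localization.
apply/seteqP; split=> [x mx|x [mx Ox]]; first by split; [exact: mm|exact: midealW].
have [u|//] := unitVm Ox.
by case: u => x0 _ Ox'; case: mx => _ []; split=> //; [exact: OO'|exact: OO'].
Qed.

Lemma mideal_anti O O' : O `<=` O' -> mideal O' `&` O `<=` mideal O.
Proof. by move=> OO' x [[_ nu] Ox]; split=> // -[x0 _ Ox']; apply: nu; split=> //; exact: OO'. Qed.

End VarietyPoints.

(** An element outside E leads, by [normal_dvr], to a localization of E that is a discrete valuation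
    ring; codimension one forces it to be E. *)
Lemma normal_prime_divisor X E : normal_variety iota X -> prime_divisor X E -> exists t, dvr E t.
Proof.
move=> [hX nX] [XE nE maxE].
have [x nx] : exists x, ~ E x.
  by apply: contrapT => no; apply: nE; apply/seteqP; split=> // x _; apply: contrapT => h; apply: no; exists x.
have [p [t [hp hd nLx]]] := normal_dvr (point_local hX XE) (point_noeth hX XE) (nX _ XE) (point_frac hX XE) nx.
exists t; case: (maxE _ (point_loc hX XE hp)) => [|<-//|e].
  exact: loc_sub (point_sr hX XE) hp.
by case: nLx; rewrite e.
Qed.

Lemma dvr_prime_divisor X E t : variety iota X -> X E -> dvr E t -> prime_divisor X E.
Proof.
move=> hX XE [lE mE t0 hE]; have [hs _] := lE.
have mt : mideal E t by rewrite mE; exists 1; [exact: sr1|rewrite mulr1].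
split=> //.
  by move=> eE; case: mt => _ []; rewrite eE; split.
move=> Q XQ EQ; case: (unitVm (EQ _ (midealW mt))) => [[_ Qt Qt']|mQt]; [right|left].
  apply/seteqP; split=> // x _; have [->|x0] := eqVneq x 0.
    by apply: sr0; exact: point_sr XQ.
  have hQ := point_sr hX XQ.
  have [n [_ Exn _]] := hE x x0; rewrite -(divfK (expfz_neq0 n t0) x).
  apply: (srM hQ); first exact: EQ.
  by case: n {Exn} => n; rewrite ?NegzE -?exprnP -?exprnN; [|rewrite -exprVn]; exact: srX.
symmetry; apply: (point_sub_inj hX) => // x; rewrite mE => -[a Ea ->].
rewrite mulrC; apply: midealM => //; [exact: point_sr XQ|exact: EQ].
Qed.

End Points.

(** * Towers of transcendental elements *)

Section Towers.
Context {K : fieldType}.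
Implicit Types (A C O L M R : set K) (x y z c : K) (s zs : seq K) (f g q : {poly K}).

Definition is_subfield L := is_subring L /\ forall x, L x -> L x^-1.

Definition alg L x := exists f, [/\ polyin L f, f != 0 & root f x].

Definition fadj L z : set K := [set x | exists f g,
  [/\ polyin L f, polyin L g, g.[z] != 0 & x = f.[z] / g.[z]]].

Fixpoint fadjs L zs := if zs is z :: zs' then fadjs (fadj L z) zs' else L.

(** Algebraic independence of the list over L, in the form in which towers are extended at the
    end. *)
Fixpoint trtower L zs := if zs is z :: zs' then ~ alg L z /\ trtower (fadj L z) zs' else True.

Lemma fadjs_rcons L zs z : fadjs L (rcons zs z) = fadj (fadjs L zs) z.
Proof. by elim: zs L => //= y zs IH L. Qed.

Lemma trtower_rcons L zs z : trtower L (rcons zs z) <-> trtower L zs /\ ~ alg (fadjs L zs) z.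
Proof.
elim: zs L => [|y zs IH] L /=; first by split=> [[]|[]].
by rewrite IH; split=> [[h [h1 h2]]|[[h h1] h2]].
Qed.

Lemma fadj_sf L z : is_subring L -> is_subfield (fadj L z).
Proof.
move=> hL; split.
  split.
  - exists 1, 1; rewrite hornerC divr1 oner_eq0; split=> //; exact: (polyinC hL (sr1 hL)).
  - move=> _ _ [f [g [Lf Lg g0 ->]]] [f' [g' [Lf' Lg' g0' ->]]].
    exists (f * g' - f' * g), (g * g'); rewrite hornerD hornerN !hornerM mulf_neq0 //.
    split=> //; [|exact: polyinM|by field; rewrite g0 g0'].
    by apply: polyinB => //; exact: polyinM.
  - move=> _ _ [f [g [Lf Lg g0 ->]]] [f' [g' [Lf' Lg' g0' ->]]].
    exists (f * f'), (g * g'); rewrite !hornerM mulf_neq0 //.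
    by split=> //; [exact: polyinM|exact: polyinM|field; rewrite g0 g0'].
move=> _ [f [g [Lf Lg g0 ->]]]; have [f0|f0] := eqVneq f.[z] 0.
  exists 0, 1; rewrite f0 mul0r invr0 hornerC horner0 mul0r oner_eq0; split=> //.
    exact: polyin0.
  exact: (polyinC hL (sr1 hL)).
by exists g, f; rewrite invf_div.
Qed.

Lemma sub_fadj L z : is_subring L -> L `<=` fadj L z.
Proof.
move=> hL x Lx; exists x%:P, 1; rewrite !hornerC divr1 oner_eq0; split=> //.
  exact: polyinC.
exact: (polyinC hL (sr1 hL)).
Qed.

Lemma fadj_gen L z : is_subring L -> fadj L z z.
Proof.
move=> hL; exists 'X, 1; rewrite hornerX hornerC divr1 oner_eq0; split=> //.
  exact: polyinX.
exact: (polyinC hL (sr1 hL)).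
Qed.

Lemma adj_fadj L z : is_subring L -> adj L z `<=` fadj L z.
Proof.
move=> hL; apply: adj_min; [by case: (fadj_sf z hL)|exact: sub_fadj|exact: fadj_gen].
Qed.

Lemma fadjs_subfield L zs : is_subfield L -> is_subfield (fadjs L zs).
Proof. by elim: zs L => //= z zs IH L [hL _]; apply: IH; exact: fadj_sf. Qed.

Lemma sub_fadjs L zs : is_subfield L -> L `<=` fadjs L zs.
Proof.
elim: zs L => [|z zs IH] L; first by move=> _ x.
by move=> [hL _]; apply: (subset_trans (sub_fadj z hL)); apply: IH; exact: fadj_sf.
Qed.

Lemma alg_mono L M x : L `<=` M -> alg L x -> alg M x.
Proof. by move=> LM [f [Lf f0 rf]]; exists f; split=> // j; exact: LM. Qed.

Lemma alg_fadj L z : is_subring L -> alg (fadj L z) z.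
Proof.
move=> hL; have [hF _] := fadj_sf z hL; exists ('X - z%:P); split.
- by apply: polyinB => //; [exact: polyinX|apply: polyinC => //; exact: fadj_gen].
- by rewrite polyXsubC_eq0.
- by rewrite root_XsubC.
Qed.

(* By induction on the number of generators that are still transcendental. *)
Lemma tower_extend L zs s : is_subfield L -> trtower L zs ->
  exists xs, [/\ {subset xs <= s}, trtower L (zs ++ xs) &
    forall y, y \in s -> alg (fadjs L (zs ++ xs)) y].
Proof.
move=> hL; have [n] := ubnP (count (fun y => `[< ~ alg (fadjs L zs) y >]) s).
elim: n zs => // n IHn zs hn tz.
have [no|/existsNP [y /not_implyP [ys ny]]] := pselect (forall y, y \in s -> alg (fadjs L zs) y).
  by exists [::]; rewrite cats0.
have [hF _] := fadjs_subfield zs hL.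
have [||xs [xss txs axs]] := IHn (rcons zs y).
- rewrite -ltnS (leq_trans _ hn) // ltnS fadjs_rcons.
  have sub z : `[< ~ alg (fadj (fadjs L zs) y) z >] -> `[< ~ alg (fadjs L zs) z >].
    by move=> /asboolP h; apply/asboolP => h'; apply: h; apply: alg_mono h'; exact: sub_fadj.
  have y1 : ~~ `[< ~ alg (fadj (fadjs L zs) y) y >].
    by apply/asboolPn => h; apply: h; exact: alg_fadj.
  have y2 : `[< ~ alg (fadjs L zs) y >] by apply/asboolP.
  move: ys {hn IHn}; elim: s => // a s IHs; rewrite inE => /orP[/eqP<-|ys] /=.
    rewrite y2 (negbTE y1) add0n add1n ltnS; exact: sub_count.
  by rewrite -addnS leq_add ?IHs //; case: `[< _ >] (sub a) => //= ->.
- by apply/trtower_rcons.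
exists (y :: xs); rewrite -cat_rcons; split=> //.
by move=> z; rewrite inE => /orP[/eqP->//|/xss].
Qed.

Lemma common_denom C f : is_subring C ->
  (forall j, exists a b, [/\ C a, C b, b != 0 & f`_j = a / b]) ->
  exists d, [/\ C d, d != 0 & polyin C (d *: f)].
Proof.
move=> hC h; suff [d [Cd d0 hd]] : exists d, [/\ C d, d != 0 & forall j, (j < size f)%N -> C (d * f`_j)].
  exists d; split=> // j; rewrite coefZ; case: (ltnP j (size f)) => [/hd//|jf].
  by rewrite nth_default // mulr0; exact: sr0.
elim: (size f) => [|n [d [Cd d0 hd]]]; first by exists 1; split=> //; [exact: sr1|exact: oner_neq0].
have [a [b [Ca Cb b0 e]]] := h n; exists (d * b); split; [exact: srM|exact: mulf_neq0|].
move=> j; rewrite ltnS leq_eqVlt => /orP[/eqP->|/hd hj].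
  by rewrite e -mulrA (mulrCA b) divff // mulr1; exact: srM.
by rewrite mulrAC; exact: srM.
Qed.

(** L is the fraction field of its part inside A. This puts L into every localization of A at a
    prime without nonzero elements of L. *)
Definition fracin A L := forall l, L l -> exists a b,
  [/\ (L `&` A) a, (L `&` A) b, b != 0 & l = a / b].

Lemma setI_subring A C : is_subring A -> is_subring C -> is_subring (A `&` C).
Proof.
move=> hA hC; split; first by split; exact: sr1.
  by move=> x y [Ax Cx] [Ay Cy]; split; exact: srB.
by move=> x y [Ax Cx] [Ay Cy]; split; exact: srM.
Qed.

Lemma fracin_fadj A L x : is_subring A -> is_subring L -> fracin A L -> A x -> fracin A (fadj L x).
Proof.
move=> hA hL fL Ax _ [f [g [Lf Lg g0 ->]]].
have hLA := setI_subring hL hA.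
have [d [[Ld Ad] d0 hd]] := common_denom hLA (fun j => fL _ (Lf j)).
have [e [[Le Ae] e0 he]] := common_denom hLA (fun j => fL _ (Lg j)).
have ev (u : K) q : (L `&` A) u -> polyin (L `&` A) q -> (fadj L x `&` A) (u * q.[x]).
  move=> [Lu Au] hq; have [hF _] := fadj_sf x hL; split; apply: srM => //.
  - exact: sub_fadj.
  - by apply: adj_fadj => //; exists q => // j; case: (hq j).
  - by apply: polyin_horner => // j; case: (hq j).
exists (e * (d *: f).[x]), (d * (e *: g).[x]); split.
- exact: ev.
- exact: ev.
- by rewrite !hornerZ !mulf_neq0.
- by rewrite !hornerZ; field; rewrite g0 e0 d0.
Qed.

Section LocalTower.
Variables (O L : set K) (lO : local O) (hL : is_subfield L) (LO : L `<=` O).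

Lemma subfield_unit x : L x -> x != 0 -> is_unit O x.
Proof. by move=> Lx x0; split=> //; apply: LO => //; case: hL => _; apply. Qed.

Lemma subfield_nmideal x : L x -> mideal O x -> x = 0.
Proof. by move=> Lx [_ nx]; apply: contrapT => /eqP x0; apply: nx; exact: subfield_unit. Qed.

Lemma poly_lowest f : f != 0 -> polyin L f -> exists n g,
  [/\ f = g * 'X^n, polyin L g & g`_0 != 0].
Proof.
move=> f0 Lf; have [n [g ng ef]] := multiplicity_XsubC f 0; exists n, g.
rewrite subr0 in ef; rewrite f0 /= in ng; split=> //; last first.
  by move: ng; rewrite rootE horner_coef0.
by move=> j; have := Lf (j + n)%N; rewrite ef coefMXn ltnNge leq_addl /= addnK.
Qed.

Lemma mideal_horner z f : mideal O z -> polyin L f -> f`_0 != 0 -> is_unit O f.[z].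
Proof.
move=> mz Lf f0; have [hO _] := lO; rewrite -[f]coefK.
have [sf|sf] := eqVneq (size f) 0%N.
  by move: f0; rewrite nth_default ?eqxx // sf.
rewrite horner_poly -(prednK (n := size f)) ?lt0n // big_ord_recl expr0 mulr1.
apply: unit_add => //; first exact: subfield_unit.
have hm := local_prime lO; apply: (submod_sum _ (prime_idl hm).1) => i _.
rewrite exprS mulrCA; apply: (primeMr hm) => //; apply: srM => //; first exact: LO.
by apply: srX => //; exact: midealW.
Qed.

(** A polynomial over L with nonzero constant term takes a unit value at z, and every nonzero
    polynomial is a power of the variable times such a one. *)
Lemma mideal_transc z : mideal O z -> z != 0 -> ~ alg L z.
Proof.
move=> mz z0 [f [Lf f0 rf]]; have [n [g [ef Lg g0]]] := poly_lowest f0 Lf.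
have [gz _ _] := mideal_horner mz Lg g0.
by move: rf; rewrite ef rootE hornerM hornerXn mulf_eq0 (negbTE gz) expf_eq0 (negbTE z0) andbF.
Qed.

Lemma mideal_fadj_sub z O' : mideal O z -> O `<=` O' -> is_subring O' -> is_unit O' z ->
  fadj L z `<=` O'.
Proof.
move=> mz OO' hO' uz _ [f [g [Lf Lg gz ->]]].
have [g0|g0] := eqVneq g 0; first by move: gz; rewrite g0 horner0 eqxx.
have [n [h [eg Lh h0]]] := poly_lowest g0 Lg.
have [hz0 Ohz Ohz'] := mideal_horner mz Lh h0.
apply: srM => //.
  by apply: OO'; apply: polyin_horner; [by case: lO|move=> j; exact: LO|exact: midealW].
rewrite eg hornerM hornerXn invfM; apply: srM => //; first exact: OO'.
by rewrite -exprVn; apply: srX => //; case: uz.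
Qed.

End LocalTower.
End Towers.

(** * Chains of points and transcendence degree *)

Section Dimension.
Context {k K : fieldType} (iota : {rmorphism k -> K}).
Implicit Types (X Y Z : set (set K)) (A O P Q R E L M : set K) (s xs zs : seq K) (x y : K).

Lemma base_sf : is_subfield (base iota).
Proof.
split; first exact: base_sr.
by move=> _ [c ->]; exists c^-1; rewrite fmorphV.
Qed.

(** Each strict inclusion provides z in the maximal ideal of the smaller ring that is a unit in the
    larger one. Such z is transcendental over the subfield L built so far, and L(z) lies in the
    larger ring. *)
Lemma chain_tower X n (c : nat -> set K) : variety iota X ->
  (forall j, (j <= n)%N -> X (c j)) -> (forall j, (j < n)%N -> c j `<` c j.+1) ->
  exists zs, size zs = n /\ trtower (base iota) zs.
Proof.
move=> hX Xc incr.
suff [zs [sz tz _]] : exists zs, [/\ size zs = n, trtower (base iota) zs & fadjs (base iota) zs `<=` c n].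
  by exists zs.
elim: n Xc incr => [|n IHn] Xc incr.
  by exists [::]; split=> // _ [a ->]; apply: (point_base hX); exact: Xc.
have [||zs [sz tz zc]] := IHn; [by move=> j jn; apply: Xc; exact: leqW|by move=> j jn; apply: incr; exact: leqW|].
have Xn := Xc n (leqnSn n); have XSn := Xc n.+1 (leqnn _).
have [sub nsub] := incr n (leqnn _).
have [z [mz uz]] : exists z, mideal (c n) z /\ is_unit (c n.+1) z.
  apply: contrapT => no; apply: nsub.
  rewrite (point_sub_inj hX Xn XSn sub) // => z mz.
  by case: (unitVm (sub _ (midealW mz))) => // uz; case: no; exists z.
have hL := fadjs_subfield zs base_sf; have lO := point_local hX Xn.
exists (rcons zs z); rewrite size_rcons sz fadjs_rcons; split=> //.
  by apply/trtower_rcons; split=> //; apply: (mideal_transc lO) => //; case: uz.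
exact: (mideal_fadj_sub lO hL zc mz sub (point_sr hX XSn) uz).
Qed.

(** The residue of x is algebraic over L: for a subfield L of O, a nonzero f has a nonzero
    reduction. *)
Definition talg O L x := exists f : {poly K}, [/\ polyin L f, f != 0 & mideal O f.[x]].

Lemma ntalg_fadj_sub O L x : local O -> is_subfield L -> L `<=` O -> O x -> ~ talg O L x ->
  fadj L x `<=` O.
Proof.
move=> lO hL LO Ox nt _ [f [g [Lf Lg gx ->]]]; have [hO _] := lO.
have h (q : {poly K}) : polyin L q -> O q.[x].
  by move=> Lq; apply: polyin_horner => // j; exact: LO.
apply: srM => //; first exact: h.
have [[]//|mg] := unitVm (h _ Lg); case: nt; exists g; split=> //.
by apply: contraNneq gx => ->; rewrite horner0.
Qed.

(* L' is enlarged through the list until the residue field becomes algebraic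
   over L'(x). *)
Lemma talg_maximal O L s : local O -> is_subfield L -> L `<=` O -> {in s, forall y, O y} ->
  (exists2 y, y \in s & ~ talg O L y) ->
  exists L' x, [/\ is_subfield L', L `<=` L' /\ L' `<=` O, x \in s, ~ talg O L' x &
    forall y, y \in s -> talg O (fadj L' x) y].
Proof.
move=> lO + + sO; have [n] := ubnP (count (fun y => `[< ~ talg O L y >]) s).
elim: n L => // n IHn L hn hL LO [x xs nx]; have [hLr _] := hL.
have [all|/existsNP [y /not_implyP [ys ny]]] := pselect (forall y, y \in s -> talg O (fadj L x) y).
  by exists L, x; split=> //; split.
have FO := ntalg_fadj_sub lO hL LO (sO _ xs) nx.
have hF := fadj_sf x hLr.
have [||//||L' [z [hL' [FL' L'O] zs nz az]]] := IHn (fadj L x).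
- rewrite -ltnS (leq_trans _ hn) // ltnS.
  have sub w : `[< ~ talg O (fadj L x) w >] -> `[< ~ talg O L w >].
    move=> /asboolP h; apply/asboolP => -[f [Lf f0 mf]]; apply: h; exists f; split=> //.
    by move=> j; exact: sub_fadj.
  have x1 : ~~ `[< ~ talg O (fadj L x) x >].
    apply/asboolPn => h; apply: h; exists ('X - x%:P); split.
    - apply: polyinB; [by case: hF|apply: polyinX; by case: hF|].
      by apply: polyinC; [case: hF|exact: fadj_gen].
    - by rewrite polyXsubC_eq0.
    - by rewrite !hornerE subrr; apply: mideal0; case: lO.
  have x2 : `[< ~ talg O L x >] by apply/asboolP.
  move: xs {hn IHn ys sO}; elim: s => // a s IHs; rewrite inE => /orP[/eqP<-|xs] /=.
    rewrite x2 (negbTE x1) add0n add1n ltnS; exact: sub_count.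
  by rewrite -addnS leq_add ?IHs //; case: `[< _ >] (sub a) => //= ->.
- exact: hF.
- by exists y.
exists L', z; split=> //; split=> //; apply: (subset_trans _ FL'); exact: sub_fadj.
Qed.

(** L is enlarged to L' until the residue field is algebraic over L'(x), x transcendental. D is a
    common denominator of integral equations for the generators over C = L'[x]. A valuation ring
    over C plus the maximal ideal of O, with c = 1 + x D in its maximal ideal, has D as a unit; so
    it contains the generators, and its center on the chart is the new point. *)
Lemma chart_specialize X s O q L : variety iota X -> chart iota X s -> prime_ideal (kgen iota s) q ->
  O = localization (kgen iota s) q -> is_subfield L -> base iota `<=` L -> L `<=` O ->
  fracin (kgen iota s) L -> (exists2 y, y \in s & ~ talg O L y) ->
  exists q', let O' := localization (kgen iota s) q' in
    [/\ prime_ideal (kgen iota s) q', O' `<` O & L `<=` O'].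
Proof.
move=> hX cs hq eO hL bL LO fL exy; set A := kgen iota s in cs hq eO fL *.
have hA : is_subring A by exact: kgen_sr.
have lO : local O by rewrite eO; exact: loc_local.
have AO : A `<=` O by rewrite eO; exact: loc_sub.
have [hO _] := lO; have hm := local_prime lO.
have sO y : y \in s -> O y by move=> ys; apply: AO; exact: kgen_mem.
have [L' [x [hL' [LL' L'O] xs nx alls]]] := talg_maximal lO hL LO sO exy.
have [hLr' invL'] := hL'.
pose C := adj L' x; have hC : is_subring C by exact: adj_sr.
have CO : C `<=` O by apply: adj_min => //; exact: sO.
have [D [CD D0 hD]] : exists D, [/\ C D, D != 0 & forall y, y \in s ->
    exists f : {poly K}, [/\ f \is monic, polyin C (D *: f) & mideal O f.[y]]].
  have hF := fadj_sf x hLr'; have [hFr Finv] := hF.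
  have one y : y \in s -> exists D, [/\ C D, D != 0 &
    exists f : {poly K}, [/\ f \is monic, polyin C (D *: f) & mideal O f.[y]]].
    move=> /alls [f [Lf f0 mf]]; have lf0 : lead_coef f != 0 by rewrite lead_coef_eq0.
    have FO := ntalg_fadj_sub lO hL' L'O (sO _ xs) nx.
    have Li : fadj L' x (lead_coef f)^-1 by apply: Finv; exact: Lf.
    have [|D [CD D0 hD]] := @common_denom K C ((lead_coef f)^-1 *: f) hC.
      move=> j; rewrite coefZ; have [u [v [Lu Lv v0 ->]]] : fadj L' x ((lead_coef f)^-1 * f`_j).
        exact: srM.
      by exists u.[x], v.[x]; split=> //; [exists u|exists v].
    exists D; split=> //; exists ((lead_coef f)^-1 *: f); split=> //.
      by rewrite monicE lead_coefZ mulVf.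
    by rewrite hornerZ; apply: (primeMl hm) => //; exact: FO.
  elim: s {cs A hA hq eO fL exy alls AO sO xs} one => [|y s IHs] one.
    by exists 1; split=> //; [exact: sr1|exact: oner_neq0].
  have [D [CD D0 [f [mf Cf mfy]]]] := one y (mem_head _ _).
  have [|E [CE E0 hE]] := IHs; first by move=> z zs; apply: one; rewrite inE zs orbT.
  exists (D * E); split; [exact: srM|exact: mulf_neq0|].
  move=> z; rewrite inE => /orP[/eqP->|/hE [g [mg Cg mgz]]].
    by exists f; split=> //; rewrite mulrC -scalerA; exact: polyinZ.
  by exists g; split=> //; rewrite -scalerA; exact: polyinZ.
have [d Ld eD] := CD; have d0 : d != 0 by apply: contraNneq D0 => d0; rewrite eD d0 horner0.
(* c has positive degree in x, hence generates a proper ideal, while c = 0 forces D to be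
   invertible. *)
pose c := 1 + x * D; pose e : {poly K} := 1 + 'X * d.
have ec : c = e.[x] by rewrite /c /e !hornerE eD.
have Le : polyin L' e.
  apply: polyinD => //; first exact: (polyinC hLr' (sr1 hLr')).
  by apply: polyinM => //; exact: polyinX.
have se : (1 < size e)%N.
  by rewrite /e addrC (mulrC 'X) size_polyDl size_mulX // ?size_poly1 ltnS lt0n size_poly_eq0.
have Cc : C c by exists e.
have Cx : C x by exact: adj_gen.
pose C0 := [set y | exists f m, [/\ C f, mideal O m & y = f + m]].
pose I0 := [set y | exists f m, [/\ C f, mideal O m & y = c * f + m]].
have hC0 : is_subring C0.
  split.
  - by exists 1, 0; rewrite addr0; split=> //; [exact: sr1|exact: prime0 hm].
  - move=> _ _ [f [m [Cf mm ->]]] [g [n [Cg mn ->]]]; exists (f - g), (m - n).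
    by split; [exact: srB|exact: (primeB hO hm)|ring].
  - move=> _ _ [f [m [Cf mm ->]]] [g [n [Cg mn ->]]].
    exists (f * g), (f * n + g * m + m * n); split; [exact: srM| |ring].
    apply: (primeD hm); [apply: (primeD hm)|]; apply: (primeMl hm) => //; [exact: CO|exact: CO|].
    exact: midealW.
have iI0 : idl C0 I0.
  split; last first.
    by move=> _ [f [m [Cf mm ->]]]; exists (c * f), m; split=> //; exact: srM.
  split.
  - by exists 0, 0; rewrite mulr0 addr0; split=> //; [exact: sr0|exact: prime0 hm].
  - move=> _ _ [f [m [Cf mm ->]]] [g [n [Cg mn ->]]]; exists (f + g), (m + n).
    by split; [exact: srD|exact: (primeD hm)|ring].
  - move=> _ _ [f [m [Cf mm ->]]] [g [n [Cg mn ->]]].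
    exists (f * g), (f * n + c * g * m + m * n); split; [exact: srM| |ring].
    apply: (primeD hm); [apply: (primeD hm)|]; apply: (primeMl hm) => //; first exact: CO.
      by apply: CO; exact: srM.
    exact: midealW.
have nI1 : ~ I0 1.
  move=> [_ [m [[f Lf ->] mm e1]]]; have e2 : (1 - e * f).[x] = m.
    by rewrite hornerD hornerN hornerM -ec hornerC; apply/eqP; rewrite subr_eq addrC -e1.
  have : 1 - e * f == 0.
    apply: contrapT => /negP h; apply: nx; exists (1 - e * f); split=> //; last by rewrite e2.
    by apply: polyinB => //; [exact: (polyinC hLr' (sr1 hLr'))|exact: polyinM].
  rewrite subr_eq0 => /eqP ef; have f0 : f != 0.
    by apply/eqP => f0; move/eqP: ef; rewrite f0 mulr0 oner_eq0.
  have e0 : e != 0 by rewrite -size_poly_eq0 -lt0n; exact: ltnW.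
  have := size_mul e0 f0; rewrite -ef size_poly1.
  have : (0 < size f)%N by rewrite size_poly_gt0.
  move=> sf0 h; have h2 := leq_add se sf0.
  have : (2 < (size e + size f).-1.+1)%N by rewrite (ltn_predK h2).
  by rewrite -h.
have [R [hR CR IR]] := chevalley hC0 iI0 nI1.
have hRs := val_sr hR.
have mR m : mideal O m -> mideal R m.
  by move=> mm; apply: IR; exists 0, m; rewrite mulr0 add0r; split=> //; exact: sr0.
have CsR f : C f -> R f.
  by move=> Cf; apply: CR; exists f, 0; rewrite addr0; split=> //; exact: prime0 hm.
have mc : mideal R c by apply: IR; exists 1, 0; rewrite mulr1 addr0; split=> //; [exact: sr1|exact: prime0 hm].
have uD : is_unit R D.
  apply: (unit_Ml hRs (CsR _ CD) (CsR _ Cx)); rewrite mulrC.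
  have -> : x * D = - (1 + - c) by rewrite /c; ring.
  apply: unitN => //; apply: unit_add; [exact: val_local|exact: unit1|].
  by apply: (submodN hRs) mc; case: (val_local hR).
have AR : A `<=` R.
  apply: kgen_min => //.
    by move=> b /bL /LL' Lb; apply: CsR; exact: sub_adj.
  move=> y ys; have [f [mf Cf mfy]] := hD y ys.
  apply: (val_integral hR mf).
  - rewrite ltnNge; apply/negP => sf; have f1 : f = 1.
      by move: mf; rewrite (size1_polyC sf) monicE lead_coefC => /eqP ->.
    by move: mfy; rewrite f1 hornerC; exact: prime_n1 hm.
  - move=> j; have := CsR _ (Cf j); rewrite coefZ => h.
    by case: uD => _ _ /(srM hRs) /(_ h); rewrite mulKf.
  - by apply: midealW; exact: mR.
pose q' := mideal R `&` A.
have [XO' dO'] := chart_center cs hR AR.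
have [hq' _] := dominates_loc hA (val_local hR) AR.
exists q'; split=> //.
- split.
    move=> _ [a [b [Aa Ab nb ->]]]; rewrite eO; apply: loc_div => // qb; apply: nb; split=> //.
    by apply: mR; rewrite eO; case: (loc_midealI hA hq Ab) => _; apply.
  (* The inclusion is strict because c is a unit of O but not of the new point. *)
  move=> OO'; have Oc := CO _ Cc; have [Rc nuc] := mc; apply: nuc.
  have [c0 _ Oc'] : is_unit O c.
    have [//|mOc] := unitVm Oc; case: nx; exists e; split=> //; last by rewrite -ec.
    by rewrite -size_poly_eq0 -lt0n; exact: ltnW.
  by split=> //; case: dO' => h _; apply: h; exact: OO'.
- move=> l /fL [a [b [[La Aa] [Lb Ab] b0 ->]]]; apply: loc_div => // -[[_ nu] _]; apply: nu.
  have LR u : L u -> R u by move=> /LL' Lu; apply: CsR; exact: sub_adj.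
  by split=> //; apply: LR => //; case: hL => _; apply.
Qed.

End Dimension.

(** * Bases of a field over an embedded subfield *)

Section LinearAlgebra.
Variables (F K : fieldType) (f : {rmorphism F -> K}).
Implicit Types (I J : finType).

Definition fspan I (e : I -> K) (x : K) := exists c : I -> F, x = \sum_i f (c i) * e i.
Definition ffree I (e : I -> K) := forall c : I -> F, \sum_i f (c i) * e i = 0 -> forall i, c i = 0.
Definition fbasis I (e : I -> K) := (forall x, fspan e x) /\ ffree e.

Lemma fdep I J (e : I -> K) (v : J -> K) : (forall j, fspan e (v j)) -> (#|I| < #|J|)%N ->
  exists c : J -> F, (exists j, c j != 0) /\ \sum_j f (c j) * v j = 0.
Proof.
move=> /choice [C eC] IJ.
pose M : 'M[F]_(#|J|, #|I|) := \matrix_(j, i) C (enum_val j) (enum_val i).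
have : kermx M != 0.
  rewrite -mxrank_eq0 mxrank_ker -lt0n subn_gt0.
  exact: leq_ltn_trans (rank_leq_col M) IJ.
move=> /matrix0Pn [a [b nab]].
pose u := row a (kermx M).
have uM : u *m M = 0.
  by apply: sub_kermxP; exact: row_sub.
exists (fun j => u 0 (enum_rank j)); split; first by exists (enum_val b); rewrite enum_valK mxE.
transitivity (\sum_i f ((u *m M) 0 (enum_rank i)) * e i); last first.
  by rewrite uM big1 // => i _; rewrite mxE rmorph0 mul0r.
under eq_bigr => j _ do rewrite eC mulr_sumr.
rewrite exchange_big; apply: eq_bigr => i _ /=.
rewrite mxE rmorph_sum mulr_suml (reindex (@enum_val J predT)) /=; last first.
  by exists enum_rank => j _; rewrite ?enum_valK ?enum_rankK.
by apply: eq_bigr => j _; rewrite !mxE enum_valK enum_rankK rmorphM mulrA.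
Qed.

Lemma fbasis_card I J (e : I -> K) (v : J -> K) : fbasis e -> fbasis v -> #|I| = #|J|.
Proof.
move=> [se fe] [sv fv]; apply/eqP; rewrite eqn_leq; apply/andP; split; rewrite leqNgt; apply/negP.
  by move=> /(fdep (fun j => sv _)) - /(_ e) [c [[j nj] /fe /(_ j) cj]]; rewrite cj eqxx in nj.
by move=> /(fdep (fun j => se _)) - /(_ v) [c [[j nj] /fv /(_ j) cj]]; rewrite cj eqxx in nj.
Qed.

Lemma free_fbasis I J (e : I -> K) (v : J -> K) : fbasis e -> ffree v -> #|I| = #|J| -> fbasis v.
Proof.
move=> [se fe] fv IJ; split=> // x.
have [|c [[j nj] e0]] := @fdep I (J + unit)%type e
    (fun o => match o with inl j => v j | inr _ => x end) (fun j => se _).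
  by rewrite card_sum card_unit IJ addn1.
move: e0; rewrite big_sumType /= [X in _ + X](big_pred1 tt); last by case.
have [c0 e0|c0 /eqP e0] := eqVneq (c (inr tt)) 0.
  move: e0; rewrite c0 rmorph0 mul0r addr0 => /fv cl.
  by case/eqP: nj; case: j => [j|[]].
exists (fun j => - (c (inl j) / c (inr tt))).
have fc0 : f (c (inr tt)) != 0 by rewrite fmorph_eq0.
move: e0; rewrite addrC addr_eq0 => /eqP e0; apply: (mulfI fc0); rewrite e0 mulr_sumr -sumrN.
apply: eq_bigr => i _; rewrite rmorphN rmorphM fmorphV mulNr mulrN; congr (- _).
by field.
Qed.

Lemma fbasis_exists n (v : 'I_n -> K) : (forall x, fspan v x) -> exists m (e : 'I_m -> K), fbasis e.
Proof.
move=> sv; pose P m := `[< exists e : 'I_m -> K, forall x, fspan e x >].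
have exP : exists m, P m by exists n; apply/asboolP; exists v.
case: (ex_minnP exP) => m /asboolP [e se] minm; exists m, e; split=> // c e0 i.
apply: contrapT => /eqP ci.
case: m e se minm c e0 i ci => [|m] e se minm c e0 i ci; first by case: i {ci}.
have : (m.+1 <= m)%N.
  apply: minm; apply/asboolP; exists (e \o lift i) => x; have [d ->] := se x.
  exists (fun j => d (lift i j) - d i * (c (lift i j) / c i)).
  have fc0 : f (c i) != 0 by rewrite fmorph_eq0.
  move: e0; rewrite (bigD1_ord i) //= => /eqP; rewrite addr_eq0 => /eqP e0.
  rewrite (bigD1_ord i) //=.
  have -> : f (d i) * e i = - \sum_j f (d i * (c (lift i j) / c i)) * e (lift i j).
    apply: (mulfI fc0); rewrite mulrCA e0 mulrN mulrN mulr_sumr mulr_sumr; congr (- _).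
    by apply: eq_bigr => j _; rewrite !rmorphM fmorphV; field.
  rewrite addrC -sumrB; apply: eq_bigr => j _.
  by rewrite rmorphB mulrBl.
by rewrite ltnn.
Qed.

End LinearAlgebra.

Lemma fbasis_tower (F G K : fieldType) (f : {rmorphism F -> G}) (g : {rmorphism G -> K})
    (I J : finType) (e : I -> G) (v : J -> K) : fbasis f e -> fbasis g v ->
  fbasis (g \o f) (fun ij : I * J => g (e ij.1) * v ij.2).
Proof.
move=> [se fe] [sv fv]; split=> [x|c].
  have [d ->] := sv x; have /choice [C eC] j := se (d j).
  exists (fun ij => C ij.2 ij.1); rewrite -(pair_bigA _ (fun i j => g (f (C j i)) * (g (e i) * v j))) /=.
  rewrite exchange_big; apply: eq_bigr => j _ /=; rewrite {1}eC rmorph_sum mulr_suml.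
  by apply: eq_bigr => i _; rewrite rmorphM mulrA.
have -> : \sum_i (g \o f) (c i) * (g (e i.1) * v i.2) =
    \sum_i \sum_j g (f (c (i, j))) * (g (e i) * v j).
  rewrite (pair_bigA _ (fun i j => g (f (c (i, j))) * (g (e i) * v j))) /=.
  by apply: eq_bigr => -[].
rewrite exchange_big /=.
under eq_bigr => j _ do under eq_bigr => i _ do rewrite mulrA -rmorphM.
under eq_bigr => j _ do rewrite -mulr_suml -rmorph_sum.
by move=> /fv h [i j]; apply: (fe (fun i => c (i, j))); exact: h.
Qed.

(** * Subfields as field types *)

Section SubfieldType.
Variable K : fieldType.

Record subfld := Subfld { sfset :> set K; sfP : is_subfield sfset }.

Definition sfmem (L : subfld) : {pred K} := fun x => `[< sfset L x >].

Fact sfmem_closed (L : subfld) : divring_closed (sfmem L).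
Proof.
have [hL invL] := sfP L; split; first by apply/asboolP; exact: sr1.
  by move=> x y /asboolP Lx /asboolP Ly; apply/asboolP; exact: srB.
by move=> x y /asboolP Lx /asboolP Ly; apply/asboolP; apply: srM => //; exact: invL.
Qed.

HB.instance Definition _ (L : subfld) := GRing.isDivringClosed.Build K (sfmem L) (sfmem_closed L).

Record sftype (L : subfld) := SfType { sfval : K; sfvalP : sfval \in sfmem L }.

HB.instance Definition _ L := [isSub for @sfval L].
HB.instance Definition _ L := [Choice of sftype L by <:].
HB.instance Definition _ L := [SubChoice_isSubIntegralDomain of sftype L by <:].
HB.instance Definition _ L := [SubIntegralDomain_isSubField of sftype L by <:].

Definition sfinj (L : subfld) : {rmorphism sftype L -> K} := val.

Lemma sfinjP (L : subfld) x : sfset L x -> exists y, sfinj L y = x.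
Proof. by move=> Lx; exists (SfType (introT (asboolP _) Lx)). Qed.

Lemma sfinj_in (L : subfld) y : sfset L (sfinj L y).
Proof. by case: y => y hy; apply/asboolP. Qed.

End SubfieldType.

(** * The degree of K over its p-th powers *)

Section PDegree.
Context {K : fieldType} (p : nat) (hp : p \in [pchar K]).
Implicit Types (A C L M : set K) (x y z : K) (s zs : seq K).

Local Notation frob := (pFrobenius_aut hp).

Lemma pprime : prime p. Proof. exact: pcharf_prime hp. Qed.
Lemma p_gt0 : (0 < p)%N. Proof. exact: prime_gt0 pprime. Qed.
Lemma p_gt1 : (1 < p)%N. Proof. exact: prime_gt1 pprime. Qed.

Lemma frobE x : frob x = x ^+ p. Proof. exact: pFrobenius_autE. Qed.

Lemma frobD x y : (x + y) ^+ p = x ^+ p + y ^+ p.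
Proof. by rewrite -!frobE rmorphD. Qed.
Lemma frobN x : (- x) ^+ p = - x ^+ p. Proof. by rewrite -!frobE rmorphN. Qed.
Lemma frobB x y : (x - y) ^+ p = x ^+ p - y ^+ p. Proof. by rewrite frobD frobN. Qed.
Lemma frob_sum T (r : seq T) (P : pred T) (F : T -> K) :
  (\sum_(i <- r | P i) F i) ^+ p = \sum_(i <- r | P i) F i ^+ p.
Proof. by rewrite -frobE rmorph_sum; apply: eq_bigr => i _; rewrite /= frobE. Qed.
Lemma frob0 : 0 ^+ p = 0 :> K. Proof. by rewrite -frobE rmorph0. Qed.
Lemma frob_inj x y : x ^+ p = y ^+ p -> x = y.
Proof. by rewrite -!frobE => /fmorph_inj. Qed.
Lemma frob_eq0 x : (x ^+ p == 0) = (x == 0).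
Proof. by rewrite expf_eq0 p_gt0. Qed.

(* [K : K^p] = p ^ n *)
Definition pdegree n := exists (I : finType) (e : I -> K), #|I| = (p ^ n)%N /\ fbasis frob e.

Lemma pdegree_uniq m n : pdegree m -> pdegree n -> m = n.
Proof.
move=> [I [e [cI he]]] [J [v [cJ hv]]]; have := fbasis_card he hv.
by rewrite cI cJ => /eqP; rewrite eqn_exp2l ?p_gt1 // => /eqP.
Qed.

(** A basis of L over L^p stated inside K, so that L can move up a tower of subfields. *)
Definition subpbasis L (I : finType) (e : I -> K) := [/\ forall i, L (e i),
  forall x, L x -> exists c : I -> K, (forall i, L (c i)) /\ x = \sum_i c i ^+ p * e i
  & forall c : I -> K, (forall i, L (c i)) -> \sum_i c i ^+ p * e i = 0 -> forall i, c i = 0].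

Lemma divn_pair m j m' (j' : 'I_p) : (j < p)%N -> (p * m + j = p * m' + j')%N -> m = m' /\ j = j'.
Proof.
move=> jp e; have hp0 := p_gt0; split.
  by have := congr1 (fun n => n %/ p)%N e; rewrite !(mulnC p) !divnMDl // !divn_small // !addn0.
by have := congr1 (fun n => n %% p)%N e; rewrite !(mulnC p) !modnMDl !modn_small.
Qed.

(** Since f / g = f g^(p-1) / g^p, denominators may be taken to be p-th powers, and exponents of z
    are reduced modulo p. For independence, the exponents p m + j are pairwise distinct, so a
    relation cleared of denominators is a polynomial over L vanishing at the transcendental z. *)
Lemma subpbasis_fadj L (I : finType) (e : I -> K) z : is_subfield L -> subpbasis L e -> ~ alg L z ->
  subpbasis (fadj L z) (fun ij : I * 'I_p => e ij.1 * z ^+ ij.2).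
Proof.
move=> [hL invL] [Le se fe] nz; have [hF invF] := fadj_sf z hL.
have LF : L `<=` fadj L z by exact: sub_fadj.
have Fz : fadj L z z by exact: fadj_gen.
split.
- by move=> [i j]; apply: srM => //; [exact: LF|exact: srX].
- pose S := [set x | exists c : I * 'I_p -> K, (forall ij, fadj L z (c ij)) /\
    x = \sum_ij c ij ^+ p * (e ij.1 * z ^+ ij.2)].
  have S0 : S 0.
    exists (fun _ => 0); split=> [_|]; first exact: sr0.
    by rewrite big1 // => ij _; rewrite frob0 mul0r.
  have SD x y : S x -> S y -> S (x + y).
    move=> [c [Fc ->]] [d [Fd ->]]; exists (fun ij => c ij + d ij); split=> [ij|].
      exact: srD.
    by rewrite -big_split; apply: eq_bigr => ij _; rewrite frobD mulrDl.
  have SM y x : fadj L z y -> S x -> S (y ^+ p * x).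
    move=> Fy [c [Fc ->]]; exists (fun ij => y * c ij); split=> [ij|]; first exact: srM.
    by rewrite mulr_sumr; apply: eq_bigr => ij _; rewrite exprMn mulrA.
  have Sb i (j : 'I_p) : S (e i * z ^+ j).
    exists (fun ij => if ij == (i, j) then 1 else 0); split=> [ij|].
      by case: ifP => _; [exact: sr1|exact: sr0].
    rewrite (bigD1 (i, j)) //= eqxx expr1n mul1r big1 ?addr0 // => ij /negbTE ->.
    by rewrite frob0 mul0r.
  have Sn i n : S (e i * z ^+ n).
    rewrite (divn_eq n p) exprD exprM mulrCA; apply: SM; first exact: srX.
    exact: (Sb i (Ordinal (ltn_pmod n p_gt0))).
  have Ssum T (r : seq T) (P : pred T) (F : T -> K) : (forall i, S (F i)) ->
      S (\sum_(i <- r | P i) F i).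
    by move=> h; elim/big_ind: _.
  move=> x [f [g [Lf Lg g0 ->]]].
  suff : S (f.[z] / g.[z]) by [].
  have -> : f.[z] / g.[z] = (g.[z])^-1 ^+ p * (f * g ^+ p.-1).[z].
    rewrite hornerM horner_exp exprVn -{1}(prednK p_gt0) exprS invfM.
    by field; rewrite expf_neq0.
  apply: (SM); first by apply: invF; apply: adj_fadj => //; exists g.
  rewrite horner_coef; apply: (Ssum) => n.
  have : L (f * g ^+ p.-1)`_n by apply: polyinM => //; exact: polyinE.
  move=> /se [c [Lc ->]]; rewrite mulr_suml; apply: (Ssum) => i.
  by rewrite -mulrA; apply: (SM) => //; exact: LF.
- move=> c Fc h.
  have [d [d0 Cd]] : exists d, d != 0 /\ forall ij, adj L z (d * c ij).
    have : forall ij, exists d, [/\ d != 0, adj L z d & adj L z (d * c ij)].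
      move=> ij; have [f [g [Lf Lg g0 ->]]] := Fc ij; exists g.[z]; split=> //; first by exists g.
      by rewrite mulrC divfK //; exists f.
    move=> /choice [d hd]; exists (\prod_ij d ij); split.
      by apply/prodf_neq0 => ij _; case: (hd ij).
    move=> ij; rewrite (bigD1 ij) //= mulrAC; apply: srM; first exact: adj_sr.
      by case: (hd ij).
    by apply: sr_prod => [|i _]; [exact: adj_sr|case: (hd i)].
  have /choice [F hF'] : forall ij, exists f, polyin L f /\ d * c ij = f.[z].
    by move=> ij; have [f Lf ef] := Cd ij; exists f.
  have h2 : \sum_ij (F ij).[z] ^+ p * (e ij.1 * z ^+ ij.2) = 0.
    transitivity (d ^+ p * \sum_ij c ij ^+ p * (e ij.1 * z ^+ ij.2)); last by rewrite h mulr0.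
    rewrite mulr_sumr; apply: eq_bigr => ij _.
    by have [_ <-] := hF' ij; rewrite exprMn mulrA.
  pose N := \max_ij size (F ij).
  pose G := \sum_ij \sum_(m < N) ((F ij)`_m ^+ p * e ij.1) *: 'X^(p * m + ij.2).
  have LG : polyin L G.
    move=> n; rewrite coef_sum; apply: sr_sum => // ij _; rewrite coef_sum.
    apply: sr_sum => // m _; rewrite coefZ; apply: srM => //; last exact: polyinXn.
    by apply: srM => //; apply: srX => //; case: (hF' ij).
  have G0 : G = 0.
    apply: contrapT => /eqP G0; apply: nz; exists G; split=> //.
    rewrite rootE -h2 horner_sum; apply/eqP; apply: eq_bigr => ij _.
    have -> : (F ij).[z] = \sum_(m < N) (F ij)`_m * z ^+ m.
      by apply: horner_coef_wide; exact: leq_bigmax.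
    rewrite frob_sum mulr_suml horner_sum.
    apply: eq_bigr => m _; rewrite hornerZ hornerXn exprMn exprD -!exprM mulnC.
    by rewrite -!mulrA; congr (_ * _); rewrite mulrCA.
  move=> [i0 j0]; have [_ ec] := hF' (i0, j0); apply: (mulfI d0); rewrite mulr0 ec.
  suff -> : F (i0, j0) = 0 by rewrite horner0.
  apply/polyP => m0; rewrite coef0; case: (ltnP m0 N) => [m0N|Nm0]; last first.
    by rewrite nth_default // (leq_trans (leq_bigmax _) Nm0).
  have := congr1 (fun q : {poly K} => q`_(p * m0 + j0)) G0; rewrite /= coef0 coef_sum.
  have -> : \sum_ij (\sum_(m < N) ((F ij)`_m ^+ p * e ij.1) *: 'X^(p * m + ij.2))`_(p * m0 + j0)
     = \sum_i (F (i, j0))`_m0 ^+ p * e i.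
    transitivity (\sum_i \sum_j (\sum_(m < N) ((F (i, j))`_m ^+ p * e i) *: 'X^(p * m + j))`_(p * m0 + j0)).
      by rewrite pair_bigA /=; apply: eq_bigr => -[].
    apply: eq_bigr => i _; rewrite (bigD1 j0) //= [X in _ + X]big1 ?addr0; last first.
      move=> j jj0; rewrite coef_sum big1 // => m _; rewrite coefZ coefXn.
      by case: eqP => [/esym/divn_pair [//|_ /val_inj/eqP]|]; rewrite ?(negbTE jj0) ?mulr0.
    rewrite coef_sum (bigD1 (Ordinal m0N)) //= [X in _ + X]big1 ?addr0; last first.
      move=> m mm0; rewrite coefZ coefXn; case: eqP => [/esym/divn_pair [//|/eqP]|]; last by rewrite mulr0.
      by move=> e1; case/eqP: mm0; apply: val_inj; rewrite /= (eqP e1).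
    by rewrite coefZ coefXn eqxx mulr1.
  by move/fe => ->//; move=> i; case: (hF' (i, j0)).
Qed.

Lemma subpbasis_tower L (I : finType) (e : I -> K) zs m : is_subfield L -> subpbasis L e ->
  #|I| = (p ^ m)%N -> trtower L zs ->
  exists (J : finType) (v : J -> K), #|J| = (p ^ (m + size zs))%N /\ subpbasis (fadjs L zs) v.
Proof.
elim: zs L I e m => [|z zs IHzs] L I e m hL be cI /=; first by move=> _; exists I, e; rewrite addn0.
move=> [nz tz]; have [hLr _] := hL.
have [|J [v [cJ bv]]] := IHzs _ _ _ m.+1 (fadj_sf z hLr) (subpbasis_fadj hL be nz) _ tz.
  by rewrite card_prod card_ord cI expnSr.
by exists J, v; rewrite addnS -addSn.
Qed.

Lemma mspanP A s x : is_subring A -> mspan A [set` s] x <->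
  exists c : 'I_(size s) -> K, (forall j, A (c j)) /\ x = \sum_j c j * s`_j.
Proof.
move=> hA; split; last first.
  move=> [c [Ac ->]]; apply: (submod_sum _ (mspanS _ _)) => j _.
  by have [_ _ hM] := mspanS A [set` s]; apply: hM => //; apply: sub_mspan; exact: mem_nth.
move: x; apply: mspan_sub.
  split.
  - by exists (fun _ => 0); split=> [_|]; [exact: sr0|rewrite big1 // => j _; rewrite mul0r].
  - move=> _ _ [c [Ac ->]] [d [Ad ->]]; exists (fun j => c j + d j); split=> [j|]; first exact: srD.
    by rewrite -big_split; apply: eq_bigr => j _; rewrite mulrDl.
  - move=> a _ Aa [c [Ac ->]]; exists (fun j => a * c j); split=> [j|]; first exact: srM.
    by rewrite mulr_sumr; apply: eq_bigr => j _; rewrite mulrA.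
move=> x /= xs; have xi : (index x s < size s)%N by rewrite index_mem.
exists (fun j => if j == Ordinal xi then 1 else 0); split=> [j|].
  by case: ifP => _; [exact: sr1|exact: sr0].
rewrite (bigD1 (Ordinal xi)) //= eqxx mul1r nth_index // big1 ?addr0 // => j /negbTE ->.
by rewrite mul0r.
Qed.

Lemma fingen_adj M R s y : is_subfield M -> is_subring R -> R = mspan M [set` s] -> alg M y ->
  exists s', adj R y = mspan M [set` s'].
Proof.
move=> [hM invM] hR eR [f [Mf f0 rf]].
case sf: (size f) => [|d]; first by move/eqP: sf; rewrite size_poly_eq0 (negbTE f0).
have MR : forall a r, M a -> R r -> R (a * r).
  by rewrite eR => a r Ma; case: (mspanS M [set` s]) => _ _; apply.
pose s' := [seq a * y ^+ j | a <- s, j <- iota 0 d]; exists s'.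
set T := mspan M [set` s']; have hT : submod M T by exact: mspanS.
have [T0 TD TM] := hT.
have Ts' a j : a \in s -> (j < d)%N -> T (a * y ^+ j).
  by move=> sa jd; apply: sub_mspan; apply: allpairs_f => //; rewrite mem_iota.
have Td a : a \in s -> T (a * y ^+ d).
  move=> sa; move: rf; rewrite rootE horner_coef sf big_ord_recr /= addrC addr_eq0 => /eqP e.
  have fd : f`_d != 0 by move: f0; rewrite -lead_coef_eq0 lead_coefE sf.
  rewrite -(mulKf fd (y ^+ d)) e mulrN mulrN mulrA mulr_sumr; apply: (submodN hM hT).
  apply: (submod_sum _ hT) => i _.
  have -> : a / f`_d * (f`_i * y ^+ i) = (f`_d)^-1 * f`_i * (a * y ^+ i) by ring.
  by apply: TM; [apply: srM => //; exact: invM|exact: Ts'].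
have Ty x : T x -> T (x * y).
  move: x; apply: mspan_sub.
    split; first by rewrite /= mul0r.
      by move=> u v /= Tu Tv; rewrite mulrDl; exact: TD.
    by move=> u v /= Mu Tv; rewrite -mulrA; exact: TM.
  move=> _ /= /allpairsP [[a j] [sa + ->]] /=; rewrite mem_iota add0n => /andP [_ jd].
  rewrite -mulrA -exprSr; case: (ltnP j.+1 d) => [|dj]; first exact: Ts'.
  by rewrite (_ : j.+1 = d); [exact: Td|apply/eqP; rewrite eqn_leq jd dj].
apply/seteqP; split.
  move=> _ [q Rq ->]; rewrite horner_coef; apply: (submod_sum _ hT) => i _.
  have := Rq i; rewrite eR; move: (q`_i); apply: mspan_sub.
    split; first by rewrite /= mul0r.
      by move=> u v /= Tu Tv; rewrite mulrDl; exact: TD.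
    by move=> u v /= Mu Tv; rewrite -mulrA; exact: TM.
  move=> a sa /=; elim: (i : nat) => [|n IHn]; last by rewrite exprSr mulrA; exact: Ty.
  case: (posnP d) => [d0|d0]; last exact: Ts'.
  by rewrite -{1}d0; exact: Td.
apply: mspan_sub.
  split; first by apply: sr0; exact: adj_sr.
    by move=> u v; apply: srD; exact: adj_sr.
  move=> a _ Ma [q Rq ->]; exists (a *: q); last by rewrite hornerZ.
  by move=> j; rewrite coefZ; exact: MR.
move=> _ /= /allpairsP [[a j] [sa _ ->]] /=; apply: srM; first exact: adj_sr.
  by apply: sub_adj => //; rewrite eR; exact: sub_mspan.
by apply: srX; [exact: adj_sr|exact: adj_gen].
Qed.

Lemma alg_generated_finite M s : is_subfield M -> (forall y, y \in s -> alg M y) ->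
  exists (R : set K) (t : seq K), [/\ is_subring R, M `<=` R, forall y, y \in s -> R y & R = mspan M [set` t]].
Proof.
move=> hMf; have [hM invM] := hMf; elim: s => [|y s IHs] als.
  exists M, [:: 1]; split=> //; apply/seteqP; split.
    move=> x Mx; rewrite -(mulr1 x); have [_ _ h] := mspanS M [set` [:: (1 : K)]].
    by apply: h => //; apply: sub_mspan; rewrite /= inE.
  apply: mspan_sub; first by case: (self_idl hM).
  by move=> x; rewrite /= inE => /eqP->; exact: sr1.
have [|R [t [hR MR sR eR]]] := IHs; first by move=> z zs; apply: als; rewrite inE zs orbT.
have [t' et'] := fingen_adj hMf hR eR (als y (mem_head _ _)).
exists (adj R y), t'; split=> //; first exact: adj_sr.
  by apply: (subset_trans MR); exact: sub_adj.
move=> z; rewrite inE => /orP[/eqP->|zs]; first exact: adj_gen.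
by apply: sub_adj => //; exact: sR.
Qed.

(** The powers of b are dependent over M. A relation freed of common powers of b has a nonzero
    constant term, and dividing by it exhibits the inverse. *)
Lemma fin_domain_inv M R (t : seq K) b : is_subfield M -> is_subring R -> M `<=` R -> R = mspan M [set` t] ->
  R b -> b != 0 -> R b^-1.
Proof.
move=> hMf hR MR eR Rb b0; have [hM invM] := hMf.
pose f := sfinj (Subfld hMf).
have [||c [[j nj] ec]] := @fdep _ _ f 'I_(size t) 'I_(size t).+1 (fun j => t`_j) (fun j => b ^+ j).
- move=> j; have : R (b ^+ j) by exact: srX.
  rewrite eR => /(mspanP _ _ hM) [c [Mc ->]].
  have /choice [d hd] : forall j, exists w, f w = c j.
    by move=> i; have [y ey] := @sfinjP _ (Subfld hMf) (c i) (Mc i); exists y.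
  by exists d; apply: eq_bigr => i _; rewrite hd.
- by rewrite !card_ord.
pose q := \poly_(i < (size t).+1) f (c (inord i)).
have qb : q.[b] = 0.
  by rewrite horner_poly -[RHS]ec; apply: eq_bigr => i _; rewrite inord_val.
have q0 : q != 0.
  apply/eqP => /(congr1 (fun g : {poly K} => g`_j)); rewrite coef0 coef_poly ltn_ord inord_val.
  by move/eqP; rewrite fmorph_eq0 (negbTE nj).
have Mq : polyin M q.
  move=> i; rewrite coef_poly; case: ifP => _; last exact: sr0.
  exact: (sfinj_in (L := Subfld hMf)).
have [n [g [eq Mg g0]]] := poly_lowest q0 Mq.
have gb : g.[b] = 0.
  by move: qb; rewrite eq hornerM hornerXn => /eqP; rewrite mulf_eq0 expf_eq0 (negbTE b0) andbF orbF => /eqP.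
have -> : b^-1 = - (g`_0)^-1 * (drop_poly 1 g).[b].
  apply: (mulfI b0); rewrite mulfV //.
  have : g.[b] = g`_0 + b * (drop_poly 1 g).[b].
    rewrite -{1}(poly_take_drop 1 g) hornerD hornerM hornerXn expr1 mulrC; congr (_ + _).
    by rewrite horner_poly big_ord1 expr0 mulr1.
  rewrite gb => /esym/eqP; rewrite addrC addr_eq0 => /eqP h.
  by rewrite mulrCA h mulrNN mulVf.
apply: srM => //; first by apply: srN => //; apply: MR; exact: invM.
by apply: polyin_horner => // j'; rewrite coef_drop_poly; exact: MR.
Qed.

End PDegree.

Notation pperfect p k := (forall x : k, exists y : k, y ^+ p = x).

(** * Dimension as the exponent of [K : K^p] *)

Section DimensionPDegree.
Context {k K : fieldType} (iota : {rmorphism k -> K}) (p : nat) (hp : p \in [pchar K])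
  (hperf : pperfect p k).

(** K is finite over M. Computing [K : M^p] through M and through K^p, with [K^p : M^p] = [K : M],
    gives [K : K^p] = [M : M^p]; perfectness starts the tower with [k : k^p] = 1. *)
Lemma tower_pdegree s zs : frac (kgen iota s) -> trtower (base iota) zs ->
  (forall y, y \in s -> alg (fadjs (base iota) zs) y) -> pdegree hp (size zs).
Proof.
move=> fs tz az; set M := fadjs (base iota) zs in az.
have hM : is_subfield M by apply: fadjs_subfield; exact: base_sf.
have hB : subpbasis p (base iota) (fun _ : unit => 1).
  split.
  - by move=> _; exists 1; rewrite rmorph1.
  - move=> _ [c ->]; have [d ed] := hperf c; exists (fun _ => iota d); split=> [_|]; first by exists d.
    by rewrite (big_pred1 tt) ?mulr1 -?rmorphXn ?ed //; case.
  - move=> c _ + []; rewrite (big_pred1 tt) ?mulr1 => [/eqP|]; last by case.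
    by rewrite (frob_eq0 hp) => /eqP.
have [|J [v [cJ [Mv sv fv]]]] := subpbasis_tower hp (m := 0) (base_sf iota) hB _ tz.
  by rewrite card_unit expn0.
rewrite add0n in cJ.
have [R [t [hR MR sR eR]]] := alg_generated_finite hM az.
have RK x : R x.
  have [a [b [ha hb b0 ->]]] := fs x.
  have sub : kgen iota s `<=` R.
    apply: kgen_min => //; apply: subset_trans MR; apply: sub_fadjs; exact: base_sf.
  by apply: srM => //; [exact: sub|apply: (fin_domain_inv hM hR MR eR) => //; exact: sub].
have [hMr _] := hM.
have [f [fM Mf]] : exists f : {rmorphism sftype (Subfld hM) -> K},
    (forall x, M x -> exists w, f w = x) /\ forall w, M (f w).
  exists (sfinj (Subfld hM)); split; [exact: (@sfinjP _ (Subfld hM))|exact: (@sfinj_in _ (Subfld hM))].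
have hpM : p \in [pchar sftype (Subfld hM)] by rewrite -(fmorph_pchar f).
have /choice [w ew] : forall j, exists w', f w' = v j by move=> j; exact: fM.
have bw : fbasis (pFrobenius_aut hpM) w.
  split=> [x|c].
    have [c [Mc ec]] := sv _ (Mf x); have /choice [d ed] : forall j, exists w', f w' = c j.
      by move=> j; exact: fM.
    exists d; apply: (fmorph_inj f); rewrite ec rmorph_sum; apply: eq_bigr => j _.
    by rewrite rmorphM /= pFrobenius_autE rmorphXn /= ed ew.
  move=> /(congr1 f); rewrite rmorph_sum rmorph0 => h j; apply: (fmorph_inj f); rewrite rmorph0.
  apply: (fv (fun j => f (c j))) => // [i|]; first exact: Mf.
  by rewrite -[RHS]h; apply: eq_bigr => i _; rewrite rmorphM /= pFrobenius_autE rmorphXn /= ew.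
have sf x : fspan f (fun j : 'I_(size t) => t`_j) x.
  have := RK x; rewrite eR => /(mspanP _ _ hMr) [c [Mc ->]].
  have /choice [d hd] : forall j, exists w', f w' = c j by move=> i; exact: fM.
  by exists d; apply: eq_bigr => i _; rewrite hd.
have [m [e be]] := fbasis_exists sf.
have m0 : (0 < m)%N.
  case: m e be => // e [se _]; have [c] := se 1; rewrite big_ord0 => /eqP.
  by rewrite oner_eq0.
have b1 := fbasis_tower bw be.
pose g := pFrobenius_aut hp.
have sg x : fspan g (fun ij : J * 'I_m => f (w ij.1) * e ij.2) x.
  have [[s1 _] _] := (b1, tt); have [c ->] := s1 x; exists (fun ij => f (c ij)).
  by apply: eq_bigr => ij _; rewrite /= !pFrobenius_autE rmorphXn.
have [n [u bu]] : exists n (u : 'I_n -> K), fbasis g u.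
  apply: (@fbasis_exists _ _ g #|{: J * 'I_m}| (fun i => f (w (enum_val i).1) * e (enum_val i).2)) => x.
  have [c ->] := sg x; exists (fun i => c (enum_val i)); rewrite (reindex (@enum_val (J * 'I_m)%type predT)) //=.
  by exists enum_rank => j _; rewrite ?enum_valK ?enum_rankK.
have b2 := fbasis_tower be bu.
have cc : #|{: J * 'I_m}| = #|{: 'I_m * 'I_n}|.
  apply: (fbasis_card b1 (v := (fun ij => g (e ij.1) * u ij.2))).
  have efg w' : (g \o f) w' = (f \o pFrobenius_aut hpM) w'.
    by rewrite /= /g !pFrobenius_autE rmorphXn.
  case: b2 => s2 f2; split=> [x|c h].
    by have [c ->] := s2 x; exists c; apply: eq_bigr => ij _; congr (_ * _); exact: efg.
  by apply: f2; rewrite -[RHS]h; apply: eq_bigr => ij _; congr (_ * _); exact: efg.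
exists 'I_n, u; split=> //; rewrite card_ord -cJ; move/eqP: cc.
by rewrite !card_prod !card_ord mulnC eqn_pmul2l // => /eqP.
Qed.

(** The chain is built downwards from the generic point. While a point contains L(y), with y
    transcendental over L, its residue field is transcendental over L, and [chart_specialize] yields
    a smaller point that still contains L. *)
Lemma has_chain_gens X s xs : variety iota X -> chart iota X s -> {subset xs <= s} ->
  trtower (base iota) xs -> has_chain X (size xs).
Proof.
move=> hX cs xss txs; set A := kgen iota s.
have hA : is_subring A by exact: kgen_sr.
have fin ys : {subset ys <= s} -> fracin A (fadjs (base iota) ys).
  move=> yss; elim/last_ind: ys yss => [|ys y IHys] yss /=.
    move=> l [c ->]; exists (iota c), 1; rewrite divr1 oner_eq0; split=> //.
    - by split; [exists c|apply: kgen_base; exists c].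
    - by split; [exists 1; rewrite rmorph1|exact: sr1].
  rewrite fadjs_rcons; apply: fracin_fadj => //.
  - by have [] := fadjs_subfield ys (base_sf iota).
  - by apply: IHys => z zys; apply: yss; rewrite mem_rcons inE zys orbT.
  - by apply: kgen_mem; apply: yss; rewrite mem_rcons mem_head.
suff claim m : (m <= size xs)%N -> exists (c : nat -> set K) q,
    [/\ forall j, (j <= m)%N -> X (c j), forall j, (j < m)%N -> c j `<` c j.+1,
       prime_ideal A q, c 0%N = localization A q &
       fadjs (base iota) (take (size xs - m) xs) `<=` c 0%N].
  by have [c [q [Xc ic _ _ _]]] := claim _ (leqnn _); exists c.
elim: m => [|m IHm] mx.
  exists (fun _ => setT), [set 0]; split=> //.
  - by move=> j _; exact: (generic_point hX).
  - exact: kgen_prime0.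
  - apply/seteqP; split=> // x _; have [a [b [ha hb b0 ->]]] := cs.1 x.
    by exists a, b; split=> // e; rewrite e eqxx in b0.
have [c [q [Xc ic hq e0 sub]]] := IHm (ltnW mx).
set n := (size xs - m.+1)%N; have en : (size xs - m = n.+1)%N by rewrite /n subnSK.
have nx : (n < size xs)%N by rewrite /n; lia.
have tk : take (size xs - m) xs = rcons (take n xs) (nth 0 xs n) by rewrite en (take_nth 0).
have tt : trtower (base iota) (rcons (take n xs) (nth 0 xs n)).
  rewrite -tk; move: txs; rewrite -{1}(cat_take_drop (size xs - m) xs).
  elim: (take _ _) (base iota) => //= z zs IH L [nz tz]; split=> //; exact: IH.
have [tt1 nalg] := (trtower_rcons _ _ _).1 tt.
rewrite tk fadjs_rcons in sub; set L := fadjs (base iota) (take n xs) in nalg sub.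
have hL : is_subfield L by apply: fadjs_subfield; exact: base_sf.
have lO := point_local hX (Xc 0%N (leq0n _)).
have xns : nth 0 xs n \in s by apply: xss; exact: mem_nth.
have LF : L `<=` fadj L (nth 0 xs n) by apply: sub_fadj; case: hL.
have [|||q' [hq' cc LO]] := chart_specialize hX cs hq e0 hL _ (subset_trans LF sub) _.
- by apply: sub_fadjs; exact: base_sf.
- by apply: fin => z /mem_take; exact: xss.
- exists (nth 0 xs n) => // -[f [Lf f0 mf]].
  apply: nalg; exists f; split=> //; apply/eqP.
  have hF := fadj_sf (nth 0 xs n) hL.1.
  apply: (subfield_nmideal hF sub) mf; apply: adj_fadj; first exact: hL.1.
  by exists f.
exists (fun j => if j is j'.+1 then c j' else localization A q'), q'; split=> //.
- by case=> [_|j jm]; [exact: cs.2|exact: Xc].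
- by case=> [_|j jm]; [|exact: ic].
Qed.

(** This makes the dimension a property of K, shared by X, Y and every resolution, and gives the
    number p^2 of monomials in a p-basis on a surface. *)
Lemma dimension_pdegree X n : variety iota X -> dimension X n <-> pdegree hp n.
Proof.
move=> hX; have [S [Sc SX]] := charts_finite hX.
have [s sS _] := SX _ (generic_point hX).
have cs : chart iota X s by exact: Sc.
have [xs [xss txs axs]] := @tower_extend _ _ [::] s (base_sf iota) Logic.I.
have pd : pdegree hp (size xs) by apply: tower_pdegree cs.1 txs axs.
have hc := has_chain_gens hX cs xss txs.
have nhc m : has_chain X m -> (m <= size xs)%N.
  move=> [c [Xc ic]]; have [zs [<- tz]] := chain_tower hX Xc ic.
  have [ys [yss tys ays]] := tower_extend s (base_sf iota) tz.
  rewrite (pdegree_uniq pd (tower_pdegree cs.1 tys ays)) size_cat leq_addr //.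
have mono m m' : (m <= m')%N -> has_chain X m' -> has_chain X m.
  move=> mm [c [Xc ic]]; exists c; split=> j jm; [apply: Xc|apply: ic]; lia.
split=> [[hn nhn]|pn].
  rewrite (_ : n = size xs) //; apply/eqP; rewrite eqn_leq nhc //= leqNgt; apply/negP => h.
  by apply: nhn; exact: mono hc.
by rewrite -(pdegree_uniq pd pn); split=> // /nhc; rewrite ltnn.
Qed.

End DimensionPDegree.

(** * Residue fields of local rings *)

Section ResidueField.
Local Open Scope quotient_scope.
Variable K : fieldType.

Record localring := LocalRing { lrset :> set K; lrP : local lrset }.

Section Construction.
Variable O : localring.

Let hO : is_subring (lrset O) := (lrP O).1.
Let hm : prime_ideal (lrset O) (mideal (lrset O)) := local_prime (lrP O).

Definition lrmem : {pred K} := fun x => `[< lrset O x >].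

Fact lrmem_closed : subring_closed lrmem.
Proof.
split; first by apply/asboolP; exact: sr1.
  by move=> x y /asboolP Ox /asboolP Oy; apply/asboolP; exact: srB.
by move=> x y /asboolP Ox /asboolP Oy; apply/asboolP; exact: srM.
Qed.

HB.instance Definition _ := GRing.isSubringClosed.Build K lrmem lrmem_closed.

Record lrtype := LrType { lrval : K; lrvalP : lrval \in lrmem }.

HB.instance Definition _ := [isSub for lrval].
HB.instance Definition _ := [Choice of lrtype by <:].
HB.instance Definition _ := [SubChoice_isSubComNzRing of lrtype by <:].

Lemma lrval_in (x : lrtype) : lrset O (val x). Proof. by case: x => x hx; apply/asboolP. Qed.

Definition lrideal : {pred lrtype} := fun x => `[< mideal (lrset O) (val x) >].

Fact lrideal_closed : idealr_closed lrideal.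
Proof.
split.
- by apply/asboolP; exact: mideal0.
- by apply/asboolP; exact: mideal_n1.
- move=> a u v /asboolP mu /asboolP mv; apply/asboolP; apply: (primeD hm) => //.
  by apply: (primeMl hm) => //; exact: lrval_in.
Qed.

HB.instance Definition _ := isIdealr.Build lrtype lrideal lrideal_closed.

Definition resfield := {ideal_quot lrideal}.
HB.instance Definition _ := GRing.ComNzRing.on resfield.

Lemma resfield_eq0 (x : lrtype) : (\pi_resfield x == 0) = (x \in lrideal).
Proof. by rewrite !piE Quotient.equivE subr0. Qed.

Lemma resfield_inv (z : resfield) : exists w : resfield, (z != 0 -> w * z = 1) /\ (z = 0 -> w = 0).
Proof.
have [->|] := eqVneq z 0; first by exists 0.
elim/quotW: z => x; rewrite resfield_eq0 => nx.
have [[v0 _ Ov]|mx] := unitVm (lrval_in x); last by case/negP: nx; apply/asboolP.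
pose y := LrType (introT (asboolP _) Ov); exists (\pi_resfield y); split=> [_|/eqP].
  rewrite -rmorphM (_ : y * x = 1) ?rmorph1 //; apply: val_inj.
  by rewrite /= mulVf.
by rewrite resfield_eq0 (negbTE nx).
Qed.

Definition resfield_invf (z : resfield) : resfield := sval (cid (resfield_inv z)).

Fact resfield_mulV (z : resfield) : z != 0 -> resfield_invf z * z = 1.
Proof. by rewrite /resfield_invf; case: cid => w []. Qed.

Fact resfield_inv0 : resfield_invf 0 = 0.
Proof. by rewrite /resfield_invf; case: (cid _) => w /= [_]; apply. Qed.

HB.instance Definition _ := GRing.ComNzRing_isField.Build resfield resfield_mulV resfield_inv0.

Definition respi (x : K) : resfield := \pi_resfield (insubd 0 x).

Lemma respi_val (x : K) (hx : lrset O x) : respi x = \pi_resfield (LrType (introT (asboolP _) hx)).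
Proof.
congr (\pi _); apply: val_inj; rewrite val_insubd /= -[_ \in _]/`[< lrset O x >].
by case: asboolP.
Qed.

End Construction.

(** The residue map is a total function on K of which only the values on O count; the residue field
    can then be any field type. *)
Record residue (O : set K) (kap : fieldType) (pi : K -> kap) : Prop := Residue {
  res_sub : is_subring O;
  resD : forall x y, O x -> O y -> pi (x + y) = pi x + pi y;
  resM : forall x y, O x -> O y -> pi (x * y) = pi x * pi y;
  res1 : pi 1 = 1;
  res_eq0 : forall x, O x -> (pi x = 0 <-> mideal O x);
  res_surj : forall z, exists2 x, O x & pi x = z }.

Lemma residue_field (O : set K) : local O -> exists (kap : fieldType) (pi : K -> kap), residue O pi.
Proof.
move=> lO; pose L := LocalRing lO; exists (resfield L), (@respi L); have [hO _] := lO.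
have rv x (hx : O x) := @respi_val L x hx.
split=> //.
- move=> x y hx hy; rewrite (rv _ (srD hO hx hy)) (rv _ hx) (rv _ hy) -rmorphD.
  by congr (\pi _); apply: val_inj.
- move=> x y hx hy; rewrite (rv _ (srM hO hx hy)) (rv _ hx) (rv _ hy) -rmorphM.
  by congr (\pi _); apply: val_inj.
- rewrite (rv _ (sr1 hO)) -[RHS](rmorph1 (\pi_(resfield L))).
  by congr (\pi _); apply: val_inj.
- move=> x hx; rewrite (rv _ hx); split.
    by move/eqP; rewrite resfield_eq0 => /asboolP.
  by move=> mx; apply/eqP; rewrite resfield_eq0; apply/asboolP.
- elim/quotW => x; exists (val x); first exact: (@lrval_in L).
  rewrite (rv _ (@lrval_in L x)); congr (\pi _); exact: val_inj.
Qed.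

End ResidueField.

Section ResidueTheory.
Context {K : fieldType} (O : set K) (kap : fieldType) (pi : K -> kap) (hpi : residue O pi).

Let hO := res_sub hpi.

Lemma res0 : pi 0 = 0. Proof. by apply/(res_eq0 hpi); [exact: sr0|exact: mideal0]. Qed.
Lemma resN x : O x -> pi (- x) = - pi x.
Proof.
move=> Ox; apply/eqP; rewrite -subr_eq0 opprK -(resD hpi) //; last exact: srN.
by rewrite addNr res0.
Qed.
Lemma resB x y : O x -> O y -> pi (x - y) = pi x - pi y.
Proof. by move=> Ox Oy; rewrite (resD hpi) ?resN //; exact: srN. Qed.
Lemma resX x n : O x -> pi (x ^+ n) = pi x ^+ n.
Proof.
move=> Ox; elim: n => [|n IHn]; rewrite ?expr0 ?(res1 hpi) // !exprS (resM hpi) ?IHn //.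
exact: srX.
Qed.
Lemma res_sum T (r : seq T) (P : pred T) (F : T -> K) : (forall i, P i -> O (F i)) ->
  pi (\sum_(i <- r | P i) F i) = \sum_(i <- r | P i) pi (F i).
Proof.
move=> OF; elim: r => [|i r IHr]; rewrite ?big_nil ?res0 // !big_cons; case: ifP => // Pi.
by rewrite (resD hpi) ?IHr //; [exact: OF|exact: sr_sum].
Qed.
Lemma res_nat n : pi n%:R = n%:R.
Proof.
elim: n => [|n IHn]; rewrite ?res0 // -!natr1 (resD hpi) ?IHn ?(res1 hpi) //; last exact: sr1.
exact: sr_nat.
Qed.
Lemma res_eq x y : O x -> O y -> (pi x = pi y <-> mideal O (x - y)).
Proof.
move=> Ox Oy; rewrite -(res_eq0 hpi) ?resB //; last exact: srB.
by split=> [->|/eqP]; rewrite ?subrr // subr_eq0 => /eqP.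
Qed.
Lemma resV x : is_unit O x -> pi x^-1 = (pi x)^-1.
Proof.
move=> [x0 Ox Ox']; have h : pi x != 0.
  by apply/eqP => /(res_eq0 hpi Ox) [_]; apply.
by apply: (mulfI h); rewrite mulfV // -(resM hpi) // mulfV // (res1 hpi).
Qed.
Lemma res_unit x : O x -> pi x != 0 -> is_unit O x.
Proof.
by move=> Ox /eqP nx; case: (unitVm Ox) => // mx; case: nx; apply/(res_eq0 hpi).
Qed.
Lemma res_pchar p : p \in [pchar K] -> p \in [pchar kap].
Proof.
move=> hp; rewrite inE (pcharf_prime hp) /= -res_nat (pcharf0 hp) res0 //.
Qed.
Lemma res_horner (f : {poly K}) x : polyin O f -> O x -> pi f.[x] = (map_poly pi f).[pi x].
Proof.
move=> Of Ox; rewrite horner_coef (horner_coef_wide (n := size f)); last exact: size_poly.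
rewrite res_sum; last by move=> i _; apply: srM => //; exact: srX.
apply: eq_bigr => i _; rewrite (resM hpi) ?resX //; last exact: srX.
by congr (_ * _); rewrite coef_map_id0 // res0.
Qed.
End ResidueTheory.

Lemma residue_rmorph {k K kap : fieldType} (iota : {rmorphism k -> K}) (O : set K) (pi : K -> kap) :
  residue O pi -> (forall c, O (iota c)) ->
  exists j : {rmorphism k -> kap}, forall c, j c = pi (iota c).
Proof.
move=> hpi bO; pose f := pi \o iota.
have fB : zmod_morphism f by move=> x y; rewrite /f /= rmorphB (resB hpi).
have fM : monoid_morphism f.
  by split; [rewrite /f /= rmorph1 (res1 hpi)|move=> x y; rewrite /f /= rmorphM (resM hpi)].
pose af := GRing.isZmodMorphism.Build k kap f fB.
pose mf := GRing.isMonoidMorphism.Build k kap f fM.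
pose F : {rmorphism k -> kap} := HB.pack f af mf.
by exists F.
Qed.

Lemma span_fbasis (F K : fieldType) (f : {rmorphism F -> K}) (I J : finType) (e : I -> K)
  (v : J -> K) : fbasis f e -> (forall x, fspan f v x) -> #|I| = #|J| -> fbasis f v.
Proof.
move=> [se fe] sv IJ; split=> // c e0 j0; apply: contrapT => /eqP cj.
pose w (j : {j | j != j0}) := v (val j).
have split_sum (G : J -> K) : \sum_j G j = G j0 + \sum_(j : {j | j != j0}) G (val j).
  rewrite (bigD1 j0) //=; congr (_ + _); rewrite (reindex_omap (val : {j | j != j0} -> J) insub) /=; last first.
    by move=> i ij; rewrite insubT.
  by apply: eq_bigl => j; rewrite (valP j) valK eqxx.
have fc0 : f (c j0) != 0 by rewrite fmorph_eq0.
move: e0; rewrite split_sum => /eqP; rewrite addr_eq0 => /eqP e0.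
have sw x : fspan f w x.
  have [d ->] := sv x; exists (fun j => d (val j) - d j0 * (c (val j) / c j0)).
  rewrite split_sum; apply: (mulfI fc0); rewrite mulrDr mulrCA e0 mulrN -mulNr !mulr_sumr.
  rewrite -big_split; apply: eq_bigr => j _ /=; rewrite rmorphB !rmorphM fmorphV /w; by field.
have [|c' [[i ni] /fe /(_ i) ci]] := fdep (fun i => sw (e i)).
  by rewrite card_sig cardC1 IJ prednK //; apply/card_gt0P; exists j0.
by rewrite ci eqxx in ni.
Qed.

(** * p-bases of local rings *)

Section Inseparable.
Context {K : fieldType} (p : nat) (hp : p \in [pchar K]).

(* X^p - s^p = (X - s)^p has no proper factor over K^p. *)
Lemma insep_free (s : K) (c : 'I_p -> K) : (forall y, y ^+ p <> s) ->
  \sum_j c j ^+ p * s ^+ j = 0 -> forall j, c j = 0.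
Proof.
move=> ns h0; have p0 := p_gt0 hp; pose F := pFrobenius_aut hp.
pose g := \poly_(j < p) c (insubd (Ordinal p0) j).
have gj (j : 'I_p) : g`_j = c j.
  by rewrite coef_poly ltn_ord; congr c; apply: val_inj; rewrite insubdK // unfold_in.
have [g0 j|g0] := eqVneq g 0; first by rewrite -gj g0 coef0.
have rg : root (map_poly F g) s.
  rewrite rootE (horner_coef_wide (n := p)) ?size_map_poly ?size_poly //.
  rewrite -[X in _ == X]h0; apply/eqP/eq_bigr => j _; rewrite coef_map /= gj.
  by rewrite /F pFrobenius_autE.
pose q := gcdp g ('X^p - s%:P).
have qn : map_poly F ('X^p - s%:P) = ('X - s%:P) ^+ p.
  have hpp : p \in [pchar {poly K}] by rewrite pchar_poly.
  rewrite rmorphB /= map_polyXn map_polyC /= /F pFrobenius_autE.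
  rewrite exprDn_pchar; last by rewrite (eq_pnat _ (pcharf_eq hpp)) pnat_id // (pprime hp).
  by rewrite -(polyCN s) -polyC_exp (frobN hp) polyCN.
have qg : map_poly F q = gcdp (map_poly F g) (('X - s%:P) ^+ p) by rewrite /q gcdp_map qn.
have : map_poly F q %| ('X - s%:P) ^+ p by rewrite qg dvdp_gcdr.
move=> /dvdp_exp_XsubCP [m mp eqm].
have sm : size (map_poly F q) = m.+1 by rewrite (eqp_size eqm) size_exp_XsubC.
have m1 : (0 < m)%N.
  have : 'X - s%:P %| map_poly F q.
    by rewrite qg dvdp_gcd dvdp_XsubCl rg /= dvdp_exp.
  move=> /dvdp_leq; rewrite -size_poly_eq0 sm => /(_ isT).
  by rewrite size_XsubC.
have mlt : (m < p)%N.
  have : map_poly F q %| map_poly F g by rewrite qg dvdp_gcdl.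
  move=> /dvdp_leq; rewrite map_poly_eq0 g0 => /(_ isT); rewrite sm => h.
  by rewrite (leq_trans h) // size_map_poly size_poly.
pose u := (lead_coef q)^-1 *: q.
have q0 : q != 0 by rewrite -(map_poly_eq0 F) -size_poly_eq0 sm.
have eu : map_poly F u = ('X - s%:P) ^+ m.
  apply/eqP; rewrite -eqp_monic.
  - apply: eqp_trans eqm; rewrite /u map_polyZ eqp_scale // fmorph_eq0 invr_eq0 lead_coef_eq0 //.
  - by rewrite monicE lead_coef_map lead_coefZ mulVf ?rmorph1 // lead_coef_eq0.
  - by apply: monic_exp; exact: monicXsubC.
have e0 : u`_0 ^+ p = (- s) ^+ m.
  have := congr1 (fun h : {poly K} => h.[0]) eu; rewrite /= !horner_coef0 coef_map /= /F pFrobenius_autE => ->.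
  by rewrite -horner_coef0 horner_exp hornerXsubC sub0r.
have s0 : - s != 0.
  rewrite oppr_eq0; apply/eqP => s0; apply: (ns 0); by rewrite s0 expr0n gtn_eqF.
have /(coprimeP _ m1) [[a b] /= ab] : coprime m p.
  by rewrite coprime_sym prime_coprime ?(pprime hp) // gtnNdvd.
have e1 : (- s) ^+ (a * m) = - s * (- s) ^+ (b * p).
  by rewrite -exprS; congr (_ ^+ _); lia.
case: (ns (- (u`_0 ^+ a / (- s) ^+ b))); rewrite (frobN hp) exprMn exprVn -!exprM.
apply: (canLR (@opprK _)); apply: (mulIf (expf_neq0 (b * p) s0)).
by rewrite divfK ?expf_neq0 // -e1 mulnC exprM e0 -exprM mulnC.
Qed.

Implicit Types (A O M : set K) (gs : seq K).

Lemma principalS A x : is_subring A -> submod A (principal A x).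
Proof.
move=> hA; split.
- by exists 0; rewrite ?mulr0 //; exact: sr0.
- by move=> _ _ [u Au ->] [v Av ->]; exists (u + v); rewrite ?mulrDr //; exact: srD.
- by move=> c _ Ac [u Au ->]; exists (c * u); [exact: srM|rewrite mulrCA].
Qed.

(** Induction on the list: modulo g0 the tail lies in M, and substituting this into the equation of
    g0 leaves (1 - c) g0 in M with c in the maximal ideal. *)
Lemma nakayama A M gs : local A -> submod A M ->
  (forall g, g \in gs ->
     idlD M (mspan A [set x | exists c h, [/\ mideal A c, h \in gs & x = c * h]]) g) ->
  forall g, g \in gs -> M g.
Proof.
move=> lA; have [hA hm] := lA; elim: gs M => // g0 gs IH M hM hgs.
have mA : mideal A `<=` A by exact: midealW.
have [M0 MD MM] := hM.
have h' g : g \in gs -> idlD M (principal A g0) g.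
  apply: IH; first by apply: submodD_add => //; exact: principalS.
  move=> {}g gin; have [|m [q [Mm hq ->]]] := hgs g; first by rewrite inE gin orbT.
  have [a [b [pa mb ->]]] : idlD (principal A g0)
      (mspan A [set x | exists c h, [/\ mideal A c, h \in gs & x = c * h]]) q.
    move: q hq; apply: mspan_sub.
      by apply: submodD_add; [exact: principalS|exact: mspanS].
    move=> z [c [h [mc hin ->{z}]]]; move: hin; rewrite inE => /orP[/eqP->|hin].
      apply: idlDl; first exact: mspanS.
      by exists c; [exact: mA|rewrite mulrC].
    apply: idlDr; first exact: principalS.
    by apply: sub_mspan; exists c, h.
  rewrite addrA; exists (m + a), b; split=> //.
  by exists m, a.
pose N := [set x | exists2 c, mideal A c & x = g0 * c].
have hN : submod A N.
  split.
  - by exists 0; rewrite ?mulr0 //; case: hm.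
  - by move=> _ _ [u Au ->] [v Av ->]; exists (u + v); rewrite ?mulrDr //; case: hm => _ h _; exact: h.
  - by move=> c _ Ac [u Au ->]; exists (c * u); [case: hm => _ _; exact|rewrite mulrCA].
have Mg0 : M g0.
  have [|m [q [Mm hq eg]]] := hgs g0; first by rewrite inE eqxx.
  have [a [_ [Ma [c mc ->] eq]]] : idlD M N q.
    move: q hq {eg}; apply: mspan_sub; first exact: submodD_add.
    move=> z [c [h [mc hin ->{z}]]]; move: hin; rewrite inE => /orP[/eqP->|hin].
      by apply: (idlDr hM); exists c => //; rewrite mulrC.
    have [u [_ [Mu [v Av ->] ->]]] := h' h hin.
    exists (c * u), (g0 * (c * v)); split; last by ring.
      by apply: MM => //; exact: mA.
    by exists (c * v) => //; rewrite mulrC; exact: midealM.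
  have : is_unit A (1 + (- c)).
    by apply: unit_add => //; [exact: unit1|exact: (submodN hA hm)].
  move=> [c0 _ Ac].
  have -> : g0 = (1 + - c)^-1 * (m + a).
    apply: (mulfI c0); rewrite mulVKf // mulrDl mul1r {1}eg eq; ring.
  by apply: MM => //; exact: MD.
move=> g; rewrite inE => /orP[/eqP->//|/h' [u [_ [Mu [v Av ->] ->]]]].
by apply: MD => //; rewrite mulrC; exact: MM.
Qed.

Lemma mspan_scale A (G H : set K) c x : (forall g, G g -> mspan A H (c * g)) ->
  mspan A G x -> mspan A H (c * x).
Proof.
move=> GH; move: x; apply: (@mspan_sub _ A G [set x | mspan A H (c * x)]) => //.
have [h0 hD hM] := mspanS A H; split.
- by rewrite /= mulr0.
- by move=> x y; rewrite /= mulrDr; exact: hD.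
- by move=> a x Aa /=; rewrite mulrCA; exact: hM.
Qed.

Implicit Types (C : set K) (x y z : K) (s : seq K).

Local Notation frob := (pFrobenius_aut hp).

Definition powp O : set K := [set x | exists2 a, O a & x = a ^+ p].

Lemma powp_subring O : is_subring O -> is_subring (powp O).
Proof.
move=> hO; split.
- by exists 1; [exact: sr1|rewrite expr1n].
- by move=> _ _ [a Oa ->] [b Ob ->]; exists (a - b); [exact: srB|rewrite (frobB hp)].
- by move=> _ _ [a Oa ->] [b Ob ->]; exists (a * b); [exact: srM|rewrite exprMn].
Qed.

Lemma powp_mideal O x : is_subring O -> mideal (powp O) x <-> exists2 a, mideal O a & x = a ^+ p.
Proof.
move=> hO; split=> [[[a Oa ->] nu]|[a [Oa nu] ->]].
  exists a => //; split=> // -[a0 _ Oa']; apply: nu; split; rewrite ?expf_neq0 //.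
    by exists a.
  by exists a^-1 => //; rewrite exprVn.
split; first by exists a.
move=> [a0 _ [b Ob]]; rewrite -exprVn => /(frob_inj hp) eb; apply: nu; split=> //.
  by move: a0; rewrite (frob_eq0 hp).
by rewrite eb.
Qed.

Lemma powp_local O : local O -> local (powp O).
Proof.
move=> [hO [m0 mD mM]]; split; first exact: powp_subring.
split.
- by apply/powp_mideal => //; exists 0 => //; rewrite (frob0 hp).
- move=> _ _ /(powp_mideal _ hO) [a ma ->] /(powp_mideal _ hO) [b mb ->].
  by apply/powp_mideal => //; exists (a + b); [exact: mD|rewrite (frobD hp)].
- move=> _ _ [c Oc ->] /(powp_mideal _ hO) [a ma ->].
  by apply/powp_mideal => //; exists (c * a); [exact: mM|rewrite exprMn].
Qed.

(** F-finiteness: O is a finite module over its subring of p-th powers. *)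
Definition pfin O := exists gs : seq K, {in gs, forall g, O g} /\ O `<=` mspan (powp O) [set` gs].

Lemma powp_le A O : A `<=` O -> powp A `<=` powp O.
Proof. by move=> AO _ [a /AO Oa ->]; exists a. Qed.

Lemma mspan_ring_le A O (G : set K) : A `<=` O -> mspan A G `<=` mspan O G.
Proof.
move=> AO x hx M [h0 hD hM] GM; apply: hx => //; split=> // a y /AO; exact: hM.
Qed.

Lemma pfin_adj A y : is_subring A -> pfin A -> pfin (adj A y).
Proof.
move=> hA [gs [gA hgs]]; have hB := adj_sr hA y; have AB := sub_adj hA y.
have By := adj_gen hA y.
exists [seq g * y ^+ j | g <- gs, j <- iota 0 p]; split.
  move=> _ /allpairsP [[g j] /= [gin _ ->]]; apply: srM => //; first by apply: AB; exact: gA.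
  exact: srX.
set H := [set` _]; have [h0 hD hM] := mspanS (powp (adj A y)) H.
move=> _ [f Af ->]; rewrite horner_coef.
apply: (submod_sum _ (mspanS _ _)) => n _.
have key g : g \in gs -> mspan (powp (adj A y)) H (y ^+ n * g).
  move=> gin; have -> : y ^+ n * g = (y ^+ (n %/ p)) ^+ p * (g * y ^+ (n %% p)).
    by rewrite {1}(divn_eq n p) exprD exprM; ring.
  apply: hM; first by exists (y ^+ (n %/ p)) => //; exact: srX.
  apply: sub_mspan; apply/allpairsP; exists (g, n %% p)%N; split=> //=.
  by rewrite mem_iota add0n ltn_mod (p_gt0 hp).
rewrite mulrC; apply: mspan_scale (mspan_ring_le (powp_le AB) (hgs _ (Af n))).
by move=> g; exact: key.
Qed.

Lemma pfin_loc A q : is_subring A -> prime_ideal A q -> pfin A -> pfin (localization A q).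
Proof.
move=> hA hq [gs [gA hgs]]; exists gs; split=> [g /gA|]; first exact: loc_sub.
move=> _ [a [b [Aa Ab nb ->]]].
have b0 : b != 0 by exact: (prime_nz hq nb).
have -> : a / b = b^-1 ^+ p * (a * b ^+ p.-1).
  by rewrite -[in LHS](mulfK (expf_neq0 p.-1 b0) a) exprVn -(prednK (p_gt0 hp)) exprS /=; field;
    rewrite b0 expf_neq0.
have [_ _ hM] := mspanS (powp (localization A q)) [set` gs]; apply: hM.
  by exists b^-1 => //; exact: loc_inv.
apply: mspan_ring_le (hgs _ _); first by apply: powp_le; exact: loc_sub.
by apply: srM => //; exact: srX.
Qed.

Lemma pfin_point {k : fieldType} (iota : {rmorphism k -> K}) X O :
  (forall x : k, exists y : k, y ^+ p = x) -> variety iota X -> X O -> pfin O.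
Proof.
move=> hperf hX XO; have [s [q [_ hq ->]]] := point_chart hX XO.
apply: pfin_loc => //; first exact: kgen_sr.
elim: s {hq} => [|y s IHs]; last first.
  by rewrite kgen_cons; apply: pfin_adj => //; exact: kgen_sr.
rewrite kgen_nil; have hb := base_sr iota; exists [:: 1]; split.
  by move=> g; rewrite inE => /eqP->; exact: sr1.
move=> _ [c ->]; have [d <-] := hperf c; rewrite rmorphXn -[X in mspan _ _ X]mulr1.
have [_ _ hM] := mspanS (powp (base iota)) [set` [:: 1]]; apply: hM.
  by exists (iota d) => //; exists d.
by apply: sub_mspan; rewrite /= inE.
Qed.

Definition pmon x y (ij : 'I_p * 'I_p) := x ^+ ij.1 * y ^+ ij.2.

(** x, y is a p-basis of O itself, not only of K: coordinates of elements of O over the p-th powers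
    are p-th powers from O. *)
Definition pbasis O x y :=
  [/\ fbasis frob (pmon x y), O x, O y &
     forall c, O (\sum_ij c ij ^+ p * pmon x y ij) -> forall ij, O (c ij)].

Definition ord_p0 : 'I_p := Ordinal (p_gt0 hp).
Definition ord_p1 : 'I_p := Ordinal (p_gt1 hp).

Lemma fspanE (I : finType) (e : I -> K) x :
  fspan frob e x <-> exists c, x = \sum_i c i ^+ p * e i.
Proof.
by split=> -[c ->]; exists c; apply: eq_bigr => i _; rewrite /= (frobE hp).
Qed.

Lemma ffreeE (I : finType) (e : I -> K) :
  ffree frob e <-> forall c, \sum_i c i ^+ p * e i = 0 -> forall i, c i = 0.
Proof.
split=> fe c e0; apply: fe; by rewrite -[RHS]e0; apply: eq_bigr => i _; rewrite /= (frobE hp).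
Qed.

Lemma pbasis_nz O x y : pbasis O x y -> x != 0 /\ y != 0.
Proof.
case=> -[_ /ffreeE ff] _ _ _.
have nz ij : pmon x y ij != 0.
  apply/eqP => e; have := ff (fun ij' => (ij' == ij)%:R); rewrite (bigD1 ij) //= eqxx expr1n e mulr0 add0r.
  rewrite big1 => [/(_ erefl ij)/eqP|i /negbTE ->]; first by rewrite eqxx oner_eq0.
  by rewrite (frob0 hp) mul0r.
by have := nz (ord_p1, ord_p1); rewrite /pmon /= !expr1 mulf_eq0 negb_or => /andP.
Qed.

(** Repeated use of g = a^p + x u + y v expands g in the monomials up to terms with a factor x^p or
    y^p, which lie in the maximal ideal of O^p times O. Nakayama's lemma over O^p removes them.
    Independence is a count: p^2 monomials span K over K^p. *)
Lemma pgen_pbasis O x y : pdegree hp 2 -> local O -> frac O -> pfin O ->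
  mideal O x -> mideal O y ->
  (forall g, O g -> exists a u v, [/\ O a, O u, O v & g = a ^+ p + x * u + y * v]) ->
  pbasis O x y.
Proof.
move=> [I [e [cI he]]] lO fO [gs [gO hgs]] mx my hg; have [hO _] := lO.
have Ox := midealW mx; have Oy := midealW my.
pose N := [set g | exists c, (forall ij, O (c ij)) /\ g = \sum_ij c ij ^+ p * pmon x y ij].
have hN : submod (powp O) N.
  split.
  - exists (fun _ => 0); split=> [_|]; first exact: sr0.
    by rewrite big1 // => ij _; rewrite (frob0 hp) mul0r.
  - move=> _ _ [c [Oc ->]] [d [Od ->]]; exists (fun ij => c ij + d ij); split=> [ij|]; first exact: srD.
    by rewrite -big_split; apply: eq_bigr => ij _; rewrite (frobD hp) mulrDl.
  - move=> _ _ [a Oa ->] [c [Oc ->]]; exists (fun ij => a * c ij); split=> [ij|]; first exact: srM.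
    by rewrite mulr_sumr; apply: eq_bigr => ij _; rewrite exprMn mulrA.
have lP := powp_local lO.
pose H := [set z | exists c h, [/\ mideal (powp O) c, h \in gs & z = c * h]].
have [J0 JD JM] := submodD_add hN (mspanS (powp O) H).
have inH a u : mideal O a -> O u -> mspan (powp O) H (a ^+ p * u).
  move=> ma /hgs; apply: mspan_scale => g gin; apply: sub_mspan; exists (a ^+ p), g; split=> //.
  by apply/powp_mideal => //; exists a.
have inX i j u : (p <= i)%N -> O u -> idlD N (mspan (powp O) H) (x ^+ i * y ^+ j * u).
  move=> pi Ou; apply: (idlDr hN); rewrite -(subnK pi) exprD.
  have -> : x ^+ (i - p) * x ^+ p * y ^+ j * u = x ^+ p * (x ^+ (i - p) * y ^+ j * u) by ring.
  by apply: inH => //; apply: srM => //; apply: srM => //; exact: srX.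
have inY i j u : (p <= j)%N -> O u -> idlD N (mspan (powp O) H) (x ^+ i * y ^+ j * u).
  move=> pi Ou; apply: (idlDr hN); rewrite -(subnK pi) exprD.
  have -> : x ^+ i * (y ^+ (j - p) * y ^+ p) * u = y ^+ p * (x ^+ i * y ^+ (j - p) * u) by ring.
  by apply: inH => //; apply: srM => //; apply: srM => //; exact: srX.
(* Each expansion of u raises i + j; when it reaches 2 p, one of the exponents is at least p. *)
have inJ n i j u : (2 * p - (i + j) <= n)%N -> O u -> idlD N (mspan (powp O) H) (x ^+ i * y ^+ j * u).
  elim: n i j u => [|n IHn] i j u le Ou.
    by have [pi|ip] := leqP p i; [exact: inX|apply: inY => //; lia].
  have [pi|ip] := leqP p i; first exact: inX.
  have [pj|jp] := leqP p j; first exact: inY.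
  have [a [v [w [Oa Ov Ow ->]]]] := hg u Ou.
  have -> : x ^+ i * y ^+ j * (a ^+ p + x * v + y * w) =
    a ^+ p * (x ^+ i * y ^+ j * 1) + (x ^+ i.+1 * y ^+ j * v + x ^+ i * y ^+ j.+1 * w).
    by rewrite !exprS; ring.
  apply: (JD); last by apply: (JD); apply: IHn => //; lia.
  apply: (idlDl (mspanS _ _)).
  exists (fun ij => if ij == (Ordinal ip, Ordinal jp) then a else 0); split=> [ij|].
    by case: ifP => _ //; exact: sr0.
  rewrite (bigD1 (Ordinal ip, Ordinal jp)) //= eqxx big1 ?addr0 ?mulr1 // => ij /negbTE ->.
  by rewrite (frob0 hp) mul0r.
have ON : O `<=` N.
  have gN : forall h, h \in gs -> N h; last by move=> g /hgs; apply: mspan_sub => // h; exact: gN.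
  apply: (nakayama lP hN) => h hin.
  by have := inJ _ 0%N 0%N h (leqnn _); rewrite !expr0 !mul1r; apply; exact: gO.
have sp z : fspan frob (pmon x y) z.
  have [a [b [Oa Ob b0 ->]]] := fO z; apply/fspanE.
  have [|c [_ ec]] := ON (a * b ^+ p.-1); first by apply: srM => //; exact: srX.
  exists (fun ij => c ij / b).
  apply: (mulfI (expf_neq0 p b0)); rewrite mulr_sumr.
  rewrite (eq_bigr (fun ij => c ij ^+ p * pmon x y ij)); last first.
    by move=> ij _; rewrite mulrA -exprMn (mulrC b) divfK.
  by rewrite -ec -{1}(prednK (p_gt0 hp)) exprS; field.
have hb : fbasis frob (pmon x y).
  by apply: span_fbasis he sp _; rewrite cI card_prod card_ord.
split=> // c /ON [d [Od e0]] ij.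
have /ffreeE /(_ (fun ij => c ij - d ij)) := hb.2.
rewrite (eq_bigr (fun ij => c ij ^+ p * pmon x y ij - d ij ^+ p * pmon x y ij)); last first.
  by move=> i _; rewrite (frobB hp) mulrBl.
by rewrite sumrB e0 subrr => /(_ erefl ij) /eqP; rewrite subr_eq0 => /eqP ->.
Qed.

End Inseparable.

Notation pframe p hp x y := (fbasis (pFrobenius_aut hp) (pmon (p := p) x y)).

Lemma sum_mod {T : nmodType} p N (F : nat -> T) :
  \sum_(n < p * N) F n = \sum_(j < p) \sum_(m < N) F (p * m + j)%N.
Proof.
elim: N => [|N IHN].
  by rewrite muln0 big_ord0 [RHS]big1 // => j _; rewrite big_ord0.
rewrite mulnS addnC big_split_ord /= IHN -big_split /=.
by apply: eq_bigr => j _; rewrite big_ord_recr.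
Qed.

(** Were s no p-th power, split a polynomial of least degree with root s by exponents modulo p. Its
    coefficients have p-th roots in L, so [insep_free] makes every piece vanish at s; the pieces
    have smaller degree and are therefore zero. *)
Lemma perfect_alg {K : fieldType} (p : nat) (hp : p \in [pchar K]) (L : set K) s :
  is_subring L -> (forall a, L a -> exists2 b, L b & b ^+ p = a) -> alg L s ->
  exists y, y ^+ p = s.
Proof.
move=> hL perf [f0 [Lf0 nf0 rf0]]; apply: contrapT => no.
have ns y : y ^+ p <> s by move=> e; apply: no; exists y.
pose P n := `[< exists f, [/\ polyin L f, f != 0, root f s & size f = n] >].
have exP : exists n, P n by exists (size f0); apply/asboolP; exists f0.
case: (ex_minnP exP) => n /asboolP [f [Lf nf rf ef]] minf.
have /choice [r hr] : forall a, exists b, L a -> L b /\ b ^+ p = a.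
  by move=> a; have [/perf [b Lb e]|nLa] := pselect (L a); [exists b|exists 0].
have r0 : r 0 = 0.
  by have [] := hr 0 (sr0 hL) => _ /eqP; rewrite (frob_eq0 hp) => /eqP.
pose g (j : 'I_p) := \poly_(m < n) r f`_(p * m + j).
have n1 : (1 < n)%N by rewrite -ef; exact: root_size_gt1 rf.
have p1 := p_gt1 hp.
have gs (j : 'I_p) : (g j).[s] = 0.
  have sg i : (g i).[s] ^+ p = \sum_(m < n) f`_(p * m + i) * s ^+ (p * m).
    rewrite (horner_coef_wide (n := n)) ?size_poly // (frob_sum hp).
    apply: eq_bigr => m _; rewrite coef_poly ltn_ord exprMn -exprM (mulnC m p).
    by have [_ ->] := hr _ (Lf (p * m + i)%N).
  apply: (insep_free hp ns (c := fun j => (g j).[s])) => {j}.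
  transitivity f.[s]; last exact/eqP.
  rewrite (horner_coef_wide (n := p * n)) ?ef ?leq_pmull ?(p_gt0 hp) // (sum_mod _ _ (fun n => f`_n * s ^+ n)).
  apply: eq_bigr => j _; rewrite sg mulr_suml; apply: eq_bigr => m _.
  by rewrite exprD mulrA.
have g0 j : g j = 0.
  apply: contrapT => /eqP nz.
  have : (n <= size (g j))%N.
    apply: minf; apply/asboolP; exists (g j); split=> //; last by rewrite rootE gs.
    move=> m; rewrite coef_poly; case: ifP => _; last exact: sr0.
    by have [] := hr _ (Lf (p * m + j)%N).
  apply/negP; rewrite -ltnNge -(prednK (ltnW n1)) ltnS; apply/leq_sizeP => m hm.
  rewrite coef_poly; case: ifP => // _; rewrite nth_default // ef.
  by have : (2 * m <= p * m)%N; [rewrite leq_mul2r p1 orbT|lia].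
move/eqP: nf; apply; apply/polyP => m; rewrite coef0.
have := congr1 (fun q : {poly K} => q`_(m %/ p)) (g0 (Ordinal (ltn_pmod m (p_gt0 hp)))).
rewrite /= coef0 coef_poly /= (mulnC p) -divn_eq.
have [mn|nm _] := ltnP m n; last by rewrite nth_default // ef.
rewrite (leq_ltn_trans (leq_div _ _) mn) => e.
by have [_ <-] := hr _ (Lf m); rewrite e (frob0 hp).
Qed.

(** * Closed points, their residue fields and smoothness *)

Section ClosedPoints.
Context {k K : fieldType} (iota : {rmorphism k -> K}) (p : nat) (hp : p \in [pchar K])
  (hperf : pperfect p k).
Implicit Types (X Y Z : set (set K)) (A O P Q R E : set K) (s : seq K) (x y : K).

(** Otherwise [chart_specialize] over k would give a point strictly inside Q. *)
Lemma closed_talg X Q s q y : variety iota X -> closed_point X Q -> chart iota X s ->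
  prime_ideal (kgen iota s) q -> Q = localization (kgen iota s) q -> y \in s -> talg Q (base iota) y.
Proof.
move=> hX [XQ Qmin] cs hq eQ ys; have hA := kgen_sr iota s; apply: contrapT => nt.
have [|||q' [hq' [O'Q nO'] _]] := chart_specialize hX cs hq eQ (base_sf iota) (fun c hc => hc).
- by move=> _ [c ->]; exact (point_base hX XQ c).
- move=> _ [c ->]; exists (iota c), 1; rewrite divr1 oner_neq0; split=> //; split.
  + by exists c.
  + by apply: kgen_base; exists c.
  + by exists 1; rewrite rmorph1.
  + exact: sr1.
- by exists y.
by apply: nO'; rewrite (Qmin _ _ O'Q) //; apply: (cs.2).
Qed.

Lemma res_alg O (kap : fieldType) (pi : K -> kap) (j : {rmorphism k -> kap}) y : residue O pi ->
  (forall c, O (iota c)) -> (forall c, j c = pi (iota c)) -> O y -> talg O (base iota) y ->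
  alg (base j) (pi y).
Proof.
move=> hpi Ob hj Oy [f [Lf f0 mf]]; exists (map_poly pi f); split.
- move=> n; rewrite coef_map_id0; last exact: (res0 hpi).
  by have [c ->] := Lf n; exists c; rewrite hj.
- apply: contraNneq f0 => e; apply/eqP/polyP => n; rewrite coef0.
  have := congr1 (fun g : {poly kap} => g`_n) e; rewrite /= coef0 coef_map_id0; last exact: (res0 hpi).
  have [c ->] := Lf n; rewrite -hj => /eqP; rewrite fmorph_eq0 => /eqP ->.
  by rewrite rmorph0.
- rewrite rootE -(res_horner hpi) //; last by move=> n; have [c ->] := Lf n.
  by apply/eqP/(res_eq0 hpi) => //; exact: midealW.
Qed.

Lemma closed_residue_perfect X Q (kap : fieldType) (pi : K -> kap) : variety iota X ->
  closed_point X Q -> residue Q pi -> forall z : kap, exists y : kap, y ^+ p = z.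
Proof.
move=> hX cQ hpi; have [XQ _] := cQ.
have Qb c : Q (iota c) by exact (point_base hX XQ c).
have [j hj] := residue_rmorph hpi Qb; have hpk := res_pchar hpi hp.
have [s [q [cs hq eQ]]] := point_chart hX XQ; have hQ := res_sub hpi.
have hA := kgen_sr iota s.
have sQ y : y \in s -> Q y by move=> ys; rewrite eQ; apply: loc_sub => //; exact: kgen_mem.
pose S := [set z : kap | exists y : kap, y ^+ p = z].
have hS : is_subring S.
  split.
  - by exists 1; rewrite expr1n.
  - by move=> _ _ [a <-] [b <-]; exists (a - b); rewrite (frobB hpk).
  - by move=> _ _ [a <-] [b <-]; exists (a * b); rewrite exprMn.
have sS y : y \in s -> S (pi y).
  move=> ys; have Qy := sQ y ys.
  apply: (perfect_alg hpk (base_sr j)).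
    by move=> _ [c ->]; have [d <-] := hperf c; exists (j d); [exists d|rewrite rmorphXn].
  exact (res_alg hpi Qb hj Qy (closed_talg hX cQ cs hq eQ ys)).
have AS a : kgen iota s a -> S (pi a).
  move=> Aa; suff [] : Q a /\ S (pi a) by [].
  move: a Aa; apply: kgen_min.
  - split.
    + by split; [exact: sr1|rewrite (res1 hpi); exact: sr1].
    + by move=> a b [Qa Sa] [Qb' Sb]; split; [exact: srB|rewrite (resB hpi) //; exact: srB].
    + by move=> a b [Qa Sa] [Qb' Sb]; split; [exact: srM|rewrite (resM hpi) //; exact: srM].
  - move=> _ [c ->]; split=> //; rewrite -hj; have [d <-] := hperf c.
    by exists (j d); rewrite rmorphXn.
  - by move=> y ys; split; [exact: sQ|exact: sS].
move=> z; have [x Qx <-] := res_surj hpi z; move: (Qx); rewrite eQ => -[a [b [Aa Ab nb ->]]].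
have AQ c : kgen iota s c -> Q c by move=> Ac; rewrite eQ; exact: loc_sub.
have b0 := prime_nz hq nb.
have ub : is_unit Q b by split=> //; [exact: AQ|rewrite eQ; exact: loc_inv].
rewrite (resM hpi) ?(resV hpi ub); [|exact: AQ|by case: ub].
have [u <-] := AS _ Aa; have [v <-] := AS _ Ab; exists (u / v).
by rewrite exprMn exprVn.
Qed.

Lemma closed_pth_decomp X Q g : variety iota X -> closed_point X Q -> Q g ->
  exists2 a, Q a & mideal Q (g - a ^+ p).
Proof.
move=> hX cQ Qg; have [kap [pi hpi]] := residue_field (point_local hX cQ.1).
have [y ey] := closed_residue_perfect hX cQ hpi (pi g).
have [a Qa ea] := res_surj hpi y; have hQ := res_sub hpi.
exists a => //; apply/(res_eq hpi) => //; first exact: srX.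
by rewrite (resX hpi) // ea.
Qed.

Lemma ideal_genE O s : is_subring O -> ideal_gen O s = mspan O [set` s].
Proof.
move=> hO; apply/seteqP; split=> x.
  by move=> [a Oa ->]; apply/mspanP => //; exists a.
by move=> /(mspanP _ _ hO) [a [Oa ->]]; exists a.
Qed.

Lemma parameters_exist O : local O -> noeth O -> exists s, parameters O s.
Proof.
move=> lO nO; have [hO hm] := lO.
pose P n := `[< exists2 s, mideal O = ideal_gen O s & size s = n >].
have exP : exists n, P n.
  have [|s es] := nO (mideal O); first by split=> //; exact: midealW.
  by exists (size s); apply/asboolP; exists s => //; rewrite ideal_genE.
case: (ex_minnP exP) => n /asboolP [s es en] mins; exists s; split=> // s' es'.
by rewrite en; apply: mins; apply/asboolP; exists s'.
Qed.

Lemma parameters_free O s (c : 'I_(size s) -> K) : local O -> parameters O s ->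
  (forall j, O (c j)) -> \sum_j c j * s`_j = 0 -> forall j, mideal O (c j).
Proof.
move=> lO [es mins] Oc e0 i; have [hO hm] := lO; apply: contrapT => nm.
have [|//] := unitVm (Oc i) => -[ci0 _ Oci].
pose s' := take i s ++ drop i.+1 s.
have szs : size s' = (size s).-1.
  by rewrite size_cat size_takel ?size_drop ?(ltnW (ltn_ord i)) //; have := ltn_ord i; lia.
suff e' : mideal O = ideal_gen O s'.
  by have := mins s' e'; rewrite szs; have := ltn_ord i; lia.
rewrite es !ideal_genE //; have hM := mspanS O [set` s'].
have ms' j : j != i -> mspan O [set` s'] s`_j.
  move=> ji; apply: sub_mspan; rewrite /= mem_cat.
  have [jli|] := ltnP j i.
    by rewrite -(nth_take 0 jli) mem_nth // size_take ltn_ord.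
  rewrite leq_eqVlt eq_sym => /orP[/eqP/val_inj/eqP|ij]; first by rewrite (negbTE ji).
  apply/orP; right; rewrite -(subnKC ij) -nth_drop mem_nth // size_drop.
  by rewrite ltn_sub2r // (leq_ltn_trans ij (ltn_ord j)).
apply/seteqP; split; last first.
  apply: mspan_le => x /=; rewrite mem_cat => xin; apply: sub_mspan => /=.
  by move: xin => /orP[/mem_take|/mem_drop].
apply: mspan_le => x /= xs; pose j := Ordinal (etrans (index_mem x s) xs).
have -> : x = s`_j by rewrite nth_index.
have [->|ji] := eqVneq j i; last exact: ms'.
have -> : s`_i = \sum_(j | j != i) (- (c j / c i)) * s`_j.
  apply: (mulfI ci0); move: e0; rewrite (bigD1 i) //= => /eqP; rewrite addr_eq0 => /eqP ->.
  rewrite mulr_sumr -sumrN; apply: eq_bigr => l _; by field.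
apply: (submod_sum _ hM) => l li; case: (hM) => _ _; apply; last exact: ms'.
by apply: srN => //; exact: srM.
Qed.

Section SmoothClosed.
Variables (X : set (set K)) (Q : set K) (s : seq K).
Hypotheses (hX : variety iota X) (cQ : closed_point X Q) (hs : parameters Q s).
Let lQ := point_local hX cQ.1.
Let hQ := lQ.1.
Let n := size s.

Lemma parameter_in (i : 'I_n) : mideal Q s`_i.
Proof.
by rewrite hs.1 ideal_genE //; apply: sub_mspan; exact: mem_nth.
Qed.

Lemma param_decomp g : exists ac : K * ('I_n -> K), Q g ->
  [/\ Q ac.1, forall j, Q (ac.2 j) & g = ac.1 ^+ p + \sum_j ac.2 j * s`_j].
Proof.
have [Qg|nQ] := pselect (Q g); last by exists (0, fun=> 0).
have [a Qa] := closed_pth_decomp hX cQ Qg.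
rewrite hs.1 => -[c Qc e]; exists (a, c) => _; split=> //.
by rewrite /= -e addrC subrK.
Qed.

Lemma param_decomp_uniq a (c : 'I_n -> K) : Q a -> (forall j, Q (c j)) ->
  a ^+ p + \sum_j c j * s`_j = 0 -> forall j, mideal Q (c j).
Proof.
move=> Qa Qc e j; have [m0 mD mM] := lQ.2; have p1 := p_gt1 hp.
have ma : mideal Q a.
  have map : mideal Q (a ^+ p).
    move/eqP: e; rewrite addr_eq0 => /eqP ->; apply: (submodN hQ lQ.2).
    by apply: (submod_sum _ lQ.2) => i _; apply: mM => //; exact: parameter_in.
  exact: (primeX hQ (local_prime lQ) Qa map).
have [d Qd ed] : ideal_gen Q s a by rewrite -hs.1.
have map : mideal Q (a ^+ p.-1).
  by rewrite -(ltn_predK p1) /= -(prednK (n := p.-1)) ?exprS; [rewrite mulrC; apply: midealM => //; exact: srX|lia].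
have : mideal Q (c j + a ^+ p.-1 * d j).
  apply: (parameters_free lQ hs (c := fun j => c j + a ^+ p.-1 * d j)).
    by move=> i; apply: srD => //; apply: srM => //; exact: midealW.
  rewrite -[RHS]e (eq_bigr (fun i => c i * s`_i + a ^+ p.-1 * (d i * s`_i))); last first.
    by move=> i _; rewrite mulrDl mulrA.
  by rewrite big_split /= -mulr_sumr -ed addrC -exprSr prednK // (p_gt0 hp).
move=> h; rewrite -(addrK (a ^+ p.-1 * d j) (c j)); apply: (submodB hQ lQ.2) => //.
by rewrite mulrC; exact: mM.
Qed.

(** In g = a^p + sum c_j s_j the c_j are unique modulo the maximal ideal, so their residues define n
    derivations into the residue field. They are independent, having Kronecker values on the s_j,
    whereas a derivation is determined by its values on m elements. *)
Lemma smooth_embdim m : Omega_free iota Q m -> (n <= m)%N.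
Proof.
move=> [x Qx univ]; have [kap [pi hpi]] := residue_field lQ.
have [D hD] := choice param_decomp.
pose act (a : K) (z : kap) := pi a * z.
have hact : module_over Q act.
  split; rewrite /act.
  - by move=> *; rewrite mulrDr.
  - by move=> a b u Qa Qb; rewrite (resD hpi) // mulrDl.
  - by move=> a b u Qa Qb; rewrite (resM hpi) // mulrA.
  - by move=> u; rewrite (res1 hpi) mul1r.
have [_ uniq] := univ _ _ hact.
pose delta i g := pi ((D g).2 i).
have deltaE i g a (c : 'I_n -> K) : Q a -> (forall j, Q (c j)) ->
    g = a ^+ p + \sum_j c j * s`_j -> delta i g = pi (c i).
  move=> Qa Qc e.
  have Qg : Q g.
    rewrite e; apply: srD => //; first exact: srX.
    by apply: sr_sum => // l _; apply: srM => //; apply: midealW; exact: parameter_in.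
  have [Qa' Qc' e'] := hD g Qg; apply/(res_eq hpi) => //.
  apply: (param_decomp_uniq (a := (D g).1 - a) (c := fun l => (D g).2 l - c l)).
  - exact: srB.
  - by move=> l; exact: srB.
  - rewrite (frobB hp); under eq_bigr do rewrite mulrBl.
    by rewrite sumrB addrACA -opprD -e -e' subrr.
have hdelta (u : 'I_n -> kap) : derivation iota Q act (fun g => \sum_i u i * delta i g).
  split.
  - move=> a b Qa Qb; rewrite -big_split /=; apply: eq_bigr => i _; rewrite -mulrDr; congr (_ * _).
    have [Qa1 Qa2 ea] := hD a Qa; have [Qb1 Qb2 eb] := hD b Qb.
    rewrite (deltaE i (a + b) ((D a).1 + (D b).1) (fun l => (D a).2 l + (D b).2 l)) ?(resD hpi) //.
    + exact: srD.
    + by move=> l; exact: srD.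
    + rewrite (frobD hp); under eq_bigr do rewrite mulrDl.
      by rewrite big_split /= addrACA -ea -eb.
  - move=> a b Qa Qb; rewrite /act !mulr_sumr -big_split /=; apply: eq_bigr => i _.
    have [Qa1 Qa2 ea] := hD a Qa; have [Qb1 Qb2 eb] := hD b Qb.
    pose sb := \sum_j (D b).2 j * s`_j.
    have msb : mideal Q sb.
      by rewrite hs.1; exists (D b).2.
    have Qsb := midealW msb.
    have Qap : Q ((D a).1 ^+ p) by exact: srX.
    have Qbp : Q ((D b).1 ^+ p) by exact: srX.
    rewrite (deltaE i (a * b) ((D a).1 * (D b).1)
      (fun l => (D a).1 ^+ p * (D b).2 l + (D b).1 ^+ p * (D a).2 l + sb * (D a).2 l)).
    + have ma : pi a = pi ((D a).1 ^+ p).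
        apply/(res_eq hpi) => //; rewrite {1}ea addrAC subrr add0r hs.1; by exists (D a).2.
      have mb : pi b = pi ((D b).1 ^+ p).
        by apply/(res_eq hpi) => //; rewrite {1}eb addrAC subrr add0r.
      rewrite !(resD hpi) ?(resM hpi) //; try (by repeat (apply: srD => // || apply: srM => //)).
      have /(res_eq0 hpi) -> // := msb.
      by rewrite -ma -mb /delta; ring.
    + exact: srM.
    + by move=> l; repeat (apply: srD => // || apply: srM => //).
    + rewrite {1}ea {1}eb -/sb exprMn mulrDl !mulrDr -addrA; congr (_ + _).
      under [in RHS]eq_bigr do rewrite 2!mulrDl.
      rewrite !big_split /= -addrA; congr (_ + _).
        by rewrite mulr_sumr; apply: eq_bigr => l _; rewrite mulrA.
      by congr (_ + _); [rewrite mulrC|rewrite mulrC]; rewrite mulr_sumr; apply: eq_bigr => l _; rewrite mulrA.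
  - move=> c; rewrite big1 // => i _; have [d <-] := hperf c.
    have Qd : Q (iota d) by exact (point_base hX cQ.1 d).
    rewrite (deltaE i _ (iota d) (fun=> 0)) ?(res0 hpi) ?mulr0 //.
    + by move=> _; exact: sr0.
    + by rewrite rmorphXn big1 ?addr0 // => j _; rewrite mul0r.
rewrite leqNgt; apply/negP => mn.
pose M : 'M[kap]_(n, m) := \matrix_(i, j) delta i (x j).
have : kermx M != 0.
  by rewrite -mxrank_eq0 mxrank_ker -lt0n subn_gt0; exact: leq_ltn_trans (rank_leq_col M) mn.
move=> /matrix0Pn [a [b nab]].
pose u i := (kermx M) a i.
have uM j : \sum_i u i * delta i (x j) = 0.
  have := mulmx_ker M => /matrixP /(_ a j); rewrite !mxE => e; rewrite -[RHS]e.
  by apply: eq_bigr => i _; congr (_ * _); rewrite mxE.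
have h0 : derivation iota Q act (fun=> 0).
  by split=> *; rewrite /act ?mulr0 ?addr0.
have Qsb : Q s`_b by apply: midealW; exact: parameter_in.
have := uniq _ _ (hdelta u) h0 uM s`_b Qsb.
rewrite (bigD1 b) //= big1 ?addr0.
  rewrite (deltaE b _ 0 (fun j => (j == b)%:R)) ?eqxx ?(res1 hpi) ?mulr1.
  - by move=> e; move: nab; rewrite -/(u b) e eqxx.
  - exact: sr0.
  - by move=> j; exact: sr_nat.
  - rewrite (frob0 hp) add0r (bigD1 b) //= eqxx mul1r big1 ?addr0 // => j /negbTE ->.
    by rewrite mul0r.
move=> i ib; rewrite (deltaE i _ 0 (fun j => (j == b)%:R)) ?(negbTE ib) ?(res0 hpi) ?mulr0 //.
- exact: sr0.
- by move=> j; exact: sr_nat.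
- rewrite (frob0 hp) add0r (bigD1 b) //= eqxx mul1r big1 ?addr0 // => j /negbTE ->.
  by rewrite mul0r.
Qed.

Lemma smooth_closed_pbasis : pdegree hp 2 -> Omega_free iota Q 2 ->
  size s = 2 /\ pbasis hp Q s`_0 s`_1.
Proof.
move=> hdeg /smooth_embdim n2.
have m0 : mideal Q 0 by exact: mideal0.
have mj j : mideal Q s`_j.
  have [jn|nj] := ltnP j n; last by rewrite nth_default.
  exact: (parameter_in (Ordinal jn)).
have hb : pbasis hp Q s`_0 s`_1.
  apply: pgen_pbasis => //.
  - exact (point_frac hX cQ.1).
  - exact (pfin_point hp hperf hX cQ.1).
  - move=> g Qg; have [[a c] /(_ Qg) /= [Qa Qc ->]] := param_decomp g.
    have Q0 := sr0 hQ.
    pose d (j : nat) := if insub j is Some l then c l else 0.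
    have Qd j : Q (d j) by rewrite /d; case: insubP.
    exists a, (d 0%N), (d 1%N); split=> //; rewrite -addrA; congr (_ + _).
    transitivity (\sum_(j < 2) d j * s`_j); last first.
      by rewrite !big_ord_recr big_ord0 /= add0r !(mulrC (d _)).
    have -> : \sum_j c j * s`_j = \sum_(j < n) d j * s`_j.
      by apply: eq_bigr => j _; rewrite /d valK.
    rewrite (big_ord_widen 2 (fun j => d j * s`_j) n2) big_mkcond /=.
    apply: eq_bigr => j _; case: ifP => // /negbT; rewrite -leqNgt => nj.
    by rewrite nth_default ?mulr0.
(* With fewer than two parameters the second one would be the default 0 of [nth], which no p-basis
   contains. *)
split=> //; apply/eqP; rewrite eqn_leq n2 ltnNge; apply/negP => s1.
have [_ /eqP] := pbasis_nz hb; apply; exact: nth_default.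
Qed.

End SmoothClosed.
End ClosedPoints.

(** * Orders along a discrete valuation ring *)

Section Ord.
Context {K : fieldType}.
Implicit Types (E : set K) (x y u t : K).

Lemma unitXz E u (n : int) : is_subring E -> is_unit E u -> is_unit E (u ^ n).
Proof.
by move=> hE uu; case: n => n; [exact: unitX|apply: unitV; exact: unitX].
Qed.

Definition vge E (n : int) x := x = 0 \/ n <= ord E x.

Section Dvr.
Variables (E : set K) (t : K) (hE : dvr E t).

Lemma dvr_local : local E. Proof. by case: hE. Qed.
Lemma dvr_sr : is_subring E. Proof. by case: dvr_local. Qed.
Let sE := dvr_sr.
Lemma dvr_t0 : t != 0. Proof. by case: hE. Qed.
Let t0 := dvr_t0.
Lemma dvr_mideal : mideal E = principal E t. Proof. by case: hE. Qed.
Lemma dvr_mt : mideal E t.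
Proof. by rewrite dvr_mideal; exists 1; [exact: sr1|rewrite mulr1]. Qed.
Lemma dvr_t : E t. Proof. exact: midealW dvr_mt. Qed.

Lemma dvr_unit_tz (d : int) : is_unit E (t ^ d) -> d = 0.
Proof.
have pos n : ~ is_unit E (t ^+ n.+1).
  have [_] := dvr_mt; apply: contra_not; rewrite exprS => h.
  by apply: (unit_Ml sE dvr_t) h; exact: srX dvr_t.
case: d => [[|n]|n] //; first by move=> /pos.
by move=> /unitV; rewrite NegzE -exprnN invrK => /pos.
Qed.

Lemma ord_eq x n : is_unit E (x / t ^ n) -> ord E x = n.
Proof.
move=> ux; apply: xget_unique; first by exists t => //; exact: dvr_mideal.
move=> m [t' et' ux'].
have [w Ew ew] : principal E t t'.
  by rewrite -dvr_mideal et'; exists 1; [exact: sr1|rewrite mulr1].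
have [w' Ew' ew'] : principal E t' t.
  by rewrite -et' dvr_mideal; exists 1; [exact: sr1|rewrite mulr1].
have ww : w * w' = 1 by apply: (mulfI t0); rewrite mulrA -ew -ew' mulr1.
have w0 : w != 0 by apply/eqP => e; move/eqP: ww; rewrite e mul0r eq_sym oner_eq0.
have uw : is_unit E w by apply: (unit_Ml sE Ew Ew'); rewrite ww; exact: unit1.
have x0 : x != 0 by case: ux; rewrite mulf_eq0 negb_or => /andP[].
apply/eqP; rewrite -subr_eq0; apply/eqP/dvr_unit_tz.
have -> : t ^ (m - n) = (x / t ^ n) * (x / t' ^ m)^-1 / w ^ m.
  rewrite ew expfzDr // exprzMl ?unitfE // -invr_expz.
  by field; rewrite x0 !expfz_neq0.
apply: unitM => //; first by apply: unitM => //; exact: unitV.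
by apply: unitV; exact: unitXz.
Qed.

Lemma ordP x : x != 0 -> is_unit E (x / t ^ ord E x).
Proof. by move=> x0; case: hE => _ _ _ /(_ x x0) [n un]; rewrite (ord_eq un). Qed.

Lemma ordM x y : x != 0 -> y != 0 -> ord E (x * y) = ord E x + ord E y.
Proof.
move=> x0 y0; apply: ord_eq; rewrite expfzDr // invfM mulrACA.
by apply: unitM => //; exact: ordP.
Qed.

Lemma ord_one : ord E 1 = 0.
Proof. by apply: ord_eq; rewrite expr0z divr1; exact: unit1. Qed.

Lemma ordV x : x != 0 -> ord E x^-1 = - ord E x.
Proof.
move=> x0; have := @ordM x x^-1 x0; rewrite invr_eq0 mulfV // ord_one => /(_ x0); lia.
Qed.

Lemma ordX x n : x != 0 -> ord E (x ^+ n) = ord E x *+ n.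
Proof.
move=> x0; elim: n => [|n IH]; first by rewrite expr0 ord_one.
by rewrite exprS ordM ?expf_neq0 // IH mulrS.
Qed.

Lemma ordXz x (n : int) : x != 0 -> ord E (x ^ n) = ord E x * n.
Proof.
move=> x0; case: n => n; first by rewrite ordX // -mulr_natr natz.
by rewrite NegzE -exprnN ordV ?expf_neq0 // ordX // mulrN -mulr_natr natz.
Qed.

Lemma ord_t : ord E t = 1.
Proof. by apply: ord_eq; rewrite expr1z divff //; exact: unit1. Qed.

Lemma ord_ge0 x : x != 0 -> E x <-> 0 <= ord E x.
Proof.
move=> x0; have ux := ordP x0; split; last first.
  case: (ord E x) ux => // n [_ Eu _] _.
  by rewrite -(divfK (expf_neq0 n t0) x); apply: srM => //; apply: srX => //; exact: dvr_t.
case: (ord E x) ux => // n; rewrite NegzE -exprnN invrK => -[_ _ Ei] Ex.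
have [_] := dvr_mt; case; split=> //; first exact: dvr_t.
have -> : t^-1 = x * t ^+ n * (x * t ^+ n.+1)^-1.
  by rewrite exprS; field; rewrite t0 x0 expf_neq0.
by apply: srM => //; apply: srM => //; apply: srX => //; exact: dvr_t.
Qed.

Lemma vgeP n x : vge E n x <-> E (x / t ^ n).
Proof.
have [->|x0] := eqVneq x 0; first by rewrite mul0r; split=> _; [exact: sr0|left].
have tn0 : (t ^ n)^-1 != 0 by rewrite invr_eq0 expfz_neq0.
rewrite ord_ge0 ?mulf_neq0 // ordM // ordV ?expfz_neq0 // ordXz // ord_t mul1r subr_ge0.
by split=> [[/eqP|//]|]; [rewrite (negbTE x0)|right].
Qed.

Lemma vge0P x : vge E 0 x <-> E x. Proof. by rewrite vgeP expr0z divr1. Qed.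

Lemma vgeD n x y : vge E n x -> vge E n y -> vge E n (x + y).
Proof. by rewrite !vgeP mulrDl; exact: srD. Qed.

Lemma vgeN n x : vge E n x -> vge E n (- x).
Proof. by rewrite !vgeP mulNr; exact: srN. Qed.

Lemma vge_sum n T (r : seq T) (P : pred T) (F : T -> K) :
  (forall i, P i -> vge E n (F i)) -> vge E n (\sum_(i <- r | P i) F i).
Proof. by move=> h; elim/big_ind: _ => //; [left|exact: vgeD]. Qed.

Lemma vgeM m n x y : vge E m x -> vge E n y -> vge E (m + n) (x * y).
Proof.
rewrite !vgeP => Ex Ey; rewrite expfzDr // invfM mulrACA; exact: srM.
Qed.

Lemma vgeMl n x y : E x -> vge E n y -> vge E n (x * y).
Proof. by rewrite -{2}[n]add0r => /vge0P; exact: vgeM. Qed.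

Lemma vge_le m n x : m <= n -> vge E n x -> vge E m x.
Proof. by move=> mn [->|h]; [left|right; exact: le_trans h]. Qed.

Lemma vge_tz n x : vge E n (t ^ n * x) <-> E x.
Proof. by rewrite vgeP mulrAC mulfV ?mul1r // expfz_neq0. Qed.

Lemma vge1P x : vge E 1 x <-> mideal E x.
Proof.
rewrite dvr_mideal vgeP expr1z; split=> [h|[a Ea ->]]; first by exists (x / t); rewrite // mulrC divfK.
by rewrite mulrC mulKf.
Qed.

Lemma ord_unit x : is_unit E x <-> x != 0 /\ ord E x = 0.
Proof.
split=> [ux|[x0 e]]; last by have := ordP x0; rewrite e expr0z divr1.
by split; [case: ux|apply: ord_eq; rewrite expr0z divr1].
Qed.

End Dvr.
End Ord.

(** * p-bases of discrete valuation rings *)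

Section DvrPBasis.
Context {K : fieldType} (p : nat) (hp : p \in [pchar K]).
Variables (E : set K) (t : K) (hE : dvr E t).
Variables (kap : fieldType) (pi : K -> kap) (hpi : residue E pi) (s : K) (Es : E s)
  (ns : forall y, y ^+ p <> pi s).
Let sE := dvr_sr hE.
Let t0 := dvr_t0 hE.
Let Et := dvr_t hE.

(** The sum is compared power by power in t. Terms with smaller exponent are divisible by t^p by
    induction, so the coefficient of t^i vanishes in the residue field, where [insep_free] applies
    to the residue of s. *)
Lemma dvr_free_step (c : 'I_p * 'I_p -> K) : (forall ij, E (c ij)) ->
  E ((\sum_ij c ij ^+ p * pmon t s ij) / t ^+ p) -> forall ij, mideal E (c ij).
Proof.
move=> Ec hS; have hpk := res_pchar hpi hp.
pose A (i : 'I_p) := \sum_j c (i, j) ^+ p * s ^+ j.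
have EA i : E (A i).
  by apply: sr_sum => // j _; apply: srM => //; exact: srX.
set S := \sum_ij _ in hS.
have eS : S = \sum_i A i * t ^+ i.
  transitivity (\sum_i \sum_j c (i, j) ^+ p * pmon t s (i, j)).
    by rewrite pair_bigA /=; apply: eq_bigr => -[].
  apply: eq_bigr => i _; rewrite mulr_suml; apply: eq_bigr => j _.
  by rewrite /pmon /= -mulrA (mulrC (s ^+ _)).
suff H n : (n <= p)%N -> forall ij : 'I_p * 'I_p, (ij.1 < n)%N -> mideal E (c ij).
  by move=> ij; apply: (H p).
elim: n => // n IHn np [i j] /=; rewrite ltnS leq_eqVlt => /orP[/eqP ein|]; last first.
  by move=> ltin; apply: (IHn (ltnW np) (i, j)).
have hI := principalS (t ^+ n.+1) sE.
have tge m x : (n < m)%N -> E x -> principal E (t ^+ n.+1) (x * t ^+ m).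
  move=> nm Ex; exists (t ^+ (m - n.+1) * x); last by rewrite mulrA -exprD subnKC // mulrC.
  by apply: srM => //; exact: srX.
have : principal E (t ^+ n.+1) (A i * t ^+ i).
  have -> : A i * t ^+ i = S - \sum_(l | l != i) A l * t ^+ l.
    by rewrite eS (bigD1 i) //= addrK.
  apply: (submodB sE hI); first by have := tge p (S / t ^+ p) np hS; rewrite divfK ?expf_neq0.
  apply: (submod_sum _ hI) => l li.
  have [ltl|] := ltnP n l; first exact: tge.
  rewrite leq_eqVlt => /orP[/eqP e|ln]; first by case/eqP: li; apply: val_inj; rewrite /= e ein.
  have -> : A l = (\sum_j (c (l, j) / t) ^+ p * s ^+ j) * t ^+ p.
    rewrite mulr_suml; apply: eq_bigr => m _; rewrite mulrAC; congr (_ * _).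
    by rewrite -exprMn divfK.
  rewrite -mulrA -exprD; apply: tge; first exact: ltn_addr.
  apply: sr_sum => // m _; apply: srM => //; last exact: srX.
  apply: srX => //; have := IHn (ltnW np) (l, m) ln.
  by rewrite (dvr_mideal hE) => -[b Eb ->]; rewrite mulrC mulKf.
move=> [b Eb]; rewrite ein exprSr -mulrA mulrC => /(mulfI (expf_neq0 _ t0)) eA.
have mA : mideal E (A i) by rewrite (dvr_mideal hE); exists b.
have := (res_eq0 hpi (EA i)).2 mA.
rewrite (res_sum hpi) => [|l _]; last by apply: srM => //; exact: srX.
rewrite (eq_bigr (fun l : 'I_p => pi (c (i, l)) ^+ p * pi s ^+ l)); last first.
  by move=> l _; rewrite (resM hpi) ?(resX hpi) //; exact: srX.
move=> h; apply/(res_eq0 hpi) => //.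
by apply: (insep_free hpk ns (c := fun j => pi (c (i, j)))).
Qed.

Lemma dvr_comp_in (c : 'I_p * 'I_p -> K) :
  E (\sum_ij c ij ^+ p * pmon t s ij) -> forall ij, E (c ij).
Proof.
have div n (d : 'I_p * 'I_p -> K) : (forall ij, E (d ij)) ->
    E ((\sum_ij d ij ^+ p * pmon t s ij) / t ^+ (p * n)) -> forall ij, E (d ij / t ^+ n).
  move=> Ed; elim: n => [|n IHn] hS ij; first by rewrite divr1.
  have Ed' : forall ij, E (d ij / t ^+ n).
    apply: IHn; have -> : forall z, z / t ^+ (p * n) = z / t ^+ (p * n.+1) * t ^+ p.
      by move=> z; rewrite mulnS exprD; field; rewrite !expf_neq0.
    by apply: srM => //; exact: srX.
  have [] : mideal E (d ij / t ^+ n) /\ True; last first.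
    by rewrite (dvr_mideal hE) => -[b Eb e] _; rewrite exprSr invfM mulrA e mulrC mulKf.
  split=> //; apply: (dvr_free_step Ed').
  rewrite (eq_bigr (fun ij => (d ij ^+ p * pmon t s ij) / t ^+ (p * n))); last first.
    by move=> i _; rewrite exprMn exprVn -exprM mulnC mulrAC.
  by rewrite -mulr_suml; move: hS; rewrite mulnS exprD invfM mulrA mulrAC.
move=> hS.
have /choice [m hm] : forall ij, exists m : nat, E (c ij * t ^+ m).
  move=> ij; have [->|c0] := eqVneq (c ij) 0; first by exists 0%N; rewrite mul0r; exact: sr0.
  exists `|ord E (c ij)|%N; apply/(ord_ge0 hE); first by rewrite mulf_neq0 ?expf_neq0.
  rewrite (ordM hE) ?expf_neq0 // (ordX hE) // (ord_t hE); lia.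
pose n := (\sum_ij m ij)%N.
have Ed ij : E (c ij * t ^+ n).
  rewrite /n (bigD1 ij) //= exprD mulrA; apply: srM => //; exact: srX.
move=> ij; rewrite -(mulfK (expf_neq0 n t0) (c ij)); apply: (div n (fun ij => c ij * t ^+ n)) => //.
rewrite (eq_bigr (fun ij => (c ij ^+ p * pmon t s ij) * t ^+ (p * n))); last first.
  by move=> i _; rewrite exprMn -exprM mulnC mulrAC.
by rewrite -mulr_suml mulfK ?expf_neq0.
Qed.

Lemma dvr_pbasis_residue : pdegree hp 2 -> pbasis hp E t s.
Proof.
move=> [I [e [cI he]]]; split=> //; last exact: dvr_comp_in.
apply: free_fbasis he _ _; last by rewrite cI card_prod card_ord.
apply/ffreeE => c e0 ij; apply: contrapT => /eqP c0.
have : E (c ij / t ^+ `|ord E (c ij) + 1|).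
  apply: (dvr_comp_in (c := fun l => c l / t ^+ `|ord E (c ij) + 1|)).
  rewrite (eq_bigr (fun l => (c l ^+ p * pmon t s l) / t ^+ (`|ord E (c ij) + 1| * p))); last first.
    by move=> l _; rewrite exprMn exprVn -exprM mulrAC.
  by rewrite -mulr_suml e0 mul0r; exact: sr0.
move/(ord_ge0 hE) => -/(_ _).
rewrite (ordM hE) ?invr_eq0 ?expf_neq0 // (ordV hE) ?expf_neq0 // (ordX hE) // (ord_t hE).
rewrite mulf_neq0 ?invr_eq0 ?expf_neq0 // => /(_ isT); lia.
Qed.

End DvrPBasis.

(** If all residues were p-th powers, every g would have the form a^p + t u, and [pgen_pbasis] would
    make t, 0 a p-basis. So some residue is not a p-th power, and a lift of it serves as s. *)
Lemma dvr_pbasis {K : fieldType} (p : nat) (hp : p \in [pchar K]) (E : set K) t :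
  dvr E t -> pfin p E -> pdegree hp 2 -> exists2 s, is_unit E s & pbasis hp E t s.
Proof.
move=> hE fE hdeg; have [kap [pi hpi]] := residue_field (dvr_local hE).
have sE := dvr_sr hE; have t0 := dvr_t0 hE.
have [z hz] : exists z : kap, forall y : kap, y ^+ p <> z.
  apply: contrapT => no.
  have hb : pbasis hp E t 0.
    apply: pgen_pbasis => //; first exact: dvr_local hE.
    - move=> x; have [->|x0] := eqVneq x 0.
        by exists 0, 1; rewrite mul0r oner_neq0; split=> //; [exact: sr0|exact: sr1].
      exists (x * t ^+ `|ord E x|), (t ^+ `|ord E x|).
      rewrite expf_neq0 // mulfK ?expf_neq0 //; split=> //; last by apply: srX => //; exact: dvr_t hE.
      apply/(ord_ge0 hE); first by rewrite mulf_neq0 ?expf_neq0.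
      by rewrite (ordM hE) ?expf_neq0 // (ordX hE) // (ord_t hE); lia.
    - exact: dvr_mt hE.
    - exact: mideal0.
    - move=> g Eg; have [y ey] : exists y : kap, y ^+ p = pi g.
        by apply: contrapT => h; apply: no; exists (pi g) => y ey; apply: h; exists y.
      have [a Ea ea] := res_surj hpi y.
      have Eap : E (a ^+ p) by exact: srX.
      have : mideal E (g - a ^+ p) by apply/(res_eq hpi) => //; rewrite (resX hpi) // ea.
      rewrite (dvr_mideal hE) => -[u Eu e]; exists a, u, 0; split=> //; first exact: sr0.
      by rewrite mulr0 addr0 -e addrC subrK.
  by have [_ /eqP] := pbasis_nz hb.
have [s Es es] := res_surj hpi z; exists s; last first.
  by apply: (dvr_pbasis_residue hE hpi) => // y; rewrite es; exact: hz.
apply: (res_unit hpi) => //; apply/eqP => z0.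
apply: (hz 0); rewrite -es z0 expr0n gtn_eqF //; exact: p_gt0 hp.
Qed.

(** * Derivations and Jacobson's formula *)

Section Derivations.
Context {R : comNzRingType}.
Implicit Types (D : R -> R) (a b f g x y : R).

Definition isder D := {morph D : x y / x + y} /\ forall x y, D (x * y) = D x * y + x * D y.

Section Der.
Variables (D : R -> R) (hD : isder D).
Lemma derD : {morph D : x y / x + y}. Proof. exact: hD.1. Qed.
Lemma derM x y : D (x * y) = D x * y + x * D y. Proof. exact: hD.2. Qed.
Lemma der0 : D 0 = 0.
Proof. by apply: (addrI (D 0)); rewrite -derD !addr0. Qed.
Lemma derN x : D (- x) = - D x.
Proof. by apply/eqP; rewrite -addr_eq0 -derD addNr der0. Qed.
Lemma derB x y : D (x - y) = D x - D y. Proof. by rewrite derD derN. Qed.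
Lemma der1 : D 1 = 0.
Proof. by have := derM 1 1; rewrite !mulr1 mul1r => /eqP; rewrite -subr_eq subrr eq_sym => /eqP. Qed.
Lemma der_sum T (r : seq T) (P : pred T) (F : T -> R) :
  D (\sum_(i <- r | P i) F i) = \sum_(i <- r | P i) D (F i).
Proof. by elim/big_rec2: _ => [|i y z _ <-]; [exact: der0|rewrite derD]. Qed.
Lemma derXn x n : D (x ^+ n) = n%:R * x ^+ n.-1 * D x.
Proof.
elim: n => [|n IHn]; first by rewrite expr0 der1 !mul0r.
rewrite exprS derM IHn; case: n {IHn} => [|n] /=; first by rewrite expr0; ring.
by rewrite exprS -!natr1; ring.
Qed.
Lemma der_nat n : D n%:R = 0.
Proof. by elim: n => [|n IH]; [exact: der0|rewrite -natr1 derD IH der1 addr0]. Qed.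
Lemma iter_derD n : {morph iter n D : x y / x + y}.
Proof. by move=> x y; elim: n => //= n ->; rewrite derD. Qed.
Lemma der_nzl n x : D (n%:R * x) = n%:R * D x.
Proof. by rewrite derM der_nat mul0r add0r. Qed.
Lemma iter_derM n x y :
  iter n D (x * y) = \sum_(k < n.+1) ('C(n, k))%:R * (iter k D x * iter (n - k) D y).
Proof.
elim: n => [|n IHn]; first by rewrite big_ord1 mul1r.
rewrite iterS IHn der_sum.
under eq_bigr => k _ do rewrite der_nzl derM mulrDr.
rewrite big_split /= [in RHS]big_ord_recl /= [X in X + _ = _]big_ord_recr /=.
rewrite [X in _ + X = _]big_ord_recl /= !bin0 !binn subnn !subn0 [X in _ = _ + X]big_ord_recr /=.
rewrite [X in _ + (_ + X) = _](eq_bigr (fun i : 'I_n =>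
  'C(n, i.+1)%:R * (iter i.+1 D x * iter (n - i) D y))); last first.
  by move=> i _; rewrite /bump /= add1n -[in RHS](subnSK (ltn_ord i)).
rewrite [X in _ = _ + (X + _)](eq_bigr (fun i : 'I_n =>
  'C(n, i)%:R * (iter i.+1 D x * iter (n - i) D y) +
  'C(n, i.+1)%:R * (iter i.+1 D x * iter (n - i) D y))); last first.
  by move=> i _; rewrite /bump /= add1n binS natrD mulrDl subSS addrC.
by rewrite big_split /bump /= add1n binn subnn /=; ring.
Qed.

End Der.

Lemma isder_comb a b D D' : isder D -> isder D' -> isder (fun x => a * D x + b * D' x).
Proof.
move=> h h'; split=> x y; first by rewrite (derD h) (derD h'); ring.
by rewrite (derM h) (derM h'); ring.
Qed.

Lemma isder_scale a D : isder D -> isder (fun x => a * D x).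
Proof. by move=> h; split=> x y; rewrite ?(derD h) ?(derM h); ring. Qed.

Section Pchar.
Variables (p : nat) (hp : p \in [pchar R]) (D : R -> R) (hD : isder D).

Lemma der_pX x : D (x ^+ p) = 0.
Proof. by rewrite (derXn hD) pcharf0 // !mul0r. Qed.

Lemma der_pl a x : D (a ^+ p * x) = a ^+ p * D x.
Proof. by rewrite (derM hD) der_pX mul0r add0r. Qed.

Lemma isder_iter_p : isder (iter p D).
Proof.
split; first exact: iter_derD.
move=> x y; have pp := pcharf_prime hp; have p0 := prime_gt0 pp.
rewrite (iter_derM hD) (bigD1 ord0) //= (bigD1 ord_max) //=; last first.
  by rewrite -val_eqE /= -lt0n.
rewrite bin0 binn subn0 subnn !mul1r big1 ?addr0 1?addrC // => i /andP[i0 im].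
have : (p %| 'C(p, i))%N.
  by rewrite prime_dvd_bin // lt0n i0 /= ltn_neqAle im -ltnS ltn_ord.
by rewrite (dvdn_pcharf hp) => /eqP ->; rewrite mul0r.
Qed.

End Pchar.
End Derivations.

Section FieldDer.
Context {K : fieldType} (D : K -> K) (hD : isder D).

Lemma derV x : x != 0 -> D x^-1 = - D x / x ^+ 2.
Proof.
move=> x0; have := der1 hD; rewrite -(mulfV x0) (derM hD) => /eqP.
rewrite addr_eq0 => /eqP e; apply: (mulfI x0); rewrite -[LHS]opprK -e; by field.
Qed.

Lemma der_div x y : y != 0 -> D (x / y) = D x / y - x * D y / y ^+ 2.
Proof. by move=> y0; rewrite (derM hD) derV //; ring. Qed.

Lemma dlogM x y : x != 0 -> y != 0 -> D (x * y) / (x * y) = D x / x + D y / y.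
Proof. by move=> x0 y0; rewrite (derM hD); field; rewrite x0 y0. Qed.

Lemma der_loc A q : is_subring A -> prime_ideal A q -> (forall a, A a -> A (D a)) ->
  forall x, localization A q x -> localization A q (D x).
Proof.
move=> hA hq hDA _ [a [b [Aa Ab nb ->]]]; have b0 := prime_nz hq nb.
exists (D a * b - a * D b), (b ^+ 2); split; last by rewrite der_div //; field.
- by apply: srB => //; apply: srM => //; exact: hDA.
- exact: srX.
- exact: (prime_nX hA hq Ab nb).
Qed.

End FieldDer.

Section Jacobson.
Context {R : comNzRingType} (p : nat) (hp : p \in [pchar R]) (D : R -> R) (hD : isder D).
Local Notation dp := (map_poly D).

Lemma coef_dpoly (f : {poly R}) i : (dp f)`_i = D f`_i.
Proof. by rewrite coef_map_id0 //; exact: der0. Qed.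

Lemma dpoly_isder : isder (dp).
Proof.
split=> f g; apply/polyP => i; first by rewrite coefD !coef_dpoly coefD (derD hD).
rewrite coefD coef_dpoly !coefM (der_sum hD) -big_split; apply: eq_bigr => j _ /=.
by rewrite (derM hD) !coef_dpoly.
Qed.

Lemma dpolyC a : dp a%:P = (D a)%:P.
Proof. by apply/polyP => i; rewrite coef_dpoly !coefC; case: ifP => // _; exact: der0. Qed.

Lemma dpolyX : dp 'X = 0.
Proof. by apply/polyP => i; rewrite coef_dpoly coefX coef0 der_nat. Qed.

Lemma natr_pcancel n (w : R) : (0 < n < p)%N -> n%:R * w = 0 -> w = 0.
Proof.
move=> /andP[n0 np] e; have pp := pcharf_prime hp.
have /(coprimeP _ n0) [[a b] /= ab] : coprime n p.
  by rewrite coprime_sym prime_coprime // gtnNdvd.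
have : (a * n)%:R * w = w.
  by have -> : (a * n = 1 + b * p)%N; [lia|rewrite natrD natrM (pcharf0 hp) mulr0 addr0 mul1r].
by rewrite natrM -mulrA e mulr0.
Qed.

Variable u : R.
(** The variable counts the occurrences of D in the expansion of (D + u)^n; setting it to 1 gives
    the operator itself. *)
Let T (f : {poly R}) := 'X * dp f + u%:P * f.
Let b n := iter n T 1.
Let us j := iter j D u.
Let F n j := 'X^j * (us j.+1)%:P * b (n.-1 - j).

Let TD : {morph T : f g / f + g}.
Proof. by move=> f g; rewrite /T (derD dpoly_isder); ring. Qed.

Let Tn n f : T (n%:R * f) = n%:R * T f.
Proof. by rewrite /T (der_nzl dpoly_isder); ring. Qed.

Let T_sum n (G : 'I_n -> {poly R}) : T (\sum_j G j) = \sum_j T (G j).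
Proof.
have T0 : T 0 = 0 by apply: (addrI (T 0)); rewrite -TD !addr0.
by elim/big_rec2: _ => [|i y z _ <-] //; rewrite TD.
Qed.

Let TF n j : (j < n)%N -> T (F n j) = F n.+1 j.+1 + F n.+1 j.
Proof.
move=> jn; rewrite /F /= subnS; have -> : (n - j = (n.-1 - j).+1)%N by lia.
rewrite /= /T (derM dpoly_isder) (derM dpoly_isder) dpolyC (derXn dpoly_isder) dpolyX.
by rewrite exprS; ring.
Qed.

Let Db n : dp (b n) = \sum_(j < n) ('C(n, j.+1))%:R * F n j.
Proof.
elim: n => [|n IHn]; first by rewrite big_ord0 (der1 dpoly_isder).
have -> : dp (b n.+1) = T (dp (b n)) + F n.+1 0.
  rewrite /b iterS -/(b n) /T (derD dpoly_isder) !(derM dpoly_isder) dpolyX dpolyC /F /us /= subn0 expr0.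
  by ring.
rewrite IHn T_sum; under eq_bigr => j _ do rewrite Tn TF // mulrDr.
rewrite big_split /=; under [RHS]eq_bigr => j _ do rewrite binS natrD mulrDl.
rewrite [RHS]big_split /= [X in _ = X + _]big_ord_recr /= bin_small // mul0r addr0.
by rewrite [X in _ = _ + X]big_ord_recl /= bin0 mul1r; under [X in _ = _ + (_ + X)]eq_bigr do rewrite /bump /= add1n; ring.
Qed.

Let eb n : (b n.+1)^`() = \sum_(j < n) (j.+1 * 'C(n.+1, j.+2))%:R * F n j.
Proof.
have step m : (b m.+1)^`() = dp (b m) + T ((b m)^`()).
  rewrite /b iterS -/(b m) /T derivD !derivM derivX derivC mul1r mul0r add0r.
  have -> : (dp (b m))^`() = dp ((b m)^`()).
    apply/polyP => i; rewrite coef_dpoly !coef_deriv coef_dpoly.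
    by rewrite -[LHS]mulr_natl -(der_nzl hD) mulr_natl.
  by rewrite addrA.
elim: n => [|n IHn].
  by rewrite big_ord0 step /b /= derivC /T (der1 dpoly_isder) (der0 dpoly_isder) !mulr0 !addr0.
rewrite step IHn Db T_sum; under [X in _ + X]eq_bigr => j _ do rewrite Tn TF // mulrDr.
rewrite big_split /=.
rewrite [RHS](eq_bigr (fun j : 'I_n.+1 => (j.+1 * 'C(n.+1, j.+2))%:R * F n.+1 j +
  ('C(n.+1, j.+1)%:R * F n.+1 j + (j * 'C(n.+1, j.+1))%:R * F n.+1 j))); last first.
  by move=> j _; rewrite binS mulnDr (mulSn j 'C(n.+1, j.+1)) natrD [('C(_, _) + _)%:R]natrD !mulrDl.
rewrite [RHS]big_split /= [X in _ = X + _]big_ord_recr /= bin_small // muln0 mul0r addr0.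
rewrite big_split /= [X in _ = _ + (_ + X)]big_ord_recl /= mul0n mul0r add0r.
rewrite [X in _ = _ + (_ + X)](eq_bigr (fun j : 'I_n => (j.+1 * 'C(n.+1, j.+2))%:R * F n.+1 j.+1)).
  by ring.
by move=> j _; rewrite /bump /= add1n.
Qed.

(** The derivative of [b p] in the variable has the binomial coefficients 'C(p, j + 2), divisible by
    p except at the top. As [b p] has degree below p, only its constant term u^p and a term of
    degree p - 1 with coefficient D^(p-1) u survive. *)
Lemma jacobson1 : iter p (fun f => D f + u * f) 1 = u ^+ p + iter p.-1 D u.
Proof.
have pp := pcharf_prime hp; have p1 := prime_gt1 pp; have p0 := ltnW p1.
have sb n : (size (b n.+1) <= n.+1)%N.
  elim: n => [|n IHn].
    by rewrite /b /= /T (der1 dpoly_isder) mulr0 add0r mulr1 size_polyC_leq1.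
  rewrite /b iterS -/(b n.+1) /T; apply: (leq_trans (size_polyD _ _)); rewrite geq_max.
  apply/andP; split.
    apply: (leq_trans (size_polyMleq _ _)); rewrite size_polyX addSn /=.
    by rewrite add1n ltnS (leq_trans (size_poly _ _)).
  by rewrite mul_polyC (leq_trans (size_scale_leq _ _)) // (leq_trans IHn).
pose h := b p - 'X^(p.-1) * (us p.-1)%:P.
have h' : h^`() = 0.
  have [q eq] : exists q, p = q.+2 by exists p.-2; lia.
  have e1 : p.-1 = q.+1 by rewrite eq.
  rewrite /h e1 {1}eq derivB eb derivM derivC mulr0 addr0 derivXn succnK.
  rewrite big_ord_recr /= big1 ?add0r.
    by rewrite binn muln1 /F /= subnn /b /= mulr1 mulr_natl mulrnAl subrr.
  move=> j _; have : (p %| 'C(q.+2, j.+2))%N.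
    by rewrite eq prime_dvd_bin -?eq //= eq; have := ltn_ord j; lia.
  move=> /dvdnP [d ->]; rewrite mulnA natrM.
  have -> : (p%:R : {poly R}) = 0 by rewrite -polyC_natr (pcharf0 hp).
  by rewrite mulr0 mul0r.
have sh i : (0 < i)%N -> h`_i = 0.
  move=> i0; have [ip|pi] := ltnP i p.
    apply: (natr_pcancel (n := i)); first by rewrite i0.
    have := congr1 (fun f : {poly R} => f`_i.-1) h'; rewrite /= coef_deriv coef0 prednK //.
    by rewrite mulr_natl.
  rewrite /h coefB [(b p)`_i]nth_default; last by rewrite (leq_trans _ pi) // -{2}(prednK p0) -{1}(prednK p0) sb.
  rewrite coefXnM; have -> : (i < p.-1)%N = false by lia.
  by rewrite coefC; have -> : (i - p.-1 == 0)%N = false; [lia|rewrite subrr].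
have h0 : h`_0 = u ^+ p.
  rewrite /h coefB coefXnM; have -> : (0 < p.-1)%N by lia.
  rewrite subr0; elim: (p) => [|n IHn]; first by rewrite coef1.
  by rewrite /b iterS -/(b n) /T coefD coefXM /= add0r coefCM IHn exprS.
have e : b p = (u ^+ p)%:P + 'X^(p.-1) * (us p.-1)%:P.
  rewrite -h0; apply/eqP; rewrite -subr_eq -/h; apply/eqP/polyP => -[|i]; rewrite coefC //=.
  by rewrite sh.
have ev n : (b n).[1] = iter n (fun f => D f + u * f) 1.
  elim: n => [|n IHn]; first by rewrite hornerC.
  rewrite /b iterS -/(b n) /T hornerD !hornerM hornerX hornerC mul1r IHn /=; congr (_ + _).
  rewrite -IHn (horner_coef_wide (n := size (b n))) ?size_poly // horner_coef (der_sum hD).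
  by apply: eq_bigr => i _; rewrite coef_dpoly expr1n !mulr1.
by rewrite -ev e hornerD hornerM hornerXn !hornerC expr1n mul1r.
Qed.

End Jacobson.

(** * Frobenius coordinates, logarithmic derivations and the trace form *)

Section FrobeniusFrames.
Context {K : fieldType} (p : nat) (hp : p \in [pchar K]).

Section PCoord.
Variables (x y : K) (hb : pframe p hp x y).
Local Notation o := (ord_p0 hp).
Local Notation pm := (pmon (p:=p) x y).

Definition pco g : 'I_p * 'I_p -> K :=
  sval (cid ((fspanE hp (pm) g).1 (hb.1 g))).

Lemma pco_sum g : g = \sum_ij pco g ij ^+ p * pm ij.
Proof. by rewrite /pco; case: cid. Qed.

Lemma pco_uniq g c : g = \sum_ij c ij ^+ p * pm ij -> forall ij, pco g ij = c ij.
Proof.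
move=> eg ij; apply/eqP; rewrite -subr_eq0; apply/eqP.
have /ffreeE/(_ (fun ij => pco g ij - c ij)) := hb.2; apply.
under eq_bigr do rewrite (frobB hp) mulrBl.
by rewrite sumrB -pco_sum -eg subrr.
Qed.

Lemma pcoD g h ij : pco (g + h) ij = pco g ij + pco h ij.
Proof.
apply: (pco_uniq (c := fun ij => pco g ij + pco h ij)).
under eq_bigr do rewrite (frobD hp) mulrDl.
by rewrite big_split /= -!pco_sum.
Qed.

Lemma pco_pM a g ij : pco (a ^+ p * g) ij = a * pco g ij.
Proof.
apply: (pco_uniq (c := fun ij => a * pco g ij)).
under eq_bigr do rewrite exprMn -mulrA.
by rewrite -mulr_sumr -pco_sum.
Qed.

Lemma pco_mon ij ij' : pco (pm ij) ij' = (ij' == ij)%:R.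
Proof.
apply: (pco_uniq (c := fun l => (l == ij)%:R)).
rewrite (bigD1 ij) //= eqxx expr1n mul1r big1 ?addr0 // => l /negbTE ->.
by rewrite (frob0 hp) mul0r.
Qed.

Lemma pcoord_nz : x != 0 /\ y != 0.
Proof.
by apply: (@pbasis_nz _ _ hp setT); split.
Qed.
Let x0 := pcoord_nz.1.
Let y0 := pcoord_nz.2.

Lemma plin_ext (F G s : K -> K) : {morph F : g h / g + h} -> {morph G : g h / g + h} ->
  (forall a g, F (a ^+ p * g) = s a * F g) -> (forall a g, G (a ^+ p * g) = s a * G g) ->
  (forall ij, F (pm ij) = G (pm ij)) -> F =1 G.
Proof.
move=> FD GD Fs Gs FG g; rewrite (pco_sum g).
have F0 : F 0 = 0 by apply: (addrI (F 0)); rewrite -FD !addr0.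
have G0 : G 0 = 0 by apply: (addrI (G 0)); rewrite -GD !addr0.
apply: (big_ind (fun z => F z = G z)) => [|a b ea eb|ij _]; first by rewrite F0 G0.
  by rewrite FD GD ea eb.
by rewrite Fs Gs FG.
Qed.

Lemma natr_modp n : (n %% p)%:R = n%:R :> K.
Proof. by rewrite {2}(divn_eq n p) natrD natrM (pcharf0 hp) mulr0 add0r. Qed.

(** The logarithmic derivation u x d/dx + v y d/dy. *)
Definition pD (u v : nat) g := \sum_(ij : 'I_p * 'I_p) (u * ij.1 + v * ij.2)%:R * pco g ij ^+ p * pm ij.

Lemma pD_add u v : {morph pD u v : g h / g + h}.
Proof.
move=> g h; rewrite /pD -big_split; apply: eq_bigr => ij _ /=.
by rewrite pcoD (frobD hp); ring.
Qed.

Lemma pD_pM u v a g : pD u v (a ^+ p * g) = a ^+ p * pD u v g.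
Proof.
by rewrite /pD mulr_sumr; apply: eq_bigr => ij _; rewrite pco_pM exprMn; ring.
Qed.

Lemma pD_mon u v (m n : nat) : pD u v (x ^+ m * y ^+ n) = (u * m + v * n)%:R * (x ^+ m * y ^+ n).
Proof.
pose ij : 'I_p * 'I_p := (Ordinal (ltn_pmod m (p_gt0 hp)), Ordinal (ltn_pmod n (p_gt0 hp))).
have -> : x ^+ m * y ^+ n = (x ^+ (m %/ p) * y ^+ (n %/ p)) ^+ p * pm ij.
  by rewrite /pmon /= {1}(divn_eq m p) {1}(divn_eq n p) !exprD !exprM exprMn; ring.
rewrite pD_pM mulrCA; congr (_ * _).
rewrite /pD (bigD1 ij) //= big1 ?addr0 => [|l lij]; last first.
  by rewrite pco_mon (negbTE lij) (frob0 hp) mulr0 mul0r.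
by rewrite pco_mon eqxx expr1n mulr1 !natrD !natrM !natr_modp.
Qed.

Lemma pD_isder u v : isder (pD u v).
Proof.
split; first exact: pD_add.
move=> g h; move: g.
apply: (@plin_ext (fun g => pD u v (g * h)) (fun g => pD u v g * h + g * pD u v h) (fun a => a ^+ p)).
- by move=> a b; rewrite mulrDl pD_add.
- by move=> a b; rewrite pD_add; ring.
- by move=> a b; rewrite -mulrA pD_pM.
- by move=> a b; rewrite pD_pM; ring.
move=> ij; move: h.
apply: (@plin_ext (fun h => pD u v (pm ij * h))
  (fun h => pD u v (pm ij) * h + pm ij * pD u v h) (fun a => a ^+ p)).
- by move=> a b; rewrite mulrDr pD_add.
- by move=> a b; rewrite pD_add; ring.
- by move=> a b; rewrite mulrCA pD_pM.
- by move=> a b; rewrite pD_pM; ring.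
move=> ij'; have -> : pm ij * pm ij' = x ^+ (ij.1 + ij'.1) * y ^+ (ij.2 + ij'.2).
  by rewrite /pmon !exprD; ring.
by rewrite /pmon !pD_mon !exprD !mulnDr !natrD; ring.
Qed.

Lemma pDx u v : pD u v x = u%:R * x.
Proof. by have := pD_mon u v 1 0; rewrite expr1 expr0 mulr1 muln0 muln1 addn0. Qed.
Lemma pDy u v : pD u v y = v%:R * y.
Proof. by have := pD_mon u v 0 1; rewrite expr1 expr0 mul1r muln0 muln1 add0n. Qed.

Lemma der_ext (F G : K -> K) : isder F -> isder G -> F x = G x -> F y = G y -> F =1 G.
Proof.
move=> hF hG Fx Fy; apply: (plin_ext hF.1 hG.1 (s := fun a => a ^+ p)).
- exact: der_pl.
- exact: der_pl.
- by move=> ij; rewrite /pmon (derM hF) (derM hG) !(derXn hF) !(derXn hG) Fx Fy.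
Qed.

Definition pD1 := pD 1 0.
Definition pD2 := pD 0 1.
Definition vf (a b : K) g := a * pD1 g + b * pD2 g.

Lemma pD1_der : isder pD1. Proof. exact: pD_isder. Qed.
Lemma pD2_der : isder pD2. Proof. exact: pD_isder. Qed.
Lemma vf_der a b : isder (vf a b).
Proof. by apply: isder_comb; exact: pD_isder. Qed.

Lemma pD1x : pD1 x = x. Proof. by rewrite /pD1 pDx mul1r. Qed.
Lemma pD1y : pD1 y = 0. Proof. by rewrite /pD1 pDy mul0r. Qed.
Lemma pD2x : pD2 x = 0. Proof. by rewrite /pD2 pDx mul0r. Qed.
Lemma pD2y : pD2 y = y. Proof. by rewrite /pD2 pDy mul1r. Qed.

Lemma der_vf F : isder F -> F =1 vf (F x / x) (F y / y).
Proof.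
move=> hF; apply: der_ext => //; first exact: vf_der.
  by rewrite /vf pD1x pD2x mulr0 addr0 divfK.
by rewrite /vf pD1y pD2y mulr0 add0r divfK.
Qed.

Lemma vf_x a b : vf a b x = a * x. Proof. by rewrite /vf pD1x pD2x mulr0 addr0. Qed.
Lemma vf_y a b : vf a b y = b * y. Proof. by rewrite /vf pD1y pD2y mulr0 add0r. Qed.

Lemma pD_comm u v u' v' g : pD u v (pD u' v' g) = pD u' v' (pD u v g).
Proof.
move: g; apply: (@plin_ext (pD u v \o pD u' v') (pD u' v' \o pD u v) (fun a => a ^+ p)).
- by move=> a b /=; rewrite !pD_add.
- by move=> a b /=; rewrite !pD_add.
- by move=> a b /=; rewrite !pD_pM.
- by move=> a b /=; rewrite !pD_pM.
move=> ij /=; rewrite /pmon !pD_mon !(derM (pD_isder _ _)) !(der_nat (pD_isder _ _)).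
by rewrite !mul0r !add0r -!(derM (pD_isder _ _)) !pD_mon; ring.
Qed.

Lemma natr_pX n : n%:R ^+ p = n%:R :> K.
Proof. by rewrite -(frobE hp) pFrobenius_aut_nat. Qed.

Lemma iter_pD_mon u v n (i j : nat) :
  iter n (pD u v) (x ^+ i * y ^+ j) = (u * i + v * j)%:R ^+ n * (x ^+ i * y ^+ j).
Proof.
elim: n => [|n IHn]; first by rewrite mul1r.
rewrite iterS IHn -natrX (der_nzl (pD_isder _ _)) pD_mon natrX exprS; ring.
Qed.

Lemma iter_pD u v : iter p (pD u v) =1 pD u v.
Proof.
apply: (@plin_ext _ _ (fun a => a ^+ p)).
- exact: iter_derD (pD_isder u v) p.
- exact: pD_add.
- move=> a g; have h n : iter n (pD u v) (a ^+ p * g) = a ^+ p * iter n (pD u v) g; last exact: h.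
  by elim: n => //= n ->; exact: pD_pM.
- exact: pD_pM.
- by move=> ij; rewrite /pmon iter_pD_mon natr_pX pD_mon.
Qed.

(** On g dlog x /\ dlog y this is the Cartier operator, read in the same logarithmic frame. *)
Definition ptr g := pco g (o, o).

Lemma ptrD : {morph ptr : g h / g + h}. Proof. by move=> g h; exact: pcoD. Qed.
Lemma ptr_pM a g : ptr (a ^+ p * g) = a * ptr g. Proof. exact: pco_pM. Qed.
Lemma ptr0 : ptr 0 = 0. Proof. by apply: (addrI (ptr 0)); rewrite -ptrD !addr0. Qed.
Lemma ptrN g : ptr (- g) = - ptr g.
Proof. by apply/eqP; rewrite -addr_eq0 -ptrD addNr ptr0. Qed.
Lemma ptrB g h : ptr (g - h) = ptr g - ptr h. Proof. by rewrite ptrD ptrN. Qed.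
Lemma ptr1 : ptr 1 = 1.
Proof. by have := pco_mon (o, o) (o, o); rewrite eqxx /pmon !expr0 mulr1. Qed.
Lemma ptr_pX a : ptr (a ^+ p) = a.
Proof. by rewrite -[X in ptr X]mulr1 ptr_pM ptr1 mulr1. Qed.

Lemma ptr_pD u v g : ptr (pD u v g) = 0.
Proof.
rewrite /ptr (pco_uniq (c := fun ij => (u * ij.1 + v * ij.2)%:R * pco g ij)).
  by rewrite /= !muln0 mul0r.
by rewrite /pD; apply: eq_bigr => ij _; rewrite exprMn natr_pX.
Qed.

(** A monomial other than 1 is, up to a nonzero integer factor, a derivative along x or y, so F
    vanishes on it. *)
Lemma ptr_char (F : K -> K) : {morph F : g h / g + h} -> (forall a g, F (a ^+ p * g) = a * F g) ->
  (forall g, F (pD1 g) = 0) -> (forall g, F (pD2 g) = 0) -> forall g, F g = ptr g * F 1.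
Proof.
move=> FD Fp F1 F2; apply: (@plin_ext _ _ id) => //.
- by move=> a b; rewrite ptrD mulrDl.
- by move=> a g; rewrite ptr_pM mulrA.
move=> ij; have F_nat n g : F (n%:R * g) = n%:R * F g.
  by rewrite -{1}(natr_pX n) Fp.
have [/eqP/[dup] e1 /eqP|n1] := eqVneq (ij.1%:R : K) 0; last first.
  have := F1 (pm ij); rewrite /pD1 /pmon pD_mon mul1n mul0n addn0 F_nat => /eqP.
  rewrite mulf_eq0 (negbTE n1) /= => /eqP ->; rewrite /ptr pco_mon.
  by case: eqP => [e|]; rewrite ?mul0r //; case/eqP: n1; rewrite -e.
have [/eqP/[dup] e2 /eqP|n2] := eqVneq (ij.2%:R : K) 0; last first.
  have := F2 (pm ij); rewrite /pD2 /pmon pD_mon mul0n mul1n add0n F_nat => /eqP.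
  rewrite mulf_eq0 (negbTE n2) /= => /eqP ->; rewrite /ptr pco_mon.
  by case: eqP => [e|]; rewrite ?mul0r //; case/eqP: n2; rewrite -e.
have z (i : 'I_p) : (i%:R : K) == 0 -> i = o.
  rewrite -(dvdn_pcharf hp) => d; apply: val_inj => /=.
  by case: (nat_of_ord i) (ltn_ord i) d => // n np /(dvdn_leq (ltn0Sn n)); rewrite leqNgt np.
rewrite [ij]surjective_pairing (z _ e1) (z _ e2) /ptr pco_mon eqxx mul1r.
by rewrite /pmon /= !expr0 mulr1.
Qed.

Lemma ptr_mon (m n : nat) : ~~ ((p %| m)%N && (p %| n)%N) -> ptr (x ^+ m * y ^+ n) = 0.
Proof.
pose ij : 'I_p * 'I_p := (Ordinal (ltn_pmod m (p_gt0 hp)), Ordinal (ltn_pmod n (p_gt0 hp))).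
have -> : x ^+ m * y ^+ n = (x ^+ (m %/ p) * y ^+ (n %/ p)) ^+ p * pm ij.
  by rewrite /pmon /= {1}(divn_eq m p) {1}(divn_eq n p) !exprD !exprM exprMn; ring.
rewrite ptr_pM /ptr pco_mon => h.
case: eqP => [[e1 e2]|]; rewrite ?mulr0 //; case/negP: h.
by rewrite /dvdn -e1 -e2 eqxx.
Qed.

Lemma ptr_divmon ij ij' : ptr (pm ij / pm ij') = (ij == ij')%:R.
Proof.
have [->|ne] := eqVneq ij ij'.
  by rewrite divff ?ptr1 // mulf_neq0 ?expf_neq0.
have -> : pm ij / pm ij' =
    ((x * y)^-1) ^+ p * (x ^+ (p + ij.1 - ij'.1) * y ^+ (p + ij.2 - ij'.2)).
  rewrite /pmon; have h (i j : 'I_p) (z : K) : z != 0 -> z ^+ (p + i - j) = z ^+ p * z ^+ i / z ^+ j.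
    move=> z0; apply: (mulIf (expf_neq0 j z0)); rewrite divfK ?expf_neq0 // -!exprD subnK //.
    by rewrite (leq_trans (ltnW (ltn_ord j))) // leq_addr.
  rewrite !h // exprVn exprMn; field; by rewrite !expf_neq0.
rewrite ptr_pM ptr_mon ?mulr0 //; apply: contra ne => /andP[].
have h (i j : 'I_p) : (p %| p + i - j)%N -> i = j.
  move=> d; apply: val_inj => /=; have := ltn_ord i; have := ltn_ord j => jp ip.
  have : (p %| p + i - j)%N by [].
  have e : (p + i - j = i - j + p \/ p + i - j = p - (j - i))%N by lia.
  case/dvdnP: d => q eq _; case: (q) eq => [|[|q']] eq; lia.
by move=> /h e1 /h e2; rewrite [ij]surjective_pairing e1 e2 -surjective_pairing.
Qed.

Lemma pco_ptr g ij : pco g ij = ptr (g / pm ij).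
Proof.
move: g; apply: (@plin_ext _ _ id).
- by move=> a b; rewrite pcoD.
- by move=> a b; rewrite mulrDl ptrD.
- by move=> a g; rewrite pco_pM.
- by move=> a g; rewrite -mulrA ptr_pM.
- by move=> ij'; rewrite pco_mon ptr_divmon eq_sym.
Qed.

Lemma ptr_nondeg a : (forall g, ptr (a * g) = 0) -> a = 0.
Proof.
move=> h; rewrite (pco_sum a) big1 // => ij _; rewrite pco_ptr h (frob0 hp) mul0r //.
Qed.

(** The monomials and their inverses are dual bases for the pairing [ptr (a * g)]. *)
Lemma ptr_repr (F : K -> K) : {morph F : g h / g + h} -> (forall a g, F (a ^+ p * g) = a * F g) ->
  exists c, forall g, F g = ptr (c * g).
Proof.
move=> FD Fp; exists (\sum_ij F (pm ij) ^+ p / pm ij).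
apply: (@plin_ext _ _ id) => //.
- by move=> a b; rewrite mulrDr ptrD.
- by move=> a g; rewrite mulrCA ptr_pM.
move=> ij; rewrite mulr_suml (bigD1 ij) //= ptrD divfK; last first.
  by rewrite mulf_neq0 ?expf_neq0.
rewrite ptr_pX -[LHS]addr0; congr (_ + _).
have : forall r : seq ('I_p * 'I_p), ptr (\sum_(l <- r | l != ij) F (pm l) ^+ p / pm l * pm ij) = 0.
  elim=> [|l r IH]; first by rewrite big_nil ptr0.
  rewrite big_cons; case: eqP => // ne; rewrite ptrD IH addr0 -mulrA ptr_pM (mulrC _^-1) ptr_divmon.
  by rewrite eq_sym; case: eqP ne => //; rewrite mulr0.
by move=> ->.
Qed.

End PCoord.

(** * Hochschild's formula and a p-linear twist of the p-th iterate *)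

Section Hochschild.

(* The operator [f Y] is expanded as a polynomial in [Y] with coefficients in K;
   these coefficients are computed in the model where Y is [xi + 'X] on K['X]. *)
Lemma hochschild (xi Y : K -> K) f y : isder xi -> {morph Y : g z / g + z} ->
  (forall g z, Y (g * z) = g * Y z + xi g * z) ->
  iter p.-1 (fun z => f * Y z) (f * y) =
  f ^+ p * iter p.-1 Y y + iter p.-1 (fun z => f * xi z) f * y.
Proof.
move=> hxi YD YM; have pp := pprime hp; have p1 := p_gt1 hp; have p0 := ltnW p1.
pose dp := map_poly xi; have hdp : isder dp by exact: dpoly_isder.
have dX : dp 'X = 0 by exact: dpolyX.
have dC a : dp a%:P = (xi a)%:P by exact: dpolyC.
pose A n := iter n (fun g : {poly K} => f%:P * (dp g + 'X * g)) f%:P.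
have sA n : (size (A n) <= n.+1)%N.
  elim: n => [|n IHn]; first exact: size_polyC_leq1.
  rewrite /A iterS -/(A n) mul_polyC (leq_trans (size_scale_leq _ _)) //.
  rewrite (leq_trans (size_polyD _ _)) // geq_max (leq_trans (size_poly _ _)) ?(leqW IHn) //=.
  by rewrite (leq_trans (size_polyMleq _ _)) // size_polyX add2n.
have exp n : iter n (fun z => f * Y z) (f * y) = \sum_(k < n.+1) (A n)`_k * iter k Y y.
  elim: n => [|n IHn]; first by rewrite big_ord1 coefC.
  rewrite iterS IHn; have Y0 : Y 0 = 0 by apply: (addrI (Y 0)); rewrite -YD !addr0.
  have YS (r : seq 'I_n.+1) (G : 'I_n.+1 -> K) : Y (\sum_(i <- r) G i) = \sum_(i <- r) Y (G i).
    by elim/big_rec2: _ => [|i a b _ <-] //; rewrite YD.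
  rewrite YS mulr_sumr; under eq_bigr => k _ do rewrite YM mulrDr.
  rewrite big_split /=.
  have cA k : (A n.+1)`_k = f * (xi (A n)`_k + (if k == 0%N then 0 else (A n)`_k.-1)).
    by rewrite /A iterS -/(A n) coefCM coefD (coef_dpoly hxi) coefXM.
  under [RHS]eq_bigr => k _ do rewrite cA mulrDr mulrDl.
  rewrite [RHS]big_split /= [X in _ = X + _]big_ord_recr /=.
  rewrite [(A n)`_n.+1]nth_default ?sA // (der0 hxi) mulr0 mul0r addr0.
  rewrite [X in _ = _ + X]big_ord_recl /= mulr0 mul0r add0r addrC; congr (_ + _).
    by apply: eq_bigr => k _; rewrite mulrA.
  by apply: eq_bigr => k _; rewrite mulrA.
(* Jacobson's formula for the derivation f xi and the function f 'X on polynomials: only the top and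
   the constant coefficient survive. *)
have eA : A p.-1 = (f ^+ p)%:P * 'X^(p.-1) + (iter p.-1 (fun z => f * xi z) f)%:P.
  have hfd : isder (fun g : {poly K} => f%:P * dp g) by exact: isder_scale.
  have hpp : p \in [pchar {poly K}] by rewrite pchar_poly.
  have X0 : 'X != 0 :> {poly K} by rewrite polyX_eq0.
  have := jacobson1 hpp hfd (f%:P * 'X); rewrite -[X in iter X _ 1](prednK p0) iterSr.
  rewrite (der1 hdp) mulr0 add0r mulr1.
  have -> n : iter n (fun g : {poly K} => f%:P * dp g + f%:P * 'X * g) (f%:P * 'X) = A n * 'X.
    elim: n => [//|n IHn]; rewrite iterS IHn /A iterS -/(A n) (derM hdp) dX.
    by ring.
  have -> n : iter n (fun g : {poly K} => f%:P * dp g) (f%:P * 'X) = (iter n (fun z => f * xi z) f)%:P * 'X.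
    elim: n => [//|n IHn]; rewrite !iterS IHn (derM hdp) dX mulr0 addr0.
    by rewrite dC mulrA -polyCM.
  rewrite exprMn -polyC_exp -{1}[in X in _ = X + _](prednK p0) => e.
  apply: (mulIf X0); rewrite e mulrDl; congr (_ + _).
  by rewrite prednK // -mulrA -exprSr prednK.
rewrite exp prednK // eA; under eq_bigr => k _ do rewrite coefD coefCM coefXn coefC mulrDl.
rewrite big_split /=; congr (_ + _).
  have lp : (p.-1 < p)%N by rewrite ltn_predL.
  rewrite (bigD1 (Ordinal lp)) //= eqxx mulr1 big1 ?addr0 // => k kp.
  by rewrite -(inj_eq val_inj) /= in kp; rewrite (negbTE kp) mulr0 mul0r.
rewrite (bigD1 (Ordinal p0)) //= big1 ?addr0 // => k k0.
by rewrite -(inj_eq val_inj) /= in k0; rewrite (negbTE k0) mul0r.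
Qed.

Lemma hochschild_der (xi : K -> K) f g : isder xi ->
  iter p (fun z => f * xi z) g = f ^+ p * iter p xi g + iter p.-1 (fun z => f * xi z) f * xi g.
Proof.
move=> hxi; have p0 := p_gt0 hp.
have -> : iter p (fun z => f * xi z) g = iter p.-1 (fun z => f * xi z) (f * xi g).
  by rewrite -[X in iter X _ g](prednK p0) iterSr.
rewrite (hochschild _ _ hxi (derD hxi)); first by rewrite -iterSr prednK.
by move=> a z; rewrite (derM hxi); ring.
Qed.

(* The adjoint of a derivation xi for [phi] is [- (xi + theta)]; for [phi] the
   trace attached to the Cartier operator, [theta] is the divergence of xi. *)
Definition twist (xi : K -> K) (theta g : K) :=
  iter p xi g - iter p.-1 (fun z => xi z + theta * z) 1 * xi g.

Lemma twist_der xi theta : isder xi -> isder (twist xi theta).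
Proof.
move=> hxi; have hi := isder_iter_p hp hxi; split=> x y.
  by rewrite /twist (derD hi) (derD hxi); ring.
by rewrite /twist (derM hi) (derM hxi); ring.
Qed.

(** Scaling xi by f changes its p-th iterate by a multiple of xi, and Hochschild's formula with Y =
    xi + theta changes the correction by the same multiple; the difference is p-linear. *)
Lemma twist_scale xi theta f g : isder xi ->
  twist (fun z => f * xi z) (f * theta + xi f) g = f ^+ p * twist xi theta g.
Proof.
move=> hxi; rewrite /twist (hochschild_der _ _ hxi).
have -> : iter p.-1 (fun z => f * xi z + (f * theta + xi f) * z) 1 * (f * xi g) =
  iter p.-1 (fun z => f * (xi z + theta * z)) (f * 1) * xi g.
  rewrite mulrA; congr (_ * _); elim: p.-1 => [|n IHn]; first by rewrite mulrC.
  by rewrite !iterS -IHn (derM hxi); ring.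
rewrite (hochschild (xi := xi) (Y := fun z => xi z + theta * z)) //; first by ring.
  by move=> a b; rewrite (derD hxi); ring.
by move=> a b; rewrite (derM hxi); ring.
Qed.

(** Multiplication by c conjugates xi + theta into xi + delta. The poles that dlog c brings into
    theta thus disappear after multiplication by c. *)
Lemma twist_conj xi theta delta c : isder xi -> c != 0 -> theta = delta + xi c / c ->
  forall g, c * twist xi theta g =
    c * iter p xi g - iter p.-1 (fun z => xi z + delta * z) c * xi g.
Proof.
move=> hxi c0 -> g; rewrite /twist mulrBr mulrA; congr (_ - _ * _).
elim: p.-1 => [|n IHn]; first by rewrite mulr1.
by rewrite !iterS -IHn (derM hxi); field.
Qed.

Lemma signp : (-1) ^+ p.-1 = 1 :> K.
Proof.
have p0 := p_gt0 hp; have e := frobN hp 1.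
have n0 : -1 != 0 :> K by rewrite oppr_eq0 oner_eq0.
apply: (mulfI n0).
by rewrite -exprS prednK // e expr1n mulr1.
Qed.

Lemma iter_dlog (xi : K -> K) g n : isder xi -> g != 0 ->
  iter n (fun f => xi f + xi g / g * f) 1 = iter n xi g / g.
Proof.
move=> hxi g0; elim: n => [|n IHn]; first by rewrite divff.
by rewrite !iterS IHn (der_div hxi) //; field.
Qed.

(** With u = xi g / g, Jacobson's formula gives u^p + xi^(p-1) u for the first term of the twist
    over g. By adjunction the second term cancels xi^(p-1) u under phi, the sign being (-1)^(p-1) =
    1 in K, and phi(u^p) = u. *)
Lemma twist_lift (phi : K -> K) xi theta g : {morph phi : a b / a + b} ->
  (forall a b, phi (a ^+ p * b) = a * phi b) -> phi 1 = 1 -> isder xi ->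
  (forall b, phi (xi b + theta * b) = 0) -> g != 0 ->
  phi (twist xi theta g / g) = xi g / g.
Proof.
move=> phiD phip phi1 hxi adj g0; have p0 := p_gt0 hp.
have phi0 : phi 0 = 0 by apply: (addrI (phi 0)); rewrite -phiD !addr0.
have phiN a : phi (- a) = - phi a by apply/eqP; rewrite -addr_eq0 -phiD addNr phi0.
pose Y z := xi z + theta * z; pose u := xi g / g.
have adj1 z w : phi (Y z * w) = - phi (z * xi w).
  apply/eqP; rewrite -addr_eq0 -phiD -(adj (z * w)); apply/eqP; congr phi.
  by rewrite /Y (derM hxi); ring.
have adjn n w z : phi (iter n Y z * w) = (-1) ^+ n * phi (z * iter n xi w).
  elim: n w => [|n IHn] w; first by rewrite mul1r.
  by rewrite iterS adj1 IHn iterSr exprS mulN1r mulNr.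
have e : iter p xi g / g = u ^+ p + iter p.-1 xi u by rewrite -iter_dlog // (jacobson1 hp hxi).
rewrite /twist mulrBl e phiD phiN -mulrA -/u adjn signp mul1r mul1r.
by rewrite phiD addrK -[u ^+ p]mulr1 phip phi1 mulr1.
Qed.

End Hochschild.

(** * Independence of the Cartier operator from the frame *)

Section CartierInvariance.
Variables (x y : K) (hb : pframe p hp x y).
Local Notation D1 := (pD1 hb).
Local Notation D2 := (pD2 hb).
Let hD1 := pD1_der hb.
Let hD2 := pD2_der hb.

Lemma pD12 g : D1 (D2 g) = D2 (D1 g). Proof. exact: pD_comm. Qed.

Lemma dlog_pth u v a : a != 0 -> let al := pD hb u v a / a in
  al = al ^+ p + iter p.-1 (pD hb u v) al.
Proof.
move=> a0 al; have hD := pD_isder hb u v.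
by rewrite -(jacobson1 hp hD) iter_dlog // iter_pD.
Qed.

Lemma dlog_comm a : a != 0 -> D1 (D2 a / a) = D2 (D1 a / a).
Proof. by move=> a0; rewrite (der_div hD1) // (der_div hD2) // pD12; ring. Qed.

(** dlog a differs from its p-th power, taken coordinatewise in the logarithmic frame, by an exact
    form. *)
Lemma dlog_potential a : a != 0 ->
  exists f, D1 f = D1 a / a - (D1 a / a) ^+ p /\ D2 f = D2 a / a - (D2 a / a) ^+ p.
Proof.
move=> a0; have p1 := p_gt1 hp; have [q eq] : exists q, p = q.+2 by exists p.-2; lia.
have e1 := dlog_pth 1 0 a0; have e2 := dlog_pth 0 1 a0; rewrite /= -/D1 -/D2 in e1 e2.
have dc := dlog_comm a0.
set a1 := D1 a / a in e1 dc *; set a2 := D2 a / a in e2 dc *.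
have ep : p.-1 = q.+1 by rewrite eq.
rewrite ep in e1 e2; pose h := iter q D2 a2.
(* In each direction, the (p-2)-th derivative of the coordinate is a potential. Since D1^p = D1, the
   values of 1 - D1^(p-1) are killed by D1, so the second summand corrects D2 without disturbing
   D1. *)
exists (iter q D1 a1 + (h - iter q.+1 D1 h)); split.
  rewrite (derD hD1) (derB hD1) -!iterS -eq /D1 iter_pD subrr addr0.
  by rewrite -/D1 {2}e1 addrAC subrr add0r.
have c2 n g : D2 (iter n D1 g) = iter n D1 (D2 g).
  by elim: n => //= n <-; rewrite pD12.
have iB : iter q.+1 D1 (a2 - a2 ^+ p) = iter q.+1 D1 a2.
  by rewrite 2!iterSr (derB hD1) der_pX // subr0.
have e2' : D2 h = a2 - a2 ^+ p by rewrite /h -iterS {2}e2 addrAC subrr add0r.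
by rewrite (derD hD2) (derB hD2) !c2 -dc -iterSr e2' iB addrC subrK.
Qed.

Definition dlogdet a b := D1 a / a * (D2 b / b) - D2 a / a * (D1 b / b).

(** The Cartier operator fixes dlog a /\ dlog b: with the potentials of [dlog_potential], the
    determinant is its own p-th power plus derivatives, and [ptr] kills derivatives. *)
Lemma cartier_dlog a b : a != 0 -> b != 0 -> ptr hb (dlogdet a b) = dlogdet a b.
Proof.
move=> a0 b0; have [f [f1 f2]] := dlog_potential a0; have [g [g1 g2]] := dlog_potential b0.
rewrite /dlogdet; set a1 := D1 a / a in f1 *; set a2 := D2 a / a in f2 *.
set b1 := D1 b / b in g1 *; set b2 := D2 b / b in g2 *.
clearbody a1 a2 b1 b2.
pose X1 := - (a2 ^+ p * g) + b2 ^+ p * f + f * D2 g.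
pose X2 := a1 ^+ p * g - b1 ^+ p * f - f * D1 g.
have e : a1 * b2 - a2 * b1 = (a1 * b2 - a2 * b1) ^+ p + D1 X1 + D2 X2.
  rewrite (frobB hp) !exprMn /X1 /X2 !(derD hD1) !(derB hD2) (derN hD1).
  rewrite !(der_pl hp hD1) !(der_pl hp hD2) (derM hD1) (derM hD2) pD12 f1 f2 g1 g2; ring.
by rewrite {1}e !ptrD ptr_pX /D1 /D2 /pD1 /pD2 !ptr_pD !addr0.
Qed.

End CartierInvariance.

Section FrameChange.
Variables (x y x' y' : K)
  (hb : pframe p hp x y)
  (hb' : pframe p hp x' y').
Local Notation D1 := (pD1 hb').
Local Notation D2 := (pD2 hb').
Let x0 : x != 0 := (pcoord_nz hb).1.
Let y0 : y != 0 := (pcoord_nz hb).2.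
Local Notation h := (dlogdet hb' x y).

Lemma frame_D1 g : h * pD1 hb g = vf hb' (D2 y / y) (- (D1 y / y)) g.
Proof.
apply: (der_ext hb (F := fun g => h * pD1 hb g) (G := vf hb' _ _)) => //.
- by apply: isder_scale; exact: pD1_der.
- exact: vf_der.
- by rewrite pD1x /vf /dlogdet; field; rewrite x0 y0.
- by rewrite pD1y /vf; field.
Qed.

Lemma frame_D2 g : h * pD2 hb g = vf hb' (- (D2 x / x)) (D1 x / x) g.
Proof.
apply: (der_ext hb (F := fun g => h * pD2 hb g) (G := vf hb' _ _)) => //.
- by apply: isder_scale; exact: pD2_der.
- exact: vf_der.
- by rewrite pD2x /vf; field.
- by rewrite pD2y /vf /dlogdet; field; rewrite x0 y0.
Qed.

Lemma frame_det_nz : h != 0.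
Proof.
apply/eqP => h0; have [x0' y0'] := pcoord_nz hb'.
have e1 := frame_D1; have e2 := frame_D2.
have nx : D1 x / x = 0.
  by apply: (mulIf y0'); rewrite mul0r -(vf_y hb' (- (D2 x / x))) -e2 h0 mul0r.
have ny : D1 y / y = 0.
  by apply: (mulIf y0'); apply: oppr_inj; rewrite mul0r oppr0 -mulNr -(vf_y hb' (D2 y / y)) -e1 h0 mul0r.
have : D1 x' = 0.
  have hz : isder (fun _ : K => 0 : K) by split=> [u v|u v] /=; rewrite ?mul0r ?mulr0 addr0.
  apply: (der_ext hb (F := D1) (G := fun=> 0)) => //; first exact: pD1_der.
    by rewrite -(divfK x0 (D1 x)) nx mul0r.
  by rewrite -(divfK y0 (D1 y)) ny mul0r.
by rewrite pD1x => e; rewrite e eqxx in x0'.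
Qed.

(** The right side vanishes on derivatives of the first frame, hence is a multiple of [ptr hb] by
    [ptr_char]; [cartier_dlog] fixes the multiple. *)
Lemma ptr_frame g : ptr hb g = h^-1 * ptr hb' (h * g).
Proof.
have h0 := frame_det_nz; pose F g := h^-1 * ptr hb' (h * g).
have F1 : F 1 = 1 by rewrite /F mulr1 cartier_dlog // mulVf.
have dc1 := dlog_comm hb' x0; have dc2 := dlog_comm hb' y0.
rewrite -[LHS]mulr1 -F1 -(ptr_char (F := F)) //.
- by move=> a b; rewrite /F mulrDr ptrD mulrDr.
- by move=> a b; rewrite /F mulrCA ptr_pM mulrCA.
- move=> a; rewrite /F frame_D1 /vf mulNr.
  have -> : D2 y / y * D1 a - D1 y / y * D2 a = D1 (D2 y / y * a) - D2 (D1 y / y * a).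
    by rewrite (derM (pD1_der _)) (derM (pD2_der _)) dc2; ring.
  by rewrite ptrB /pD1 /pD2 !ptr_pD subrr mulr0.
- move=> a; rewrite /F frame_D2 /vf mulNr.
  have -> : - (D2 x / x * D1 a) + D1 x / x * D2 a = D2 (D1 x / x * a) - D1 (D2 x / x * a).
    by rewrite (derM (pD1_der _)) (derM (pD2_der _)) dc1; ring.
  by rewrite ptrB /pD1 /pD2 !ptr_pD subrr mulr0.
Qed.

End FrameChange.

(** * Lifting derivations through a Frobenius splitting *)

Section FrobeniusLift.
Variables (phi : K -> K).
Hypotheses (phiD : {morph phi : a b / a + b}) (phip : forall a b, phi (a ^+ p * b) = a * phi b)
  (phi1 : phi 1 = 1).

Section Frame.
Variables (x y : K) (hb : pframe p hp x y).

Lemma phi_coef : exists c, forall g, phi g = ptr hb (c * g).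
Proof. exact: ptr_repr. Qed.

Variables (c : K) (hc : forall g, phi g = ptr hb (c * g)).

Lemma phi_coef_nz : c != 0.
Proof.
apply/eqP => c0; have := phi1; rewrite hc c0 mul0r ptr0 => /eqP.
by rewrite eq_sym oner_eq0.
Qed.

Lemma phi_nondeg a : (forall g, phi (a * g) = 0) -> a = 0.
Proof.
move=> h; have : c * a = 0 by apply: (ptr_nondeg (hb := hb)) => g; rewrite -mulrA -hc.
by move/eqP; rewrite mulf_eq0 (negbTE phi_coef_nz) => /eqP.
Qed.

Definition vdiv xi := pD1 hb (xi x / x) + pD2 hb (xi y / y).

(** xi(c g) plus the divergence of xi times c g is a sum of derivatives along the frame, which [ptr]
    kills. *)
Lemma phi_adjoint xi g : isder xi -> phi (xi g + (vdiv xi + xi c / c) * g) = 0.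
Proof.
move=> hxi; have c0 := phi_coef_nz; rewrite hc.
have -> : c * (xi g + (vdiv xi + xi c / c) * g) =
   pD1 hb (xi x / x * (c * g)) + pD2 hb (xi y / y * (c * g)).
  transitivity (xi (c * g) + vdiv xi * (c * g)); first by rewrite (derM hxi); field.
  rewrite (der_vf hb hxi (c * g)) /vf /vdiv (derM (pD1_der hb) (_ / _) (c * g)) (derM (pD2_der hb) (_ / _) (c * g)); ring.
by rewrite ptrD /pD1 /pD2 !ptr_pD addr0.
Qed.

End Frame.

Variables (x y : K) (hb : pframe p hp x y).

(** The adjunction with phi determines this function, so no frame enters the definition;
    [theta_frame] computes it in any frame. *)
Definition theta xi := xget 0 [set t | forall g, phi (xi g + t * g) = 0].

Lemma phiB a b : phi (a - b) = phi a - phi b.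
Proof.
have phi0 : phi 0 = 0 by apply: (addrI (phi 0)); rewrite -phiD !addr0.
by rewrite phiD; congr (_ + _); apply/eqP; rewrite -addr_eq0 -phiD addNr phi0.
Qed.

Lemma theta_uniq xi t : (forall g, phi (xi g + t * g) = 0) -> theta xi = t.
Proof.
move=> ht; apply: xget_unique => // t' ht'; have [c hc] := phi_coef hb.
apply/eqP; rewrite -subr_eq0; apply/eqP/(phi_nondeg hc) => g.
have -> : (t' - t) * g = (xi g + t' * g) - (xi g + t * g) by ring.
by rewrite phiB ht ht' subrr.
Qed.

Lemma theta_frame x' y' (hb' : pframe p hp x' y') c xi :
  (forall g, phi g = ptr hb' (c * g)) -> isder xi -> theta xi = vdiv hb' xi + xi c / c.
Proof. by move=> hc hxi; apply: theta_uniq => g; exact: phi_adjoint. Qed.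

Lemma thetaP xi g : isder xi -> phi (xi g + theta xi * g) = 0.
Proof.
by move=> hxi; have [c hc] := phi_coef hb; rewrite (theta_frame hc hxi) phi_adjoint.
Qed.

Lemma theta_scale f xi : isder xi -> theta (fun z => f * xi z) = f * theta xi + xi f.
Proof.
move=> hxi; apply: theta_uniq => g.
rewrite -(thetaP (f * g) hxi); congr phi; rewrite (derM hxi); ring.
Qed.

Definition flift xi := twist xi (theta xi).

Lemma flift_der xi : isder xi -> isder (flift xi).
Proof. exact: twist_der. Qed.

Lemma flift_scale f xi g : isder xi -> flift (fun z => f * xi z) g = f ^+ p * flift xi g.
Proof. by move=> hxi; rewrite /flift theta_scale // twist_scale. Qed.

Lemma fliftP xi g : isder xi -> g != 0 -> phi (flift xi g / g) = xi g / g.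
Proof. by move=> hxi g0; apply: (twist_lift) => // b; exact: thetaP. Qed.

(** c transforms as the coordinate of a section of the (1 - p)-th power of the canonical bundle; h
    is the ratio of the two volume forms. *)
Lemma phi_coef_frame x1 y1 (hb1 : pframe p hp x1 y1) c c1 :
  (forall g, phi g = ptr hb (c * g)) -> (forall g, phi g = ptr hb1 (c1 * g)) ->
  let h := dlogdet hb1 x y in c1 * h ^+ p = h * c.
Proof.
move=> hc hc1 h; have h0 : h != 0 := frame_det_nz hb hb1.
apply/eqP; rewrite -subr_eq0; apply/eqP.
have : c1 - c * h / h ^+ p = 0.
  apply: (ptr_nondeg (hb := hb1)) => g; rewrite mulrBl ptrB -hc1 hc (ptr_frame hb hb1) -/h.
  have -> : c * h / h ^+ p * g = h^-1 ^+ p * (h * (c * g)) by rewrite exprVn; ring.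
  by rewrite ptr_pM subrr.
by move=> /eqP; rewrite subr_eq0 => /eqP ->; rewrite divfK ?expf_neq0 // mulrC subrr.
Qed.

End FrobeniusLift.

Section PBasisDer.
Variables (O : set K) (x y : K)
  (hO : is_subring O) (hO' : pbasis hp O x y)
  (hb : pframe p hp x y).

Lemma pbasis_pco g ij : O g -> O (pco hb g ij).
Proof. by case: hO' => _ _ _ h Og; apply: h; rewrite -pco_sum. Qed.

Let Ox : O x. Proof. by case: hO'. Qed.
Let Oy : O y. Proof. by case: hO'. Qed.

Lemma pbasis_pD u v g : O g -> O (pD hb u v g).
Proof.
move=> Og; apply: sr_sum => // ij _; apply: srM => //.
  by apply: srM => //; [exact: sr_nat|apply: srX => //; exact: pbasis_pco].
by apply: srM => //; exact: srX.
Qed.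

Lemma pbasis_pD1x g : O g -> O (pD1 hb g / x).
Proof.
move=> Og; have [x0 y0] := pcoord_nz hb.
rewrite /pD1 /pD mulr_suml; apply: sr_sum => // -[i j] _ /=; rewrite mul1n mul0n addn0 /pmon /=.
case: i => -[|i] ip /=; first by rewrite !mul0r; exact: sr0.
have -> : i.+1%:R * pco hb g (Ordinal ip, j) ^+ p * (x ^+ i.+1 * y ^+ j) / x =
  i.+1%:R * pco hb g (Ordinal ip, j) ^+ p * (x ^+ i * y ^+ j) by rewrite exprS; field.
apply: srM => //; last by apply: srM => //; exact: srX.
by apply: srM => //; [exact: sr_nat|apply: srX => //; exact: pbasis_pco].
Qed.

Lemma pbasis_pD2y g : O g -> O (pD2 hb g / y).
Proof.
move=> Og; have [x0 y0] := pcoord_nz hb.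
rewrite /pD2 /pD mulr_suml; apply: sr_sum => // -[i j] _ /=; rewrite mul1n mul0n add0n /pmon /=.
case: j => -[|j] jp /=; first by rewrite !mul0r; exact: sr0.
have -> : j.+1%:R * pco hb g (i, Ordinal jp) ^+ p * (x ^+ i * y ^+ j.+1) / y =
  j.+1%:R * pco hb g (i, Ordinal jp) ^+ p * (x ^+ i * y ^+ j) by rewrite exprS; field.
apply: srM => //; last by apply: srM => //; exact: srX.
by apply: srM => //; [exact: sr_nat|apply: srX => //; exact: pbasis_pco].
Qed.

End PBasisDer.

(** * Orders of traces and of lifted derivations along a prime divisor *)

Section Regularity.
Variables (F : set K) (t s : K)
  (hF : dvr F t) (us : is_unit F s) (hpb : pbasis hp F t s)
  (hb : pframe p hp t s).
Let sF := dvr_sr hF.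
Let t0 := dvr_t0 hF.
Let Ft := dvr_t hF.
Let s0 : s != 0. Proof. by case: us. Qed.
Let Fs : F s. Proof. by case: us. Qed.
Let Fsi : F s^-1. Proof. by case: us. Qed.

Lemma unit_vgeM n g u : is_unit F u -> vge F n (g / u) <-> vge F n g.
Proof.
case=> u0 Fu Fui; split=> h; last by rewrite mulrC; exact: (vgeMl hF).
by rewrite -(divfK u0 g) mulrC; exact: (vgeMl hF).
Qed.

Lemma ptr_tM g : ptr hb (t * g) = t * pco hb g (rev_ord (ord_p0 hp), ord_p0 hp).
Proof.
rewrite pco_ptr -ptr_pM; congr (ptr hb _); rewrite /pmon /= expr0 mulr1 subn1.
by rewrite -{1}(prednK (p_gt0 hp)) exprS; field; rewrite expf_neq0.
Qed.

(** In a logarithmic frame the trace maps t F into t F, by [ptr_tM], so an order above n p becomes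
    an order above n. *)
Lemma ptr_vge m n g : n * p%:Z < m -> vge F m g -> vge F (n + 1) (ptr hb g).
Proof.
move=> nm hg; have : vge F (n * p%:Z + 1) g by apply: vge_le hg; rewrite lezD1.
move=> /(vgeP hF); set g' := g / _ => Fg'.
have -> : g = (t ^ n) ^+ p * (t * g').
  by rewrite /g' expfzDr // expr1z (exprnP (t ^ n)) exprz_exp; field; rewrite ?t0 ?expfz_neq0.
rewrite ptr_pM ptr_tM mulrA -[X in _ * X * _]expr1z -expfzDr //.
by apply/(vge_tz hF); exact: pbasis_pco.
Qed.

Lemma iter_ptr_vge (e : nat) m n g : n * (p ^ e)%N%:Z < m -> vge F m g ->
  vge F (n + 1) (iter e (ptr hb) g).
Proof.
elim: e m g => [|e IHe] m g; first by rewrite expn0 mulr1 => h; apply: vge_le; rewrite lezD1.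
move=> h hg; rewrite iterSr; apply: (IHe (n * (p ^ e)%N%:Z + 1)); first by rewrite ltrDl.
by apply: ptr_vge hg; rewrite -mulrA -PoszM -expnSr.
Qed.

(** The Frobenius coordinates of c / t^b are traces of its quotients by monomials. Those at
    monomials without t lie in F; those at t^i s^j with i > 0 do so after multiplication by t, and
    their terms have order at least i - p. *)
Lemma coef_vge c (b : nat) : (forall g, F g -> F (ptr hb (c / t ^+ b * g))) ->
  vge F (b%:Z + 1 - p%:Z) c.
Proof.
move=> h; set X := c / t ^+ b in h.
suff : vge F (1 - p%:Z) X.
  move=> hX; have -> : c = t ^ b * X by rewrite /X mulrC -exprnP divfK ?expf_neq0.
  rewrite -addrA; apply: (vgeM hF) => //; rewrite -[t ^ b]mulr1.
  by apply/(vge_tz hF); exact: sr1.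
have p1 := p_gt1 hp; rewrite (pco_sum hb X); apply: (vge_sum hF) => -[i j] _.
have Fsj : F (s ^- j) by rewrite -exprVn; exact: srX.
rewrite /pmon /=; case: i => -[|i] ip /=.
  apply: (@vge_le _ _ _ 0); first by lia.
  apply/(vge0P hF); rewrite expr0 mul1r; apply: srM => //; last exact: srX.
  by apply: srX => //; rewrite pco_ptr /pmon /= expr0 mul1r; exact: h.
have : F (t * pco hb X (Ordinal ip, j)).
  rewrite pco_ptr -ptr_pM /pmon /=.
  have -> : t ^+ p * (X / (t ^+ i.+1 * s ^+ j)) = X * (t ^+ (p - i.+1) * s ^- j).
    rewrite -{1}(subnK (ltnW ip)) exprD; field; by rewrite ?expf_neq0.
  by apply: h; apply: srM => //; exact: srX.
set q := pco hb X _ => Fq.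
have -> : q ^+ p * (t ^+ i.+1 * s ^+ j) = t ^ (1 - p%:Z) * ((t * q) ^+ p * t ^+ i * s ^+ j).
  rewrite expfzDr // expr1z -exprnN exprMn exprS; field; by rewrite expf_neq0.
by apply/(vge_tz hF); repeat (apply: srM => //; try exact: srX).
Qed.

Variables (phi : K -> K).
Hypotheses (phiD : {morph phi : a b / a + b}) (phip : forall a b, phi (a ^+ p * b) = a * phi b)
  (phi1 : phi 1 = 1).
Variables (c : K) (hc : forall g, phi g = ptr hb (c * g)).
Let c0 : c != 0 := phi_coef_nz phi1 hc.

Let flift_tz n xi g : isder xi ->
  flift phi xi g = t ^ (n * p%:Z) * flift phi (fun z => t ^ (- n) * xi z) g.
Proof.
move=> hxi; have hxi' : isder (fun z => t ^ (- n) * xi z) by exact: isder_scale.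
have -> : t ^ (n * p%:Z) = (t ^ n) ^+ p by rewrite exprnP exprz_exp.
rewrite -(flift_scale phiD phip phi1 hb (t ^ n) g hxi').
by congr (flift phi _ g); apply/funext => z; rewrite mulrA -expfzDr // subrr expr0z mul1r.
Qed.

(** xi divided by t^m preserves F and t F, hence so do its iterates, and p-linearity of [flift]
    restores the factor t^(m p). The factor c absorbs the poles of theta, by [twist_conj]. *)
Lemma flift_log m xi : isder xi -> F c -> vge F m (xi t / t) -> vge F m (xi s / s) ->
  vge F (m * p%:Z) (c * flift phi xi t / t) /\ vge F (m * p%:Z) (c * flift phi xi s / s).
Proof.
move=> hxi Fc h1 h2; pose xi0 z := t ^ (- m) * xi z.
have hx0 : isder xi0 by exact: isder_scale.
have fa : F (xi0 t / t).
  by move/(vgeP hF): h1; rewrite /xi0 -invr_expz mulrC mulrA.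
have fb : F (xi0 s / s).
  by move/(vgeP hF): h2; rewrite /xi0 -invr_expz mulrC mulrA.
have xF g : F g -> F (xi0 g).
  move=> Fg; rewrite (der_vf hb hx0 g).
  by apply: srD => //; apply: srM => //; apply: (pbasis_pD sF hpb).
have xtF g : F (g / t) -> F (xi0 g / t).
  move=> Fg; have -> : xi0 g / t = xi0 (g / t) + (g / t) * (xi0 t / t).
    by rewrite (der_div hx0) //; field.
  by apply: srD => //; [exact: xF|exact: srM].
have th : theta phi xi0 = vdiv hb xi0 + xi0 c / c by exact: (theta_frame phiD phip phi1 hb hc).
have Fd : F (vdiv hb xi0) by apply: srD => //; apply: (pbasis_pD sF hpb).
have key g : c * flift phi xi g = t ^ (m * p%:Z) * (c * iter p xi0 g -
    iter p.-1 (fun z => xi0 z + vdiv hb xi0 * z) c * xi0 g).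
  by rewrite (flift_tz m) // -(twist_conj hx0 c0 th g) mulrCA.
have Fi : F (iter p.-1 (fun z => xi0 z + vdiv hb xi0 * z) c).
  elim: p.-1 => //= n Fn; apply: srD => //; [exact: xF|exact: srM].
split; rewrite key -mulrA; apply/(vge_tz hF).
  set I0 := iter p.-1 _ c in Fi *; have -> : (c * iter p xi0 t - I0 * xi0 t) / t =
    c * (iter p xi0 t / t) - I0 * (xi0 t / t) by ring.
  apply: srB => //; apply: srM => //.
  by elim: (p) => [|n IHn] /=; [rewrite divff //; exact: sr1|exact: xtF].
apply: srM => //; apply: srB => //; apply: srM => //; last exact: xF.
by elim: (p) => //= n; exact: xF.
Qed.

(** Without a logarithmic pole the derivation that can be normalized is xi over t^(m+1), which
    preserves F but perhaps not t F; the surplus factor t^p is shared between c and the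
    conclusion. *)
Lemma flift_plain m xi : isder xi -> vge F (1 - p%:Z) c ->
  vge F m (xi t / t) -> vge F (m + 1) (xi s / s) ->
  vge F (m * p%:Z) (c * flift phi xi t / t) /\ vge F (m * p%:Z + 1) (c * flift phi xi s / s).
Proof.
move=> hxi hvc h1 h2; pose xi0 z := t ^ (- (m + 1)) * xi z.
have hx0 : isder xi0 by exact: isder_scale.
have fa : F (xi0 t).
  by move/(vgeP hF): h1; rewrite /xi0 -invr_expz expfzDr // expr1z invfM mulrC mulrA mulrAC.
have fb : F (xi0 s / s).
  by move/(vgeP hF): h2; rewrite /xi0 -invr_expz mulrC mulrA.
have xF g : F g -> F (xi0 g).
  move=> Fg; rewrite (der_vf hb hx0 g) /vf mulrAC -mulrA.
  apply: srD => //; apply: srM => //; first exact: (pbasis_pD1x sF hpb).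
  exact: (pbasis_pD sF hpb).
(* As p - 1 = -1 in K, the factor t^(p-1) turns the divergence for dlog t, dlog s into the one for
   dt, dlog s, which is regular; and c1 is regular because c has order at least 1 - p. *)
pose c1 := c * t ^+ p.-1; pose d := pD1 hb (xi0 t) / t + pD2 hb (xi0 s / s).
have c10 : c1 != 0 by rewrite mulf_neq0 ?expf_neq0.
have Fc1 : F c1.
  apply/(vge0P hF); have -> : 0 = 1 - p%:Z + p.-1%:Z by have := p_gt0 hp; lia.
  apply: (vgeM hF) => //; rewrite exprnP -[t ^ _]mulr1; apply/(vge_tz hF); exact: sr1.
have th : theta phi xi0 = d + xi0 c1 / c1.
  rewrite (theta_frame phiD phip phi1 hb hc) // /vdiv (der_div (pD1_der hb)) // pD1x.
  have -> : xi0 c1 / c1 = xi0 c / c - xi0 t / t.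
    rewrite /c1 dlogM ?expf_neq0 //; congr (_ + _); rewrite (derXn hx0).
    have -> : p.-1%:R = -1 :> K.
      by apply/eqP; rewrite -addr_eq0 natr1 (prednK (p_gt0 hp)) (pcharf0 hp).
    have p1 := p_gt1 hp; rewrite -{2}(prednK (n := p.-1)); last by lia.
    by rewrite exprS; field; rewrite t0 expf_neq0.
  by rewrite /d; field; rewrite ?t0 ?s0 ?c0.
have Fd : F d.
  by apply: srD => //; [exact: (pbasis_pD1x sF hpb)|exact: (pbasis_pD sF hpb)].
have key g : c * flift phi xi g = t ^ (m * p%:Z + 1) * (c1 * iter p xi0 g -
    iter p.-1 (fun z => xi0 z + d * z) c1 * xi0 g).
  rewrite (flift_tz (m + 1)) // -(twist_conj hx0 c10 th g) /c1.
  have -> : t ^ ((m + 1) * p%:Z) = t ^ (m * p%:Z + 1) * t ^+ p.-1.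
    rewrite exprnP -expfzDr //; congr (_ ^ _); have := p_gt0 hp; lia.
  by rewrite /flift -/xi0; ring.
have Fi : F (iter p.-1 (fun z => xi0 z + d * z) c1).
  elim: p.-1 => //= n Fn; apply: srD => //; [exact: xF|exact: srM].
have Fk g : F g -> F (c1 * iter p xi0 g - iter p.-1 (fun z => xi0 z + d * z) c1 * xi0 g).
  move=> Fg; apply: srB => //; apply: srM => //; last exact: xF.
  by elim: (p) => //= n; exact: xF.
split; rewrite key.
  have h z : t ^ (m * p%:Z + 1) * z / t = t ^ (m * p%:Z) * z.
    by rewrite expfzDr // expr1z; field.
  by rewrite h; apply/(vge_tz hF); exact: Fk.
by rewrite -mulrA; apply/(vge_tz hF); apply: srM => //; exact: Fk.
Qed.

End Regularity.

(** * Derivations with values in a vector space *)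

Section ModuleDer.
Implicit Types (W : lmodType K) (g h : K).

Definition wder W (d : K -> W) :=
  {morph d : g h / g + h} /\ forall g h, d (g * h) = g *: d h + h *: d g.

Lemma wderXn W (d : K -> W) g n : wder d -> d (g ^+ n) = (n%:R * g ^+ n.-1) *: d g.
Proof.
move=> [dD dM]; elim: n => [|n IHn].
  have := dM 1 1; rewrite mulr1 scale1r expr0 !mul0r scale0r => /eqP.
  by rewrite -subr_eq subrr eq_sym => /eqP.
rewrite exprS dM IHn scalerA -scalerDl; congr (_ *: _).
case: n {IHn} => [|n] /=; first by rewrite expr0; ring.
by rewrite exprS -!natr1; ring.
Qed.

Lemma wder_pl W (d : K -> W) g h : wder d -> d (g ^+ p * h) = g ^+ p *: d h.
Proof.
by move=> hd; rewrite hd.2 (wderXn _ _ hd) (pcharf0 hp) mul0r scale0r scaler0 addr0.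
Qed.

Lemma wder_frame (x y : K) (hb : pframe p hp x y) W (d : K -> W) g :
  wder d -> d g = pD1 hb g *: (x^-1 *: d x) + pD2 hb g *: (y^-1 *: d y).
Proof.
move=> hd; have [dD dM] := hd; have [x0 y0] := pcoord_nz hb.
have d0 : d 0 = 0 by apply: (addrI (d 0)); rewrite -dD !addr0.
rewrite [in LHS](pco_sum hb g) [in RHS](pco_sum hb g).
rewrite (der_sum (pD1_der hb)) (der_sum (pD2_der hb)) !scaler_suml -big_split /=.
rewrite (big_morph d dD d0); apply: eq_bigr => ij _.
rewrite (wder_pl _ _ hd) (der_pl hp (pD1_der hb)) (der_pl hp (pD2_der hb)).
rewrite /pmon dM !(wderXn _ _ hd) /pD1 /pD2 !pD_mon !scalerA scalerDr !scalerA addrC.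
rewrite !mul1n !mul0n add0n addn0.
have h (z : K) n : z != 0 -> n%:R * z ^+ n.-1 = n%:R * z ^+ n / z.
  by move=> z0; case: n => [|n]; rewrite ?mul0r // exprS /=; field.
by rewrite !h //; congr (_ *: _ + _ *: _); ring.
Qed.

End ModuleDer.

End FrobeniusFrames.

(** * Coordinates of differential forms *)

Section FormsOnSurfaces.
Context {k K : fieldType} (iota : {rmorphism k -> K}) (p : nat) (hp : p \in [pchar K])
  (hperf : pperfect p k).
Implicit Types (X S : set (set K)) (B D : set K -> rat) (C E F G O P : set K).

Section FormCoordinates.
Context {i : nat} {V : lmodType K} (dw : ('I_i -> K) -> V) (hV : Kaehler_forms iota dw).

(** k consists of p-th powers, which every derivation kills, so k-linearity is automatic. *)
Lemma derivation_wder (W : lmodType K) (d : K -> W) :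
  derivation iota setT (fun a (v : W) => a *: v) d <-> wder d.
Proof.
split=> [[dD dM _]|[dD dM]]; first by split=> g h; [exact: dD|exact: dM].
split=> [g h _ _|g h _ _|c]; [exact: dD|exact: dM|].
have [c' <-] := hperf c; rewrite rmorphXn (wderXn _ _ (conj dD dM)) (pcharf0 hp).
by rewrite mul0r scale0r.
Qed.

Lemma subst_self (b : 'I_i -> K) j : subst b j (b j) = b.
Proof. by apply/funext => l; rewrite /subst; case: eqP => // ->. Qed.

Lemma alt_lin (W : lmodType K) (u : {linear V -> W}) : alt_derivation iota (fun b => u (dw b)).
Proof.
have [[hd ha] _] := hV; split=> [b j|b j l jl e]; last by rewrite (ha b j l) ?linear0.
apply/derivation_wder; have /derivation_wder [dD dM] := hd b j.
split=> g h; first by rewrite dD linearD.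
by rewrite dM linearD !linearZ.
Qed.

Lemma forms_ext (W : lmodType K) (u u' : {linear V -> W}) :
  (forall b, u (dw b) = u' (dw b)) -> forall v, u v = u' v.
Proof. by have [_ /(_ _ _ (alt_lin u)) [_]] := hV; apply. Qed.

Lemma det_alt (D : 'I_i -> K -> K) : (forall l, isder (D l)) ->
  alt_derivation (V := K^o) iota (fun b => \det (\matrix_(m, l) D l (b m))).
Proof.
move=> hD; split=> [b j|b j l jl e]; last first.
  by apply: (determinant_alternate jl) => m; rewrite !mxE e.
pose M z := \matrix_(m, l) D l (subst b j z m) : 'M[K]_i.
have rowM z : row j (M z) = \row_l D l z by apply/rowP => l; rewrite !mxE /subst eqxx.
have rowM' z z' : row' j (M z) = row' j (M z').
  by apply/matrixP => m l; rewrite !mxE /subst eq_sym (negbTE (neq_lift _ _)).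
apply/derivation_wder; split=> g h.
  rewrite -[RHS](congr2 +%R (mul1r _) (mul1r _)).
  apply: (determinant_multilinear (i0 := j)) => //; try exact: rowM'.
  by rewrite !rowM; apply/rowP => l; rewrite !mxE (derD (hD l)) !mul1r.
apply: (determinant_multilinear (i0 := j)) => //; try exact: rowM'.
by rewrite !rowM; apply/rowP => l; rewrite !mxE (derM (hD l)); ring.
Qed.

Section Frame.
Variables (x y : K) (hb : pframe p hp x y).
Let x0 : x != 0 := (pcoord_nz hb).1.
Let y0 : y != 0 := (pcoord_nz hb).2.

Definition frD (l : 'I_2) : K -> K := if l == ord0 then pD1 hb else pD2 hb.
Definition frx (l : 'I_2) := if l == ord0 then x else y.

Lemma frD_der l : isder (frD l).
Proof. by rewrite /frD; case: ifP => _; exact: pD_isder. Qed.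

Lemma frx_nz l : frx l != 0. Proof. by rewrite /frx; case: ifP. Qed.

Lemma frD_frx l m : frD l (frx m) = (l == m)%:R * frx m.
Proof.
rewrite /frD /frx; case: l => -[|[|//]] ?; case: m => -[|[|//]] ? /=;
  by rewrite ?pD1x ?pD1y ?pD2x ?pD2y ?mul1r ?mul0r.
Qed.

Lemma lam_exists (a : 'I_i -> 'I_2) : exists u : {linear V -> K^o},
  forall b, u (dw b) = \det (\matrix_(m, l) frD (a l) (b m)).
Proof.
by have [_ /(_ _ _ (det_alt (fun l => frD_der (a l)))) [hu _]] := hV.
Qed.

(** The coordinate at the wedge product of the dlog's selected by a: the universal property applied
    to a minor of logarithmic derivatives. *)
Definition lam a : {linear V -> K^o} := sval (cid (lam_exists a)).

Lemma lamE a b : lam a (dw b) = \det (\matrix_(m, l) frD (a l) (b m)).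
Proof. by rewrite /lam; case: cid. Qed.

Lemma dw_wder b j : wder (fun z => dw (subst b j z)).
Proof. by apply/derivation_wder; case: hV => -[]. Qed.

Definition frw (a : 'I_i -> 'I_2) : V := (\prod_l (frx (a l))^-1) *: dw (fun l => frx (a l)).

(** The instances below take for A the increasing multi-indices in two variables, none in degree
    above two, so that one notation serves all degrees. *)
Definition reconstructs n (A : 'I_n -> 'I_i -> 'I_2) :=
  forall w, w = \sum_j lam (A j) w *: frw (A j).

Lemma reconstructs_dw n (A : 'I_n -> 'I_i -> 'I_2) :
  (forall b, dw b = \sum_j lam (A j) (dw b) *: frw (A j)) -> reconstructs A.
Proof.
move=> h; pose u w := \sum_j lam (A j) w *: frw (A j).
have lu : linear u.
  move=> c v w; rewrite /u scaler_sumr -big_split /=; apply: eq_bigr => j _.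
  have -> : lam (A j) (c *: v + w) = c * lam (A j) v + lam (A j) w by rewrite linearP.
  rewrite [LHS]scalerDl; congr (_ + _); exact: (esym (scalerA c (lam (A j) v : K) _)).
pose U : {linear V -> V} := HB.pack u (GRing.isLinear.Build K V V _ u lu).
exact: (forms_ext (u := idfun) (u' := U)).
Qed.

Lemma dw_frame b j : dw b = \sum_m frD m (b j) *: ((frx m)^-1 *: dw (subst b j (frx m))).
Proof.
rewrite -[in LHS](subst_self b j) (wder_frame hb _ (dw_wder b j)).
by rewrite !big_ord_recl big_ord0 addr0.
Qed.

Lemma subst_comm (b : 'I_i -> K) j l g h : j != l -> subst (subst b j g) l h = subst (subst b l h) j g.
Proof.
move=> jl; apply/funext => m; rewrite /subst; case: eqP => [->|_] //.
by rewrite eq_sym (negbTE jl).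
Qed.

Lemma dw_same b j l g : j != l -> dw (subst (subst b j g) l g) = 0.
Proof.
case: hV => -[_ ha] _ jl; apply: (ha _ j l) => //.
by rewrite /subst !eqxx; case: ifP.
Qed.

Lemma dw_skew b j l g h : j != l ->
  dw (subst (subst b j g) l h) = - dw (subst (subst b j h) l g).
Proof.
move=> jl; apply/eqP; rewrite -addr_eq0; apply/eqP.
have := dw_same b (g + h) jl; rewrite (dw_wder _ _).1 !(subst_comm _ _ _ jl) !(dw_wder _ _).1.
rewrite -!(subst_comm _ _ _ jl) !dw_same // add0r addr0.
by rewrite addrC.
Qed.

Lemma dw_zero b j : (forall m, dw (subst b j (frx m)) = 0) -> dw b = 0.
Proof. by move=> h; rewrite (dw_frame b j) big1 // => m _; rewrite h !scaler0. Qed.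

Section Stalks.

(** The coordinate is a determinant whose rows are scaled by g and columns by u; every scaled entry
    lies in O. *)
Lemma lam_log_generator (u : 'I_2 -> K) O S a w : is_subring O ->
  (forall l g, O g -> O (u l * frD l g)) ->
  (forall l C c, S C -> local_equation O C c -> O (u l * frD l c / c)) ->
  log_generator dw S O w -> O (\prod_l u (a l) * lam a w).
Proof.
move=> hO h1 h2 [b [g [hg ->]]]; rewrite linearZ /= lamE.
pose M := \matrix_(m, l) (g m * (u (a l) * frD (a l) (b m))) : 'M[K]_i.
have -> : \prod_l u (a l) * ((\prod_j g j) * \det (\matrix_(m, l) frD (a l) (b m))) = \det M.
  have -> : M = diag_mx (\row_m g m) *m (\matrix_(m, l) frD (a l) (b m)) *m diag_mx (\row_l u (a l)).
    by apply/matrixP => m l; rewrite mul_mx_diag mul_diag_mx !mxE; ring.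
  have d1 (v : 'I_i -> K) : \det (diag_mx (\row_m v m)) = \prod_m v m.
    by rewrite det_diag; apply: eq_bigr => m _; rewrite mxE.
  by rewrite !det_mulmx !d1; ring.
rewrite /determinant; apply: sr_sum => // s _; apply: srM => //.
  by case: (perm.odd_perm s); rewrite ?expr1 ?expr0; [apply: srN => //|]; exact: sr1.
apply: sr_prod => // m _; rewrite mxE; have [[-> Ob]|[-> [C SC hC]]] := hg m.
  by rewrite mul1r; exact: h1.
by rewrite mulrC; exact: h2 hC.
Qed.

Lemma dstalk_prime (X : set (set K)) (D : set K -> rat) F g : prime_divisor X F ->
  (divisor_stalk X D F g <-> vge F (- Num.floor (D F)) g).
Proof.
move=> [XF FT Fmax]; rewrite /vge lerNl -subr_ge0 opprK; split=> [[->|h]|[->|h]]; [by left|right|by left|right].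
  by rewrite addrC; exact: (h F).
move=> E [XE ET _] FE; have [->|//] := Fmax E XE FE.
by rewrite addrC.
Qed.

Lemma log_form_stalk_vge (X : set (set K)) (D : set K -> rat) F t S (u : 'I_2 -> K) a w :
  prime_divisor X F -> dvr F t ->
  (forall l g, F g -> F (u l * frD l g)) ->
  (forall l C c, S C -> local_equation F C c -> F (u l * frD l c / c)) ->
  log_form_stalk dw X S D F w -> vge F (- Num.floor (D F)) (\prod_l u (a l) * lam a w).
Proof.
move=> pF hF h1 h2 [n [h [g [hg ->]]]]; rewrite linear_sum mulr_sumr.
apply: (vge_sum hF) => j _; rewrite linearZ /= mulrCA; have [hj gj] := hg j.
rewrite mulrC; apply: (vgeMl hF); last by apply/(dstalk_prime D _ pF).
exact (lam_log_generator _ (dvr_sr hF) h1 h2 gj).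
Qed.

Lemma frame_log_form_stalk (X : set (set K)) (D : set K -> rat) P S (e : 'I_2 -> bool)
    n (A : 'I_n -> 'I_i -> 'I_2) w :
  reconstructs A -> P x -> P y ->
  (forall l, e l -> exists2 C, S C & local_equation P C (frx l)) ->
  (forall j, divisor_stalk X D P
     ((\prod_l (if e (A j l) then 1 else (frx (A j l))^-1)) * lam (A j) w)) ->
  log_form_stalk dw X S D P w.
Proof.
move=> hA Px Py he hw; pose v (a : 'I_i -> 'I_2) := \prod_l (if e (a l) then 1 else (frx (a l))^-1).
exists n, (fun j => v (A j) * lam (A j) w).
exists (fun j => (\prod_l (if e (A j l) then (frx (A j l))^-1 else 1)) *: dw (fun l => frx (A j l))).
split.
  move=> j; split; first exact: hw.
  exists (fun l => frx (A j l)), (fun l => if e (A j l) then (frx (A j l))^-1 else 1); split=> // l.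
  have Pf m : P (frx m) by rewrite /frx; case: ifP.
  by case: (boolP (e (A j l))) => [/he h|_]; [right|left].
rewrite [LHS]hA; apply: eq_bigr => j _; rewrite /frw !scalerA; congr (_ *: _).
rewrite [v _ * _]mulrC -mulrA; congr (_ * _); rewrite /v -big_split /=; apply: eq_bigr => l _.
by case: ifP; rewrite ?mul1r ?mulr1.
Qed.

End Stalks.
End Frame.
End FormCoordinates.

Section Reconstruction.
Variables (x y : K) (hb : pframe p hp x y).

Lemma reconstruct0 V dw (hV : @Kaehler_forms _ _ iota 0 V dw) :
  reconstructs hV hb (fun (_ : 'I_1) _ => ord0).
Proof.
apply: reconstructs_dw => b.
rewrite big_ord1 lamE det_mx00 /frw big_ord0 !scale1r; congr dw.
by apply/funext => -[].
Qed.

Lemma reconstruct1 V dw (hV : @Kaehler_forms _ _ iota 1 V dw) :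
  reconstructs hV hb (fun (j : 'I_2) _ => j).
Proof.
apply: reconstructs_dw => b.
rewrite [LHS](dw_frame hV hb b ord0); apply: eq_bigr => m _.
rewrite lamE det_mx11 mxE /frw big_ord1; congr (_ *: (_ *: dw _)).
by apply/funext => l; rewrite /subst ord1 eqxx.
Qed.

Lemma reconstruct2 V dw (hV : @Kaehler_forms _ _ iota 2 V dw) :
  reconstructs hV hb (fun (_ : 'I_1) l => l).
Proof.
apply: reconstructs_dw => b.
pose o1 : 'I_2 := lift ord0 ord0.
have e2 (G : 'I_2 -> V) : \sum_m G m = G ord0 + G o1.
  by rewrite !big_ord_recl big_ord0 addr0.
have n01 : (ord0 : 'I_2) != o1 by [].
have b1 z : subst b ord0 z o1 = b o1 by [].
have sb u v : subst (subst b ord0 u) o1 v = fun l => if l == ord0 then u else v.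
  by apply/funext => -[[|[|//]] ?].
rewrite big_ord1 [LHS](dw_frame hV hb b ord0) e2.
rewrite !(dw_frame hV hb (subst b ord0 _) o1) !e2 !b1 !(dw_same hV) ?scaler0 ?add0r ?addr0 //.
rewrite (dw_skew hV _ (frx x y o1)) //.
have -> : subst (subst b ord0 (frx x y ord0)) o1 (frx x y o1) = frx x y.
  by rewrite sb; apply/funext.
rewrite /frw lamE.
have -> : \det (\matrix_(m, l) frD hb l (b m)) =
   frD hb ord0 (b ord0) * frD hb o1 (b o1) - frD hb o1 (b ord0) * frD hb ord0 (b o1).
  by rewrite (expand_det_row _ ord0) !big_ord_recl big_ord0 /cofactor !det_mx11 !mxE /=; ring.
rewrite !big_ord_recl big_ord0 mulr1 -/o1 !scalerN !scalerA -scalerBl; congr (_ *: _).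
by ring.
Qed.

Lemma reconstruct3 i V dw (hV : @Kaehler_forms _ _ iota i.+3 V dw) :
  reconstructs hV hb (fun (_ : 'I_0) _ => ord0).
Proof.
apply: reconstructs_dw => b; rewrite big_ord0.
pose j0 : 'I_i.+3 := ord0; pose j1 : 'I_i.+3 := lift ord0 ord0.
pose j2 : 'I_i.+3 := lift ord0 (lift ord0 ord0).
apply: (dw_zero hV hb (j := j0)) => m0; apply: (dw_zero hV hb (j := j1)) => m1.
apply: (dw_zero hV hb (j := j2)) => m2; have [[_ ha] _] := hV.
have [e|n01] := eqVneq m0 m1; first by apply: (ha _ j0 j1); rewrite // /subst /= e.
have [e|n02] := eqVneq m0 m2; first by apply: (ha _ j0 j2); rewrite // /subst /= e.
have [e|n12] := eqVneq m1 m2; first by apply: (ha _ j1 j2); rewrite // /subst /= e.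
by move: n01 n02 n12; case: m0 => -[|[|//]] ?; case: m1 => -[|[|//]] ?; case: m2 => -[|[|//]] ?.
Qed.

End Reconstruction.

(** * Finiteness of the divisor of a function *)

Section OrdFinite.

(** What orders along divisors need of normality. By [smooth_divisorial] it holds on the resolution
    too, so X, Y and Z are treated alike. *)
Definition divisorial X := variety iota X /\ forall E, prime_divisor X E -> exists t, dvr E t.

Lemma normal_divisorial X : normal_variety iota X -> divisorial X.
Proof. by move=> hX; split=> [|E pE]; [case: hX|exact: (normal_prime_divisor hX pE)]. Qed.

Lemma loc_all A q (d : K) : is_subring A -> prime_ideal A q -> q d -> d != 0 ->
  localization A q <> setT.
Proof.
move=> hA hq qd d0 e; have : localization A q d^-1 by rewrite e.
have /(loc_midealI hA hq (prime_sub hq qd)) [_ nu] := qd.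
by move=> h; apply: nu; split=> //; apply: loc_sub => //; exact: prime_sub qd.
Qed.

(** On a chart g = a / b, and a divisor where g has nonzero order comes from a prime containing a b.
    It contains a minimal prime over (a b), and codimension one makes the two localizations
    equal. *)
Lemma ord_finite X g : divisorial X -> g != 0 ->
  finite_set [set E | prime_divisor X E /\ ord E g != 0].
Proof.
move=> [hX hd] g0; have [S [cS covS]] := charts_finite hX.
pose T s := [set E | exists q, [/\ prime_ideal (kgen iota s) q, E = localization (kgen iota s) q,
  prime_divisor X E & ord E g != 0]].
have finT s : s \in S -> finite_set (T s).
  move=> sS; have cs := cS s sS; have hA := kgen_sr iota s; have nA : noeth (kgen iota s) := @kgen_noeth _ _ iota s.
  have [a [b [Aa Ab b0 eg]]] := cs.1 g.
  have a0 : a != 0 by apply: contraNneq g0 => a0; rewrite eg a0 mul0r.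
  have [M [finM hM minM]] := finite_min_primes hA nA (principalI hA (srM hA Aa Ab)).
  apply: (sub_finite_set (B := (fun q => localization (kgen iota s) q) @` M)); last exact: finite_image.
  move=> E [q [hq eE pE oE]]; have [t hE] := hd E pE.
  have qab : q (a * b).
    apply: contrapT => nq; move/eqP: oE; apply.
    have na : ~ q a by move=> qa; apply: nq; rewrite mulrC; exact: (primeMl hq).
    have nb : ~ q b by move=> qb; apply: nq; exact: (primeMl hq).
    have ua : is_unit E a by rewrite eE; split=> //; [exact: loc_sub|exact: loc_inv].
    have ub : is_unit E b by rewrite eE; split=> //; [exact: loc_sub|exact: loc_inv].
    rewrite eg (ordM hE) ?invr_eq0 // (ordV hE) //.
    by move: ua ub => /(ord_unit hE) [_ ->] /(ord_unit hE) [_ ->].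
  have [|q' Mq' q'q] := minM q hq.
    by move=> _ [c Ac ->]; rewrite mulrC; exact: (primeMl hq).
  have [hq' q'ab] := hM q' Mq'.
  have q'd : q' (a * b) by apply: q'ab; exists 1; [exact: sr1|rewrite mulr1].
  exists q' => //; have [XE ET Emax] := pE.
  have [||//|e] := Emax (localization (kgen iota s) q'); first exact: cs.2.
    by rewrite eE => _ [c [d [Ac Ad nd ->]]]; exists c, d; split=> // /q'q.
  by case: (loc_all hA hq' q'd (mulf_neq0 a0 b0)).
apply: (sub_finite_set (B := \bigcup_(s in [set` S]) T s)).
  move=> E [pE oE]; have [XE _ _] := pE; have [s sS [q hq eq]] := covS E XE.
  by exists s => //; exists q.
by apply: bigcup_finite => [|s /= sS]; [exact: finite_seq|exact: finT].
Qed.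

Lemma prime_separate X P E F : variety iota X -> X P -> prime_divisor X E -> prime_divisor X F ->
  P `<=` E -> P `<=` F -> E <> F -> exists d, [/\ P d, mideal E d & ~ mideal F d].
Proof.
move=> hX XP [XE ET _] [XF _ Fmax] PE PF EF; apply: contrapT => no.
have [hE eE] := point_sub hX XP XE PE; have [hF eF] := point_sub hX XP XF PF.
have FE : F `<=` E.
  rewrite eF eE => _ [a [b [Pa Pb nb ->]]]; exists a, b; split=> // -[mb _]; apply: nb.
  by split=> //; apply: contrapT => nm; apply: no; exists b.
by have [|] := Fmax E XE FE.
Qed.

(** For each G in the divisor of g, a power of an element vanishing on G but not on F is spent. *)
Lemma pole_clear X P F g : divisorial X -> X P -> prime_divisor X F -> P `<=` F ->
  exists d, [/\ P d, is_unit F d &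
    forall G, prime_divisor X G -> P `<=` G -> G <> F -> G (d * g)].
Proof.
move=> dX XP pF PF; have [hX hd] := dX; have [hP _] := point_local hX XP.
have [->|g0] := eqVneq g 0.
  have [XF _ _] := pF; exists 1; split; [exact: sr1|exact: (unit1 (point_sr hX XF))|].
  by move=> G [XG _ _] _ _; rewrite mulr0; apply: sr0; exact: (point_sr hX XG).
have /finite_seqP [s es] := ord_finite dX g0.
have [tF hF] := hd F pF; have sF := dvr_sr hF.
have /choice [d hdd] : forall G, exists d, [/\ P d, is_unit F d &
    prime_divisor X G -> P `<=` G -> G <> F -> mideal G d].
  move=> G; have [[pG PG GF]|no] := pselect [/\ prime_divisor X G, P `<=` G & G <> F]; last first.
    exists 1; split; [exact: sr1|exact: unit1|by move=> a b c; case: no].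
  have [e [Pe mG nF]] := prime_separate hX XP pG pF PG PF GF; exists e; split=> //.
  by have [|//] := unitVm (PF e Pe).
exists (\prod_(G <- s) d G ^+ `|ord G g|); split.
- by apply: sr_prod => // G _; apply: srX => //; case: (hdd G).
- elim: (s) => [|G r IH]; first by rewrite big_nil; exact: unit1.
  by rewrite big_cons; apply: unitM => //; apply: unitX => //; case: (hdd G).
move=> G pG PG GF; have [t hG] := hd G pG; have sG := dvr_sr hG.
have [og|og] := eqVneq (ord G g) 0.
  apply: srM => //; last by apply/(ord_ge0 hG); rewrite // og.
  by apply: sr_prod => // H _; apply: srX => //; apply: PG; case: (hdd H).
have Gs : G \in s by have : [set` s] G by rewrite -es.
rewrite (big_rem G) //= -mulrA mulrCA; apply: srM => //.
  by apply: sr_prod => // H _; apply: srX => //; apply: PG; case: (hdd H).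
have [Pd [d0 _ _] /(_ pG PG GF) mG] := hdd G.
apply/(ord_ge0 hG); first by rewrite mulf_neq0 ?expf_neq0.
rewrite (ordM hG) ?expf_neq0 // (ordX hG) //.
have /(vge1P hG) [/eqP|] := mG; first by rewrite (negbTE d0).
move=> o1; have : `|ord G g|%N%:Z <= ord G (d G) *+ `|ord G g|%N by rewrite -mulr_natr natz; nia.
lia.
Qed.

End OrdFinite.

(** * Extending a Frobenius splitting to the function field *)

Section FPure.

(** Every g enters L after multiplication by some d^p with d in P, so the splitting extends to K. At
    F, [pole_clear] allows d to be a unit of F, whence the value lies in F. *)
Lemma fpure_extend X B P : divisorial X -> effective B -> F_pure p X B -> closed_point X P ->
  exists phi : K -> K, [/\ {morph phi : a b / a + b}, forall a b, phi (a ^+ p * b) = a * phi b,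
    phi 1 = 1 & forall F g, prime_divisor X F -> P `<=` F ->
      vge F (- Num.floor ((p - 1)%N%:R * B F)) g -> F (phi g)].
Proof.
move=> dX effB hF cP; have [hX hd] := dX; have XP := cP.1; have [hP _] := point_local hX XP.
have := hF P 1%N cP isT; rewrite /= expn1; set L := divisor_stalk _ _ _.
move=> [ph [phP phD phM ph1]].
have fB E : 0 <= Num.floor ((p - 1)%N%:R * B E).
  by rewrite floor_ge0 mulr_ge0 ?ler0n.
have LE g : L g <-> forall E, prime_divisor X E -> P `<=` E ->
    vge E (- Num.floor ((p - 1)%N%:R * B E)) g.
  split=> [[-> E _ _|h E pE PE]|h]; first by left.
    by right; rewrite -subr_ge0 opprK; exact: h.
  have [->|g0] := eqVneq g 0; first by left.
  right=> E pE PE; have [/eqP|] := h E pE PE; first by rewrite (negbTE g0).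
  by rewrite -subr_ge0 opprK.
have PL a : P a -> L a.
  move=> Pa; apply/LE => E pE PE; have [t hE] := hd E pE.
  by apply: (@vge_le _ _ _ 0); [rewrite oppr_le0|apply/(vge0P hE); exact: PE].
have LD g h : L g -> L h -> L (g + h).
  move=> /LE Lg /LE Lh; apply/LE => E pE PE; have [t hE] := hd E pE.
  by apply: (vgeD hE); [exact: Lg|exact: Lh].
have LM a g : P a -> L g -> L (a * g).
  move=> Pa /LE Lg; apply/LE => E pE PE; have [t hE] := hd E pE.
  by apply: (vgeMl hE); [exact: PE|exact: Lg].
have p0 := p_gt0 hp.
have /choice [d hdd] : forall g, exists d, [/\ P d, d != 0 & L (d ^+ p * g)].
  move=> g; have [a [b [Pa Pb b0 ->]]] := point_frac hX XP g; exists b; split=> //.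
  apply: PL; have -> : b ^+ p * (a / b) = b ^+ p.-1 * a.
    by rewrite -{1}(prednK p0) exprS; field.
  by apply: srM => //; exact: srX.
pose phi g := ph (d g ^+ p * g) / d g.
have phiE g e : P e -> e != 0 -> L (e ^+ p * g) -> phi g = ph (e ^+ p * g) / e.
  move=> Pe e0 Le; have [Pd d0 Ld] := hdd g; rewrite /phi.
  apply/eqP; rewrite eqr_div // mulrC -(phM _ _ Pe Ld) [_ * d g]mulrC -(phM _ _ Pd Le).
  by apply/eqP; congr ph; ring.
exists phi; split.
- move=> g h; have [Pd d0 Ld] := hdd g; have [Pe e0 Le] := hdd h.
  have L1 : L ((d g * d h) ^+ p * g).
    by rewrite exprMn -mulrA mulrCA; apply: LM => //; exact: srX.
  have L2 : L ((d g * d h) ^+ p * h).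
    by rewrite exprMn -mulrA; apply: LM => //; exact: srX.
  have Pde : P (d g * d h) by exact: srM.
  have de0 : d g * d h != 0 by exact: mulf_neq0.
  rewrite (phiE _ _ Pde de0 L1) (phiE _ _ Pde de0 L2) (phiE _ (d g * d h)) // ?mulrDr ?phD ?mulrDl //.
  exact: LD.
- move=> a b; have [Pd d0 Ld] := hdd b; have [u [v [Pu Pv v0 ->]]] := point_frac hX XP a.
  have Pvd : P (v * d b) by exact: srM.
  have vd0 : v * d b != 0 by exact: mulf_neq0.
  have e : (v * d b) ^+ p * ((u / v) ^+ p * b) = u ^+ p * (d b ^+ p * b).
    by rewrite !exprMn exprVn; field; rewrite expf_neq0.
  rewrite (phiE _ (v * d b)) // e; last by apply: LM => //; exact: srX.
  by rewrite phM // (phiE b (d b)) //; field; rewrite v0 d0.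
- have P1 : P 1 by exact: sr1.
  have e : phi 1 = ph (1 ^+ p * 1) / 1.
    by apply: phiE; rewrite ?oner_neq0 // expr1n mulr1; exact: PL.
  by rewrite e mulr1 ph1 // divr1.
- move=> F g pF PF hg; have [e [Pe uF he]] := pole_clear g dX XP pF PF.
  have [e0 Fe Fei] := uF; have [t hFt] := hd F pF; have sF := dvr_sr hFt.
  have Le : L (e ^+ p * g).
    apply/LE => G pG PG; have [tG hG] := hd G pG; have sG := dvr_sr hG.
    have [->|/eqP GF] := eqVneq G F; first by apply: (vgeMl hFt) => //; exact: srX.
    apply: (@vge_le _ _ _ 0); first by rewrite oppr_le0.
    apply/(vge0P hG); rewrite -(prednK p0) exprSr -mulrA; apply: srM => //; last exact: he.
    by apply: srX => //; exact: PG.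
  by rewrite (phiE g e) //; apply: srM => //; apply: PF; exact: phP.
Qed.

End FPure.

(** * Stalks of log forms at a prime divisor *)

Section PrimeFrame.
Variables (X S : set (set K)) (F : set K) (t s : K) (pF : prime_divisor X F) (hF : dvr F t)
  (us : is_unit F s) (hpb : pbasis hp F t s) (hS : S `<=` prime_divisor X)
  (hb : pframe p hp t s).
Let sF := dvr_sr hF.

Definition fre (l : 'I_2) := (l == ord0) && `[< S F >].
(** The passage from logarithmic coordinates to those of a basis of the log stalk: dlog t at a
    component of S and dt elsewhere, and ds in both cases. *)
Definition fru l := if fre l then 1 else (frx t s l)^-1.

Lemma fru_frD l g : F g -> F (fru l * frD hb l g).
Proof.
move=> Fg; rewrite /fru /fre /frx /frD; case: (l == ord0) => /=.
  case: ifP => _; first by rewrite mul1r; exact: (pbasis_pD sF hpb).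
  by rewrite mulrC; exact: (pbasis_pD1x sF hpb).
by rewrite mulrC; exact: (pbasis_pD2y sF hpb).
Qed.

Lemma comp_prime C : S C -> F `<=` C -> C = F.
Proof. by move=> /hS [XC CT _]; case: pF => _ _ h FC; have [] := h C XC FC. Qed.

Lemma fru_dlog l C c : S C -> local_equation F C c -> F (fru l * frD hb l c / c).
Proof.
move=> SC [FC]; have t0 := dvr_t0 hF; rewrite (comp_prime SC FC) /ideal_at => ec.
have [[_ sn0] [_ Fs Fsi]] := (pcoord_nz hb, us).
have mc : mideal F c.
  have : (F `&` mideal F) c by rewrite ec; exists 1; [exact: sr1|rewrite mulr1].
  by case.
have [w Fw ew] : principal F t c by rewrite -(dvr_mideal hF).
have [w' Fw' ew'] : principal F c t by rewrite -ec; split; [exact: dvr_t hF|exact: dvr_mt hF].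
have w0 : w != 0 by apply: contraNneq t0 => w0; rewrite ew' ew w0 mulr0 mul0r.
have wi : w^-1 = w'.
  have e1 : w * w' = 1 by apply: (mulfI t0); rewrite mulrA -ew -ew' mulr1.
  by apply: (mulfI w0); rewrite mulfV.
have -> : fru l * frD hb l c / c = fru l * (l == ord0)%:R + fru l * frD hb l w * w'.
  rewrite ew (derM (frD_der hb l)) -wi.
  have -> : frD hb l t = (l == ord0)%:R * t by rewrite -(frD_frx hb l ord0).
  by field; rewrite t0 w0.
apply: srD => //; last by apply: srM => //; exact: fru_frD.
rewrite /fru /fre; case: (l == ord0); rewrite ?mulr0 /=; last exact: sr0.
have -> : `[< S F >] by apply/asboolP; rewrite -(comp_prime SC FC).
by rewrite mulr1; exact: sr1.
Qed.

Lemma prime_stalkP i V dw (hV : @Kaehler_forms _ _ iota i V dw)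
    (D : set K -> rat) n (A : 'I_n -> 'I_i -> 'I_2) w :
  reconstructs hV hb A ->
  (log_form_stalk dw X S D F w <->
   forall j, vge F (- Num.floor (D F)) ((\prod_l fru (A j l)) * lam hV hb (A j) w)).
Proof.
move=> hA; split=> [h j|h].
  by apply: (log_form_stalk_vge hV (A j) pF hF fru_frD _ h) => l C c SC; exact: fru_dlog.
apply: (frame_log_form_stalk (e := fre) hA) => [| |l|j].
- exact: dvr_t hF.
- by case: us.
- move=> /andP[/eqP -> /asboolP SF]; exists F => //; split=> //.
  have eF : F `&` mideal F = mideal F.
    by apply/seteqP; split=> z; [case|move=> mz; split=> //; exact: midealW mz].
  by rewrite /ideal_at eF (dvr_mideal hF).
- by apply/(dstalk_prime _ _ pF); exact: h.
Qed.

End PrimeFrame.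

(** * The inverse Cartier lift of forms *)

Section Sigma.
Variables (phi : K -> K) (phiD : {morph phi : a b / a + b})
  (phip : forall a b, phi (a ^+ p * b) = a * phi b) (phi1 : phi 1 = 1).
Variables (x y : K) (hb : pframe p hp x y).
Variables (X S : set (set K)) (hS : S `<=` prime_divisor X).

(** The last condition says that phi, as a section of the (1 - p)-th power of the log canonical
    sheaf of (X, S), is regular at F; s is a unit and needs no factor. *)
Definition adapted F t s := [/\ prime_divisor X F, dvr F t, is_unit F s, pbasis hp F t s &
  forall (hb' : pframe p hp t s) c,
    (forall g, phi g = ptr hb' (c * g)) -> F (c / fru S F t s ord0 ^+ p.-1)].

Definition lifts i V dw (hV : @Kaehler_forms _ _ iota i V dw)
    n (A : 'I_n -> 'I_i -> 'I_2) (sigma : V -> V) :=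
  (forall j w, lam hV hb (A j) w = ptr hb (lam hV hb (A j) (sigma w))) /\
  forall F t s (D : set K -> int) w, adapted F t s ->
    log_form_stalk dw X S (fun E => (D E)%:~R) F w ->
    log_form_stalk dw X S (fun E => (D E * p%:Z)%:~R) F (sigma w).

Let x0 : x != 0 := (pcoord_nz hb).1.
Let y0 : y != 0 := (pcoord_nz hb).2.

Lemma vge_exp F t n (z : K) (m : nat) : dvr F t -> vge F n z -> vge F (n * m%:Z) (z ^+ m).
Proof.
move=> hF h; elim: m => [|m IH]; first by rewrite mulr0 expr0; apply/(vge0P hF); exact: sr1 (dvr_sr hF).
by rewrite exprS; have -> : n * m.+1%:Z = n + n * m%:Z; [lia|exact: (vgeM hF)].
Qed.

Lemma det2 (M : 'M[K]_2) :
  \det M = M ord0 ord0 * M (lift ord0 ord0) (lift ord0 ord0) - M ord0 (lift ord0 ord0) * M (lift ord0 ord0) ord0.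
Proof.
rewrite (expand_det_row _ ord0) !big_ord_recl big_ord0 /cofactor !det_mx11 !mxE /=.
have -> : lift (lift ord0 ord0) ord0 = ord0 :> 'I_2 by exact: val_inj.
by ring.
Qed.

Lemma sigma0 V dw (hV : @Kaehler_forms _ _ iota 0 V dw) :
  exists sigma, lifts hV (fun (_ : 'I_1) _ => ord0) sigma.
Proof.
pose a0 : 'I_0 -> 'I_2 := fun=> ord0.
have lam0 x' y' (hb' : pframe p hp x' y') z :
    lam hV hb' a0 (z *: frw dw x y a0) = z.
  by rewrite /frw big_ord0 scale1r linearZ /= lamE det_mx00; exact: mulr1.
have lamF x' y' (hb' : pframe p hp x' y') w :
    lam hV hb' a0 w = lam hV hb a0 w.
  by rewrite {1}(reconstruct0 hb hV w) big_ord1 lam0.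
exists (fun w => (lam hV hb a0 w) ^+ p *: frw dw x y a0); split=> [j w|F t s D w].
  by rewrite lam0 ptr_pX.
move=> [pF hF us hpb _]; have [hb' _ _ _] := hpb; have R := reconstruct0 hb' hV.
move=> /(prime_stalkP pF hF us hpb hS _ _ R) h; apply/(prime_stalkP pF hF us hpb hS _ _ R) => j.
have := h j; rewrite !big_ord0 !mul1r !intrKfloor lamF lam0 -mulNr.
exact: (vge_exp _ hF).
Qed.

(** The p-th power of w times the section c of the (1 - p)-th power of the canonical bundle is again
    a top form, independent of the frame by [phi_coef_frame]. *)
Lemma sigma2 V dw (hV : @Kaehler_forms _ _ iota 2 V dw) :
  exists sigma, lifts hV (fun (_ : 'I_1) l => l) sigma.
Proof.
have [c hc] := phi_coef phiD phip hb.
have lamw x' y' (hb' : pframe p hp x' y') z :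
    lam hV hb' id (z *: frw dw x y id) = z * dlogdet hb' x y.
  rewrite linearZ /= linearZ /= lamE det2 !mxE /= !big_ord_recl big_ord0 /frx /frD /= /dlogdet.
  rewrite mulr1 /GRing.scale /=; by field; rewrite x0 y0.
have lamF x' y' (hb' : pframe p hp x' y') w :
    lam hV hb' id w = lam hV hb id w * dlogdet hb' x y.
  by rewrite {1}(reconstruct2 hb hV w) big_ord1 lamw.
have d1 : dlogdet hb x y = 1.
  by rewrite /dlogdet pD1x pD2y pD2x mul0r mul0r subr0 !divff // mulr1.
exists (fun w => (c * lam hV hb id w ^+ p) *: frw dw x y id); split=> [j w|F t s D w].
  by rewrite lamw d1 mulr1 mulrC ptr_pM -[c]mulr1 -hc phi1 mulr1.
move=> [pF hF us hpb hcF]; have [hb' _ _ _] := hpb; have R := reconstruct2 hb' hV.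
have [c' hc'] := phi_coef phiD phip hb'; have Fc := hcF hb' c' hc'.
have eh := phi_coef_frame hc hc'; rewrite /= in eh.
move=> /(prime_stalkP pF hF us hpb hS _ _ R) h; apply/(prime_stalkP pF hF us hpb hS _ _ R) => j.
have := h j; rewrite !intrKfloor lamw !big_ord_recl big_ord0 mulr1 -mulNr => hw.
set z := lam hV hb id w in hw *; set v := fru S F t s ord0 in Fc hw *.
have v0 : v != 0.
  by rewrite /v /fru; case: ifP => _; rewrite ?oner_neq0 // invr_eq0 (frx_nz hb').
have e1 : fru S F t s (lift ord0 ord0) = s^-1 by [].
rewrite e1 in hw *; rewrite lamF -/z in hw.
set d := dlogdet hb' x y in eh hw *.
have -> : v * s^-1 * (c * z ^+ p * d) = (c' / v ^+ p.-1) * (v * (z * d)) ^+ p / s.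
  have -> : (v * (z * d)) ^+ p = v * v ^+ p.-1 * (z ^+ p * d ^+ p).
    by rewrite -exprS (prednK (p_gt0 hp)) !exprMn.
  have -> : c * z ^+ p * d = z ^+ p * (d * c) by ring.
  by rewrite -eh; field; rewrite expf_neq0 // (pcoord_nz hb').2.
apply/(unit_vgeM hF _ _ us); apply: (vgeMl hF) => //; apply: (vge_exp _ hF).
by apply/(unit_vgeM hF _ _ us); rewrite mulrAC.
Qed.

(** w corresponds to the derivation xi with xi g = dg /\ w over dlog x /\ dlog y, and c times
    [flift] of xi corresponds to the lifted form. By [fliftP] at x and at y, the trace returns both
    coordinates of w. *)
Lemma sigma1 V dw (hV : @Kaehler_forms _ _ iota 1 V dw) :
  exists sigma, lifts hV (fun (j : 'I_2) _ => j) sigma.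
Proof.
have [c hc] := phi_coef phiD phip hb; pose o1 : 'I_2 := lift ord0 ord0.
pose A (j : 'I_2) (_ : 'I_1) := j.
have lamw x' y' (hb' : pframe p hp x' y') j m :
    lam hV hb' (A j) (frw dw x y (A m)) = frD hb' j (frx x y m) / frx x y m.
  by rewrite linearZ /= lamE det_mx11 mxE big_ord1 mulrC.
pose xi x' y' (hb' : pframe p hp x' y') w :=
  vf hb' (lam hV hb' (A o1) w) (- lam hV hb' (A ord0) w).
have hxi x' y' (hb' : pframe p hp x' y') w : isder (xi _ _ hb' w).
  exact: vf_der.
have L x' y' (hb' : pframe p hp x' y') j v1 v2 z1 z2 :
    lam hV hb' (A j) (z1 *: v1 + z2 *: v2) =
    z1 * lam hV hb' (A j) v1 + z2 * lam hV hb' (A j) v2.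
  by rewrite linearD !linearZ.
have lamF x' y' (hb' : pframe p hp x' y') j w :
    lam hV hb' (A j) w = lam hV hb (A ord0) w * (frD hb' j x / x) +
      lam hV hb (A o1) w * (frD hb' j y / y).
  have rw : w = lam hV hb (A ord0) w *: frw dw x y (A ord0) +
      lam hV hb (A o1) w *: frw dw x y (A o1).
    by rewrite {1}(reconstruct1 hb hV w) !big_ord_recl big_ord0 addr0.
  by rewrite {1}rw L !lamw.
have xiF x' y' (hb' : pframe p hp x' y') w :
    xi _ _ hb' w = fun g => dlogdet hb' x y * xi _ _ hb w g.
  apply/funext => g; rewrite /xi [in RHS]/vf mulrDr !(mulrCA (dlogdet _ _ _)) frame_D1 frame_D2.
  by rewrite (lamF _ _ hb' o1) (lamF _ _ hb' ord0) /vf /frD /=; ring.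
pose sg w := (- (c * flift p phi (xi _ _ hb w) y / y)) *: frw dw x y (A ord0) +
   (c * flift p phi (xi _ _ hb w) x / x) *: frw dw x y (A o1).
have lams w : lam hV hb (A ord0) (sg w) = - (c * flift p phi (xi _ _ hb w) y / y) /\
    lam hV hb (A o1) (sg w) = c * flift p phi (xi _ _ hb w) x / x.
  rewrite /sg !L !lamw /frD /frx /= pD1x pD2x pD1y pD2y !mul0r !divff //.
  by rewrite !mulr0 !mulr1 addr0 add0r.
have hfl w : isder (fun g => c * flift p phi (xi _ _ hb w) g).
  by apply: isder_scale; exact: flift_der.
have xis w : xi _ _ hb (sg w) = fun g => c * flift p phi (xi _ _ hb w) g.
  apply/funext => g; rewrite (der_vf hb (hfl w)) /xi.
  by have [-> ->] := lams w; rewrite opprK.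
exists sg; split=> [j w|F t s D w].
  have key z : z != 0 -> ptr hb (c * flift p phi (xi _ _ hb w) z / z) = xi _ _ hb w z / z.
    by move=> z0; rewrite -mulrA -hc (fliftP phiD phip phi1 hb).
  case: (eqVneq j ord0) => [->|j1].
    by rewrite (lams w).1 ptrN key // /xi vf_y mulfK // opprK.
  have -> : j = o1 by case: j j1 => -[|[|//]] ? // _; exact: val_inj.
  by rewrite (lams w).2 key // /xi vf_x mulfK.
move=> [pF hF us hpb hcF]; have [hb' _ _ _] := hpb; have R := reconstruct1 hb' hV.
have [c' hc'] := phi_coef phiD phip hb'; have Fc := hcF hb' c' hc'.
have eh := phi_coef_frame hc hc'; rewrite /= in eh.
have [t0 s0] := pcoord_nz hb'.
(* As h c = c' h^p, p-linearity of [flift] gives the lift by the same formula in the frame adapted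
   to F. *)
have xis' : xi _ _ hb' (sg w) = fun g => c' * flift p phi (xi _ _ hb' w) g.
  rewrite (xiF _ _ hb' (sg w)) xis (xiF _ _ hb' w); apply/funext => g.
  by rewrite (flift_scale phiD phip phi1 hb _ _ (hxi _ _ hb w)) !mulrA eh.
have co w' : lam hV hb' (A o1) w' = xi _ _ hb' w' t / t /\
    lam hV hb' (A ord0) w' = - (xi _ _ hb' w' s / s).
  by rewrite /xi vf_x vf_y !mulfK ?opprK.
move=> /(prime_stalkP pF hF us hpb hS _ _ R) h; apply/(prime_stalkP pF hF us hpb hS _ _ R).
have := h ord0; have := h o1; rewrite !intrKfloor !big_ord1 -/(A o1) -/(A ord0).
rewrite (co w).1 (co w).2 mulrN -!mulNr.
set n := - D F => h1 h0.
have {}h1 : vge F n (xi _ _ hb' w t / t).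
  by apply/(unit_vgeM hF _ _ us); rewrite mulrC.
have two j : j = ord0 \/ j = o1.
  by case: j => -[|[|//]] ?; [left|right]; exact: val_inj.
have suff_res : vge F (n * p%:Z) (fru S F t s ord0 * (c' * flift p phi (xi _ _ hb' w) s / s)) ->
   vge F (n * p%:Z) (c' * flift p phi (xi _ _ hb' w) t / t) ->
   forall j, vge F (- (D F * p%:Z)) ((\prod_(l < 1) fru S F t s j) * lam hV hb' (A j) (sg w)).
  move=> r1 r2 j; rewrite big_ord1 -mulNr -/n; have [->|->] := two j.
    by rewrite (co _).2 xis' mulrN; apply: (vgeN hF).
  by rewrite (co _).1 xis' [fru _ _ _ _ o1 * _]mulrC; apply/(unit_vgeM hF _ _ us).
have vt m z : vge F m (t^-1 * z) <-> vge F (m + 1) z.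
  rewrite !(vgeP hF); have -> // : z / t ^ (m + 1) = t^-1 * z / t ^ m.
  by rewrite expfzDr // expr1z; field; rewrite t0 expfz_neq0.
have [r1 r2] : vge F (n * p%:Z) (fru S F t s ord0 * (c' * flift p phi (xi _ _ hb' w) s / s)) /\
   vge F (n * p%:Z) (c' * flift p phi (xi _ _ hb' w) t / t).
  move: h0 Fc; rewrite /fru /fre eqxx /=; case: ifP => e.
    rewrite expr1n divr1 !mul1r mulNr mul1r => /(vgeN hF); rewrite opprK => h0 Fc.
    by have [] := flift_log hF us hpb phiD phip phi1 hc' (hxi _ _ hb' w) Fc h1 h0.
  rewrite exprVn invrK mulNr => /(vgeN hF); rewrite opprK => /vt h0 Fc.
  have Fc1 : vge F (1 - p%:Z) c'.
    rewrite (vgeP hF); have -> : c' / t ^ (1 - p%:Z) = c' * t ^+ p.-1; last by [].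
    congr (_ * _); rewrite invr_expz opprB; have -> : p%:Z - 1 = p.-1%:Z by have := p_gt0 hp; lia.
    by [].
  have [r2 r1] := flift_plain hF us hpb phiD phip phi1 hc' (hxi _ _ hb' w) Fc1 h1 h0.
  by split=> //; apply/vt.
by move=> j; rewrite /n mulNr; exact: suff_res r1 r2 j.
Qed.

Lemma sigma3 i V dw (hV : @Kaehler_forms _ _ iota i.+3 V dw) :
  exists sigma, lifts hV (fun (_ : 'I_0) _ => ord0) sigma.
Proof.
exists id; split=> [[]//|F t s D w [pF hF us hpb hcF] _]; have [hb' _ _ _] := hpb.
by apply/(prime_stalkP pF hF us hpb hS _ _ (reconstruct3 hb' hV)) => -[].
Qed.

Lemma sigma_exists i V dw (hV : @Kaehler_forms _ _ iota i V dw) :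
  exists n (A : 'I_n -> 'I_i -> 'I_2) sigma, reconstructs hV hb A /\ lifts hV A sigma.
Proof.
case: i V dw hV => [|[|[|i]]] V dw hV.
- have [s hs] := sigma0 hV; exists 1%N, (fun _ _ => ord0), s; split=> //; exact: reconstruct0.
- have [s hs] := sigma1 hV; exists 2%N, (fun j _ => j), s; split=> //; exact: reconstruct1.
- have [s hs] := sigma2 hV; exists 1%N, (fun _ l => l), s; split=> //; exact: reconstruct2.
- have [s hs] := sigma3 hV; exists 0%N, (fun _ _ => ord0), s; split=> //; exact: reconstruct3.
Qed.

End Sigma.

(** * The pole estimate at a divisor over X *)

Section Core.

Lemma prime_adapted X F : divisorial X -> pdegree hp 2 -> prime_divisor X F ->
  exists t s, [/\ dvr F t, is_unit F s & pbasis hp F t s].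
Proof.
move=> [hX hd] hdeg pF; have [t hF] := hd F pF; have [XF _ _] := pF.
have [s us hs] := dvr_pbasis hF (pfin_point hp hperf hX XF) hdeg.
by exists t, s.
Qed.

(** phi is regular on functions with poles up to (p - 1) B. At a component of floor B this allows p
    - 1 poles, so [coef_vge] makes c regular; elsewhere c has order at least 1 - p, which t^(p-1)
    compensates. *)
Lemma phi_adapted X B P phi F t s : effective B -> prime_divisor X F -> dvr F t -> is_unit F s ->
  pbasis hp F t s ->
  (forall a b, phi (a ^+ p * b) = a * phi b) ->
  (forall F g, prime_divisor X F -> P `<=` F ->
      vge F (- Num.floor ((p - 1)%N%:R * B F)) g -> F (phi g)) ->
  P `<=` F -> adapted phi X (floor_components X B) F t s.
Proof.
move=> effB pF hF us hpb phip hphi PF; split=> // hb c hc.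
have t0 := dvr_t0 hF; have sF := dvr_sr hF; have p1 := p_gt1 hp.
pose b := Num.floor ((p - 1)%N%:R * B F).
have b0 : 0 <= b by rewrite /b floor_ge0 mulr_ge0 ?ler0n.
have hv : vge F (`|b|%N%:Z + 1 - p%:Z) c.
  apply: (coef_vge hF us (hb := hb)) => g Fg.
  have -> : c / t ^+ `|b|%N * g = c * (g / t ^+ `|b|%N) by rewrite mulrAC mulrA.
  rewrite -hc; apply: hphi => //; apply/(vgeP hF).
  have e : g / t ^+ `|b|%N / t ^ (- b) = g.
    by rewrite exprnP gez0_abs // -invr_expz invrK divfK // expfz_neq0.
  by rewrite -/b e.
rewrite gez0_abs // in hv; rewrite /fru /fre /frx /=.
have [SF|nS] := pselect (floor_components X B F).
  rewrite asboolT //= expr1n divr1; apply/(vge0P hF); apply: vge_le hv.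
  have B1 : 1 <= B F.
    have [_ f0] := SF; have : 0 <= Num.floor (B F) by rewrite floor_ge0 effB.
    by rewrite le_eqVlt eq_sym (negbTE f0) /= gtz0_ge1 floor_ge_int.
  have : (p - 1)%N%:Z <= b.
    by rewrite floor_ge_int -[X in X <= _]mulr1; apply: ler_wpM2l => //; rewrite ler0n.
  by rewrite -subzn ?(ltnW p1) // => ?; lia.
rewrite asboolF //=; have -> : c / t^-1 ^+ p.-1 = c / t ^ (1 - p%:Z).
  rewrite exprVn invrK -opprB -invr_expz invrK; congr (c * _).
  by rewrite exprnP -subn1 -subzn ?(ltnW p1).
by apply/(vgeP hF); apply: vge_le hv; rewrite -addrA lerDr.
Qed.

(** The frame belongs to E, not to the divisors through P. M0 clears its denominators on a chart,
    and one further factor for each component of floor B absorbs dc / c. M does not depend on the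
    number of lifts, so its order becomes negligible after division by p^e. *)
Lemma multiplier X B P x y (hb : pframe p hp x y) :
  divisorial X -> X P -> Qdivisor X B ->
  exists M, [/\ P M, M != 0 &
    forall F, prime_divisor X F -> P `<=` F ->
      (forall l g, F g -> F (M * frD hb l g)) /\
      (forall l C c, floor_components X B C -> local_equation F C c -> F (M * frD hb l c / c))].
Proof.
move=> [hX hd] XP [finB _]; have [hP _] := point_local hX XP.
have [s [q [cs hq eP]]] := point_chart hX XP; have hA := kgen_sr iota s.
have /choice [d hdd] : forall y, exists d, [/\ kgen iota s d, d != 0 &
    forall l, kgen iota s (d * frD hb l y)].
  move=> z; have [a [b [Aa Ab b0 e1]]] := cs.1 (frD hb ord0 z).
  have [a' [b' [Aa' Ab' b0' e2]]] := cs.1 (frD hb (lift ord0 ord0) z).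
  exists (b * b'); split; [exact: (srM hA Ab Ab')|exact: mulf_neq0|].
  have h0 : kgen iota s (b * b' * frD hb ord0 z).
    by rewrite e1; have -> : b * b' * (a / b) = b' * a; [by field|exact: (srM hA Ab' Aa)].
  have h1 : kgen iota s (b * b' * frD hb (lift ord0 ord0) z).
    by rewrite e2; have -> : b * b' * (a' / b') = b * a'; [by field|exact: (srM hA Ab Aa')].
  move=> l; have [->//|->//] : l = ord0 \/ l = lift ord0 ord0.
  by case: l => -[|[|//]] ?; [left|right]; exact: val_inj.
pose M0 := \prod_(z <- s) d z.
have AM : kgen iota s M0 by apply: (sr_prod hA) => z _; case: (hdd z).
have M00 : M0 != 0 by rewrite prodf_seq_neq0; apply/allP => z _; case: (hdd z).
have MA l g : kgen iota s g -> kgen iota s (M0 * frD hb l g).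
  have hD := frD_der hb l.
  move=> Ag; suff [] : kgen iota s g /\ kgen iota s (M0 * frD hb l g) by [].
  move: g Ag; apply: kgen_min.
  - split.
    + by split; [exact: (sr1 hA)|rewrite (der1 hD) mulr0; exact: (sr0 hA)].
    + move=> a b [Aa Ma] [Ab Mb]; split; first exact: (srB hA Aa Ab).
      by rewrite (derB hD) mulrBr; exact: (srB hA Ma Mb).
    + move=> a b [Aa Ma] [Ab Mb]; split; first exact: (srM hA Aa Ab).
      have -> : M0 * frD hb l (a * b) = a * (M0 * frD hb l b) + b * (M0 * frD hb l a).
        by rewrite (derM hD); ring.
      exact: (srD hA (srM hA Aa Mb) (srM hA Ab Ma)).
  - move=> _ [c ->]; split; first by apply: kgen_base; exists c.
    have [c' <-] := hperf c; rewrite rmorphXn (der_pX hp hD) mulr0; exact: (sr0 hA).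
  - move=> z zs; split; first exact: kgen_mem.
    have [_ _ Az] := hdd z; rewrite /M0 (big_rem z) //= mulrAC; apply: (srM hA (Az l)).
    by apply: (sr_prod hA) => // u _; case: (hdd u).
have PM l g : P g -> P (M0 * frD hb l g).
  by move: g; rewrite eP; apply: (der_loc (isder_scale M0 (frD_der hb l))) => //; exact: MA.
have FM F : prime_divisor X F -> P `<=` F -> forall l g, F g -> F (M0 * frD hb l g).
  move=> [XF _ _] PF l; have [hF eF] := point_sub hX XP XF PF; rewrite eF => g.
  by apply: (der_loc (isder_scale M0 (frD_der hb l))) => //; exact: PM.
have finS : finite_set (floor_components X B).
  apply: sub_finite_set finB => E [_] /=; apply: contraNneq => ->.
  by rewrite floor0.
have /finite_seqP [sS eS] := finS.
have /choice [r hr] : forall F, exists r, [/\ P r, r != 0 & prime_divisor X F -> P `<=` F -> mideal F r].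
  move=> F; have [[pF PF]|no] := pselect (prime_divisor X F /\ P `<=` F); last first.
    by exists 1; split; [exact: sr1|exact: oner_neq0|move=> a b; case: no].
  have [t hF] := hd F pF; have [a [b [Pa Pb b0 e]]] := point_frac hX XP t.
  exists a; split=> //.
    by apply: contraNneq (dvr_t0 hF) => a0; rewrite e a0 mul0r.
  have -> : a = b * t by rewrite e mulrC divfK.
  by move=> _ _; apply: midealM (dvr_mt hF); [exact: dvr_sr hF|exact: PF].
pose N := \prod_(F <- sS) r F.
exists (M0 * N); split.
- by apply: srM => //; [rewrite eP; exact: loc_sub|apply: sr_prod => // F _; case: (hr F)].
- by rewrite mulf_neq0 // prodf_seq_neq0; apply/allP => F _; case: (hr F).
have rP F : P (r F) by case: (hr F).
move=> F pF PF; have [t hF] := hd F pF; have sF := dvr_sr hF.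
have FN (u : seq (set K)) : F (\prod_(G <- u) r G) by apply: sr_prod => // G _; exact: PF.
split=> [l g Fg|l C c SC [FC ec]].
  by rewrite mulrAC mulrC; exact: (srM sF (FN sS) (FM F pF PF l g Fg)).
have eC : C = F.
  by have [XF _ Fmax] := pF; have [[XC CT _] _] := SC; have [] := Fmax C XC FC.
rewrite eC in SC ec; have mF : F `&` mideal F = mideal F.
  by apply/seteqP; split=> z; [case|move=> mz; split=> //; exact: midealW mz].
rewrite /ideal_at mF in ec.
have Fs : F \in sS by have : [set` sS] F by rewrite -eS.
have [_ _ /(_ pF PF)] := hr F; rewrite ec => -[w Fw ew].
have c0 : c != 0.
  have : principal F c t by rewrite -ec; exact: dvr_mt hF.
  by case=> a _ e; apply: contraNneq (dvr_t0 hF) => c0; rewrite e c0 mul0r.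
rewrite /N (big_rem F) //= ew.
set N' := \prod_(j <- _) _.
have -> : M0 * (c * w * N') * frD hb l c / c = w * N' * (M0 * frD hb l c) by field.
apply: (srM sF (srM sF Fw (FN _))).
apply: (FM F pF PF); have : mideal F c by rewrite ec; exists 1; [exact: sr1|rewrite mulr1].
exact: midealW.
Qed.

Lemma core_estimate X B P E te se r (D : set K -> int) i V dw (hV : @Kaehler_forms _ _ iota i V dw)
    (hb : pframe p hp te se) :
  divisorial X -> pdegree hp 2 -> effective B -> Qdivisor X B -> F_pure p X B ->
  closed_point X P -> dvr E te -> is_unit E se -> pbasis hp E te se ->
  (forall e g, g != 0 -> divisor_stalk X (fun F => (D F * (p ^ e)%N%:Z)%:~R) P g ->
     - ((p ^ e)%N%:R * r) <= (ord E g)%:~R :> rat) ->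
  exists n (A : 'I_n -> 'I_i -> 'I_2), reconstructs hV hb A /\
  forall w, (forall F, prime_divisor X F -> P `<=` F ->
     log_form_stalk dw X (floor_components X B) (fun F => (D F)%:~R) F w) ->
    forall j, vge E (- Num.floor r) (lam hV hb (A j) w).
Proof.
move=> dX hdeg effB QB hFp cP hE ue hpb hN.
have [phi [phiD phip phi1 hphi]] := fpure_extend dX effB hFp cP.
have hS : floor_components X B `<=` prime_divisor X by move=> F [].
have [n [A [sigma [hA [lif reg]]]]] := sigma_exists phiD phip phi1 hb hS hV.
exists n, A; split=> // w hw j; have [hX hd] := dX.
have [M [PM M0 hM]] := multiplier hb dX cP.1 QB.
have hwe e F : prime_divisor X F -> P `<=` F -> log_form_stalk dw X (floor_components X B)
    (fun F => (D F * (p ^ e)%N%:Z)%:~R) F (iter e sigma w).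
  move=> pF PF; elim: e => [|e IHe].
    by have := hw F pF PF; congr log_form_stalk; apply/funext => G; rewrite expn0 mulr1.
  have [t [s [hF us hs]]] := prime_adapted dX hdeg pF.
  have := reg F t s (fun F => D F * (p ^ e)%N%:Z) _ (phi_adapted effB pF hF us hs phip hphi PF) IHe.
  by congr log_form_stalk; apply/funext => G; rewrite -mulrA -PoszM -expnSr.
pose z e := lam hV hb (A j) (iter e sigma w).
have ze e : z 0%N = iter e (ptr hb) (z e).
  elim: e => // e ->; rewrite iterSr; congr iter; exact: lif.
pose MM := \prod_(l < i) M; have MM0 : MM != 0 by apply/prodf_neq0.
have zP e : divisor_stalk X (fun F => (D F * (p ^ e)%N%:Z)%:~R) P (MM * z e).
  have [->|nz] := eqVneq (MM * z e) 0; first by left.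
  right=> F pF PF; have [t hF] := hd F pF; have [h1 h2] := hM F pF PF.
  have := log_form_stalk_vge hV (A j) pF hF h1 h2 (hwe e F pF PF).
  by case=> [/eqP|]; rewrite ?(negbTE nz) // -subr_ge0 opprK.
pose m := - Num.floor r; pose kap := ord E MM.
pose del : rat := - r - (m - 1)%:~R.
have del0 : 0 < del.
  rewrite /del /m subr_gt0 intrD rmorphN /= -opprD ltrN2.
  by have := floorD1_gt r; rewrite intrD.
(* [kap], the order of the multiplier at E, is fixed, while the gap [del] between m - 1 and -r is
   multiplied by p^e. *)
have [e he] : exists e, `|kap|%:~R < (p ^ e)%N%:R * del.
  have [e he] : exists e : nat, `|kap|%:~R / del < e%:R.
    by exists (Num.truncn (`|kap|%:~R / del)).+1; exact: truncnS_gt.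
  exists e; rewrite -ltr_pdivrMr //; apply: lt_le_trans he _; rewrite ler_nat.
  exact: ltnW (ltn_expl e (p_gt1 hp)).
rewrite -/(z 0%N) (ze e); have -> : - Num.floor r = (m - 1) + 1 by rewrite /m subrK.
have [z0|nz] := eqVneq (z e) 0.
  by apply: (iter_ptr_vge hE hpb hb (m := (m - 1) * (p ^ e)%N%:Z + 1)); [rewrite ltrDl|left].
apply: (iter_ptr_vge hE hpb hb (m := ord E (z e))); last by right.
have := hN e _ (mulf_neq0 MM0 nz) (zP e); rewrite (ordM hE) // -/kap.
rewrite -(ltr_int rat) intrD intrM /= => h.
have hk : (kap%:~R : rat) <= `|kap|%:~R by rewrite ler_int ler_norm.
have : - ((p ^ e)%N%:R * r) - (p ^ e)%N%:R * del = (m - 1)%:~R * (p ^ e)%N%:R.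
  by rewrite /del; ring.
have -> : ((p ^ e)%N%:~R : rat) = (p ^ e)%N%:R by [].
lra.
Qed.

End Core.

End FormsOnSurfaces.

(** * Dimensions of quotients over k *)

Section Curves.
Context {k L : fieldType} (iota : {rmorphism k -> L}).
Local Notation kk := (base iota).
Local Notation ksub := (submod kk).
Local Notation qdim := (quotient_dim iota).

Section QuotientDim.
Implicit Types (W : set L) (x y z : L).

Definition kspan W' W n (b : 'I_n -> L) :=
  forall x, W' x -> exists c : 'I_n -> k, W (x - \sum_j iota (c j) * b j).
Definition kfree W n (b : 'I_n -> L) :=
  forall c : 'I_n -> k, W (\sum_j iota (c j) * b j) -> forall j, c j = 0.

Lemma hom_system (J Q : finType) (a : J -> Q -> k) : (#|Q| < #|J|)%N ->
  exists c : J -> k, (exists j, c j != 0) /\ forall q, \sum_j c j * a j q = 0.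
Proof.
move=> QJ; pose M : 'M[k]_(#|J|, #|Q|) := \matrix_(j, q) a (enum_val j) (enum_val q).
have : kermx M != 0.
  rewrite -mxrank_eq0 mxrank_ker -lt0n subn_gt0.
  exact: leq_ltn_trans (rank_leq_col M) QJ.
move=> /matrix0Pn [r [s nrs]]; pose u := row r (kermx M).
have uM : u *m M = 0.
  by rewrite -row_mul mulmx_ker row0.
exists (fun j => u 0 (enum_rank j)); split; first by exists (enum_val s); rewrite enum_valK mxE.
move=> q; have := congr1 (fun N : 'rV_ _ => N 0 (enum_rank q)) uM; rewrite !mxE => e; rewrite -[RHS]e.
rewrite (reindex (enum_val (A := J))) /=; last by apply: onW_bij; exact: enum_val_bij.
by apply: eq_bigr => j _; rewrite enum_valK !mxE !enum_rankK.
Qed.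

(** One vanishing condition in each of several quotients: a family larger than the sum of their
    dimensions has a combination meeting all of them. The count plays the part of a Riemann
    inequality below. *)
Lemma multi_dep m (W' W : 'I_m -> set L) (n : 'I_m -> nat) (b : forall i, 'I_(n i) -> L)
    (J : finType) (v : J -> L) : (forall i, ksub (W i)) -> (forall i, kspan (W' i) (W i) (b i)) ->
  (forall i j, W' i (v j)) -> (\sum_i n i < #|J|)%N ->
  exists c : J -> k, (exists j, c j != 0) /\ forall i, W i (\sum_j iota (c j) * v j).
Proof.
move=> hW hs hv lt.
have ex i : exists a : J -> 'I_(n i) -> k,
    forall j, W i (v j - \sum_l iota (a j l) * b i l).
   have /choice [a ha] : forall j, exists c : 'I_(n i) -> k,
    W i (v j - \sum_l iota (c l) * b i l) by move=> j; exact: hs.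
  by exists a.
pose a i := sval (cid (ex i)); have ha i j := svalP (cid (ex i)) j.
have [|c [cn hc]] := @hom_system J {i : 'I_m & 'I_(n i)} (fun j q => a (tag q) j (tagged q)).
  rewrite card_tagged sumnE big_map big_enum; apply: leq_ltn_trans lt.
  by rewrite leq_eqVlt; apply/orP; left; apply/eqP/eq_bigr => i _; rewrite card_ord.
exists c; split=> // i.
have -> : \sum_j iota (c j) * v j = \sum_j iota (c j) * (v j - \sum_l iota (a i j l) * b i l).
  rewrite -[LHS]addr0; under [RHS]eq_bigr do rewrite mulrBr; rewrite big_split sumrN /=.
  congr (_ + _); under eq_bigr do rewrite mulr_sumr; rewrite exchange_big /= big1 ?oppr0 // => l _.
  have := hc (Tagged (fun i => 'I_(n i)) l) => /= /(congr1 iota).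
  rewrite rmorph_sum rmorph0 => e; have e' := congr1 ( *%R^~ (b i l)) e; rewrite /= mul0r mulr_suml in e'; transitivity (\sum_i0 iota (c i0 * a i i0 l) * b i l) => //.
  by apply: eq_bigr => j _; rewrite rmorphM mulrA.
have [W0 WD WM] := hW i; elim/big_ind: _ => // j _; apply: WM; last exact: ha.
by exists (c j).
Qed.

Lemma steinitz W' W n (b : 'I_n -> L) m (v : 'I_m -> L) : ksub W -> kspan W' W b ->
  (forall j, W' (v j)) -> kfree W v -> (m <= n)%N.
Proof.
move=> hW hs hv fv; rewrite leqNgt; apply/negP => nm.
have [|c [[j nj] hc]] := @multi_dep 1 (fun _ => W') (fun _ => W) (fun _ => n) (fun _ => b) 'I_m v
  (fun _ => hW) (fun _ => hs) (fun _ => hv); first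
  by rewrite big_ord1 card_ord.
by move: nj; rewrite (fv c (hc ord0)) eqxx.
Qed.

Lemma qdim_uniq W' W n m : ksub W -> qdim W' W n -> qdim W' W m -> n = m.
Proof.
move=> hW [b [Wb sb fb]] [v [Wv sv fv]]; apply/eqP; rewrite eqn_leq.
by rewrite (steinitz hW sv Wb fb) (steinitz hW sb Wv fv).
Qed.

Lemma kfree_extend W n (b : 'I_n -> L) x : ksub W -> kfree W b ->
  (forall c, ~ W (x - \sum_j iota (c j) * b j)) ->
  kfree W (fun j : 'I_n.+1 => oapp b x (unlift ord_max j)).
Proof.
move=> hW fb nx c; rewrite big_ord_recr /= unlift_none /=.
have e (d : 'I_n.+1 -> k) : \sum_(i < n) iota (d (widen_ord (leqnSn n) i)) *
    oapp b x (unlift ord_max (widen_ord (leqnSn n) i)) =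
    \sum_(i < n) iota (d (widen_ord (leqnSn n) i)) * b i.
  apply: eq_bigr => i _; have -> : widen_ord (leqnSn n) i = lift ord_max i.
    by apply: val_inj; rewrite /= /bump leqNgt ltn_ord.
  by rewrite liftK.
rewrite e => hc; have [W0 WD WM] := hW; have c0 : c ord_max = 0.
  apply/eqP; apply: contraT => cn.
  case: (nx (fun j => - (c ord_max)^-1 * c (widen_ord (leqnSn n) j))).
  have -> : x - \sum_j iota (- (c ord_max)^-1 * c (widen_ord (leqnSn n) j)) * b j =
      iota (c ord_max)^-1 * (\sum_(i < n) iota (c (widen_ord (leqnSn n) i)) * b i + iota (c ord_max) * x).
    rewrite mulrDr mulrA -rmorphM mulVf // rmorph1 mul1r addrC; congr (_ + _).
    by rewrite -sumrN mulr_sumr; apply: eq_bigr => i _; rewrite rmorphM rmorphN mulNr mulNr opprK mulrA.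
  by apply: WM => //; exists (c ord_max)^-1.
move: hc; rewrite c0 rmorph0 mul0r addr0 => /fb h j.
case: (unliftP ord_max j) => [i ->|->] //.
by rewrite -(h i); congr c; apply: val_inj; rewrite /= /bump leqNgt ltn_ord.
Qed.

Lemma qdim_exists W' W n (b : 'I_n -> L) : ksub W -> kspan W' W b ->
  exists2 m, (m <= n)%N & qdim W' W m.
Proof.
move=> hW hs; pose P m := `[< exists v : 'I_m -> L, (forall j, W' (v j)) /\ kfree W v >].
have P0 : P 0%N by apply/asboolP; exists (fun _ => 0); split=> [[]|c _ []].
have bnd m : P m -> (m <= n)%N by move=> /asboolP [v [Wv fv]]; exact: (steinitz hW hs Wv fv).
case: (ex_maxnP (ex_intro _ 0%N P0) bnd) => m Pm mx; exists m; first exact: bnd.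
have /asboolP [v [Wv fv]] := Pm; exists v; split=> // x Wx.
apply: contrapT => nx; have : P m.+1.
  apply/asboolP; exists (fun j : 'I_m.+1 => oapp v x (unlift ord_max j)); split.
    by move=> j; case: unliftP => [l|] _ //=; exact: Wv.
  by apply: kfree_extend => // c hc; apply: nx; exists c.
by move=> /mx; rewrite ltnn.
Qed.

Lemma qdim_tower W W' W'' a b : ksub W -> W `<=` W' -> ksub W' -> W' `<=` W'' -> ksub W'' ->
  qdim W'' W' a -> qdim W' W b -> qdim W'' W (a + b).
Proof.
move=> hW WW' hW' WW'' hW'' [v [Wv sv fv]] [u [Wu su fu]].
have splitS (c : 'I_(a + b) -> k) (w := fun i => match fintype.split i with inl j => v j | inr j => u j end) :
    \sum_i iota (c i) * w i = \sum_j iota (c (lshift b j)) * v j + \sum_j iota (c (rshift a j)) * u j.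
  rewrite big_split_ord /=; congr (_ + _); apply: eq_bigr => j _; rewrite /w.
    by rewrite (unsplitK (inl j)).
  by rewrite (unsplitK (inr j)).
have [_ W'D W'M] := hW'.
have Wsu (c : 'I_b -> k) : W' (\sum_j iota (c j) * u j).
  case: (hW') => W'0 _ _; elim/big_ind: _ => // j _; apply: W'M => //; by exists (c j).
exists (fun i => match fintype.split i with inl j => v j | inr j => u j end); split.
- by move=> i; case: fintype.split => j //; apply: WW''.
- move=> x Wx; have [c hc] := sv x Wx; have [d hd] := su _ hc.
  exists (fun i => match fintype.split i with inl j => c j | inr j => d j end); rewrite splitS.
  under eq_bigr do rewrite (unsplitK (inl _)).
  by under [X in _ - (_ + X)]eq_bigr do rewrite (unsplitK (inr _)); rewrite opprD addrA.
- move=> c; rewrite splitS => hc.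
  have cv : forall j, c (lshift b j) = 0.
    apply: (fv (fun j => c (lshift b j))).
    rewrite -[X in W' X](addrK (\sum_j iota (c (rshift a j)) * u j)).
    by apply: W'D; [exact: WW'|rewrite -mulN1r; apply: W'M => //; exists (-1); rewrite rmorphN rmorph1].
  have cu : forall j, c (rshift a j) = 0.
    apply: (fu (fun j => c (rshift a j))); move: hc; rewrite big1 ?add0r // => j _.
    by rewrite cv rmorph0 mul0r.
  by move=> i; rewrite -(splitK i); case: fintype.split => j; [exact: cv|exact: cu].
Qed.

Definition kfin W' W := exists n, qdim W' W n.
(** Zero by default when the quotient has no finite dimension. *)
Definition qd W' W : nat := xget 0%N [set n | qdim W' W n].

Lemma qdE W' W n : ksub W -> qdim W' W n -> qd W' W = n.
Proof. by move=> hW h; apply: (qdim_uniq hW _ h); exact: (@xgetPex _ 0%N [set n | qdim W' W n] (ex_intro _ n h)). Qed.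

Lemma qdP W' W : ksub W -> kfin W' W -> qdim W' W (qd W' W).
Proof. by move=> hW [n h]; rewrite (qdE hW h). Qed.

Lemma kfin_mid W W' W'' : ksub W -> W `<=` W' -> ksub W' -> W' `<=` W'' -> ksub W'' ->
  kfin W'' W -> [/\ kfin W'' W', kfin W' W & qd W'' W = (qd W'' W' + qd W' W)%N].
Proof.
move=> hW s1 hW' s2 hW'' [n hn]; have [b [Wb sb fb]] := hn.
have [m _ hm] : exists2 m, (m <= n)%N & qdim W'' W' m.
  by apply: (@qdim_exists _ _ _ b) => // x /sb [c hc]; exists c; exact: s1.
have [l _ hl] : exists2 m, (m <= n)%N & qdim W' W m.
  by apply: (@qdim_exists _ _ _ b) => // x /s2 /sb.
split; [by exists m|by exists l|].
by rewrite (qdE hW' hm) (qdE hW hl); apply: qdE => //; exact: (qdim_tower hW s1 hW' s2).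
Qed.

Lemma kfin_tower W W' W'' : ksub W -> W `<=` W' -> ksub W' -> W' `<=` W'' -> ksub W'' ->
  kfin W'' W' -> kfin W' W -> kfin W'' W.
Proof. by move=> h1 h2 h3 h4 h5 [a ha] [b hb]; exists (a + b)%N; exact: (qdim_tower h1 h2 h3). Qed.

Lemma qd_le W' W n (b : 'I_n -> L) : ksub W -> kspan W' W b -> kfin W' W /\ (qd W' W <= n)%N.
Proof.
by move=> hW hs; have [m mn hm] := qdim_exists hW hs; split; [exists m|rewrite (qdE hW hm)].
Qed.

Definition scale z W : set L := [set x | exists2 y, W y & x = z * y].

Lemma scale_ksub z W : ksub W -> ksub (scale z W).
Proof.
move=> [W0 WD WM]; split; first by exists 0; rewrite ?mulr0.
- by move=> _ _ [a Wa ->] [b Wb ->]; exists (a + b); [exact: WD|rewrite mulrDr].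
- by move=> a _ ba [b Wb ->]; exists (a * b); [exact: WM|rewrite mulrCA].
Qed.

Lemma qdim_scale z W' W n : z != 0 -> qdim W' W n -> qdim (scale z W') (scale z W) n.
Proof.
move=> z0 [b [Wb sb fb]]; exists (fun j => z * b j).
have e (c : 'I_n -> k) : \sum_j iota (c j) * (z * b j) = z * \sum_j iota (c j) * b j.
  by rewrite mulr_sumr; apply: eq_bigr => j _; rewrite mulrCA.
split; first by move=> j; exists (b j).
- by move=> _ [x /sb [c hc] ->]; exists c; exists (x - \sum_j iota (c j) * b j); rewrite ?e ?mulrBr.
- by move=> c [y Wy]; rewrite e => /(mulfI z0) ey; apply: fb; rewrite ey.
Qed.

Lemma scaleK z W : z != 0 -> scale z^-1 (scale z W) = W.
Proof.
move=> z0; apply/seteqP; split=> [_ [_ [x Wx ->] ->]|x Wx]; first by rewrite mulKf.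
by exists (z * x); [exists x|rewrite mulKf].
Qed.

Lemma kfin_scale z W' W : z != 0 -> ksub W -> kfin W' W ->
  kfin (scale z W') (scale z W) /\ qd (scale z W') (scale z W) = qd W' W.
Proof.
move=> z0 hW [n hn]; have h := qdim_scale z0 hn; split; first by exists n.
by rewrite (qdE hW hn); apply: qdE => //; exact: scale_ksub.
Qed.

End QuotientDim.

(** * Complete curves and weak approximation *)

Section PointsOfCurve.

Lemma kfin_rel W' W w : ksub W -> kfin W' W -> (forall n, W' (w ^+ n)) ->
  exists c : {poly L}, [/\ polyin kk c, c != 0 & W c.[w]].
Proof.
move=> hW [n [b [_ sb _]]] hw.
have [|c [[j nj] hc]] := @multi_dep 1 (fun _ => W') (fun _ => W) (fun _ => n) (fun _ => b)
    'I_n.+1 (fun j => w ^+ j) (fun _ => hW) (fun _ => sb) (fun _ j => hw j).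
  by rewrite big_ord1 card_ord.
pose f := \poly_(j < n.+1) iota (oapp c 0 (insub j)).
have ef (l : 'I_n.+1) : f`_l = iota (c l).
  by rewrite coef_poly ltn_ord valK.
exists f; split.
- move=> l; rewrite coef_poly; case: ifP => _; first by eexists.
  by exists 0; rewrite rmorph0.
- apply: contra nj => /eqP f0; have := ef j.
  by rewrite f0 coef0 => /esym/eqP; rewrite fmorph_eq0.
- have := hc ord0; rewrite horner_poly; congr (W _); apply: eq_bigr => l _.
  by have := ef l; rewrite coef_poly ltn_ord => ->.
Qed.

Lemma val_alg V x : valuation_ring V -> kk `<=` V -> alg kk x -> V x.
Proof.
move=> hV bV [f [bf f0 rf]]; have sV := val_sr hV.
have l0 : lead_coef f != 0 by rewrite lead_coef_eq0.
have bl : kk (lead_coef f)^-1 by apply: (base_sf iota).2; rewrite lead_coefE; exact: bf.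
apply: (val_integral hV (q := (lead_coef f)^-1 *: f)).
- by rewrite monicE lead_coefZ mulVf.
- by rewrite size_scale ?invr_eq0 //; exact: (root_size_gt1 f0 rf).
- by apply: (polyinZ sV) => [|l]; apply: bV => //; exact: bf.
- by move: rf; rewrite hornerZ rootE => /eqP ->; rewrite mulr0; exact: sr0.
Qed.

Lemma alg_fadj_rel z y : alg (fadj kk z) y -> y != 0 ->
  exists q : {poly L}, [/\ polyin (adj kk z) q, q`_0 != 0 & root q y].
Proof.
move=> [f [Lf f0 rf]] y0; have [n [g [ef Lg g0]]] := poly_lowest f0 Lf.
have sb := base_sr iota; have sA := adj_sr sb z.
have [|d [Ad d0 hd]] := @common_denom _ _ g sA.
  move=> j; have [a [b [ba bb nb e]]] := Lg j.
  by exists a.[z], b.[z]; split=> //; [exists a|exists b].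
exists (d *: g); split=> //; first by rewrite coefZ mulf_neq0.
by move: rf; rewrite ef !rootE hornerM hornerXn hornerZ !mulf_eq0 expf_eq0 (negbTE y0) andbF orbF => ->; rewrite orbT.
Qed.

Hypothesis hdep : forall x y, ~ trtower kk [:: x; y].

(* Nagata's substitution y + x ^ m, with the valuations of the terms of an
   algebraic relation pairwise distinct. *)
Lemma val_pair R x y : is_subring R -> kk `<=` R -> R x -> R y ->
  exists2 w, R w & forall V, valuation_ring V -> kk `<=` V -> V w -> V x /\ V y.
Proof.
move=> hR bR Rx Ry; have [ax|nx] := pselect (alg kk x).
  by exists y => // V hV bV Vy; split=> //; exact: val_alg.
have [y0|y0] := eqVneq y 0.
  by exists x => // V hV bV Vx; split=> //; rewrite y0; exact: sr0 (val_sr hV).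
have ay : alg (fadj kk x) y by apply: contrapT => ny; apply: (hdep (x := x) (y := y)).
have [q [Aq q0 rq]] := alg_fadj_rel ay y0.
have /choice [c hc] : forall j, exists c : {poly L}, polyin kk c /\ q`_j = c.[x].
  by move=> j; have [c bc e] := Aq j; exists c.
pose m := (\max_(j < size q) size (c j)).+1.
have cm j : (j < size q)%N -> (size (c j) < m)%N.
  by move=> jq; rewrite ltnS; exact: (leq_bigmax (Ordinal jq)).
exists (y + x ^+ m); first by apply: srD => //; exact: srX.
move=> V hV bV Vw; have hs := val_sr hV; have lV := val_local hV; have mp := local_prime lV.
suff Vx : V x by split=> //; rewrite -[y](addrK (x ^+ m)); apply: srB => //; exact: srX.
apply: contrapT => nVx; have mx := val_inv hV nVx; set t := x^-1 in mx.
have x0 : x != 0 by apply: contraPneq nVx => -> nV; apply: nV; exact: sr0.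
have Vt := midealW mx; have t0 : t != 0 by rewrite invr_eq0.
have tX n : x ^+ n * t ^+ n = 1 by rewrite -exprMn divff // expr1n.
(* If x is a pole and w is not, y has exactly the pole order of x^m; m exceeds the sizes of all c j,
   so the term of degree J dominates the relation. *)
have uu : is_unit V (y * t ^+ m).
  have -> : y * t ^+ m = - 1 + (y + x ^+ m) * t ^+ m by rewrite mulrDl tX; ring.
  apply: (unit_add lV); first by apply: (unitN hs); exact: unit1.
  by rewrite [t ^+ m]exprSr mulrA; apply: midealM mx => //; apply: srM => //; exact: srX.
have small f n : polyin kk f -> (size f <= n)%N -> V (f.[x] * t ^+ n).
  move=> bf sn; rewrite horner_coef mulr_suml; apply: sr_sum => // j _.
  rewrite -mulrA; apply: srM => //; first by apply: bV; exact: bf.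
  rewrite -(subnKC (leq_trans (ltnW (ltn_ord j)) sn)) exprD mulrA tX mul1r; exact: srX.
pose J := (size q).-1; have q00 : q != 0 by apply: contraNneq q0 => ->; rewrite coef0.
have sq : (size q = J.+1)%N by rewrite /J prednK // lt0n size_poly_eq0.
have cJ : c J != 0.
  apply: contraNneq q00 => e; rewrite -lead_coef_eq0 lead_coefE -/J (hc J).2 e horner0 //.
pose d := (size (c J)).-1.
have sd : (size (c J) = d.+1)%N by rewrite /d prednK // lt0n size_poly_eq0.
have ul : is_unit V ((c J).[x] * t ^+ d).
  rewrite horner_coef sd big_ord_recr /= mulrDl -mulrA tX mulr1 addrC.
  apply: (unit_add lV).
    apply: (subfield_unit (base_sf iota) bV); first by have [h _] := hc J; exact: h.
    by move: cJ; rewrite -lead_coef_eq0 lead_coefE.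
  rewrite mulr_suml; apply: (submod_sum _ (prime_idl mp).1) => j _.
  have -> : t ^+ d = t ^+ (j + (d - j.+1).+1) by congr (_ ^+ _); have := ltn_ord j; lia.
  rewrite exprD !mulrA -(mulrA _ (x ^+ j)) tX mulr1 exprSr mulrA.
  apply: midealM mx => //; apply: srM => //; last exact: srX.
  by apply: bV; have [h _] := hc J; exact: h.
have : mideal V ((c J).[x] * t ^+ d * (y * t ^+ m) ^+ J).
  have e : 0 = q.[y] * t ^+ (m * J + d) by move: rq; rewrite rootE => /eqP ->; rewrite mul0r.
  rewrite horner_coef sq big_ord_recr /= mulrDl (hc J).2 in e.
  have -> : (c J).[x] * t ^+ d * (y * t ^+ m) ^+ J = (c J).[x] * y ^+ J * t ^+ (m * J + d).
    by rewrite exprMn -exprM exprD; ring.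
  rewrite -[X in mideal V X](addKr (\sum_(j < J) q`_j * y ^+ j * t ^+ (m * J + d))).
  rewrite mulr_suml in e; rewrite -e addr0; apply: (primeN hs mp).
  apply: (submod_sum _ (prime_idl mp).1) => j _; rewrite (hc j).2.
  have [bc _] := hc j; have jJ := ltn_ord j.
  have -> : (m * J + d = m * j + (m.-1 + ((m * (J - j.+1)) + d).+1))%N.
    by rewrite /m mulnBr mulnS; have := leq_mul (leqnn (\max_(j < size q) size (c j)).+1) jJ; rewrite mulnS; lia.
  set s := (m * (J - j.+1) + d)%N; rewrite exprD exprM exprD exprSr.
  have -> : (c j).[x] * y ^+ j * ((t ^+ m) ^+ j * (t ^+ m.-1 * (t ^+ s * t))) =
    (y * t ^+ m) ^+ j * ((c j).[x] * t ^+ m.-1) * t ^+ s * t by rewrite exprMn; ring.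
  apply: midealM mx => //; do 2?[apply: srM => //; try exact: srX].
    by apply: srX => //; case: uu.
  by apply: small => //; rewrite -ltnS; apply: cm; rewrite sq ltnS ltnW.
by case=> _; apply; apply: (unitM hs) => //; exact: unitX.
Qed.

(** By iteration of [val_pair], a single w controls the poles of a whole list, L having
    transcendence degree at most one over k. *)
Lemma val_list R (s : seq L) : is_subring R -> kk `<=` R -> {in s, forall y, R y} ->
  exists2 w, R w & forall V, valuation_ring V -> kk `<=` V -> V w -> {in s, forall y, V y}.
Proof.
move=> hR bR; elim: s => [|x s IHs] Rs; first by exists 0; [exact: sr0|].
have [|w Rw hw] := IHs; first by move=> y ys; apply: Rs; rewrite inE ys orbT.
have [|w' Rw' hw'] := val_pair hR bR (x := x) _ Rw; first by apply: Rs; rewrite mem_head.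
exists w' => // V hV bV /(hw' V hV bV) [Vx Vw] y; rewrite inE => /orP[/eqP->//|].
exact: (hw V hV bV Vw).
Qed.

(** A complete and possibly singular curve with function field L, given by the local rings at its
    closed points. These need not be valuation rings, since an exceptional curve is not normalized;
    valuation rings only express separatedness and properness. *)
Record curve (I : choiceType) (G : set I) (A : I -> set L) : Prop := {
  cv_local : forall i, G i -> local (A i);
  cv_base : forall i, G i -> kk `<=` A i;
  cv_frac : forall i, G i -> frac (A i);
  cv_fin : forall i x, G i -> A i x -> x != 0 -> kfin (A i) (principal (A i) x);
  cv_nontriv : forall i, G i -> exists2 x, mideal (A i) x & x != 0;
  cv_sep : forall V i j, valuation_ring V -> G i -> G j ->
    dominates V (A i) -> dominates V (A j) -> i = j;
  cv_proper : forall V, valuation_ring V -> kk `<=` V -> (exists x, ~ V x) ->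
    exists2 i, G i & dominates V (A i);
  cv_finite : forall x, finite_set [set i | G i /\ ~ A i x] }.

Variables (I : choiceType) (G : set I) (A : I -> set L) (hC : curve G A).

Lemma cv_ring i : G i -> is_subring (A i).
Proof. by move=> /(cv_local hC) []. Qed.

Lemma cv_ksub i W : G i -> submod (A i) W -> ksub W.
Proof. by move=> Gi [W0 WD WM]; split=> // a x /(cv_base hC Gi); exact: WM. Qed.

(** With g = a / b, the quotient of A_i by a is finite over k, so x satisfies a polynomial relation
    modulo a. Up to a unit the relation is its lowest term x^n. *)
Lemma pow_deep i x g : G i -> mideal (A i) x -> g != 0 ->
  exists M0, forall M, (M0 <= M)%N -> principal (A i) g (x ^+ M).
Proof.
move=> Gi mx g0; have sA := cv_ring Gi.
have [a [b [Aa Ab b0 eg]]] := cv_frac hC Gi g.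
have a0 : a != 0 by apply: contraNneq g0 => a0; rewrite eg a0 mul0r.
have hp := principalS a sA.
have [|c [bc c0 [d Ad ed]]] := @kfin_rel _ _ x (cv_ksub Gi hp) (cv_fin hC Gi Aa a0).
  by move=> n; apply: srX => //; exact: midealW.
have [n [h [ec Lh h0]]] := poly_lowest c0 bc.
have [hx0 Ahx Ahx'] := mideal_horner (cv_local hC Gi) (base_sf iota) (cv_base hC Gi) mx Lh h0.
exists n => M nM; exists (b * d * h.[x]^-1 * x ^+ (M - n)).
  by do !apply: srM => //; apply: srX => //; exact: midealW.
rewrite ec hornerM hornerXn in ed; rewrite -{1}(subnKC nM) exprD.
have -> : x ^+ n = a * d / h.[x] by rewrite -ed mulrC mulKf.
by rewrite eg; field; rewrite b0 hx0.
Qed.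

Lemma val_dominates V i x : valuation_ring V -> G i -> A i `<=` V -> ~ V x -> dominates V (A i).
Proof.
move=> hV Gi AV nx; split=> // y my; have sA := cv_ring Gi; have sV := val_sr hV.
case: (unitVm (AV y (midealW my))) => // -[y0 Vy Vy']; case: nx.
have [a [b [Aa Ab b0 ->]]] := cv_frac hC Gi x; apply: srM => //; first exact: AV.
have [n hn] := pow_deep Gi my b0; have [c Ac ec] := hn n (leqnn n).
have -> : b^-1 = c * y^-1 ^+ n.
  by rewrite exprVn ec invfM mulrCA divff ?mulr1 //; apply: contraNneq (expf_neq0 n y0) => e; rewrite ec e mulr0.
by apply: srM => //; [exact: AV|exact: srX].
Qed.

(** Otherwise some element of A_i[b] has no inverse there, and Chevalley's theorem gives a proper
    valuation ring over A_i[b]; it dominates A_i and contains b. *)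
Lemma adj_full i b : G i -> (forall V, valuation_ring V -> dominates V (A i) -> ~ V b) ->
  forall x, adj (A i) b x.
Proof.
move=> Gi hb; have sA := cv_ring Gi; have sC := adj_sr sA b.
have inv x : adj (A i) b x -> x != 0 -> adj (A i) b x^-1.
  move=> Cx x0; apply: contrapT => nx.
  have [|V [hV CV mV]] := chevalley sC (principalI sC Cx).
    by move=> [a Ca e]; apply: nx; have -> : x^-1 = a by rewrite -[a](mulKf x0) -e mulr1.
  have [] := hb V hV; last by apply: CV; exact: adj_gen.
  apply: (val_dominates (x := x^-1) hV Gi) => [z Az|Vx']; first by apply: CV; exact: sub_adj.
  have [Vx] : mideal V x by apply: mV; exists 1; [exact: sr1|rewrite mulr1].
  by case.
move=> x; have [a [c [Aa Ac c0 ->]]] := cv_frac hC Gi x.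
by apply: srM => //; [exact: sub_adj|apply: inv => //; exact: sub_adj].
Qed.

(** Compactness: if no finite list worked, Chevalley's theorem would give a valuation ring
    dominating A_i and containing A_j, hence dominating both, against separatedness. *)
Lemma separating_list i j : G i -> G j -> i <> j -> exists s : seq L, {in s, forall y, A j y} /\
  forall V, valuation_ring V -> dominates V (A i) -> ~ {in s, forall y, V y}.
Proof.
move=> Gi Gj nij; have sAi := cv_ring Gi; have sAj := cv_ring Gj.
pose gen (s : seq L) V := A i `<=` V /\ {in s, forall y, V y}.
have gcat s s' V : gen (s ++ s') V -> gen s V /\ gen s' V.
  by case=> h1 h2; split; split=> // y ys; apply: h2; rewrite mem_cat ys ?orbT.
pose C := [set x | exists2 s : seq L, {in s, forall y, A j y} &
  forall B, is_subring B -> gen s B -> B x].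
pose M := [set x | exists2 s : seq L, {in s, forall y, A j y} &
  forall V, valuation_ring V -> dominates V (A i) -> gen s V -> mideal V x].
have acat s s' : {in s, forall y, A j y} -> {in s', forall y, A j y} -> {in s ++ s', forall y, A j y}.
  by move=> h h' y; rewrite mem_cat => /orP[/h|/h'].
have sC : is_subring C.
  split; first by exists [::] => // B sB _; exact: sr1.
  - move=> x y [s hs Bx] [s' hs' By]; exists (s ++ s'); first exact: acat.
    by move=> B sB /gcat [h h']; apply: srB => //; [exact: Bx|exact: By].
  - move=> x y [s hs Bx] [s' hs' By]; exists (s ++ s'); first exact: acat.
    by move=> B sB /gcat [h h']; apply: srM => //; [exact: Bx|exact: By].
have iCM : idl C (M `&` C).
  split; last by move=> x [].
  split.
  - split; last exact: sr0.
    by exists [::] => // V hV _ _; apply: mideal0; exact: val_sr.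
  - move=> x y [[s hs Mx] Cx] [[s' hs' My] Cy]; split; last exact: srD.
    exists (s ++ s'); first exact: acat.
    move=> V hV dV /gcat [h h'].
    exact: (primeD (local_prime (val_local hV)) (Mx V hV dV h) (My V hV dV h')).
  - move=> a x [s hs Ca] [[s' hs' Mx] Cx]; split; last by apply: srM => //; exists s.
    exists (s ++ s'); first exact: acat.
    move=> V hV dV /gcat [h h']; have sV := val_sr hV.
    by apply: midealM (Mx V hV dV h') => //; exact: Ca.
have [[[s hs h1] _]|n1] := pselect ((M `&` C) 1).
  exists s; split=> // V hV dV hsV; have [AV _] := dV.
  by have [_] := h1 V hV dV (conj AV hsV); apply; apply: unit1; exact: val_sr.
have [V [hV CV mV]] := chevalley sC iCM n1; exfalso; apply: nij.
have Ci x : A i x -> C x by move=> Ax; exists [::] => // B _ [h _]; exact: h.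
have dVi : dominates V (A i).
  split=> [x /Ci /CV //|x mx]; apply: mV; split; last by apply: Ci; exact: midealW.
  by exists [::] => // W hW [_ h] _; exact: h.
have [x mx x0] := cv_nontriv hC Gi; have [Vx nx] : mideal V x by exact: dVi.2.
apply: (cv_sep hC hV Gi Gj dVi); apply: (val_dominates (x := x^-1) hV Gj); last by move=> Vx'; exact: nx.
move=> y Ay; apply: CV; exists [:: y] => [z|B _ [_ h]]; first by rewrite inE => /eqP->.
by apply: h; rewrite mem_head.
Qed.

(** [val_list] condenses the lists for the other points into one w in A (T j0). A polynomial in w
    over k lies in the maximal ideal there, and a valuation ring containing it contains w. *)
Lemma separating_element m (T : 'I_m -> I) j0 : injective T -> (forall j, G (T j)) ->
  exists2 b, mideal (A (T j0)) b & forall j, j != j0 -> forall x, adj (A (T j)) b x.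
Proof.
move=> injT GT; have sA j := cv_ring (GT j); have bA j := cv_base hC (GT j).
have /choice [s hs] : forall j, exists s : seq L, {in s, forall y, A (T j0) y} /\ (j != j0 ->
    forall V, valuation_ring V -> dominates V (A (T j)) -> ~ {in s, forall y, V y}).
  move=> j; have [->|nj] := eqVneq j j0; first by exists [::].
  have [s [h1 h2]] := separating_list (GT j) (GT j0) (fun e => negP nj (introT eqP (injT _ _ e))).
  by exists s.
have [|w Aw hw] := val_list (s := flatten [seq s j | j <- enum 'I_m]) (sA j0) (bA j0).
  by move=> y /flatten_mapP [j _]; case: (hs j) => h _; exact: h.
have [x mx x0] := cv_nontriv hC (GT j0).
have hp := principalS x (sA j0).
have [|c [bc c0 [d Ad ed]]] := @kfin_rel _ _ w (cv_ksub (GT j0) hp) (cv_fin hC (GT j0) (midealW mx) x0).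
  by move=> n; exact: srX.
have mc : mideal (A (T j0)) c.[w] by rewrite ed mulrC; apply: midealM mx.
have lc0 : lead_coef c != 0 by rewrite lead_coef_eq0.
exists c.[w] => // j nj; apply: adj_full => // V hV dV Vc; have [AV _] := dV.
have [_ /(_ nj V hV dV)] := hs j; apply.
have sV := val_sr hV; have bV : kk `<=` V by move=> z /(bA j) /AV.
have Vw : V w.
  apply: (val_integral hV (q := (lead_coef c)^-1 *: c)).
  - by rewrite monicE lead_coefZ mulVf.
  - rewrite size_scale ?invr_eq0 // ltnNge; apply/negP => /size1_polyC e.
    move: mc c0; rewrite e hornerC polyC_eq0 => mc c0.
    have [_] := mc; apply; apply: (subfield_unit (base_sf iota) (bA _)) => //; exact: bc.
  - apply: polyinZ => //; last by move=> l; apply: bV; exact: bc.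
    by apply: bV; apply: (base_sf iota).2; rewrite lead_coefE; exact: bc.
  - rewrite hornerZ; apply: srM => //; apply: bV; apply: (base_sf iota).2.
    by rewrite lead_coefE; exact: bc.
by move=> y ys; apply: (hw V hV bV Vw); apply/flatten_mapP; exists j; rewrite ?mem_enum.
Qed.

(** b^-1 is a polynomial in b, hence integral over A_i, so its powers have a common denominator h.
    Writing 1 / (g h) as a polynomial in b then divides high powers of b^-1 by g. *)
Lemma inverse_deep i b g : G i -> (forall x, adj (A i) b x) -> b != 0 -> g != 0 ->
  exists M0, forall M, (M0 <= M)%N -> principal (A i) g (b^-1 ^+ M).
Proof.
move=> Gi full b0 g0; have sA := cv_ring Gi; pose t := b^-1.
have tX n : b ^+ n * t ^+ n = 1 by rewrite -exprMn divff // expr1n.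
have [q Aq eq] := full t.
have rel M : (size q <= M)%N -> t ^+ M.+1 = \sum_(l < size q) q`_l * t ^+ (M - l).
  move=> sM; have -> : t ^+ M.+1 = t ^+ M * q.[b] by rewrite -eq exprSr.
  rewrite horner_coef mulr_sumr; apply: eq_bigr => l _.
  have lM : (l <= M)%N by exact: leq_trans (ltnW (ltn_ord l)) sM.
  have := tX l; rewrite -{1}(subnKC lM) exprD; set u := b ^+ l; set v := t ^+ l => e.
  by rewrite -[RHS]mul1r -e; ring.
have [h [Ah h0 hh]] : exists h, [/\ A i h, h != 0 & forall M, A i (h * t ^+ M)].
  have [h [Ah h0 hh]] : exists h, [/\ A i h, h != 0 & forall M, (M <= size q)%N -> A i (h * t ^+ M)].
    elim: (size q) => [|n [h [Ah h0 hh]]].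
      exists 1; split=> //; [exact: sr1|exact: oner_neq0|].
      by move=> M; rewrite leqn0 => /eqP ->; rewrite expr0 mulr1; exact: sr1.
    have [c [Ac c0 Act]] := frac_exn (t ^+ n.+1) (cv_frac hC Gi).
    exists (h * c); split; [exact: srM|exact: mulf_neq0|].
    move=> M; rewrite leq_eqVlt => /orP[/eqP->|]; first by rewrite -mulrA; exact: srM.
    by rewrite ltnS mulrAC => /hh hM; exact: srM.
  exists h; split=> // M; elim/ltn_ind: M => -[|M] IH; first by apply: hh.
  have [sM|Ms] := leqP (size q) M; last exact: hh.
  rewrite rel // mulr_sumr; apply: sr_sum => // l _; rewrite mulrCA; apply: srM => //.
  by apply: IH; rewrite ltnS leq_subr.
have [r Ar er] := full (g * h)^-1; exists (size r) => M sM.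
exists (h * t ^+ M * r.[b]); last first.
  rewrite -er; field; by rewrite g0 h0.
rewrite horner_coef mulr_sumr; apply: sr_sum => // l _; rewrite mulrCA; apply: srM => //.
rewrite -(subnKC (leq_trans (ltnW (ltn_ord l)) sM)) exprD.
have -> u v w : h * (u * v) * w = h * v * (w * u) by ring.
by rewrite tX mulr1.
Qed.

Lemma weak_approx m (T : 'I_m -> I) (g : 'I_m -> L) j0 : injective T -> (forall j, G (T j)) ->
  (forall j, g j != 0) -> exists2 eta, principal (A (T j0)) (g j0) (eta - 1) &
    forall j, j != j0 -> principal (A (T j)) (g j) eta.
Proof.
move=> injT GT g0; have [b mb hb] := separating_element j0 injT GT.
have /choice [M0 hM0] : forall j, exists M0, forall M, (M0 <= M)%N -> if j == j0 then
    principal (A (T j0)) (g j0) (b ^+ M) else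
    principal (A (T j)) (g j) (b^-1 ^+ M) /\ mideal (A (T j)) (b^-1 ^+ M).
  move=> j; have [_|nj] := eqVneq j j0; first by exact: pow_deep.
  have [x mx x0] := cv_nontriv hC (GT j); have sA := cv_ring (GT j).
  have b0 : b != 0.
    apply/eqP => b0; have [_] := mx; apply; have := hb j nj x^-1; rewrite b0 => -[q Aq e].
    by split=> //; [exact: midealW|rewrite e; apply: polyin_horner => //; exact: sr0].
  have [M1 h1] := inverse_deep (GT j) (hb j nj) b0 (g0 j).
  have [M2 h2] := inverse_deep (GT j) (hb j nj) b0 x0.
  exists (maxn M1 M2) => M; rewrite geq_max => /andP[/h1 ? /h2 [a Aa ea]]; split=> //.
  by rewrite ea mulrC; exact: midealM.
pose M := (\max_j M0 j).+1.
have hM j := hM0 j M (leqW (leq_bigmax j)).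
have sA := cv_ring (GT j0); have lA := cv_local hC (GT j0).
have mM : mideal (A (T j0)) (b ^+ M) by rewrite /M exprSr; apply: (midealM sA _ mb); apply: srX => //; exact: midealW mb.
have [u0 Au Au'] := unit_add lA (unit1 sA) mM.
(* Close to 1 where b is small, close to 0 where b^-1 is small. *)
exists (1 + b ^+ M)^-1.
  have := hM j0; rewrite eqxx => -[a Aa ea]; exists (- a * (1 + b ^+ M)^-1).
    by apply: srM => //; exact: srN.
  by rewrite mulrA mulrN -ea; field.
move=> j nj; have := hM j; rewrite (negbTE nj) => -[[a Aa ea] mj].
have sAj := cv_ring (GT j); have [v0 Av Av'] := unit_add (cv_local hC (GT j)) (unit1 sAj) mj.
have bM0 : b ^+ M != 0.
  apply: contraNneq v0 => e; have := hb j nj; move: e => /eqP; rewrite expf_eq0 /= => /eqP ->.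
  move=> full; case: (prime_n1 (local_prime (cv_local hC (GT j)))).
  have [x mx x0] := cv_nontriv hC (GT j); have [q Aq e] := full x^-1.
  have Ax' : A (T j) x^-1 by rewrite e; apply: polyin_horner => //; exact: sr0.
  by rewrite -(mulVf x0); exact: midealM.
exists (a * (1 + b^-1 ^+ M)^-1); first exact: srM.
rewrite mulrA -ea exprVn in v0 *; field.
by rewrite bM0 addrC u0.
Qed.

End PointsOfCurve.

(** * Growth of pole filtrations at one point *)

Section PoleFiltration.

(** For z = f / g these elements have denominator at most g^N; the growth in N of their dimension
    over B is what is compared. *)
Definition wsub (B : set L) z N : set L :=
  [set x | exists a : nat -> L, (forall j, B (a j)) /\ x = \sum_(j < N.+1) a j * z ^+ j].
Definition igen (B : set L) f g N : set L :=
  [set x | exists a : nat -> L, (forall j, B (a j)) /\ x = \sum_(j < N.+1) a j * (f ^+ j * g ^+ (N - j))].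
(** The dimension of B modulo these elements bounds the growth of the filtration by powers of z^-1,
    by [wsub_upper]. *)
Definition deep (B : set L) z : set L := B `&` scale z (adj B z).

Variables (B : set L) (hB : is_subring B) (bB : kk `<=` B).

Lemma ring_ksub : ksub B.
Proof.
split; [exact: sr0|move=> x y; exact: srD|move=> a x /bB Ba Bx; exact: srM].
Qed.

Lemma ksubS W : submod B W -> ksub W.
Proof. by move=> [W0 WD WM]; split=> // a x /bB; exact: WM. Qed.

Lemma sum_submod n (e : nat -> L) :
  submod B [set x | exists a : nat -> L, (forall j, B (a j)) /\ x = \sum_(j < n) a j * e j].
Proof.
split.
- by exists (fun _ => 0); split=> [_|]; [exact: sr0|rewrite big1 // => j _; rewrite mul0r].
- move=> _ _ [a [Ba ->]] [b [Bb ->]]; exists (fun j => a j + b j); split; first by move=> j; exact: srD.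
  by rewrite -big_split /=; apply: eq_bigr => j _; rewrite mulrDl.
- move=> c _ Bc [a [Ba ->]]; exists (fun j => c * a j); split; first by move=> j; exact: srM.
  by rewrite mulr_sumr; apply: eq_bigr => j _; rewrite mulrA.
Qed.

Lemma wsubS z N : submod B (wsub B z N).
Proof. exact: (sum_submod N.+1 (fun j => z ^+ j)). Qed.
Lemma igen_submod f g N : submod B (igen B f g N).
Proof. exact: (sum_submod N.+1 (fun j => f ^+ j * g ^+ (N - j))). Qed.

Lemma wsub_term z N j b : (j <= N)%N -> B b -> wsub B z N (b * z ^+ j).
Proof.
move=> jN Bb; exists (fun l => if l == j then b else 0); split.
  by move=> l; case: ifP => // _; exact: sr0.
rewrite (bigD1 (inord j)) //= inordK ?ltnS // eqxx big1 ?addr0 // => l nl.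
by case: eqP => [e|_]; [move: nl; rewrite -e inord_val eqxx|rewrite mul0r].
Qed.

Lemma wsub_sub W z N : submod B W -> (forall j, (j <= N)%N -> W (z ^+ j)) -> wsub B z N `<=` W.
Proof.
move=> hW h _ [a [Ba ->]]; apply: (submod_sum _ hW) => j _; case: hW => _ _ WM.
by apply: WM => //; apply: h; rewrite -ltnS.
Qed.

Lemma wsubX z N j : (j <= N)%N -> wsub B z N (z ^+ j).
Proof. by move=> jN; rewrite -[_ ^+ _]mul1r; apply: wsub_term => //; exact: sr1. Qed.

Lemma wsub_mono z N M : (N <= M)%N -> wsub B z N `<=` wsub B z M.
Proof.
move=> NM; apply: wsub_sub; first exact: wsubS.
by move=> j jN; apply: wsubX; exact: leq_trans NM.
Qed.

Lemma wsub0 z : wsub B z 0 = B.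
Proof.
apply/seteqP; split=> [_ [a [Ba ->]]|x Bx]; first by rewrite big_ord1 expr0 mulr1.
by rewrite -[x]mulr1 -(expr0 z); exact: wsub_term.
Qed.

Lemma sub_wsub z N : B `<=` wsub B z N.
Proof. by move=> x; rewrite -{1}(wsub0 z); exact: wsub_mono. Qed.

Lemma wsub_adj z x : adj B z x -> exists N, wsub B z N x.
Proof.
move=> [q Bq ->]; exists (size q), (fun j => q`_j); split=> //.
by rewrite (@horner_coef_wide _ (size q).+1).
Qed.

Lemma wsubM z N M x y : wsub B z N x -> wsub B z M y -> wsub B z (N + M) (x * y).
Proof.
move=> hx hy; have hW := wsubS z (N + M).
have : wsub B z M `<=` [set y | wsub B z (N + M) (x * y)].
  have [W0 WD WM] := hW; apply: wsub_sub => [|j jM].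
    split; first by rewrite /= mulr0.
    - by move=> u v hu hv; rewrite /= mulrDr; exact: WD.
    - by move=> a u Ba hu; rewrite /= mulrCA; exact: WM.
  move: hx => [a [Ba ->]]; rewrite /= mulr_suml; apply: (submod_sum _ hW) => l _.
  rewrite -mulrA -exprD; apply: wsub_term => //; apply: leq_add => //.
  by rewrite -ltnS.
exact.
Qed.

Lemma igenC f g N : igen B f g N = igen B g f N.
Proof.
suff h f' g' : igen B f' g' N `<=` igen B g' f' N by apply/seteqP; split; exact: h.
move=> _ [a [Ba ->]]; exists (fun j => a (N - j)%N); split=> //.
rewrite (reindex_inj rev_ord_inj); apply: eq_bigr => j _ /=.
have jN : (j <= N)%N by rewrite -ltnS.
by rewrite subSS subKn // [f' ^+ _ * _]mulrC.
Qed.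

Lemma scale_wsub f g N : g != 0 -> scale (g ^+ N) (wsub B (f / g) N) = igen B f g N.
Proof.
move=> g0; have e (a : nat -> L) : g ^+ N * \sum_(j < N.+1) a j * (f / g) ^+ j =
    \sum_(j < N.+1) a j * (f ^+ j * g ^+ (N - j)).
  rewrite mulr_sumr; apply: eq_bigr => j _; have jN : (j <= N)%N by rewrite -ltnS.
  by rewrite -{1}(subnK jN) exprD expr_div_n; field; rewrite expf_neq0.
apply/seteqP; split=> [_ [_ [a [Ba ->]] ->]|_ [a [Ba ->]]]; first by exists a.
by exists (\sum_(j < N.+1) a j * (f / g) ^+ j); [exists a|].
Qed.

Hypothesis finB : forall x, B x -> x != 0 -> kfin B (principal B x).
Local Notation len x := (qd B (principal B x)).

Lemma scale_comp x y : scale x (scale y B) = principal B (x * y).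
Proof.
apply/seteqP; split=> [_ [_ [a Ba ->] ->]|_ [a Ba ->]]; first by exists a; rewrite ?mulrA.
by exists (y * a); [exists a|rewrite mulrA].
Qed.

Lemma principal_sub x : B x -> principal B x `<=` B.
Proof. by move=> Bx _ [a Ba ->]; exact: srM. Qed.

Lemma lenM x y : B x -> B y -> x != 0 -> y != 0 -> len (x * y) = (len x + len y)%N.
Proof.
move=> Bx By x0 y0; have ks z : ksub (principal B z) by apply: ksubS; exact: principalS.
have sub : principal B (x * y) `<=` principal B x.
  by move=> _ [a Ba ->]; exists (y * a); rewrite ?mulrA //; exact: srM.
have [_ _ ->] := kfin_mid (ks _) sub (ks x) (principal_sub Bx) ring_ksub (finB (srM hB Bx By) (mulf_neq0 x0 y0)).
by congr (_ + _)%N; have [_ <-] := kfin_scale x0 (ks y) (finB By y0); rewrite scale_comp.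
Qed.

Lemma len_unit x : is_unit B x -> len x = 0%N.
Proof.
move=> [x0 Bx Bx']; apply: qdE; first by apply: ksubS; exact: principalS.
exists (fun _ => 0); split=> [[]//|y By|c _ []//]; exists (fun _ => 0); rewrite big_ord0 subr0.
by exists (x^-1 * y); [exact: srM|rewrite mulVKf].
Qed.

Lemma lenX x n : B x -> x != 0 -> len (x ^+ n) = (n * len x)%N.
Proof.
move=> Bx x0; elim: n => [|n IH]; first by rewrite expr0 len_unit //; exact: unit1.
by rewrite exprS lenM ?expf_neq0 //; [rewrite IH mulSn|exact: srX].
Qed.

(** Multiplication by g^N carries the N-th step to the ideal (f, g)^N, which lies between g^N B and
    B. This ideal is symmetric in f and g, so that zeros and poles can be compared. *)
Lemma wsub_dim f g N : B f -> B g -> f != 0 -> g != 0 -> kfin (wsub B (f / g) N) B /\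
  (N * len g = qd B (igen B f g N) + qd (wsub B (f / g) N) B)%N.
Proof.
move=> Bf Bg f0 g0; have gN : g ^+ N != 0 by rewrite expf_neq0.
have BgN : B (g ^+ N) by exact: srX.
have s1 : principal B (g ^+ N) `<=` igen B f g N.
  move=> _ [b Bb ->]; rewrite -scale_wsub //; exists b => //; exact: sub_wsub.
have s2 : igen B f g N `<=` B.
  by move=> _ [a [Ba ->]]; apply: (sr_sum hB) => j _; do !apply: srM => //; exact: srX.
have ki := ksubS (igen_submod f g N).
have kp : ksub (principal B (g ^+ N)) by apply: ksubS; exact: principalS.
have [_ h2 h3] := kfin_mid kp s1 ki s2 ring_ksub (finB BgN gN).
have gN' : (g ^+ N)^-1 != 0 by rewrite invr_eq0.
have kW : kfin (wsub B (f / g) N) B.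
  have [] := kfin_scale gN' kp h2.
  by rewrite -scale_wsub // (scaleK _ gN) (scaleK B gN).
split=> //; rewrite -lenX // h3; congr (_ + _)%N.
by have [_ <-] := kfin_scale gN ring_ksub kW; rewrite scale_wsub.
Qed.

Lemma deep_submod z : submod B (deep B z).
Proof.
have hA := adj_sr hB z; split.
- by split; [exact: sr0|exists 0; rewrite ?mulr0 //; exact: sr0].
- move=> x y [Bx [a Aa ex]] [By [b Ab ey]]; split; first exact: srD.
  by exists (a + b); [exact: srD|rewrite ex ey mulrDr].
- move=> c x Bc [Bx [a Aa ex]]; split; first exact: srM.
  by rewrite ex; exists (c * a); [apply: srM => //; exact: sub_adj|rewrite mulrCA].
Qed.

Lemma deep_dim f g : B f -> B g -> f != 0 -> g != 0 ->
  kfin B (deep B (f / g)) /\ kfin (deep B (f / g)) (principal B f).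
Proof.
move=> Bf Bg f0 g0; have kp : ksub (principal B f) by apply: ksubS; exact: principalS.
have s1 : principal B f `<=` deep B (f / g).
  move=> _ [a Ba ->]; split; first exact: srM.
  by exists (g * a); [apply: sub_adj => //; exact: srM|field].
by have [] := kfin_mid kp s1 (ksubS (deep_submod (f / g))) (@subIsetl _ _ _) ring_ksub (finB Bf f0).
Qed.

(** For large N, y^(N+1) times [deep B z] falls into the N-th step, so the next step adds at most
    the dimension of B modulo deep. Finitely many elements span deep modulo f B, which makes the
    threshold N0 uniform. *)
Lemma wsub_upper f g : B f -> B g -> f != 0 -> g != 0 -> exists C, forall N,
  (qd (wsub B (g / f) N) B <= C + N * qd B (deep B (f / g)))%N.
Proof.
move=> Bf Bg f0 g0; pose y := g / f; pose z := f / g.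
have y0 : y != 0 by rewrite mulf_neq0 ?invr_eq0.
have yz : y * z = 1 by rewrite /y /z; field; rewrite f0 g0.
have zy : z * y = 1 by rewrite mulrC.
have [[d hd] [r [h [Hh sh _]]]] := deep_dim Bf Bg f0 g0; rewrite -/z in hd Hh.
have kd := ksubS (deep_submod z); rewrite (qdE kd hd); have [b [Bb sb _]] := hd.
have kw N := ksubS (wsubS y N).
have /choice [n hn] : forall l, exists n, forall N, (n <= N)%N -> wsub B y N (h l * y ^+ N.+1).
  move=> l; have [_ [x [q Bq ->] ->]] := Hh l; exists (size q) => N qN.
  have -> : z * q.[z] * y ^+ N.+1 = q.[z] * y ^+ N.
    by rewrite exprS; transitivity (z * y * (q.[z] * y ^+ N)); [ring|rewrite zy mul1r].
  rewrite horner_coef mulr_suml.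
  apply: (submod_sum _ (wsubS y N)) => j _.
  have jN := leq_trans (ltnW (ltn_ord j)) qN.
  rewrite -(subnKC jN) exprD -mulrA (mulrA (z ^+ j)) -exprMn zy expr1n mul1r.
  by apply: wsub_term => //; rewrite subnKC // leq_subr.
pose N0 := \max_l n l.
have step N : (N0 <= N)%N -> (qd (wsub B y N.+1) B <= d + qd (wsub B y N) B)%N.
  move=> N0N; have [Wf0 _ _] := wsubS y N.
  have WH x : deep B z x -> wsub B y N (x * y ^+ N.+1).
    move=> /sh [c [a Ba ex]]; have [_ WD WM] := wsubS y N.
    have -> : x = f * a + \sum_j iota (c j) * h j by rewrite -ex subrK.
    rewrite mulrDl; apply: WD.
      have -> : f * a * y ^+ N.+1 = (g * a) * y ^+ N by rewrite exprS /y; field.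
      by apply: wsub_term => //; exact: srM.
    rewrite mulr_suml; apply: (submod_sum _ (wsubS y N)) => l _; rewrite -mulrA.
    apply: WM; first by apply: bB; exists (c l).
    by apply: hn; apply: leq_trans N0N; exact: leq_bigmax.
  have sp : @kspan (wsub B y N.+1) (wsub B y N) d (fun j => b j * y ^+ N.+1).
    move=> _ [a [Ba ->]]; have [c hc] := sb _ (Ba N.+1); exists c.
    rewrite big_ord_recr /= -addrA; have [_ WD _] := wsubS y N; apply: WD; first by exists a.
    have -> : a N.+1 * y ^+ N.+1 - \sum_j iota (c j) * (b j * y ^+ N.+1) =
      (a N.+1 - \sum_j iota (c j) * b j) * y ^+ N.+1.
      by rewrite mulrBl mulr_suml; congr (_ - _); apply: eq_bigr => j _; rewrite mulrA.
    exact: WH.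
  have [_ le] := qd_le (kw N) sp.
  have [kW _] := wsub_dim N.+1 Bg Bf g0 f0.
  have [_ _ ->] := kfin_mid ring_ksub (sub_wsub y N) (kw N) (wsub_mono (leqnSn N)) (kw _) kW.
  by rewrite leq_add2r.
exists (qd (wsub B y N0) B) => N; have [NN0|N0N] := leqP N N0.
  have [kW _] := wsub_dim N0 Bg Bf g0 f0; apply: leq_trans (leq_addr _ _).
  by have [_ _ ->] := kfin_mid ring_ksub (sub_wsub y N) (kw N) (wsub_mono NN0) (kw _) kW; exact: leq_addl.
rewrite -(subnK (ltnW N0N)); elim: (N - N0)%N => [|m IH]; first by rewrite leq_addr.
rewrite addSn; apply: leq_trans (step _ (leq_addl _ _)) _; rewrite mulSn addnCA leq_add2l.
exact: IH.
Qed.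

(** For algebraic z the powers of y = z^-1 lie in one step of the filtration, whose dimension is
    then bounded; so N len f exceeds N len g by a bounded amount at most. *)
Lemma alg_len f g : B f -> B g -> f != 0 -> g != 0 -> alg kk (f / g) -> (len f <= len g)%N.
Proof.
move=> Bf Bg f0 g0 az; pose z := f / g; pose y := g / f.
have z0 : z != 0 by rewrite mulf_neq0 ?invr_eq0.
have [q [bq q0 rq]] := az; rewrite -/z in rq.
have [n [u [eq bu u0]]] := poly_lowest q0 bq.
have ru : root u z by move: rq; rewrite eq rootE hornerM hornerXn mulf_eq0 expf_eq0 (negbTE z0) andbF orbF.
pose D := (size u).-1; have su : (size u = D.+1)%N.
  by rewrite /D prednK // size_poly_gt0; apply: contraNneq u0 => ->; rewrite coef0.
have yz : z * y = 1 by rewrite /y /z; field; rewrite f0 g0.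
have yD : wsub B y D (y ^+ D.+1).
  have : u.[z] * y ^+ D.+1 = 0 by move: ru; rewrite rootE => /eqP ->; rewrite mul0r.
  rewrite horner_coef su big_ord_recl /= expr0 mulr1 mulrDl => /eqP; rewrite addr_eq0 => /eqP e.
  have -> : y ^+ D.+1 = - (u`_0)^-1 * (\sum_(i < D) u`_(lift ord0 i) * z ^+ lift ord0 i * y ^+ D.+1).
    by rewrite -mulr_suml mulNr mulrC -mulNr -e mulrAC divff // mul1r.
  have hW := wsubS y D; have [_ _ WM] := hW; apply: WM.
    by rewrite -mulN1r; apply: srM => //; [apply: srN => //; exact: sr1|apply: bB; apply: (base_sf iota).2; exact: bu].
  apply: (submod_sum _ hW) => i _; rewrite /= /bump /= add1n.
  have -> : y ^+ D.+1 = y ^+ i.+1 * y ^+ (D - i) by rewrite -exprD; congr (_ ^+ _); have := ltn_ord i; lia.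
  rewrite -mulrA (mulrA (z ^+ _)) -exprMn yz expr1n mul1r; apply: wsub_term; first exact: leq_subr.
  by apply: bB; exact: bu.
have yN N : wsub B y D (y ^+ N).
  elim: N => [|N IH]; first by apply: wsubX; rewrite leq0n.
  have : wsub B y D `<=` [set x | wsub B y D (x * y)].
    have [W0 WD WM] := wsubS y D; apply: wsub_sub => [|j jD].
      split; first by rewrite /= mul0r.
      - by move=> a b ha hb; rewrite /= mulrDl; exact: WD.
      - by move=> c a Bc ha; rewrite /= -mulrA; exact: WM.
    rewrite /= -exprSr; move: jD; rewrite leq_eqVlt => /orP[/eqP ->//|jD].
    exact: wsubX.
  by move=> /(_ _ IH); rewrite exprSr.
have kw N := ksubS (wsubS y N).
set C := qd (wsub B y D) B.
have bnd N : (qd (wsub B y N) B <= C)%N.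
  have [kW _] := wsub_dim D Bg Bf g0 f0.
  have sub : wsub B y N `<=` wsub B y D by apply: wsub_sub => [|j _]; [exact: wsubS|exact: yN].
  by rewrite /C; have [_ _ ->] := kfin_mid ring_ksub (sub_wsub y N) (kw N) sub (kw _) kW; exact: leq_addl.
rewrite leqNgt; apply/negP => lt.
have [_ e1] := wsub_dim C.+1 Bg Bf g0 f0; have [_ e2] := wsub_dim C.+1 Bf Bg f0 g0.
rewrite igenC in e1; have := bnd C.+1; rewrite -/y in e1.
by have := leq_mul (leqnn C.+1) lt; rewrite mulnS; lia.
Qed.

End PoleFiltration.

(** * Zeros and poles of a rational function on a complete curve *)

Section CurveDegree.
Hypothesis hdep : forall x y, ~ trtower kk [:: x; y].
Context {I : choiceType} (G : set I) (A : I -> set L) (hC : curve G A).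

Lemma transc_val z : ~ alg kk z -> exists V, [/\ valuation_ring V, kk `<=` V & mideal V z].
Proof.
move=> nz; have sb := base_sr iota; have sC := adj_sr sb z.
have [|V [hV CV mV]] := chevalley sC (principalI sC (adj_gen sb z)).
  move=> [_ [q bq ->] e]; apply: nz; exists ('X * q - 1); split.
  - by apply: (polyinB sb); [apply: (polyinM sb) => //; exact: polyinX|exact: (polyinC sb (sr1 sb))].
  - apply/eqP => e0; have := congr1 (fun f : {poly L} => f`_0) e0.
    by rewrite coefB coefXM coef1 coef0 sub0r => /eqP; rewrite oppr_eq0 oner_eq0.
  - by rewrite rootE hornerD hornerM hornerX hornerN hornerC -e subrr.
exists V; split=> //; first exact: (subset_trans (sub_adj sb z) CV).
by apply: mV; exists 1; [exact: sr1|rewrite mulr1].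
Qed.

Lemma mideal_nV (V : set L) z : mideal V z -> z != 0 -> ~ V z^-1.
Proof. by move=> [Vz nz] z0 Vz'; apply: nz. Qed.

Lemma algV z : alg kk z -> z != 0 -> alg kk z^-1.
Proof.
move=> az z0; apply: contrapT => /transc_val [V [hV bV mz]].
have := mideal_nV mz; rewrite invr_eq0 invrK => /(_ z0); apply; exact: (val_alg hV bV az).
Qed.

Lemma transc_nz z : ~ alg kk z -> z != 0.
Proof.
move=> nz; apply/eqP => z0; apply: nz; exists 'X; split.
- exact: (polyinX (base_sr iota)).
- by rewrite polyX_eq0.
- by rewrite rootE hornerX z0.
Qed.

Lemma transc_pole z : ~ alg kk z -> exists2 i, G i & ~ A i z^-1.
Proof.
move=> nz; have [V [hV bV mz]] := transc_val nz; have nV := mideal_nV mz (transc_nz nz).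
have [i Gi [AV _]] := cv_proper hC hV bV (ex_intro (fun x => ~ V x) _ nV).
by exists i => // /AV.
Qed.

Lemma alg_not_deep i s : G i -> mideal (A i) s -> alg kk s^-1 -> s = 0.
Proof.
move=> Gi ms as'; apply: contrapT => /eqP s0.
have [V [hV [AV mAV]]] := val_dominating (cv_local hC Gi).
have [Vs] := mAV s ms; apply; split=> //.
apply: (val_alg hV _ as') => x /(cv_base hC Gi); exact: AV.
Qed.

(** If s^-1 were transcendental, s would fail to be regular somewhere. If it is algebraic, it lies
    in every valuation ring over k, so a nonzero s cannot lie in a maximal ideal. *)
Lemma global_nil i0 s : (forall i, G i -> A i s) -> G i0 -> mideal (A i0) s -> s = 0.
Proof.
move=> hs G0 ms; apply: (alg_not_deep G0 ms); apply: contrapT => /transc_pole [i Gi].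
by rewrite invrK => nA; apply: nA; exact: hs.
Qed.

Section Transcendental.
Variables (z : L) (nz : ~ alg kk z) (m : nat) (T : 'I_m -> I) (injT : injective T)
  (GT : forall j, G (T j)) (hT : forall i, G i -> (forall j, T j <> i) -> A i z /\ A i z^-1).
Variables (f g : 'I_m -> L) (Af : forall j, A (T j) (f j)) (Ag : forall j, A (T j) (g j))
  (f0 : forall j, f j != 0) (g0 : forall j, g j != 0) (ez : forall j, z = f j / g j).

Let sA j := cv_ring hC (GT j).
Let bA j := cv_base hC (GT j).
Let kA j := ring_ksub (sA j) (bA j).
Let fA j x := @cv_fin _ _ _ hC (T j) x (GT j).
Local Notation len j x := (qd (A (T j)) (principal (A (T j)) x)).

Definition lfree (J : finType) (e : J -> L) := forall c : J -> {poly L}, (forall j, polyin kk (c j)) ->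
  \sum_j (c j).[z] * e j = 0 -> forall j, c j = 0.

(** Only finitely many points are bad for x = a / b. At such a point b satisfies an equation over
    k[z] with nonzero constant term d(z), and d(z) / b is then a polynomial in b and z. *)
Lemma denominator x : exists c : {poly L}, [/\ polyin kk c, c != 0 &
  forall i, G i -> adj (A i) z (c.[z] * x)].
Proof.
have sb := base_sr iota.
have /finite_seqP [s es] := cv_finite hC x.
have {es} sP i : G i -> i \in s \/ A i x.
  move=> Gi; have [Ax|nA] := pselect (A i x); [by right|left].
  by have : [set` s] i by rewrite -es.
suff [c [bc c0 hc]] : exists c : {poly L}, [/\ polyin kk c, c != 0 &
    forall i, G i -> i \in s -> adj (A i) z (c.[z] * x)].
  exists c; split=> // i Gi; case: (sP i Gi) => [is'|Ax]; first exact: hc.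
  have sAi := cv_ring hC Gi; have sC := adj_sr sAi z.
  apply: (srM sC); last exact: sub_adj.
  by exists c => // j; apply: (cv_base hC Gi); exact: bc.
elim: (s) => [|i s' [c [bc c0 hc]]].
  by exists 1; split; [exact: (polyinC sb (sr1 sb))|exact: oner_neq0|].
have [Gi|nG] := pselect (G i); last first.
  by exists c; split=> // j Gj; rewrite inE => /orP[/eqP e|]; [case: nG; rewrite -e|exact: hc].
have sAi := cv_ring hC Gi; have sC := adj_sr sAi z.
have [a [b [Aa Ab b0 ex]]] := cv_frac hC Gi x.
have ab : alg (fadj kk z) b by apply: contrapT => nb; apply: (hdep (x := z) (y := b)).
have [q [Aq q0 rq]] := alg_fadj_rel ab b0; have [d bd ed] := Aq 0%N.
have d0 : d != 0 by apply: contraNneq q0 => d0; rewrite ed d0 horner0.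
exists (c * d); split; [exact: polyinM|exact: mulf_neq0|].
have inA j h : G j -> polyin kk h -> adj (A j) z h.[z].
  by move=> Gj bh; exists h => // l; apply: (cv_base hC Gj); exact: bh.
move=> j Gj; rewrite inE => /orP[/eqP e|js]; last first.
  rewrite hornerM mulrAC; apply: (srM (adj_sr (cv_ring hC Gj) z)); last exact: inA.
  exact: hc.
rewrite {j Gj}e hornerM -mulrA; apply: (srM sC); first exact: inA.
rewrite -ed ex; have : q.[b] = 0 by apply/eqP.
rewrite -[q in q.[b]]coefK horner_poly -(prednK (n := size q)) ?size_poly_gt0; last first.
  by apply: contraNneq q0 => ->; rewrite coef0.
rewrite big_ord_recl /= expr0 mulr1 => /eqP; rewrite addr_eq0 => /eqP ->.
rewrite -sumrN mulr_suml; apply: (sr_sum sC) => l _.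
have -> : - (q`_(lift ord0 l) * b ^+ lift ord0 l) * (a / b) = - (q`_l.+1 * (b ^+ l * a)).
  by rewrite /= /bump /= add1n exprS; field.
apply: (srN sC); apply: (srM sC); last by apply: (sub_adj sAi); apply: srM => //; exact: srX.
by have [h bh ->] := Aq l.+1; exact: inA.
Qed.

(** The products e'_j z^n lie in the filtration at every point of T. Were there more of them than
    conditions, a nonzero combination would be regular everywhere and vanish at one point, hence be
    zero, against independence over k(z). *)
Lemma lower_bound (J : finType) (e : J -> L) : lfree e -> exists c h, forall N,
  (#|J| * N.+1 <= h + \sum_j qd (wsub (A (T j)) z (N + c)) (A (T j)))%N.
Proof.
move=> fe; have /choice [d hd] := fun j => denominator (e j).
pose e' j := (d j).[z] * e j.
have Ae' j i : G i -> adj (A i) z (e' j) by have [_ _] := hd j; exact.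
have /choice [c hc] : forall l, exists c, forall j, wsub (A (T l)) z c (e' j).
  move=> l; have /choice [c hc] := fun j => wsub_adj (Ae' j (T l) (GT l)).
  exists (\max_j c j) => j; apply: (wsub_mono (sA l) (leq_bigmax j)); exact: hc.
pose C := \max_l c l.
have [i0 G0 nA0] := transc_pole nz.
have [l0 el0] : exists l, T l = i0.
  apply: contrapT => no; have [_ h] := hT G0 (fun j ej => no (ex_intro _ j ej)); exact: nA0.
have [x mx x0] := cv_nontriv hC (GT l0).
have lA := cv_local hC (GT l0); have km : ksub (mideal (A (T l0))).
  by apply: (ksubS (bA l0)); exact: lA.2.
have pm : principal (A (T l0)) x `<=` mideal (A (T l0)).
  by move=> _ [a Aa ->]; rewrite mulrC; exact: (midealM (sA l0) Aa mx).
have [kfm _ _] := kfin_mid (ksubS (bA l0) (principalS x (sA l0))) pm km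
  (@midealW _ _) (kA l0) (fA (midealW mx) x0).
exists C, (qd (A (T l0)) (mideal (A (T l0)))) => N.
pose W l := wsub (A (T l)) z (N + C).
have kW l : ksub (W l) by apply: (ksubS (bA l)); exact: wsubS.
have fW l : kfin (W l) (A (T l)).
  by have [h _] := wsub_dim (sA l) (bA l) (fA (j := l)) (N + C) (Af l) (Ag l) (f0 l) (g0 l); rewrite /W (ez l).
have fWm : kfin (W l0) (mideal (A (T l0))).
  exact: (kfin_tower km (@midealW _ _) (kA l0) (sub_wsub (sA l0) z (N + C)) (kW l0) (fW l0) kfm).
(* At one point the maximal ideal replaces the local ring, so that a combination regular everywhere
   also vanishes there; h is the cost of this condition. *)
pose M l := if l == l0 then mideal (A (T l0)) else A (T l).
have kM l : ksub (M l) by rewrite /M; case: eqP.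
have fM l : kfin (W l) (M l) by rewrite /M; case: eqP => [->|].
have dM : (\sum_l qd (W l) (M l) = qd (A (T l0)) (mideal (A (T l0))) +
    \sum_j qd (W j) (A (T j)))%N.
  rewrite (bigD1 l0) //= [in RHS](bigD1 l0) //= {1}/M eqxx addnA; congr (_ + _)%N.
    have [_ _ ->] := kfin_mid km (@midealW _ _) (kA l0) (sub_wsub (sA l0) z (N + C)) (kW l0) fWm.
    exact: addnC.
  by apply: eq_bigr => l nl; rewrite /M (negbTE nl).
rewrite -dM leqNgt; apply/negP => lt.
have hq l := qdP (kM l) (fM l).
pose b l := sval (cid (hq l)).
have hb l : kspan (W l) (M l) (b l) by rewrite /b; case: cid => ? [].
pose v (q : J * 'I_N.+1) := e' q.1 * z ^+ q.2.
have Wv l q : W l (v q).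
  rewrite /W addnC; apply: (wsubM (sA l)); last by apply: wsubX; rewrite // -ltnS.
  by apply: (wsub_mono (sA l) (leq_bigmax l)); exact: hc.
have [|a [[q nq] ha]] := multi_dep kM hb (J := (J * 'I_N.+1)%type) Wv.
  by rewrite card_prod card_ord.
set s := \sum_(q : J * 'I_N.+1) _ in ha.
have s0 : s = 0.
  have MA l : M l `<=` A (T l) by move=> y; rewrite /M; case: eqP => [->|//]; exact: midealW.
  apply: (global_nil (i0 := T l0)); [|exact: GT|by have := ha l0; rewrite /M eqxx].
  move=> i Gi; have [[l <-]|no] := pselect (exists l, T l = i); first by apply: MA.
  have sAi := cv_ring hC Gi; have bAi := cv_base hC Gi.
  have [Az _] := hT Gi (fun j ej => no (ex_intro _ j ej)).
  have adjA : adj (A i) z `<=` A i by exact: adj_min.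
  apply: (sr_sum sAi) => -[j n] _; apply: (srM sAi); first by apply: bAi; exists (a (j, n)).
  by apply: (srM sAi); [apply: adjA; exact: Ae'|exact: srX].
pose P j := \poly_(n < N.+1) iota (oapp (fun n => a (j, n)) 0 (insub n)).
have eP j (n : 'I_N.+1) : (P j)`_n = iota (a (j, n)) by rewrite coef_poly ltn_ord valK.
have h1 j : polyin kk (P j).
  by move=> n; rewrite coef_poly; case: ifP => _; [eexists|exists 0; rewrite rmorph0].
have h2 : \sum_j (P j * d j).[z] * e j = s.
  transitivity (\sum_(j : J) \sum_(n < N.+1) iota (a (j, n)) * (e' j * z ^+ n)); last first.
    by rewrite pair_bigA /s; apply: eq_bigr => -[j n] _.
  apply: eq_bigr => j _; rewrite hornerM -mulrA -/(e' j) horner_poly mulr_suml.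
  by apply: eq_bigr => n _; have := eP j n; rewrite coef_poly ltn_ord => ->; ring.
have : P q.1 * d q.1 = 0.
  apply: (fe (fun j => P j * d j)) => [l|]; last by rewrite h2 s0.
  by apply: (polyinM (base_sr iota)) => //; case: (hd l).
move/eqP; rewrite mulf_eq0; have [_ /negbTE -> _] := hd q.1; rewrite orbF => /eqP e0.
by have := eP q.1 q.2; rewrite e0 coef0 -surjective_pairing => /esym/eqP; rewrite fmorph_eq0 (negbTE nq).
Qed.

(** Weak approximation lifts bases of all quotients of A_j by its deep part to functions that are
    small at the other points. In a relation over k[z], reduction modulo z at each point kills the
    constant coefficients, and division by z lowers the degrees. *)
Lemma deep_family : exists (J : finType) (e : J -> L),
  #|J| = (\sum_j qd (A (T j)) (deep (A (T j)) z))%N /\ lfree e.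
Proof.
have kd j : ksub (deep (A (T j)) z) by apply: (ksubS (bA j)); exact: deep_submod.
have fd j : kfin (A (T j)) (deep (A (T j)) z).
  by have [h _] := deep_dim (sA j) (bA j) (fA (j := j)) (Af j) (Ag j) (f0 j) (g0 j); rewrite (ez j).
pose n j := qd (A (T j)) (deep (A (T j)) z).
pose b j : 'I_(n j) -> L := sval (cid (qdP (kd j) (fd j))).
have Ab j l : A (T j) (b j l) by rewrite /b; case: cid => ? [].
have fb j : kfree (deep (A (T j)) z) (b j) by rewrite /b; case: cid => ? [].
pose J : finType := {j : 'I_m & 'I_(n j)}; pose tg j (l : 'I_(n j)) : J := Tagged (fun j => 'I_(n j)) l.
pose B j := adj (A (T j)) z.
have sB j : is_subring (B j) by exact: adj_sr.
have /choice [e he] : forall q : J, exists x,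
    scale z (B (tag q)) (x - b _ (tagged q)) /\ forall l, l != tag q -> scale z (B l) x.
  move=> [j l] /=.
  have /choice [v hv] : forall j', exists v, [/\ A (T j') v, v != 0 & A (T j') (v * b j l)].
    by move=> j'; exact: frac_exn (cv_frac hC (GT j')).
  have [|eta h1 h2] := weak_approx hdep hC (g := fun j' => f j' * v j') j injT GT.
    by move=> j'; rewrite mulf_neq0 //; case: (hv j').
  have deepP j' a : A (T j') a -> scale z (B j') (f j' * a).
    move=> Aa; exists (g j' * a); first by apply: sub_adj => //; exact: srM.
    by rewrite mulrA {1}(ez j') divfK.
  exists (eta * b j l); split=> [|j' nj].
    have [a Aa ea] := h1; have -> : eta * b j l - b j l = f j * (a * (v j * b j l)).
      have -> : eta * b j l - b j l = (eta - 1) * b j l by ring.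
      by rewrite ea; ring.
    by apply: deepP; apply: srM => //; case: (hv j).
  have [a Aa ->] := h2 j' nj; have -> : f j' * v j' * a * b j l = f j' * (a * (v j' * b j l)) by ring.
  by apply: deepP; apply: srM => //; case: (hv j').
exists J, e; split.
  by rewrite card_tagged sumnE big_map big_enum; apply: eq_bigr => j _; rewrite card_ord.
have zB j : scale z (B j) `<=` B j.
  by move=> _ [a Ba ->]; apply: (srM (sB j)) => //; exact: adj_gen.
have z0 := transc_nz nz.
have ksc j : submod (B j) (scale z (B j)) by exact: principalS.
have eB j q : B j (e q).
  have [h1 h2] := he q; have [ej|nj] := eqVneq j (tag q); last by apply: zB; exact: h2.
  rewrite ej -[e q](subrK (b _ (tagged q))); apply: (srD (sB _)); first exact: zB.
  by apply: sub_adj.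
have sD j := @submodB _ _ (sB j) _ ^~ _.
move=> c bc rel; suff h N (c' : J -> {poly L}) : (forall j, polyin kk (c' j)) ->
    (forall j, size (c' j) <= N)%N -> \sum_j (c' j).[z] * e j = 0 -> forall j, c' j = 0.
  by apply: (h (\max_j size (c j))%N) => // j; exact: leq_bigmax.
elim: N c' => [c' _ sc _ j|N IH c' bc' sc rel'].
  by apply/eqP; rewrite -size_poly_leq0.
have /choice [h hh] : forall q, exists h, [/\ polyin kk h, (size h <= N)%N & c' q = h * 'X + ((c' q)`_0)%:P].
  move=> q; exists (\poly_(i < N) (c' q)`_i.+1); split.
  - by move=> i; rewrite coef_poly; case: ifP => _; [exact: bc'|exists 0; rewrite rmorph0].
  - exact: size_poly.
  - apply/polyP => -[|i]; rewrite coefD coefMX coefC /= ?add0r // addr0 coef_poly.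
    by case: ltnP => // sz; rewrite nth_default //; apply: leq_trans (sc q) _.
have inB j f' : polyin kk f' -> B j f'.[z] by move=> bf; exists f' => // i; apply: bA; exact: bf.
have c0 q : (c' q)`_0 = 0.
  have /choice [a ea] : forall q : J, exists a : k, (c' q)`_0 = iota a.
    by move=> q'; have [a ->] := bc' q' 0%N; exists a.
  case: q => j l; suff : a (tg j l) = 0 by rewrite ea => ->; rewrite rmorph0.
  apply: (fb j (fun l => a (tg j l))); split.
    by apply: (sr_sum (sA j)) => l' _; apply: (srM (sA j)) => //; apply: bA; eexists.
  have h1 : scale z (B j) (\sum_q iota (a q) * e q).
    have -> : \sum_q iota (a q) * e q = \sum_q (- (z * ((h q).[z] * e q))).
      apply/eqP; rewrite -subr_eq0 -sumrB -[X in _ == X]rel'; apply/eqP/eq_bigr => q _; have [_ _ ->] := hh q; rewrite hornerD hornerM hornerX hornerC ea; ring.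
    apply: (submod_sum _ (ksc j)) => q _; exists (- ((h q).[z] * e q)); last by rewrite mulrN.
    by apply: (srN (sB j)); apply: (srM (sB j)) => //; apply: inB; case: (hh q).
  have ks := ksc j.
  have e1 : \sum_q iota (a q) * e q = \sum_i \sum_(l < n i) iota (a (tg i l)) * e (tg i l).
    rewrite (sig_big_dep xpredT (fun _ => xpredT) (fun i (l : 'I_(n i)) => iota (a (tg i l)) * e (tg i l))).
    by apply: eq_bigr => -[].
  rewrite e1 in h1.
  pose s1 := \sum_(i | i != j) \sum_(l < n i) iota (a (tg i l)) * e (tg i l).
  pose s2 := \sum_(l < n j) iota (a (tg j l)) * e (tg j l).
  have {}h1 : scale z (B j) (s2 + s1) by move: h1; rewrite (bigD1 j).
  have hs1 : scale z (B j) s1.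
    apply: (submod_sum _ ks) => i ni; apply: (submod_sum _ ks) => l' _; case: (ks) => _ _; apply.
      by apply: sub_adj => //; apply: bA; eexists.
    by have [_ h2] := he (tg _ l'); apply: h2; rewrite eq_sym.
  have hs2 : scale z (B j) s2 by rewrite -(addrK s1 s2); apply: (submodB (sB j) ks).
  rewrite -[X in scale _ _ X](subKr s2); apply: (submodB (sB j) ks) => //.
  rewrite -sumrB; apply: (submod_sum _ ks) => l' _; rewrite -mulrBr; case: (ks) => _ _; apply.
    by apply: sub_adj => //; apply: bA; eexists.
  by have [h2 _] := he (tg _ l').
have hz : forall q, h q = 0.
  apply: IH => [q|q|]; [by case: (hh q)|by case: (hh q)|].
  apply: (mulfI z0); rewrite mulr0 -[RHS]rel' mulr_sumr; apply: eq_bigr => q _.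
  by have [_ _ ->] := hh q; rewrite c0 addr0 hornerM hornerX; ring.
by move=> q; have [_ _ ->] := hh q; rewrite c0 hz mul0r add0r.
Qed.

(** N times the excess of zeros over poles is the dimension of the filtration for z^-1 minus that
    for z. The first grows at most like |J| N, by [wsub_upper], and the second at least so, by
    [lower_bound]; a positive excess would be unbounded. *)
Lemma zeros_le_poles : (\sum_j len j (f j) <= \sum_j len j (g j))%N.
Proof.
have [J [e [cJ fe]]] := deep_family; have [c [h hlow]] := lower_bound fe.
have /choice [C hC'] : forall j, exists C, forall N, (qd (wsub (A (T j)) z^-1 N) (A (T j)) <=
    C + N * qd (A (T j)) (deep (A (T j)) z))%N.
  move=> j; have [C hC'] := wsub_upper (sA j) (bA j) (fA (j := j)) (Af j) (Ag j) (f0 j) (g0 j).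
  by exists C => N; have := hC' N; rewrite -(ez j) (_ : g j / f j = z^-1) // (ez j) invf_div.
set F := (\sum_j _)%N; set F' := (\sum_j _)%N.
pose S N := (\sum_j qd (wsub (A (T j)) z N) (A (T j)))%N.
pose S' N := (\sum_j qd (wsub (A (T j)) z^-1 N) (A (T j)))%N.
(* [wsub_dim] for f / g and for g / f, with the same ideal by [igenC]. *)
have eN N : (N * F' + S' N = N * F + S N)%N.
  rewrite !big_distrr /= -!big_split /=; apply: eq_bigr => j _.
  have [_ h1] := wsub_dim (sA j) (bA j) (fA (j := j)) N (Af j) (Ag j) (f0 j) (g0 j).
  have [_ h2] := wsub_dim (sA j) (bA j) (fA (j := j)) N (Ag j) (Af j) (g0 j) (f0 j).
  have ez' : z^-1 = g j / f j by rewrite (ez j) invf_div.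
  rewrite -(ez j) in h1; rewrite -ez' igenC in h2; rewrite /= in h1 h2 *; lia.
have up N : (S' N <= \sum_j C j + N * #|J|)%N.
  by rewrite cJ big_distrr /= -big_split /=; apply: leq_sum => j _.
rewrite leqNgt; apply/negP => lt.
have [N eN'] : exists N, N = (h + \sum_j C j + c * #|J|).+1 by eexists.
have h1 := hlow N; have h2 := up (N + c)%N; have h3 := eN (N + c)%N.
rewrite -/(S _) in h1; have h4 : ((N + c) * F'.+1 <= (N + c) * F)%N by rewrite leq_mul2l lt orbT.
move: h1 h2 h3 h4; rewrite !mulnS !mulnDl; lia.
Qed.

End Transcendental.

Lemma curve_degree z m (T : 'I_m -> I) (f g : 'I_m -> L) : z != 0 -> injective T ->
  (forall j, G (T j)) -> (forall i, G i -> (forall j, T j <> i) -> A i z /\ A i z^-1) ->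
  (forall j, [/\ A (T j) (f j), A (T j) (g j), f j != 0, g j != 0 & z = f j / g j]) ->
  (\sum_j qd (A (T j)) (principal (A (T j)) (f j)) =
   \sum_j qd (A (T j)) (principal (A (T j)) (g j)))%N.
Proof.
move=> z0 injT GT hT h; have Af j : A (T j) (f j) by case: (h j).
have Ag j : A (T j) (g j) by case: (h j).
have f0 j : f j != 0 by case: (h j).
have g0 j : g j != 0 by case: (h j).
have ez j : z = f j / g j by case: (h j).
have ez' j : z^-1 = g j / f j by rewrite (ez j) invf_div.
have [az|nz] := pselect (alg kk z).
  have az' := algV az z0.
  apply: eq_bigr => j _; apply/eqP; rewrite eqn_leq.
  have sA := cv_ring hC (GT j); have bA := cv_base hC (GT j).
  have fA x := cv_fin hC (GT j) (x := x).
  by rewrite !(alg_len sA bA fA) // -?ez -?ez'.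
have nz' : ~ alg kk z^-1 by move=> /algV; rewrite invrK invr_eq0 => /(_ z0).
apply/eqP; rewrite eqn_leq (zeros_le_poles nz injT GT hT Af Ag f0 g0 ez).
rewrite (zeros_le_poles nz' injT GT _ Ag Af g0 f0 ez') // => i Gi ni.
by rewrite invrK; have [] := hT i Gi ni.
Qed.

End CurveDegree.

End Curves.

(** * Regular local rings of dimension two *)

Section RegularPlane.
Context {K : fieldType}.
Variables (Q : set K) (x y : K) (lQ : local Q) (nQ : noeth Q).
Hypotheses (Qx : mideal Q x) (Qy : mideal Q y) (x0 : x != 0)
  (hm : forall z, mideal Q z -> exists a b, [/\ Q a, Q b & z = a * x + b * y])
  (hxy : forall n, ~ principal Q x (y ^+ n)).

Let sQ := lQ.1.
Let px := principalS x sQ.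
Let mQ := local_prime lQ.
Let Qxx := midealW Qx.
Let Qyy := midealW Qy.

(** Modulo x the ring behaves as a discrete valuation ring with uniformizer y. If division by y
    never stopped, the ideals (x, a_n) would become stationary, and g would be divisible by x. *)
Lemma plane_adic g : Q g -> ~ principal Q x g ->
  exists n u, is_unit Q u /\ principal Q x (g - u * y ^+ n).
Proof.
move=> Qg ng; apply: contrapT => no; have [p0 pD pM] := px.
have /choice [f hf] : forall a, exists a', mideal Q a -> Q a' /\ principal Q x (a - a' * y).
  move=> a; have [/hm [c [d [Qc Qd ->]]]|n] := pselect (mideal Q a); last by exists 0.
  by exists d => _; split=> //; exists c => //; rewrite addrK mulrC.
pose a n := iter n f g.
have Ia n : [/\ Q (a n), mideal Q (a n) & principal Q x (g - a n * y ^+ n)].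
  have main n' : Q (a n') -> principal Q x (g - a n' * y ^+ n') -> mideal Q (a n').
    by move=> Qa h; case: (unitVm Qa) => // u; case: no; exists n', (a n').
  elim: n => [|n [Qa ma pa]].
    have h : principal Q x (g - a 0%N * y ^+ 0) by rewrite expr0 mulr1 subrr.
    by split=> //; exact: main.
  have [Qa' h'] := hf _ ma; rewrite -/(a n.+1) in Qa' h'.
  have h : principal Q x (g - a n.+1 * y ^+ n.+1).
    have -> : g - a n.+1 * y ^+ n.+1 = (g - a n * y ^+ n) + y ^+ n * (a n - a n.+1 * y).
      by rewrite exprS; ring.
    by apply: pD => //; apply: pM => //; exact: srX.
  by split=> //; exact: main.
have hI n : idl Q (idlD (principal Q x) (principal Q (a n))).
  by have [Qa _ _] := Ia n; apply: (idl_add sQ); exact: principalI.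
have step n : principal Q x (a n - a n.+1 * y) by have [_ ma _] := Ia n; have [] := hf _ ma.
have [|n eI] := noeth_acc nQ hI.
  move=> n _ [u [_ [hu [d Qd ->] ->]]]; exists (u + (a n - a n.+1 * y) * d), (a n.+1 * (y * d)).
  split; last by ring.
  - by apply: pD => //; rewrite mulrC; apply: pM.
  - by exists (y * d) => //; exact: srM.
have [Qa1 _ _] := Ia n.+1.
have : idlD (principal Q x) (principal Q (a n)) (a n.+1).
  by rewrite -eI; apply: (idlDr px); exists 1; [exact: sr1|rewrite mulr1].
move=> [u [_ [hu [d Qd ->] e]]].
have [v0 Qv Qv'] : is_unit Q (1 + - (y * d)).
  apply: (unit_add lQ (unit1 sQ)); apply: (primeN sQ mQ); rewrite mulrC.
  exact: (primeMl mQ Qd Qy).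
have pa : principal Q x (a n.+1).
  have -> : a n.+1 = (1 + - (y * d))^-1 * (u + (a n - a n.+1 * y) * d).
    apply: (mulfI v0); rewrite mulVKf //.
    by rewrite -[u](addrK (a n * d)) -e; ring.
  by apply: (pM) => //; apply: (pD) => //; rewrite mulrC; exact: pM.
apply: ng; have [_ _ h] := Ia n.+1; rewrite -[g](subrK (a n.+1 * y ^+ n.+1)).
by apply: pD => //; rewrite mulrC; apply: pM => //; exact: srX.
Qed.

Lemma plane_prime : prime_ideal Q (principal Q x).
Proof.
have [p0 pD pM] := px; split=> //.
- exact: principal_sub.
- by move=> /=; have := @hxy 0; rewrite expr0.
- move=> a b Qa Qb pab; apply: contrapT => /not_orP [na nb].
  have [n [u [uu [c Qc ec]]]] := plane_adic Qa na; have [m [v [uv [d Qd ed]]]] := plane_adic Qb nb.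
  have [w0 Qw Qw'] := unitM sQ uu uv; have [u0 Qu _] := uu.
  apply: (@hxy (n + m)%N); have -> : y ^+ (n + m) = (u * v)^-1 * (u * v * y ^+ (n + m)) by rewrite mulKf.
  apply: pM => //; have -> : u * v * y ^+ (n + m) = a * b - x * (c * b + u * y ^+ n * d).
    rewrite exprD; have -> : x * (c * b + u * y ^+ n * d) = (x * c) * b + u * y ^+ n * (x * d) by ring.
    by rewrite -ec -ed; ring.
  apply: (submodB sQ px) => //; exists (c * b + u * y ^+ n * d) => //.
  by do ?[apply: (srD sQ)|apply: (srM sQ)|apply: (srX sQ)] => //.
Qed.

Lemma plane_full q : prime_ideal Q q -> q x -> q y -> q = mideal Q.
Proof.
move=> hq qx qy; apply/seteqP; split=> z.
  move=> qz; have Qz := prime_sub hq qz; case: (unitVm Qz) => // -[z0 _ Qz'].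
  by case: (prime_n1 hq); rewrite -(mulVf z0); exact: (primeMl hq).
by move=> /hm [a [b [Qa Qb ->]]]; apply: (primeD hq); exact: (primeMl hq).
Qed.

Lemma prime_nakayama q M : prime_ideal Q q -> submod Q M ->
  (forall z, q z -> exists a b, [/\ M a, q b & z = a + x * b]) -> q `<=` M.
Proof.
move=> hq hM h; have [gs eg] := nQ (prime_idl hq).
have gq g : g \in gs -> q g by move=> gg; rewrite eg; exact: sub_mspan.
have hgs : forall g, g \in gs -> M g.
  apply: (nakayama lQ hM) => g /gq /h [a [b [Ma qb ->]]]; exists a, (x * b); split=> //.
  apply: (mspan_scale (G := [set` gs])); last by rewrite -eg.
  by move=> z zg; apply: sub_mspan; exists x, z.
by rewrite eg; apply: mspan_sub => // g; exact: hgs.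
Qed.

(** For q without x: modulo x an element of q is zero or a unit times a power of y, and an element g
    with least exponent reduces every other one to x times an element of q. Nakayama's lemma then
    gives q = (g). *)
Lemma plane_principal q : prime_ideal Q q -> q <> mideal Q -> (exists2 z, q z & z != 0) ->
  exists2 c, q c & q = principal Q c.
Proof.
move=> hq nq [z0 qz0 nz0]; have pq c : q c -> principal Q c `<=` q.
  by move=> qc _ [a Qa ->]; rewrite mulrC; exact: (primeMl hq).
have unit_pow g : q g -> ~ principal Q x g -> exists n u, [/\ is_unit Q u, principal Q x (g - u * y ^+ n)
    & q x -> q y].
  move=> qg ng; have [n [u [uu h]]] := plane_adic (prime_sub hq qg) ng; exists n, u; split=> // qx.
  have [u0 Qu Qu'] := uu; apply: (primeX sQ hq Qyy (n := n)).
  have -> : y ^+ n = u^-1 * (g - (g - u * y ^+ n)) by rewrite subKr mulKf.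
  by apply: (primeMl hq Qu'); apply: (primeB sQ hq) => //; exact: pq qx _ h.
have [qx|nqx] := pselect (q x).
  exists x => //; apply/seteqP; split; last exact: pq.
  move=> g qg; apply: contrapT => ng; have [n [u [_ _ /(_ qx) qy]]] := unit_pow g qg ng.
  by apply: nq; exact: plane_full.
have qdiv w : Q w -> q (x * w) -> q w by move=> Qw /(primeP hq Qxx Qw) [].
have ex : exists n, `[< exists g u, [/\ q g, is_unit Q u & principal Q x (g - u * y ^+ n)] >].
  apply: contrapT => no; apply: (negP nz0); apply/eqP.
  have h0 : submod Q [set (0 : K)].
    by split=> // [a b -> ->|a b _ ->]; rewrite ?addr0 ?mulr0.
  suff h : q `<=` [set 0] by exact: h.
  apply: (prime_nakayama hq h0) => z qz; have [[w Qw ez]|nz] := pselect (principal Q x z).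
    by exists 0, w; rewrite add0r; split=> //; apply: qdiv => //; rewrite -ez.
  have [n [u [uu h _]]] := unit_pow z qz nz.
  by case: no; exists n; apply/asboolP; exists z, u.
case: (ex_minnP ex) => n /asboolP [g [u [qg uu hg]]] minn; exists g => //.
apply/seteqP; split; last exact: pq.
have [u0 Qu Qu'] := uu; have Qg := prime_sub hq qg.
apply: (prime_nakayama hq (principalS g sQ)) => z qz.
have [[w Qw ez]|nz] := pselect (principal Q x z).
  exists 0, w; rewrite add0r; split=> //; first by exists 0; [exact: sr0|rewrite mulr0].
  by apply: qdiv => //; rewrite -ez.
have [m [v [uv [w Qw ew] _]]] := unit_pow z qz nz; have [v0 Qv _] := uv.
have nm : (n <= m)%N by apply: minn; apply/asboolP; exists z, v; split=> //; exists w.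
have [w' Qw' ew'] := hg; pose c := v * u^-1 * y ^+ (m - n).
have Qc : Q c by rewrite /c; do ?apply: (srM sQ) => //; exact: srX.
have em : y ^+ m = y ^+ (m - n) * y ^+ n by rewrite -exprD subnK.
exists (g * c), (w - c * w'); split; first by exists c.
- apply: qdiv; first by apply: (srB sQ) => //; exact: srM.
  have -> : x * (w - c * w') = z - g * c.
    have -> : x * (w - c * w') = x * w - c * (x * w') by ring.
    rewrite -ew -ew' /c em; field; exact: u0.
  by apply: (primeB sQ hq) => //; rewrite mulrC; exact: (primeMl hq).
- have -> : x * (w - c * w') = x * w - c * (x * w') by ring.
  rewrite -ew -ew' /c em; field; exact: u0.
Qed.

(** If x divides f, the prime (x) serves. Otherwise no power of x lies in (f), because x is prime,
    and a prime over f avoiding x exists. *)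
Lemma plane_in_prime f : mideal Q f -> f != 0 ->
  exists q, [/\ prime_ideal Q q, q <> mideal Q & q f].
Proof.
move=> mf f0; have Qf := midealW mf; have hp := plane_prime.
have ff : principal Q f f by exists 1; [exact: sr1|rewrite mulr1].
have [pf|nf] := pselect (principal Q x f).
  exists (principal Q x); split=> // e; apply: (@hxy 1); rewrite expr1 e; exact: Qy.
have nx n : ~ principal Q f (x ^+ n).
  elim: n => [[h Qh e]|n IH [h Qh e]].
    case: mf => _; apply; split=> //.
    by have -> : f^-1 = h; [rewrite -[RHS](mulKf f0) -e expr0 mulr1|].
  have [|//|[h' Qh' eh]] := primeP hp Qf Qh _.
    by rewrite -e exprS; exists (x ^+ n); [exact: srX|].
  apply: IH; exists h' => //; apply: (mulfI x0); rewrite -exprS e eh; ring.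
have [q [hq fq nq]] := prime_avoid_pow sQ nQ (principalI sQ Qf) Qxx nx.
by exists q; split=> //; [move=> e; apply: nq; rewrite e|exact: fq].
Qed.

End RegularPlane.

Section PlaneOfPBasis.
Context {K : fieldType} (p : nat) (hp : p \in [pchar K]).

(** A Frobenius coordinate turns y^n = x g into divisibility of y^(n %/ p) by x; descending to
    exponent 0 would make x a unit. *)
Lemma pbasis_ndiv Q x y n : local Q -> pbasis hp Q x y -> mideal Q x -> ~ principal Q x (y ^+ n).
Proof.
move=> lQ hb mx; have [fb Qx Qy _] := hb; have [x0 y0] := pbasis_nz hb; have p1 := p_gt1 hp.
elim/ltn_ind: n => n IH [g Qg e]; have [n0|npos] := posnP n.
  by move: e mx; rewrite n0 expr0 => e [_]; apply; split=> //; have -> : x^-1 = g;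
    [rewrite -[RHS](mulKf x0) -e mulr1|].
pose b := Ordinal (ltn_pmod n (p_gt0 hp)).
apply: (IH (n %/ p)%N); first by rewrite ltn_Pdiv.
exists (pco fb g (rev_ord (ord_p0 hp), b)); first exact: (pbasis_pco hb).
have -> : y ^+ (n %/ p) = ptr fb (y ^+ n / y ^+ b).
  rewrite {2}(divn_eq n p) exprD -mulrA divff ?expf_neq0 // exprM ptr_pM ptr1 mulr1 //.
rewrite e pco_ptr -ptr_pM; congr (ptr fb _); rewrite /pmon /= subn1.
have -> : x ^+ p = x ^+ p.-1 * x by rewrite -exprSr prednK // (p_gt0 hp).
by field; rewrite !expf_neq0.
Qed.

End PlaneOfPBasis.

(** * Points of surfaces and proper birational morphisms *)

Section CurvesOnSurfaces.
Context {k K : fieldType} (iota : {rmorphism k -> K}) (p : nat) (hp : p \in [pchar K])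
  (hperf : pperfect p k).
Implicit Types (X Y Z : set (set K)) (P Q C E F I J R : set K).

Lemma surface_chain X P Q R : dimension X 2 -> X setT -> X P -> X Q -> X R ->
  P `<` Q -> Q `<` R -> R <> setT -> False.
Proof.
move=> [_ n3] XT XP XQ XR PQ QR RT; apply: n3.
exists (fun j => nth setT [:: P; Q; R] j); split; first by case=> [|[|[|[|]]]].
case=> [|[|[|]]] // _ /=; split=> // h; apply: RT; apply/seteqP; split=> //.
Qed.

Lemma setT_max (O : set K) : setT `<=` O -> O = setT.
Proof. by move=> h; apply/seteqP; split. Qed.

Lemma sub_neq (P Q : set K) : P `<=` Q -> Q <> P -> P `<` Q.
Proof. by move=> PQ n; split=> // QP; apply: n; apply/seteqP; split. Qed.

Lemma point_cases X P : variety iota X -> dimension X 2 -> X P ->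
  [\/ P = setT, prime_divisor X P | closed_point X P].
Proof.
move=> hX hd XP; have XT := generic_point hX.
have [->|PT] := pselect (P = setT); first by constructor 1.
have [cP|nc] := pselect (closed_point X P); first by constructor 3.
constructor 2; split=> // Q XQ PQ; apply: contrapT => /not_orP [QP QT].
apply: nc; split=> // R XR RP; apply: contrapT => nR.
exact: (surface_chain hd XT XR XP XQ (sub_neq RP (fun e => nR (esym e))) (sub_neq PQ QP)).
Qed.

Lemma below_divisor X E Q : variety iota X -> dimension X 2 -> prime_divisor X E -> X Q -> Q `<=` E ->
  Q <> E -> closed_point X Q.
Proof.
move=> hX hd [XE ET _] XQ QE nQ; split=> // R XR RQ; apply: contrapT => nR.
apply: (surface_chain hd (generic_point hX) XR XQ XE _ _ ET); apply: sub_neq => //.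
  by move=> e; apply: nR.
by move=> e; apply: nQ.
Qed.

Lemma point_nz X P : variety iota X -> X P -> P <> setT -> exists2 x, mideal P x & x != 0.
Proof.
move=> hX XP PT; apply: contrapT => no; apply: PT; apply/seteqP; split=> // z _.
have [a [b [Pa Pb b0 ->]]] := point_frac hX XP z; have sP := point_sr hX XP.
apply: (srM sP) => //; case: (unitVm Pb) => [[]//|mb].
by case: no; exists b.
Qed.

Lemma center_nz X P Q : variety iota X -> X P -> X Q -> Q `<=` P -> P <> setT ->
  exists2 x, (mideal P `&` Q) x & x != 0.
Proof.
move=> hX XP XQ QP PT; have [x mx x0] := point_nz hX XP PT.
have [a [b [Qa Qb b0 e]]] := point_frac hX XQ x.
have ea : a = b * x by rewrite e mulrC divfK.
exists a; last by rewrite ea mulf_neq0.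
by split=> //; rewrite ea; apply: (midealM (point_sr hX XP)) => //; exact: QP.
Qed.

Lemma surface_dim X : variety iota X -> pdegree hp 2 -> dimension X 2.
Proof. by move=> hX hd; apply/(dimension_pdegree hp hperf 2 hX). Qed.

(** The residues of chart generators are algebraic over k, so they generate a finite-dimensional
    domain, which is already the residue field. *)
Lemma closed_kfin X Q : variety iota X -> closed_point X Q -> kfin iota Q (mideal Q).
Proof.
move=> hX cQ; have [XQ _] := cQ; have lQ := point_local hX XQ; have sQ := lQ.1.
have [kap [pi hpi]] := residue_field lQ.
have Qb c : Q (iota c) by exact (point_base hX XQ c).
have [j hj] := residue_rmorph hpi Qb.
have [s [q [cs hq eQ]]] := point_chart hX XQ; have hA := kgen_sr iota s.
have AQ c : kgen iota s c -> Q c by move=> Ac; rewrite eQ; exact: loc_sub.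
have [|R [t [sR bR Rs eR]]] := @alg_generated_finite _ (base j) [seq pi y | y <- s] (base_sf j).
  move=> _ /mapP [y ys ->]; apply: (res_alg hpi Qb hj _ (closed_talg hX cQ cs hq eQ ys)).
  by apply: AQ; exact: kgen_mem.
have RA a : kgen iota s a -> R (pi a).
  move=> Aa; suff [] : Q a /\ R (pi a) by [].
  move: a Aa; apply: kgen_min.
  - split.
    + by split; [exact: sr1|rewrite (res1 hpi); exact: sr1].
    + by move=> a b [Qa Sa] [Qb' Sb]; split; [exact: srB|rewrite (resB hpi) //; exact: srB].
    + by move=> a b [Qa Sa] [Qb' Sb]; split; [exact: srM|rewrite (resM hpi) //; exact: srM].
  - by move=> _ [c ->]; split=> //; rewrite -hj; apply: bR; exists c.
  - by move=> y ys; split; [apply: AQ; exact: kgen_mem|apply: Rs; exact: map_f].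
have RQ x : Q x -> R (pi x).
  rewrite {1}eQ => -[a [b [Aa Ab nb ->]]]; have b0 := prime_nz hq nb.
  have ub : is_unit Q b by split=> //; [exact: AQ|rewrite eQ; exact: loc_inv].
  rewrite (resM hpi) ?(resV hpi ub); [|exact: AQ|by case: ub].
  apply: (srM sR); first exact: RA.
  apply: (fin_domain_inv (base_sf j) sR bR eR); first exact: RA.
  by apply/eqP => /(res_eq0 hpi (AQ _ Ab)) [_]; apply.
have /choice [b hb] : forall i : 'I_(size t), exists b, Q b /\ pi b = t`_i.
  by move=> i; have [b Qb' eb] := res_surj hpi t`_i; exists b.
have bQ : base iota `<=` Q by move=> _ [c ->].
have [] // := @qd_le _ _ iota Q (mideal Q) (size t) b (ksubS bQ lQ.2).
move=> x Qx; have := RQ x Qx; rewrite eR => /(mspanP _ _ (base_sr j)) [c [bc ec]].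
have /choice [d hd] : forall i, exists d, c i = j d by move=> i; have [d] := bc i; exists d.
have Qs : Q (\sum_i iota (d i) * b i).
  by apply: (sr_sum sQ) => i _; apply: (srM sQ) => //; case: (hb i).
exists d; apply/(res_eq hpi Qx Qs); rewrite ec (res_sum hpi); last first.
  by move=> i _; apply: (srM sQ) => //; case: (hb i).
apply: eq_bigr => i _; have [Qbi ebi] := hb i.
by rewrite (resM hpi) // ebi hd hj.
Qed.

(* Noetherian induction on I: for ab in I the quotients by I + (a) and by
   the colon ideal (I : a) are smaller. *)
Lemma colength Q I : base iota `<=` Q -> local Q -> noeth Q -> kfin iota Q (mideal Q) -> idl Q I ->
  (forall q, prime_ideal Q q -> I `<=` q -> q = mideal Q) -> kfin iota Q I.
Proof.
move=> bQ lQ nQ fm hI hq; have sQ := lQ.1; apply: contrapT => nf.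
have ks J : idl Q J -> submod (base iota) J by case=> h _; exact: (ksubS bQ h).
pose F := [set J | [/\ idl Q J, I `<=` J & ~ kfin iota Q J]].
have [|J [[hJ IJ nJ] _ maxJ]] := @noeth_max _ Q F I nQ (And3 hI (fun _ h => h) nf); first by move=> ? [].
have [[J0 JD JM] JQ] := hJ.
have big J' : idl Q J' -> J `<=` J' -> (exists2 a, J' a & ~ J a) -> kfin iota Q J'.
  move=> hJ' JJ' [a J'a na]; apply: contrapT => n'; apply: na.
  by rewrite -(maxJ J') //; split=> //; exact: subset_trans JJ'.
have nJ1 : ~ J 1.
  move=> J1; apply: nJ; rewrite (idl1 hJ J1); exists 0%N, (fun _ => 0).
  by split=> [[]|x Qx|c _ []] //; exists (fun _ => 0); rewrite big_ord0 subr0.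
have [|nprime] := pselect (prime_ideal Q J).
  by move=> pJ; apply: nJ; rewrite (hq J pJ IJ).
have [a [b [Qa Qb na nb Jab]]] : exists a b, [/\ Q a, Q b, ~ J a, ~ J b & J (a * b)].
  apply: contrapT => no; apply: nprime; split=> // a b Qa Qb Jab; apply: contrapT => /not_orP [na nb].
  by apply: no; exists a, b.
pose J1 := idlD J (principal Q a); pose J2 := [set x | Q x /\ J (x * a)].
have hJ1 : idl Q J1 by apply: (idl_add sQ) => //; exact: principalI.
have hJ2 : idl Q J2.
  split; last by move=> x [].
  split; first by split; [exact: sr0|rewrite mul0r].
  - by move=> x y [Qx Jx] [Qy Jy]; split; [exact: srD|rewrite mulrDl; exact: JD].
  - by move=> c x Qc [Qx Jx]; split; [exact: srM|rewrite -mulrA; exact: JM].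
have JJ1 : J `<=` J1 by apply: idlDl; exact: (principalS a sQ).
have f1 : kfin iota Q J1.
  apply: big => //; exists a => //; apply: (idlDr (proj1 hJ)); exists 1; [exact: sr1|by rewrite mulr1].
have [n [v [Qv sv _]]] : kfin iota Q J2.
  apply: big => //; first by move=> x Jx; split; [exact: JQ|rewrite mulrC; apply: JM].
  by exists b => //; split=> //; rewrite mulrC.
have [f2 _] : kfin iota J1 J /\ (qd iota J1 J <= n)%N.
  apply: (@qd_le _ _ iota J1 J n (fun i => v i * a) (ks _ hJ)).
  move=> _ [u [_ [Ju [c Qc ->] ->]]]; have [d [_ hd]] := sv c Qc; exists d.
  have -> : u + a * c - \sum_i iota (d i) * (v i * a) = u + (c - \sum_i iota (d i) * v i) * a.
    by rewrite mulrBl mulr_suml addrA [a * c]mulrC; congr (_ - _); apply: eq_bigr => i _; rewrite mulrA.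
  exact: JD.
apply: nJ; exact: (kfin_tower (ks _ hJ) JJ1 (ks _ hJ1) hJ1.2 (ring_ksub sQ bQ) f1 f2).
Qed.

(** * Local rings of a curve inside its residue field *)

Section ImageRing.
Context {kap : fieldType} (j : {rmorphism k -> kap}).
Variables (E : set K) (pi : K -> kap) (hpi : residue E pi) (lE : local E).
Hypotheses (hj : forall c, j c = pi (iota c)) (Ei : forall c, E (iota c)).
Variables (Q : set K) (lQ : local Q) (QE : Q `<=` E).

Definition img I : set kap := [set z | exists2 a, I a & pi a = z].
Let sQ := lQ.1.
Let sE := lE.1.

Lemma img_subring : is_subring (img Q).
Proof.
split; first by exists 1; [exact: sr1|exact: (res1 hpi)].
- by move=> _ _ [a Qa <-] [b Qb <-]; exists (a - b); [exact: srB|rewrite (resB hpi) //; exact: QE].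
- by move=> _ _ [a Qa <-] [b Qb <-]; exists (a * b); [exact: srM|rewrite (resM hpi) //; exact: QE].
Qed.

Lemma img_unit a : Q a -> (is_unit (img Q) (pi a) <-> is_unit Q a).
Proof.
move=> Qa; have Ea := QE Qa; split=> [[n0 _ [b Qb eb]]|ua].
  have [//|ma] := unitVm Qa; have Eb := QE Qb.
  have : mideal E (a * b - 1).
    apply/(res_eq hpi); [exact: srM|exact: sr1|].
    by rewrite (resM hpi) // eb (res1 hpi) divff.
  move=> h; case: (prime_n1 (local_prime lQ)).
  have h' : mideal Q (a * b - 1).
    by apply: (mideal_anti QE); split=> //; apply: srB; [exact: sQ|exact: srM|exact: sr1].
  have -> : 1 = a * b - (a * b - 1) by rewrite subKr.
  apply: (primeB sQ (local_prime lQ)) => //; exact: (primeMr (local_prime lQ)).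
have [a0 _ Qa'] := ua; have uE : is_unit E a by split=> //; exact: QE.
split; [|by exists a|by exists a^-1 => //; rewrite (resV hpi uE)].
by apply/eqP => /(res_eq0 hpi Ea) [_].
Qed.

Lemma img_mideal z : mideal (img Q) z <-> exists2 a, mideal Q a & pi a = z.
Proof.
split=> [[[a Qa <-] nu]|[a ma <-]].
  by exists a => //; split=> // ua; apply: nu; apply/img_unit.
by have [Qa nu] := ma; split; [exists a|move=> /(img_unit Qa)].
Qed.

Lemma img_local : local (img Q).
Proof.
have [m0 mD mM] := lQ.2; split; first exact: img_subring.
split.
- by apply/img_mideal; exists 0 => //; exact: (res0 hpi).
- move=> _ _ /img_mideal [a ma <-] /img_mideal [b mb <-]; apply/img_mideal.
  exists (a + b); first exact: mD.
  by rewrite (resD hpi) //; apply: QE; exact: midealW.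
- move=> _ _ [a Qa <-] /img_mideal [b mb <-]; apply/img_mideal.
  exists (a * b); first exact: mM.
  by rewrite (resM hpi) //; apply: QE => //; exact: midealW.
Qed.

Hypothesis bQ : base iota `<=` Q.

Lemma img_base : base j `<=` img Q.
Proof. by move=> _ [c ->]; exists (iota c); [apply: bQ; exists c|rewrite hj]. Qed.

Lemma img_sum n (c : 'I_n -> k) (b : 'I_n -> K) : (forall i, Q (b i)) ->
  pi (\sum_i iota (c i) * b i) = \sum_i j (c i) * pi (b i).
Proof.
move=> Qb; rewrite (res_sum hpi) => [|i _]; last by apply: (srM sE) => //; exact: QE.
by apply: eq_bigr => i _; rewrite (resM hpi) // ?hj //; exact: QE.
Qed.

Lemma img_qdim I n : submod Q I -> I `<=` Q -> mideal E `&` Q `<=` I ->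
  quotient_dim iota Q I n -> quotient_dim j (img Q) (img I) n.
Proof.
move=> hI IQ mI [b [Qb sb fb]]; exists (fun i => pi (b i)).
have Qs (c : 'I_n -> k) : Q (\sum_i iota (c i) * b i).
  by apply: (sr_sum sQ) => i _; apply: (srM sQ) => //; apply: bQ; exists (c i).
split; first by move=> i; exists (b i).
- move=> _ [a Qa <-]; have [c hc] := sb a Qa; exists c; exists (a - \sum_i iota (c i) * b i) => //.
  by rewrite (resB hpi) ?img_sum //; apply: QE.
- move=> c; rewrite -img_sum // => -[a Ia /esym ea]; apply: fb.
  have Qa := IQ a Ia; have /(res_eq hpi (QE (Qs c)) (QE Qa)) h := ea.
  have [_ ID _] := hI; rewrite -[X in I X](subrK a); apply: ID => //.
  by apply: mI; split=> //; exact: srB.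
Qed.

End ImageRing.

Section Composite.
Context {kap : fieldType}.
Variables (E : set K) (pi : K -> kap) (hpi : residue E pi).

Lemma dvr_valuation t : dvr E t -> valuation_ring E.
Proof.
move=> hE; split; first exact: (dvr_sr hE).
move=> x x0; case: (lerP 0 (ord E x)) => h; first by left; apply/(ord_ge0 hE).
by right; apply/(ord_ge0 hE); rewrite ?invr_eq0 // (ordV hE) // oppr_ge0 ltW.
Qed.

(** The composite of E with a valuation ring of its residue field; it transfers separatedness and
    properness from the surface to the curve E. *)
Definition composite (V : set kap) : set K := [set x | E x /\ V (pi x)].

Lemma composite_valuation V : valuation_ring E -> valuation_ring V -> valuation_ring (composite V).
Proof.
move=> vE hV; have sV := val_sr hV; have sE := val_sr vE; split.
  split; first by split; [exact: sr1|rewrite (res1 hpi); exact: sr1].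
  - by move=> x y [Ex Vx] [Ey Vy]; split; [exact: srB|rewrite (resB hpi) //; exact: srB].
  - by move=> x y [Ex Vx] [Ey Vy]; split; [exact: srM|rewrite (resM hpi) //; exact: srM].
have small x : mideal E x -> composite V x.
  by move=> mx; split; [exact: midealW|have /(res_eq0 hpi (midealW mx)) -> := mx; exact: sr0].
move=> x x0; have [Ex|nEx] := pselect (E x); last by right; apply: small; exact: val_inv.
have [ux|mx] := unitVm Ex; last by left; exact: small.
have [_ _ Ex'] := ux; have px0 : pi x != 0 by apply/eqP => /(res_eq0 hpi Ex) [].
by have [_ /(_ _ px0) [Vx|Vx]] := hV; [left|right; split=> //; rewrite (resV hpi ux)].
Qed.

End Composite.

Lemma proper_birational_trans X Y Z : proper_birational Z Y -> proper_birational Y X ->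
  proper_birational Z X.
Proof.
move=> [h1 p1] [h2 p2]; split=> [Q ZQ|R P hR XP dR].
  have [Q' YQ' d1] := h1 Q ZQ; have [P XP d2] := h2 Q' YQ'.
  by exists P => //; exact: dominates_trans d1 d2.
by have [Q YQ dQ] := p2 R P hR XP dR; exact: p1 dQ.
Qed.

(* The local ring of a prime divisor is a valuation ring, hence centered on Z
   at a point with the same local ring. *)
Lemma prime_divisor_lift X Z E t : variety iota X -> variety iota Z -> proper_birational Z X ->
  prime_divisor X E -> dvr E t -> prime_divisor Z E.
Proof.
move=> hX hZ [h pr] [XE _ _] hE; have vE := dvr_valuation hE.
have [Q ZQ [QE mQE]] := pr E E vE XE (conj (fun _ h => h) (fun _ h => h)).
have [P XP dP] := h Q ZQ.
have eP : P = E.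
  by apply: (center_unique hX vE XP XE); [exact: dominates_trans dP|split].
have eQ : Q = E by apply/seteqP; split=> // x Ex; apply: dP.1; rewrite eP.
by rewrite eQ in ZQ; exact: (dvr_prime_divisor hZ ZQ hE).
Qed.

(** A valuation ring dominating C is centered at P' and at a localization of P, so these
    coincide. *)
Lemma sub_center X C P P' : variety iota X -> local C -> X P -> X P' -> dominates C P' -> P `<=` C ->
  P `<=` P'.
Proof.
move=> hX lC XP XP' d PC; have [V [hV dV]] := val_dominating lC.
have [hq dq] := dominates_loc (point_sr hX XP) lC PC.
have <- : localization P (mideal C `&` P) = P'.
  apply: (center_unique hX hV (point_loc hX XP hq) XP'); exact: dominates_trans dV _.
exact: (loc_sub (point_sr hX XP) hq).
Qed.

Lemma dominates_dvr E F t : dvr F t -> dominates E F -> E = F.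
Proof.
move=> hF [FE mFE]; have sF := dvr_sr hF; apply/seteqP; split=> // x Ex; apply: contrapT => nF.
have [hV] := dvr_valuation hF; have x0 : x != 0 by apply: contraPneq nF => -> h; apply: h; exact: (sr0 sF).
move=> /(_ x x0) [//|Fx']; have : mideal F x^-1 by split=> // -[_ _]; rewrite invrK.
by move=> /mFE [_]; apply; split; rewrite ?invr_eq0 ?invrK //; exact: FE.
Qed.

Lemma nonexceptional X Z C : divisorial iota X -> variety iota Z -> prime_divisor Z C -> ~ exceptional Z X C ->
  prime_divisor X C.
Proof.
move=> [hX dX] hZ pC nC.
have [P [XP dP pP]] : exists P, [/\ X P, dominates C P & prime_divisor X P].
  apply: contrapT => no; apply: nC; split=> // P XP dP pP; apply: no; by exists P.
by have [t hP] := dX P pP; rewrite (dominates_dvr hP dP).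
Qed.

Lemma exceptional_center X Z E : variety iota X -> dimension X 2 -> proper_birational Z X ->
  exceptional Z X E -> exists2 P, closed_point X P & dominates E P.
Proof.
move=> hX dX [h _] [[ZE ET _] nE]; have [P XP dP] := h E ZE; exists P => //.
have [eP|pP|//] := point_cases hX dX XP; last by case: (nE P XP dP).
by case: ET; apply: setT_max; rewrite -eP; case: dP.
Qed.

(** The residues of P are algebraic over k, so they lie in every valuation ring V over k. The
    composite valuation ring therefore dominates P, and properness over X gives it a center. *)
Lemma exceptional_proper X Z E P (kap : fieldType) (pi : K -> kap) (j : {rmorphism k -> kap}) :
  variety iota X -> proper_birational Z X -> closed_point X P -> dominates E P -> valuation_ring E ->
  residue E pi -> (forall c, E (iota c)) -> (forall c, j c = pi (iota c)) ->
  forall V, valuation_ring V -> base j `<=` V -> exists2 Q, Z Q & dominates (composite E pi V) Q.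
Proof.
move=> hX [_ pr] cP [PE mPE] vE hpi Ei hj V hV bV; have [XP _] := cP; have sV := val_sr hV.
have lP := point_local hX XP; have bP : base iota `<=` P by move=> _ [c ->]; exact: (point_base hX XP).
have cV := composite_valuation hpi vE hV.
apply: (pr _ P) => //; split=> [a Pa|x mx].
  split; first exact: PE.
  have [|c [bc c0 mc]] := kfin_rel (ksubS bP lP.2) (closed_kfin hX cP) (w := a).
    by move=> n; exact: (srX lP.1).
  apply: (val_alg hV bV); apply: (res_alg hpi Ei hj (PE a Pa)).
  by exists c; split=> //; exact: mPE.
have mE := mPE x mx; have Ex := midealW mE; split.
  by split=> //; have /(res_eq0 hpi Ex) -> := mE; exact: (sr0 sV).
by move=> [x0 _ [Ex' _]]; case: mE => _; apply.
Qed.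

Lemma seq_argmax (T : eqType) (phi : T -> rat) (s : seq T) x : x \in s ->
  exists2 y, y \in s & forall z, z \in s -> phi z <= phi y.
Proof.
elim: s x => // a s IH x _; case: s IH => [_|b s IH].
  by exists a; [exact: mem_head|move=> z; rewrite inE => /eqP ->].
have [y ys hy] := IH b (mem_head _ _); have [h|h] := lerP (phi a) (phi y).
  exists y; first by rewrite inE ys orbT.
  by move=> z; rewrite inE => /orP[/eqP ->//|/hy].
exists a; first exact: mem_head.
by move=> z; rewrite inE => /orP[/eqP ->//|/hy hz]; exact: le_trans hz (ltW h).
Qed.

(** * Prime divisors on a smooth surface *)

Section SmoothSurface.
Variables (Z : set (set K)) (hZ : variety iota Z) (sZ : smooth iota Z) (hdeg : pdegree hp 2).

Lemma closed_plane Q : closed_point Z Q -> exists x y, [/\ pbasis hp Q x y, mideal Q x, mideal Q y &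
  forall z, mideal Q z -> exists a b, [/\ Q a, Q b & z = a * x + b * y]].
Proof.
move=> cQ; have [ZQ _] := cQ; have lQ := point_local hZ ZQ; have nQ := point_noeth hZ ZQ.
have [s hs] := parameters_exist lQ nQ; have [n dn On] := sZ ZQ.
have n2 : n = 2 by apply: (pdegree_uniq (hp := hp)) => //; apply/(dimension_pdegree hp hperf n hZ).
rewrite n2 in On; have [s2 hb] := smooth_closed_pbasis hperf hZ cQ hs hdeg On.
have ms j : (j < 2)%N -> mideal Q s`_j.
  by move=> j2; rewrite hs.1 (ideal_genE s lQ.1); apply: sub_mspan; apply: mem_nth; rewrite s2.
exists s`_0, s`_1; split; [by []|exact: ms|exact: ms|].
rewrite hs.1 => z [a Qa ->]; move: a Qa; rewrite s2 => a Qa.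
by exists (a ord0), (a (lift ord0 ord0)); rewrite !big_ord_recl big_ord0 addr0.
Qed.

Lemma closed_principal Q q : closed_point Z Q -> prime_ideal Q q -> q <> mideal Q ->
  (exists2 z, q z & z != 0) -> exists2 c, q c & q = principal Q c.
Proof.
move=> cQ; have [x [y [hb mx my hm]]] := closed_plane cQ; have [ZQ _] := cQ.
have lQ := point_local hZ ZQ.
exact: (plane_principal lQ (point_noeth hZ ZQ) mx my hm).
Qed.

Lemma closed_in_prime Q f : closed_point Z Q -> mideal Q f -> f != 0 ->
  exists q, [/\ prime_ideal Q q, q <> mideal Q & q f].
Proof.
move=> cQ; have [x [y [hb mx my hm]]] := closed_plane cQ; have [ZQ _] := cQ.
have lQ := point_local hZ ZQ; have [x0 _] := pbasis_nz hb.
exact: (plane_in_prime lQ (point_noeth hZ ZQ) mx my x0 hm (fun n => @pbasis_ndiv _ _ hp Q x y n lQ hb mx)).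
Qed.

Lemma closed_prime_divisor Q q : closed_point Z Q -> prime_ideal Q q -> q <> mideal Q ->
  (exists2 z, q z & z != 0) -> prime_divisor Z (localization Q q).
Proof.
move=> [ZQ Qmin] hq nq [z qz z0]; have sQ := point_sr hZ ZQ.
have ZL := point_loc hZ ZQ hq.
have [e|//|[_ Lmin]] := point_cases hZ (surface_dim hZ hdeg) ZL; first by case: (loc_all sQ hq qz z0).
have e := Lmin Q ZQ (loc_sub sQ hq); case: nq; apply/seteqP; split=> x.
  by move=> qx; rewrite {1}e; apply/(loc_midealI sQ hq (prime_sub hq qx)).
by move=> mx; apply/(loc_midealI sQ hq (midealW mx)); rewrite -e.
Qed.

Lemma through_prime Q f : closed_point Z Q -> mideal Q f -> f != 0 ->
  exists C, [/\ prime_divisor Z C, Q `<=` C & mideal C f].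
Proof.
move=> cQ mf f0; have [q [hq nq qf]] := closed_in_prime cQ mf f0; have [ZQ _] := cQ.
have sQ := point_sr hZ ZQ; exists (localization Q q); split.
- by apply: closed_prime_divisor => //; exists f.
- exact: loc_sub.
- by apply/(loc_midealI sQ hq (midealW mf)).
Qed.

(** A nonzero prime ideal below the maximal one gives a point strictly between Q and the generic
    point. *)
Lemma closed_not_divisor Q : closed_point Z Q -> ~ prime_divisor Z Q.
Proof.
move=> cQ [ZQ QT Qmax]; have [x mx x0] := point_nz hZ ZQ QT.
have [C [[ZC CT _] QC mC]] := through_prime cQ mx x0.
have [q [hq nq qx]] := closed_in_prime cQ mx x0.
have pL : prime_divisor Z (localization Q q) by apply: closed_prime_divisor => //; exists x.
have [ZL LT _] := pL; have sQ := point_sr hZ ZQ.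
have [e|//] := Qmax _ ZL (loc_sub sQ hq).
apply: nq; apply/seteqP; split=> z.
  by move=> qz; rewrite -[Q in mideal Q]e; apply/(loc_midealI sQ hq (prime_sub hq qz)).
by move=> mz; apply/(loc_midealI sQ hq (midealW mz)); rewrite e.
Qed.

Lemma divisor_closed E : prime_divisor Z E -> exists2 Q, closed_point Z Q & Q `<=` E.
Proof.
move=> pE; have [ZE _ _] := pE.
have [Q [ZQ QE nQ]] : exists Q, [/\ Z Q, Q `<=` E & Q <> E].
  apply: contrapT => no; apply: (closed_not_divisor _ pE); split=> // Q ZQ QE.
  by apply: contrapT => nQ; apply: no; exists Q.
by exists Q => //; exact: (below_divisor hZ (surface_dim hZ hdeg) pE ZQ QE nQ).
Qed.

Lemma divisor_equation Q C : closed_point Z Q -> prime_divisor Z C -> Q `<=` C ->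
  exists c, [/\ dvr C c, Q c & ideal_at Q C = principal Q c].
Proof.
move=> cQ pC QC; have [ZC CT _] := pC; have [ZQ _] := cQ; have sQ := point_sr hZ ZQ.
have [hq eC] := point_sub hZ ZQ ZC QC; set q := mideal C `&` Q in hq eC.
have [z qz z0] := center_nz hZ ZC ZQ QC CT.
have nq : q <> mideal Q.
  move=> e; apply: (closed_not_divisor cQ); have -> : Q = C; last by [].
  by rewrite eC e loc_self //; exact: (point_local hZ ZQ).
have [c qc eq] := closed_principal cQ hq nq (ex_intro2 _ _ z qz z0).
exists c; split; [|by case: qc|by rewrite /ideal_at setIC].
have c0 : c != 0 by apply: contraNneq z0 => c0; move: qz; rewrite -/q eq c0 => -[a _ ->]; rewrite mul0r.
apply: dvr_intro => //; [exact: (point_local hZ ZC)|exact: (point_noeth hZ ZC)| |exact: (point_frac hZ ZC)].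
have sC := point_sr hZ ZC; apply/seteqP; split=> w.
  rewrite {1}eC => /(loc_mideal hq) [a [b [qa Qb nb ->]]]; move: qa; rewrite eq => -[d Qd ->].
  exists (d / b); last by rewrite mulrA.
  by rewrite eC; exact: loc_div.
by move=> [a Ca ->]; rewrite mulrC; apply: (midealM sC) => //; case: qc.
Qed.

Lemma smooth_divisorial : divisorial iota Z.
Proof.
split=> // E pE; have [Q cQ QE] := divisor_closed pE.
by have [c [hE _ _]] := divisor_equation cQ pE QE; exists c.
Qed.

(** * Degrees on an exceptional curve *)

Section ExceptionalCurve.
Context {kap : fieldType} (j : {rmorphism k -> kap}).
Variables (E : set K) (pE : prime_divisor Z E) (pi : K -> kap) (hpi : residue E pi).
Hypothesis hj : forall c, j c = pi (iota c).

Let dZ := smooth_divisorial.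
Let ZE : Z E. Proof. by case: pE. Qed.
Let lE := point_local hZ ZE.
Let sE := lE.1.
Let Ei c : E (iota c). Proof. exact: (point_base hZ ZE). Qed.

Definition below : set (set K) := [set Q | closed_point Z Q /\ Q `<=` E].

Let Zb Q : below Q -> Z Q. Proof. by move=> [[]]. Qed.
Let lb Q : below Q -> local Q. Proof. by move=> /Zb h; exact: (point_local hZ h). Qed.
Let bb Q : below Q -> base iota `<=` Q. Proof. by move=> /Zb h _ [c ->]; exact: (point_base hZ h). Qed.

Let vE : valuation_ring E. Proof. by have [t hE] := dZ.2 E pE; exact: dvr_valuation hE. Qed.

Lemma composite_dominates V Q : valuation_ring V -> below Q -> Q `<=` composite E pi V ->
  (mideal Q `<=` mideal (composite E pi V) <-> dominates V (img pi Q)).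
Proof.
move=> hV bQ QV; have QE := bQ.2; have lQ := lb bQ; have sV := val_sr hV.
have cu x : E x -> is_unit (composite E pi V) x <-> is_unit V (pi x).
  move=> Ex; split=> [[x0 [_ Vx] [Ex' Vx']]|[px0 Vx Vx']].
    have ux : is_unit E x by [].
    by rewrite (resV hpi ux) in Vx'; split=> //; apply/eqP => /(res_eq0 hpi Ex) [].
  have ux : is_unit E x by exact: (res_unit hpi).
  have [x0 _ Ex'] := ux; have c1 : composite E pi V x by split.
  have c2 : composite E pi V x^-1 by split=> //; rewrite (resV hpi ux).
  by split.
split=> [h|[_ h] x mx].
  split=> [_ [a Qa <-]|z]; first by have [] := QV a Qa.
  move=> /(img_mideal hpi lE lQ QE) [a ma <-]; have [[Ea Va] nu] := h a ma.
  by split=> // /(cu a Ea).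
have Qx := midealW mx; split; first exact: QV.
move=> /(cu x (QE x Qx)); have [] : mideal V (pi x); last by [].
by apply: h; apply/(img_mideal hpi lE lQ QE); exists x.
Qed.

Hypothesis hprop : forall V, valuation_ring V -> base j `<=` V ->
  exists2 Q, Z Q & dominates (composite E pi V) Q.

Lemma below_neq Q : below Q -> exists2 a, mideal Q a & ~ mideal E a.
Proof.
move=> [cQ QE]; apply: contrapT => no; have [ZQ _] := cQ.
apply: (closed_not_divisor cQ).
have -> : Q = E; last exact: pE.
by apply: (point_sub_inj hZ ZQ ZE QE) => x mx; apply: contrapT => nx; apply: no; exists x.
Qed.

Lemma below_quotient Q e : below Q -> e != 0 -> ord E e = 0 -> exists a b,
  [/\ Q a, Q b, ~ mideal E a, ~ mideal E b & e = a / b].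
Proof.
move=> bQ e0 oe; have [t hE] := dZ.2 E pE.
have ue : is_unit E e by apply/(ord_unit hE).
have [hq eE] := point_sub hZ (Zb bQ) ZE bQ.2; have [_ Ee _] := ue.
move: (Ee); rewrite {1}eE => -[a [b [Qa Qb nb ea]]]; exists a, b; split=> //; last by move=> mb; apply: nb; split.
have b0 : b != 0 := prime_nz hq nb.
move=> ma; have [_] := ma; apply; have -> : a = e * b by rewrite ea divfK.
by apply: (unitM sE ue); case: (unitVm (bQ.2 b Qb)) => // mb; case: nb.
Qed.

(** On a chart, write b = a1 / a2. Such Q correspond to minimal primes over the ideal of E together
    with a1 a2, for nothing lies strictly between Q and E. *)
Lemma finite_nonunit b : E b -> ~ mideal E b -> finite_set [set Q | below Q /\ ~ is_unit Q b].
Proof.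
move=> Eb nb; have [S [cS covS]] := charts_finite hZ.
pose T s := [set Q | [/\ below Q, ~ is_unit Q b & Spec (kgen iota s) Q]].
have finT s : s \in S -> finite_set (T s).
  move=> sS; have cs := cS s sS; have hA := kgen_sr iota s.
  have [AE|nAE] := pselect (kgen iota s `<=` E); last first.
    apply: (sub_finite_set (B := set0)) => // Q [bQ _ [q hq eQ]].
    by apply: nAE => x Ax; apply: bQ.2; rewrite eQ; exact: loc_sub.
  have [ZL dL] := chart_center cs vE AE; set A := kgen iota s in hA AE ZL dL *.
  have eE : E = localization A (mideal E `&` A) by apply: (point_dominates hZ).
  have [hqE _] := dominates_loc hA lE AE.
  move: (Eb); rewrite {1}eE => -[a1 [a2 [Aa1 Aa2 n2 eb]]].
  have m2 : ~ mideal E a2 by move=> m2; apply: n2.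
  have a20 := prime_nz hqE n2.
  have m1 : ~ mideal E a1.
    move=> m1; apply: nb; rewrite eb mulrC; apply: (midealM sE) => //.
    by case: (unitVm (AE _ Aa2)) => [[]|].
  pose d := a1 * a2; have Ad : A d by exact: (srM hA).
  have nd : ~ mideal E d.
    by move=> /(primeP (local_prime lE) (AE _ Aa1) (AE _ Aa2)) [].
  have iE : idl A (mideal E `&` A) by exact: prime_idl hqE.
  have [M [finM hM minM]] := finite_min_primes hA (@kgen_noeth _ _ iota s)
    (idl_add hA iE (principalI hA Ad)).
  apply: (sub_finite_set (B := (fun q => localization A q) @` M)); last exact: finite_image.
  move=> Q [bQ nu [q hq eQ]]; have QE := bQ.2.
  have qd : q d.
    apply: contrapT => nqd; apply: nu; rewrite eb eQ.
    have n1 : ~ q a1 by move=> h; apply: nqd; exact: (primeMr hq).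
    have n2' : ~ q a2 by move=> h; apply: nqd; exact: (primeMl hq).
    by apply/(loc_unitP hq); exists a1, a2.
  have [|q' Mq' q'q] := minM q hq.
    move=> _ [u [_ [[mu Au] [c Ac ->] ->]]]; apply: (primeD hq); last exact: (primeMr hq).
    apply/(loc_midealI hA hq Au); rewrite -eQ; apply: (mideal_anti QE); split=> //.
    by rewrite eQ; exact: loc_sub.
  have [hq' Jq'] := hM q' Mq'; exists q' => //.
  have ZL' : Z (localization A q') by exact: cs.2.
  have QL : Q `<=` localization A q'.
    by rewrite eQ => _ [x [y [Ax Ay ny ->]]]; exists x, y; split=> // /q'q.
  have q'd : q' d.
    by apply: Jq'; apply: (idlDr (proj1 iE)); exists 1; [exact: sr1|rewrite mulr1].
  have LE : localization A q' `<=` E.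
    move=> _ [x [y [Ax Ay ny ->]]]; rewrite eE; exists x, y; split=> // hy; apply: ny.
    by apply: Jq'; apply: (idlDl (principalS d hA)).
  have LnE : localization A q' <> E.
    by move=> e; apply: nd; rewrite -[E in mideal E]e; apply/(loc_midealI hA hq' Ad).
  have [_ mL] := below_divisor hZ (surface_dim hZ hdeg) pE ZL' LE LnE.
  by apply/esym; apply: mL => //; exact: Zb.
apply: (sub_finite_set (B := \bigcup_(s in [set` S]) T s)).
  by move=> Q [bQ nu]; have [s sS hs] := covS Q (Zb bQ); exists s.
by apply: bigcup_finite => [|s /= sS]; [exact: finite_seq|exact: finT].
Qed.

Lemma img_principal Q a : below Q -> Q a ->
  img pi (idlD (mideal E `&` Q) (principal Q a)) = principal (img pi Q) (pi a).
Proof.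
move=> bQ Qa; have QE := bQ.2; have sQ := (lb bQ).1; apply/seteqP; split=> [_ [_ [u [_ [[mu Qu] [c Qc ->] ->]]] <-]|_ [_ [c Qc <-] ->]].
  exists (pi c); first by exists c.
  rewrite (resD hpi) ?(resM hpi); try exact: QE; last by apply: (srM sE); exact: QE.
  by have /(res_eq0 hpi (midealW mu)) -> := mu; rewrite add0r.
exists (a * c); last by rewrite (resM hpi) //; exact: QE.
have m0 : (mideal E `&` Q) 0 by split; [exact: (mideal0 sE)|exact: (sr0 sQ)].
by exists 0, (a * c); rewrite add0r; split=> //; exists c.
Qed.

Lemma below_colength Q a : below Q -> Q a -> ~ mideal E a ->
  kfin iota Q (idlD (mideal E `&` Q) (principal Q a)).
Proof.
move=> bQ Qa na; have lQ := lb bQ; have sQ := lQ.1; have [cQ QE] := bQ; have ZQ := Zb bQ.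
have [hqE eE] := point_sub hZ ZQ ZE QE.
have iE : idl Q (mideal E `&` Q) by exact: prime_idl hqE.
apply: (colength (bb bQ) lQ (point_noeth hZ ZQ) (closed_kfin hZ cQ)).
  exact: (idl_add sQ iE (principalI sQ Qa)).
move=> q hq Iq; apply: contrapT => nq.
have qa : q a by apply: Iq; apply: (idlDr (proj1 iE)); exists 1; [exact: sr1|rewrite mulr1].
have a0 : a != 0 by apply/eqP => a0; apply: na; rewrite a0; exact: mideal0.
have [ZL LT Lmax] := closed_prime_divisor cQ hq nq (ex_intro2 _ _ a qa a0).
have LE : localization Q q `<=` E.
  move=> _ [x [y [Qx Qy ny ->]]]; rewrite eE; exists x, y; split=> // hy; apply: ny.
  by apply: Iq; apply: (idlDl (principalS a sQ)).
have [e|e] := Lmax E ZE LE; last by case: pE => _ /(_ e).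
by apply: na; rewrite e; apply/(loc_midealI sQ hq Qa).
Qed.

Lemma img_len Q a : below Q -> Q a -> ~ mideal E a ->
  kfin j (img pi Q) (principal (img pi Q) (pi a)) /\
  qd j (img pi Q) (principal (img pi Q) (pi a)) = qd iota Q (idlD (mideal E `&` Q) (principal Q a)).
Proof.
move=> bQ Qa na; have lQ := lb bQ; have sQ := lQ.1; have [cQ QE] := bQ.
have [n hn] := below_colength bQ Qa na; have [hqE _] := point_sub hZ (Zb bQ) ZE QE.
have [hI IQ] := idl_add sQ (prime_idl hqE) (principalI sQ Qa).
have h := img_qdim hpi lE hj Ei lQ QE (bb bQ) hI IQ (idlDl (principalS a sQ)) hn.
rewrite img_principal // in h; split; first by exists n.
rewrite (qdE (ksubS (bb bQ) hI) hn); apply: qdE => //.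
apply: (ksubS (img_base hj (bb bQ))); apply: principalS.
exact: (img_local hpi lE lQ QE).1.
Qed.

(** Separatedness and properness come from Z through composite valuations. Finiteness is [colength]:
    only the maximal ideal of Q contains the ideal of E and a function not vanishing on E. *)
Lemma residue_curve : curve j below (img pi).
Proof.
split.
- by move=> Q bQ; exact: (img_local hpi lE (lb bQ) bQ.2).
- by move=> Q bQ; exact: (img_base hj (bb bQ)).
- move=> Q bQ z; have [e Ee <-] := res_surj hpi z; have QE := bQ.2.
  have [hq eE] := point_sub hZ (Zb bQ) ZE QE.
  move: (Ee); rewrite eE => -[a [b [Qa Qb nb ->]]]; exists (pi a), (pi b).
  have ub : is_unit E b by case: (unitVm (QE b Qb)) => // mb; case: nb.
  have [b0 Eb Eb'] := ub; split; [by exists a|by exists b| |].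
    by apply/eqP => /(res_eq0 hpi Eb) [_].
  by rewrite (resM hpi) ?(resV hpi ub) //; exact: QE.
- move=> Q _ bQ [a Qa <-] pa0.
  have na : ~ mideal E a by move=> ma; move/eqP: pa0; apply; apply/(res_eq0 hpi (bQ.2 a Qa)).
  by have [] := img_len bQ Qa na.
- move=> Q bQ; have [a ma na] := below_neq bQ; exists (pi a).
    by apply/(img_mideal hpi lE (lb bQ) bQ.2); exists a.
  by apply/eqP => /(res_eq0 hpi (bQ.2 a (midealW ma))).
- move=> V Q Q' hV bQ bQ' dQ dQ'; have hc := composite_valuation hpi vE hV.
  have sub P : below P -> dominates V (img pi P) -> P `<=` composite E pi V.
    by move=> bP [h _] a Pa; split; [exact: bP.2|apply: h; exists a].
  apply: (center_unique hZ hc (Zb bQ) (Zb bQ')); split; try exact: sub.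
    by apply/(composite_dominates hV bQ) => //; exact: sub.
  by apply/(composite_dominates hV bQ') => //; exact: sub.
- move=> V hV bV [z nz]; have [Q ZQ [QV mQ]] := hprop hV bV.
  have QE : Q `<=` E by move=> x /QV [].
  have nQ : Q <> E.
    by move=> e; have [x Ex ex] := res_surj hpi z; rewrite -e in Ex; have [_] := QV x Ex; rewrite ex.
  have bQ : below Q.
    by split=> //; exact: (below_divisor hZ (surface_dim hZ hdeg) pE ZQ QE nQ).
  by exists Q => //; apply/(composite_dominates hV bQ QV).
- move=> z; have [e Ee ez] := res_surj hpi z.
  have [me|ne] := pselect (mideal E e).
    apply: (sub_finite_set (B := set0)) => // Q [bQ nz]; apply: nz.
    by rewrite -ez; have /(res_eq0 hpi Ee) -> := me; exact: (sr0 (img_local hpi lE (lb bQ) bQ.2).1).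
  apply: sub_finite_set (finite_nonunit Ee ne) => Q [bQ nz]; split=> // -[_ Qe _].
  by apply: nz; exists e.
Qed.

(** Lifts of two independent residues, together with a uniformizer of E, would be three
    algebraically independent elements of K. *)
Lemma residue_dep (x y : kap) : ~ trtower (base j) [:: x; y].
Proof.
move=> [nx [ny _]]; have [a Ea ea] := res_surj hpi x; have [b Eb eb] := res_surj hpi y.
have bE : base iota `<=` E by move=> _ [c ->].
have sk := base_sf iota.
have na : ~ talg E (base iota) a by move=> ta; apply: nx; rewrite -ea; exact (res_alg hpi Ei hj Ea ta).
have L1E := ntalg_fadj_sub lE sk bE Ea na.
pose L1 := fadj (base iota) a; have sL1 : is_subfield L1 by exact: fadj_sf (base_sr iota).
have mpb (f : {poly K}) : polyin (base iota) f -> polyin (base j) (map_poly pi f).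
  move=> bf n; rewrite coef_map_id0; last exact: (res0 hpi).
  by have [c ->] := bf n; exists c; rewrite hj.
have bEf (f : {poly K}) : polyin (base iota) f -> polyin E f by move=> bf n; apply: bE.
have nb : ~ talg E L1 b.
  move=> [f [Lf f0 mf]]; apply: ny; rewrite -eb.
  have LfE : polyin E f by move=> n; apply: L1E; exact: Lf.
  exists (map_poly pi f); split.
  - move=> n; rewrite coef_map_id0; last exact: (res0 hpi).
    have [g [h [bg bh h0 ->]]] := Lf n.
    have Eg : E g.[a] by exact: (polyin_horner sE (bEf g bg)).
    have L1h : L1 h.[a] by apply: (adj_fadj (base_sr iota)); exists h.
    have uh : is_unit E h.[a] by exact: (subfield_unit sL1 L1E L1h).
    have [_ Eh Eh'] := uh.
    rewrite (resM hpi) // (resV hpi uh) !(res_horner hpi) //; try exact: bEf.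
    exists (map_poly pi g), (map_poly pi h); split; try exact: mpb; last by rewrite ea.
    rewrite -ea -(res_horner hpi) //; last exact: bEf.
    by apply/eqP => /(res_eq0 hpi Eh) [_].
  - apply: contraNneq f0 => e; apply/eqP/polyP => n; rewrite coef0.
    have := congr1 (fun g : {poly kap} => g`_n) e; rewrite /= coef0 coef_map_id0; last exact: (res0 hpi).
    by move=> /(res_eq0 hpi (LfE n)); exact: (subfield_nmideal sL1 L1E).
  - by rewrite rootE -(res_horner hpi) //; apply/eqP/(res_eq0 hpi (midealW mf)).
have L2E := ntalg_fadj_sub lE sL1 L1E Eb nb.
have sL2 : is_subfield (fadj L1 b) by exact: fadj_sf sL1.1.
have [t [_ et t0 _]] := dZ.2 E pE.
have mt : mideal E t by rewrite et; exists 1; [exact: sr1|rewrite mulr1].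
have ntalg L x' : alg L x' -> talg E L x'.
  by move=> [f [Lf f0 rf]]; exists f; split=> //; move: rf; rewrite rootE => /eqP ->; exact: mideal0.
have tw : trtower (base iota) [:: a; b; t].
  split; first by move=> /ntalg.
  split; first by move=> /ntalg.
  by split=> //; exact: (mideal_transc lE sL2 L2E mt t0).
have [s [q [cs _ _]]] := point_chart hZ ZE.
have [xs [_ tws als]] := tower_extend s sk tw.
have := pdegree_uniq hdeg (tower_pdegree hp hperf cs.1 tws als).
by rewrite size_cat.
Qed.

Local Notation len Q x := (qd j (img pi Q) (principal (img pi Q) x)).

Local Notation C_E C := (curve_intersection iota Z C E).

Lemma equation_other Q C D c : Z Q -> prime_divisor Z C -> prime_divisor Z D -> Q `<=` C -> Q `<=` D ->
  C <> D -> ideal_at Q C = principal Q c -> ~ mideal D c.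
Proof.
move=> ZQ pC pD QC QD nCD ec mc; have [d [Qd mCd nDd]] := prime_separate hZ ZQ pC pD QC QD nCD.
apply: nDd; have : ideal_at Q C d by split.
rewrite ec => -[a Qa ->]; rewrite mulrC; have [ZD _ _] := pD.
by apply: (midealM (point_sr hZ ZD)) => //; exact: QD.
Qed.

Lemma local_intersectionE Q C c : below Q -> prime_divisor Z C -> Q `<=` C -> C <> E -> Q c ->
  ideal_at Q C = principal Q c -> local_intersection iota Q C E = len Q (pi c).
Proof.
move=> bQ pC QC nCE Qc ec; have [[ZQ _] QE] := bQ.
have nc := equation_other ZQ pC pE QC QE nCE ec.
have [_ ->] := img_len bQ Qc nc.
rewrite /local_intersection /qd; congr (xget 0%N _); apply/seteqP; split=> n; congr (quotient_dim iota Q _ n);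
  apply/seteqP; split=> x.
- rewrite ec => -[y hy [Qxy mxy]]; exists (x - y), y; split=> //; last by rewrite subrK.
- by move=> [u [y [[mu Qu] hy ->]]]; exists y; rewrite ?ec // addrK; split.
- by move=> [u [y [[mu Qu] hy ->]]]; exists y; rewrite ?ec // addrK; split.
- rewrite ec => -[y hy [Qxy mxy]]; exists (x - y), y; split=> //; last by rewrite subrK.
Qed.

Lemma len_gt0 Q a : below Q -> mideal Q a -> ~ mideal E a -> (0 < len Q (pi a))%N.
Proof.
move=> bQ ma na; have lQ := lb bQ; have QE := bQ.2; have Qa := midealW ma.
have [fin _] := img_len bQ Qa na.
have sI := (img_local hpi lE lQ QE).1.
have kI : submod (base j) (principal (img pi Q) (pi a)).
  by apply: (ksubS (img_base hj (bb bQ))); exact: principalS.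
rewrite lt0n; apply/eqP => e0; have := qdP kI fin; rewrite e0 => -[b [_ sb _]].
have [c] := sb 1 (sr1 sI); rewrite big_ord0 subr0 => -[z Iz e].
have : is_unit (img pi Q) (pi a).
  have Ia : img pi Q (pi a) by exists a.
  have p0 : pi a != 0 by apply/eqP => a0; move/eqP: e; rewrite a0 mul0r oner_eq0.
  by split=> //; have -> : (pi a)^-1 = z by rewrite -[RHS](mulKf p0) -e mulr1.
by move=> /(img_unit hpi lE lQ QE Qa); case: ma.
Qed.

(** Induction on the length: a nonunit f vanishes on some prime divisor C through Q, the local
    equation of C divides f, and lengths add up over products. *)
Lemma local_degree Q f (S : seq (set K)) : below Q -> Q f -> ~ mideal E f -> uniq S ->
  (forall C, prime_divisor Z C -> Q `<=` C -> ord C f != 0 -> C \in S) ->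
  (len Q (pi f))%:R = \sum_(C <- S | `[< prime_divisor Z C /\ Q `<=` C >])
    (ord C f)%:~R * (local_intersection iota Q C E)%:R :> rat.
Proof.
move=> bQ; have [cQ QE] := bQ; have lQ := lb bQ; have sQ := lQ.1; have [ZQ _] := cQ.
have lI := img_local hpi lE lQ QE; have sI := lI.1; have bI := img_base hj (bb bQ).
have Inz a : Q a -> ~ mideal E a -> pi a != 0.
  by move=> Qa na; apply/eqP => /(res_eq0 hpi (QE a Qa)).
have finI x : img pi Q x -> x != 0 -> kfin j (img pi Q) (principal (img pi Q) x).
  move=> [a Qa <-] pa0; have na : ~ mideal E a.
    by move=> ma; move/eqP: pa0; apply; apply/(res_eq0 hpi (QE a Qa)).
  by have [] := img_len bQ Qa na.
have [n] := ubnP (len Q (pi f)); elim: n f => // n IH f; rewrite ltnS => len_n Qf nf uS hS.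
have f0 : f != 0 by apply/eqP => f0; apply: nf; rewrite f0; exact: (mideal0 sE).
have [uf|mf] := unitVm Qf.
  rewrite (len_unit sI bI); last by apply/(img_unit hpi lE lQ QE Qf).
  rewrite big1 // => C /asboolP [pC QC]; have [c hC] := dZ.2 C pC.
  have [_ Qf' Qfi] := uf; have : is_unit C f by split=> //; exact: QC.
  by move=> /(ord_unit hC) [_ ->]; rewrite mul0r.
have [C [pC QC mCf]] := through_prime cQ mf f0.
have [c [hC Qc ec]] := divisor_equation cQ pC QC.
have nCE : C <> E by move=> e; apply: nf; rewrite -e.
have c0 := dvr_t0 hC; have nc := equation_other ZQ pC pE QC QE nCE ec.
have [f' Qf' ef] : principal Q c f by rewrite -ec; split.
have nf' : ~ mideal E f'.
  by move=> h; apply: nf; rewrite ef; apply: (midealM sE) => //; exact: QE.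
have f'0 : f' != 0 by apply/eqP => h; apply: nf'; rewrite h; exact: (mideal0 sE).
have mc : mideal Q c.
  apply: (mideal_anti QC); split=> //; rewrite (dvr_mideal hC); exists 1; [exact: (sr1 (dvr_sr hC))|by rewrite mulr1].
have ordc D : prime_divisor Z D -> Q `<=` D -> ord D c = (D == C)%:R.
  move=> pD QD; have [->|/eqP nDC] := eqVneq D C; first exact: ord_t hC.
  have [d hD] := dZ.2 D pD.
  have nD := equation_other ZQ pC pD QC QD (fun e => nDC (esym e)) ec.
  by case: (unitVm (QD c Qc)) => // /(ord_unit hD) [_ ->].
have ordf D : prime_divisor Z D -> Q `<=` D -> ord D f = (D == C)%:R + ord D f'.
  by move=> pD QD; have [d hD] := dZ.2 D pD; rewrite ef (ordM hD) // ordc.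
have elen : len Q (pi f) = (len Q (pi c) + len Q (pi f'))%N.
  rewrite ef (resM hpi); [|exact: QE|exact: QE].
  by apply: (lenM sI bI finI); [exists c|exists f'|exact: Inz|exact: Inz].
have CS : C \in S.
  apply: hS => //; rewrite ordf // eqxx; have := (ord_ge0 hC f'0).1 (QC f' Qf'); lia.
have hS' D : prime_divisor Z D -> Q `<=` D -> ord D f' != 0 -> D \in S.
  move=> pD QD nz; apply: hS => //; rewrite ordf //; have [d hD] := dZ.2 D pD.
  by have := (ord_ge0 hD f'0).1 (QD f' Qf'); move: nz; case: (D == C); lia.
have lt : (len Q (pi f') < n)%N.
  by apply: leq_trans len_n; rewrite elen -addn1 addnC leq_add2r; exact: len_gt0.
rewrite elen natrD (IH f' lt Qf' nf' uS hS').
rewrite -(local_intersectionE bQ pC QC nCE Qc ec).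
have -> : \sum_(D <- S | `[< prime_divisor Z D /\ Q `<=` D >])
    (ord D f)%:~R * (local_intersection iota Q D E)%:R =
  \sum_(D <- S | `[< prime_divisor Z D /\ Q `<=` D >]) (D == C)%:R * (local_intersection iota Q D E)%:R +
  \sum_(D <- S | `[< prime_divisor Z D /\ Q `<=` D >])
    (ord D f')%:~R * (local_intersection iota Q D E)%:R :> rat.
  rewrite -big_split /=; apply: eq_bigr => D /asboolP [pD QD].
  by rewrite ordf // intrD mulrDl; congr (_ * _ + _); case: (D == C).
congr (_ + _); rewrite big_mkcond (bigD1_seq C) //= asboolT // eqxx mul1r big1 ?addr0 // => D nD.
by case: ifP => //; rewrite (negbTE nD) mul0r.
Qed.

Lemma common_below_finite C : prime_divisor Z C -> C <> E -> finite_set [set Q | below Q /\ Q `<=` C].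
Proof.
move=> pC nCE; have [[Q0 [bQ0 Q0C]]|no] := pselect (exists Q, below Q /\ Q `<=` C); last first.
  by apply: (sub_finite_set (B := set0)) => // Q h; case: no; exists Q.
have [d [Qd mCd nEd]] := prime_separate hZ bQ0.1.1 pC pE Q0C bQ0.2 nCE.
have Ed := bQ0.2 d Qd; apply: sub_finite_set (finite_nonunit Ed nEd) => Q [bQ QC].
split=> // -[d0 Qd1 Qd2]; have [_] := mCd; apply; split=> //; exact: QC.
Qed.

Lemma finite_list (T : choiceType) (A : set T) : finite_set A ->
  exists2 s : seq T, uniq s & forall x, x \in s <-> A x.
Proof.
move=> /finite_seqP [s ->]; exists (undup s) => [|x]; first exact: undup_uniq.
by rewrite mem_undup.
Qed.

Lemma curve_intersectionE (T : seq (set K)) C : uniq T -> (forall Q, below Q -> Q `<=` C -> Q \in T) ->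
  C_E C =
  (\sum_(Q <- T | `[< below Q /\ Q `<=` C >]) local_intersection iota Q C E)%N.
Proof.
move=> uT hT; rewrite /curve_intersection [RHS](bigfs _ uT) /=.
  congr (\sum_(Q \in _) _)%N; apply/seteqP; split=> Q /=.
    by move=> [h1 h2 h3]; apply/asboolP.
  by move=> /asboolP [[h1 h2] h3].
by move=> Q /asboolP [h1 h2]; rewrite hT.
Qed.

(** The residue of u is a rational function on E. Regrouped by closed points of E, the sum consists
    of lengths of numerators minus lengths of denominators, which balance by [curve_degree]. *)
Lemma degree_zero u (S : seq (set K)) : u != 0 -> ord E u = 0 -> uniq S ->
  (forall C, prime_divisor Z C -> ord C u != 0 -> C \in S) ->
  \sum_(C <- S | `[< prime_divisor Z C /\ C <> E >]) (ord C u)%:~R * (C_E C)%:R = 0 :> rat.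
Proof.
move=> u0 ou uS hS; have [t hE] := dZ.2 E pE.
have uu : is_unit E u by apply/(ord_unit hE).
have [_ Eu Eu'] := uu.
have pu0 : pi u != 0 by apply/eqP => /(res_eq0 hpi Eu) [].
have hcv := residue_curve.
pose bad := [set Q | below Q /\ ~ img pi Q (pi u)] `|` [set Q | below Q /\ ~ img pi Q (pi u)^-1] `|`
  \bigcup_(C in [set` S] `&` [set C | prime_divisor Z C /\ C <> E]) [set Q | below Q /\ Q `<=` C].
have [|T uT eT] := @finite_list _ bad.
  rewrite !finite_setU; split; first by split; exact: cv_finite hcv _.
  apply: bigcup_finite; first by apply: (sub_finite_set (B := [set` S])); [move=> C []|exact: finite_seq].
  by move=> C [_ [pC nC]]; exact: common_below_finite.
have bT Q : Q \in T -> below Q by move=> /eT [[[]|[]]|[C _ []]].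
have inT Q : bad Q -> Q \in T by move=> /eT.
have /choice [f hf] : forall Q, exists f : K * K, below Q ->
    [/\ Q f.1, Q f.2, ~ mideal E f.1, ~ mideal E f.2 & u = f.1 / f.2].
  move=> Q; have [bQ|nb] := pselect (below Q); last by exists (0, 0).
  by have [a [b h]] := below_quotient bQ u0 ou; exists (a, b).
have nz a : ~ mideal E a -> a != 0.
  by move=> na; apply/eqP => a0; apply: na; rewrite a0; exact: (mideal0 sE).
have /choice [s hs] : forall a : K, exists s : seq (set K), a != 0 ->
    forall C, prime_divisor Z C -> ord C a != 0 -> C \in s.
  move=> a; have [->|a0] := eqVneq a 0; first by exists [::].
  have [s _ es] := finite_list (ord_finite dZ a0); exists s => _ C pC oC; exact/es.
pose w C : rat := (ord C u)%:~R * (C_E C)%:R.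
(* Local numerators and denominators of u may vanish on divisors where u has order zero; the list
   must contain these too. *)
pose S' := undup (S ++ flatten [seq s (f Q).1 ++ s (f Q).2 | Q <- T]).
have uS' : uniq S' by exact: undup_uniq.
have -> : \sum_(C <- S | `[< prime_divisor Z C /\ C <> E >]) w C =
    \sum_(C <- S' | `[< prime_divisor Z C /\ C <> E >]) w C.
  have out C : prime_divisor Z C -> C \notin S -> w C = 0.
    by move=> pC nS; rewrite /w; case: (eqVneq (ord C u) 0) => [->|/(hS C pC)]; rewrite ?mul0r // (negbTE nS).
  rewrite (bigfs _ uS) => [|C /asboolP [pC _]]; last exact: out.
  rewrite [RHS](bigfs _ uS') // => C /asboolP [pC _]; rewrite mem_undup mem_cat negb_or => /andP[nS _].
  exact: out.
have -> : \sum_(C <- S' | `[< prime_divisor Z C /\ C <> E >]) w C =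
    \sum_(Q <- T) ((len Q (pi (f Q).1))%:R - (len Q (pi (f Q).2))%:R) :> rat.
  transitivity (\sum_(C <- S') \sum_(Q <- T) (if `[< prime_divisor Z C /\ Q `<=` C >] then
      (ord C u)%:~R * (local_intersection iota Q C E)%:R else 0) : rat).
    rewrite big_mkcond; apply: eq_bigr => C _; case: asboolP => [[pC nC]|nn]; last first.
      rewrite big1_seq // => Q /andP[_ QT]; case: asboolP => // -[pC QC].
      have -> : C = E by apply: contrapT => nC; apply: nn.
      by rewrite ou mul0r.
    rewrite /w; have [o0|o0] := eqVneq (ord C u) 0.
      by rewrite o0 mul0r big1 // => Q _; case: ifP => //; rewrite mul0r.
    rewrite (@curve_intersectionE T) //; last first.
      by move=> Q bQ QC; apply: inT; right; exists C => //; split; [exact: hS|].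
    rewrite natr_sum mulr_sumr big_mkcond; apply: eq_big_seq => Q QT.
    have bQ := bT Q QT; case: (asboolP (below Q /\ Q `<=` C)) => [[_ QC]|nn]; first by rewrite asboolT.
    by rewrite asboolF // => -[_ QC]; apply: nn.
  rewrite exchange_big; apply: eq_big_seq => Q QT; have bQ := bT Q QT.
  have [Qa Qb na nb eu] := hf Q bQ; have a0 := nz _ na; have b0 := nz _ nb.
  have sub x : (x = (f Q).1) \/ (x = (f Q).2) -> forall C, prime_divisor Z C -> ord C x != 0 -> C \in S'.
    move=> hx C pC oC; rewrite mem_undup mem_cat; apply/orP; right; apply/flatten_mapP; exists Q => //.
    by rewrite mem_cat; apply/orP; case: hx => ex; [left|right]; apply: hs => //; rewrite -ex.
  rewrite (@local_degree Q (f Q).1 S') // => [|C pC _]; last by apply: sub => //; left.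
  rewrite (@local_degree Q (f Q).2 S') // => [|C pC _]; last by apply: sub => //; right.
  rewrite -sumrB [RHS]big_mkcond; apply: eq_bigr => C _; case: asboolP => // -[pC QC].
  have [c hC] := dZ.2 C pC.
  by rewrite {1}eu (ordM hC) ?invr_eq0 // (ordV hC) // intrB mulrBl.
rewrite sumrB; apply/eqP; rewrite subr_eq0 -!natr_sum; apply/eqP; congr (_%:R).
rewrite !(big_nth E) !big_mkord.
pose Tn (i : 'I_(size T)) := nth E T i.
have bTn i : below (Tn i) by apply: bT; exact: mem_nth.
apply: (curve_degree residue_dep hcv (z := pi u) (T := Tn)) => //.
- by move=> a b /eqP; rewrite nth_uniq // => /eqP /val_inj.
- move=> Q bQ nQ; have nT : Q \notin T.
    by apply/negP => QT; have := QT; rewrite -index_mem => lt; apply: (nQ (Ordinal lt)); rewrite /Tn /= nth_index.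
  split; apply: contrapT => h; move/negP: nT; apply; apply: inT; left; [by left|by right].
- move=> i; have bQ := bTn i; have [Qa Qb na nb eu] := hf _ bQ; have QE := bQ.2.
  have ub : is_unit E (f (Tn i)).2 by case: (unitVm (QE _ Qb)).
  have [b0 Eb Eb'] := ub; have Ea := QE _ Qa; split.
  + by eexists; [exact: Qa|].
  + by eexists; [exact: Qb|].
  + by apply/eqP => /(res_eq0 hpi Ea).
  + by apply/eqP => /(res_eq0 hpi Eb).
  + by rewrite {1}eu (resM hpi) // (resV hpi ub).
Qed.

Lemma curve_intersection_gt0 Q C : below Q -> prime_divisor Z C -> Q `<=` C -> C <> E ->
  (0 < C_E C)%N.
Proof.
move=> bQ pC QC nCE; have [cQ QE] := bQ.
have [T uT eT] := finite_list (common_below_finite pC nCE).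
rewrite (@curve_intersectionE T) //; last by move=> R bR RC; exact/eT.
have QT : Q \in T by exact/eT.
rewrite big_mkcond (bigD1_seq Q) //= asboolT // ltn_addr //.
have [c [hC Qc ec]] := divisor_equation cQ pC QC.
rewrite (local_intersectionE bQ pC QC nCE Qc ec); apply: len_gt0 => //.
  apply: (mideal_anti QC); split=> //; rewrite (dvr_mideal hC).
  by exists 1; [exact: (sr1 (dvr_sr hC))|rewrite mulr1].
exact: (equation_other cQ.1 pC pE QC QE nCE ec).
Qed.

End ExceptionalCurve.

(** * Negativity over a closed point *)

Section Negativity.
Variables (X : set (set K)) (dX : divisorial iota X) (hZX : proper_birational Z X).
Let hX := dX.1.
Let dZ := smooth_divisorial.
Let dimX := surface_dim hX hdeg.

(** A prime divisor through Q containing y^(m+1) + x and y^(n+1) + x, m < n, contains y and x, hence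
    would be Q. So infinitely many prime divisors pass through Q. *)
Lemma avoiding_prime Q (l : seq (set K)) : closed_point Z Q ->
  exists C, [/\ prime_divisor Z C, Q `<=` C & C \notin l].
Proof.
move=> cQ; have [ZQ _] := cQ; have lQ := point_local hZ ZQ; have sQ := lQ.1; have mQ := local_prime lQ.
have [x [y [hb mx my hm]]] := closed_plane cQ.
have Qy := midealW my.
have hf n : mideal Q (y ^+ n.+1 + x) /\ y ^+ n.+1 + x != 0.
  split; first by apply: (primeD mQ) => //; rewrite exprSr; apply: (midealM sQ) => //; exact: srX.
  apply/negP; rewrite addr_eq0 => /eqP e; apply: (pbasis_ndiv (n := n.+1) lQ hb mx).
  by rewrite e; exists (-1); [apply: (srN sQ); exact: (sr1 sQ)|rewrite mulrN1].
have /choice [C hC] : forall n, exists C, [/\ prime_divisor Z C, Q `<=` C & mideal C (y ^+ n.+1 + x)].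
  by move=> n; have [mf f0] := hf n; exact (through_prime cQ mf f0).
have main m n : (m < n)%N -> C m <> C n.
  move=> mn e; have [pC QC mC1] := hC m; have [_ _ mC2] := hC n; rewrite -e in mC2.
  have [ZC _ _] := pC; have lC := point_local hZ ZC; have pm := local_prime lC; have sC := lC.1.
  have Cy : mideal (C m) y.
    have yn : mideal (C m) (y ^+ m.+1).
      have h : mideal (C m) (y ^+ m.+1 * (1 - y ^+ (n - m))).
        have -> : y ^+ m.+1 * (1 - y ^+ (n - m)) = (y ^+ m.+1 + x) - (y ^+ n.+1 + x).
          have -> : (n.+1 = m.+1 + (n - m))%N by lia.
          by rewrite exprD; ring.
        exact: (primeB sC pm).
      have [u0 Qu Qu'] : is_unit Q (1 - y ^+ (n - m)).
        apply: (unit_add lQ (unit1 sQ)); apply: (primeN sQ mQ).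
        by rewrite -(prednK (n := n - m)) ?subn_gt0 // exprSr; apply: (midealM sQ) => //; exact: srX.
      by rewrite -[y ^+ m.+1](mulfK u0); apply: (primeMr pm) => //; exact: QC.
    exact: (primeX sC pm (QC y Qy) yn).
  have Cx : mideal (C m) x.
    have -> : x = (y ^+ m.+1 + x) - y ^+ m * y by rewrite exprSr; ring.
    by apply: (primeB sC pm) => //; apply: (midealM sC) => //; apply: (srX sC); exact: QC.
  apply: (closed_not_divisor cQ); rewrite (point_sub_inj hZ ZQ ZC QC) // => z.
  move=> /hm [a [b [Qa Qb ->]]].
  by apply: (primeD pm); apply: (midealM sC) => //; exact: QC.
have injC : injective C.
  by move=> m n e; have [mn|mn|//] := ltngtP m n; [case: (main m n mn)|case: (main n m mn)].
apply: contrapT => no; have : (size (mkseq C (size l).+1) <= size l)%N.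
  apply: uniq_leq_size; first exact: mkseq_uniq.
  move=> D /mapP [n _ ->]; apply: contrapT => /negP nl; apply: no; exists (C n).
  by have [h1 h2 _] := hC n.
by rewrite size_mkseq ltnn.
Qed.

Section OverPoint.
Variables (P : set K) (cP : closed_point X P).

Let lP := point_local hX cP.1.

Lemma over_below E Q : dominates E P -> Z E -> closed_point Z Q -> Q `<=` E -> P `<=` Q.
Proof.
move=> dE ZE [ZQ _] QE; have [P3 XP3 [P3Q _]] := hZX.1 Q ZQ.
have P3E := subset_trans P3Q QE.
by rewrite -(cP.2 P3 XP3 (sub_center hX (point_local hZ ZE) XP3 cP.1 dE P3E)).
Qed.

Lemma over_exceptional C : exceptional Z X C -> P `<=` C -> dominates C P.
Proof.
move=> eC PC; have [[ZC _ _] _] := eC; have [P' cP' dC] := exceptional_center hX dimX hZX eC.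
have s := sub_center hX (point_local hZ ZC) cP.1 cP'.1 dC PC.
by rewrite (cP'.2 P cP.1 s).
Qed.

Lemma curve_gt0_below C E : (0 < curve_intersection iota Z C E)%N ->
  exists Q, [/\ closed_point Z Q, Q `<=` C & Q `<=` E].
Proof.
move=> h; apply: contrapT => no; move: h; rewrite /curve_intersection fsbig1 // => Q hQ.
by case: no; exists Q.
Qed.

Variables (D : set K -> int) (N : set K -> rat) (QN : Qdivisor Z N)
  (hND : forall C, prime_divisor Z C -> ~ exceptional Z X C -> N C = (D C)%:~R)
  (hNE : forall E, exceptional Z X E -> intersection_number iota Z N E 0).

Local Notation C_E E C := (curve_intersection iota Z C E).

(** If the inequality fails, a multiple of div r, with r in P vanishing on all exceptional curves
    over P, is added to div g + m N until the sum is nonnegative on these curves and zero on one of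
    them, E0. On E0 the sum has degree zero, yet no curve contributes negatively and an auxiliary
    curve meeting E0 contributes positively. *)
Lemma negativity E (m : nat) g : exceptional Z X E -> dominates E P -> g != 0 ->
  divisor_stalk X (fun F => (D F * m%:Z)%:~R) P g -> - (m%:R * N E) <= (ord E g)%:~R.
Proof.
move=> eE dE g0 [ge|hg]; first by rewrite ge eqxx in g0.
have [[ZE ET _] _] := eE.
have PT : P <> setT by move=> eP; apply: ET; apply: setT_max; rewrite -eP; case: dE.
have [r0 mr0 r00] := point_nz hX cP.1 PT.
have finE : finite_set [set E' | exceptional Z X E' /\ dominates E' P].
  apply: sub_finite_set (ord_finite dZ r00) => E' [[pE' _] [_ h]]; split=> //.
  have [t hE'] := dZ.2 E' pE'; apply/eqP => o0.
  by have [_] := h r0 mr0; apply; apply/(ord_unit hE').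
have [exs uex eex] := finite_list finE.
have exP E' : E' \in exs <-> exceptional Z X E' /\ dominates E' P by exact: eex.
(* [cr E'] is an auxiliary curve meeting E' and not exceptional over P, with an element of the
   maximal ideal of P vanishing on it; ([setT], 0) is a dummy value. *)
have /choice [cr hcr] : forall E', exists cr : set K * K, E' \in exs ->
    [/\ prime_divisor Z cr.1, cr.1 \notin exs, exists Q, [/\ closed_point Z Q, Q `<=` cr.1 & Q `<=` E'],
        cr.2 != 0 & mideal P cr.2 /\ mideal cr.1 cr.2].
  move=> E'; case: (boolP (E' \in exs)) => [/exP [[pE' _] dE']|_]; last by exists (setT, 0).
  have [Q cQ QE'] := divisor_closed pE'; have [ZE' _ _] := pE'.
  have [C [pC QC nC]] := avoiding_prime exs cQ; have PQ := over_below dE' ZE' cQ QE'.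
  have PC := subset_trans PQ QC; have [ZC CT _] := pC.
  have [x mx x0] := point_nz hZ ZC CT; have [a [b [Pa Pb b0 e]]] := point_frac hX cP.1 x.
  have ea : a = b * x by rewrite e mulrC divfK.
  have ma : mideal C a by rewrite ea; apply: (midealM (point_sr hZ ZC)) => //; exact: PC.
  exists (C, a) => _; split=> //=; first by exists Q.
    by rewrite ea mulf_neq0.
  by split=> //; apply: (mideal_anti PC); split.
pose r := \prod_(E' <- exs) (cr E').2.
have rn0 : r != 0 by rewrite prodf_seq_neq0; apply/allP => E' /hcr [].
have Pr : P r.
  rewrite /r big_seq; apply: (sr_prod lP.1) => E' /hcr [_ _ _ _ [h _]]; exact: midealW h.
have rdiv E' : E' \in exs -> exists2 a, P a & r = a * (cr E').2.
  move=> hE'; rewrite /r (big_rem E') //= mulrC; eexists; last by [].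
  rewrite big_seq; apply: (sr_prod lP.1) => E'' /mem_rem /hcr [_ _ _ _ [h _]]; exact: midealW h.
have ordr_pos E' : E' \in exs -> 0 < ord E' r.
  move=> hE'; have /exP [[pE' _] [PE' mP]] := hE'; have [t hE''] := dZ.2 E' pE'.
  have [a Pa er] := rdiv E' hE'; have [_ _ _ _ [mc _]] := hcr E' hE'.
  have : mideal E' r by rewrite er; apply: (midealM (dvr_sr hE'')); [exact: PE'|exact: mP].
  by move=> /(vge1P hE'') [/eqP|]; rewrite ?(negbTE rn0).
have ordr_ge C : prime_divisor Z C -> P `<=` C -> 0 <= ord C r.
  by move=> pC PC; have [t hC] := dZ.2 C pC; apply/(ord_ge0 hC rn0); exact: PC.
have gN C : prime_divisor Z C -> P `<=` C -> ~ exceptional Z X C -> 0 <= (ord C g)%:~R + m%:R * N C :> rat.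
  move=> pC PC nC; have pCX := nonexceptional dX hZ pC nC; have := hg C pCX PC.
  by rewrite intrKfloor (hND pC nC) -(ler_int rat) intrD intrM mulrC.
rewrite leNgt; apply/negP => lt.
pose A C : rat := (ord C g)%:~R + m%:R * N C.
have AE : A E < 0 by rewrite /A; lra.
have Eex : E \in exs by apply/exP.
(* E0 is where A is most negative relative to the order of r; la is the least factor for which A +
   la ord r is nonnegative on all exceptional curves over P. *)
have [E0 E0ex maxE] := seq_argmax (fun E' => - A E' / (ord E' r)%:~R) Eex.
pose la := - A E0 / (ord E0 r)%:~R; rewrite -/la in maxE.
have rpos E' : E' \in exs -> 0 < (ord E' r)%:~R :> rat by move=> h; rewrite ltr0z ordr_pos.
have la0 : 0 < la by apply: lt_le_trans (maxE E Eex); rewrite divr_gt0 ?rpos // oppr_gt0.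
have exge E' : E' \in exs -> 0 <= A E' + la * (ord E' r)%:~R.
  by move=> h; have := maxE E' h; rewrite ler_pdivrMr ?rpos //; lra.
have ex0 : A E0 + la * (ord E0 r)%:~R = 0.
  by rewrite /la divfK ?subrr //; rewrite gt_eqF ?rpos.
have /exP [eE0 dE0] := E0ex; have [pE0 _] := eE0; have [ZE0 _ _] := pE0.
have [t0 hE0] := dZ.2 E0 pE0; have lE0 := point_local hZ ZE0.
have [kap [pi hpi]] := residue_field lE0.
have Ei c : E0 (iota c) by exact (point_base hZ ZE0 c).
have [j hj] := residue_rmorph hpi Ei.
have hprop := exceptional_proper hX hZX cP dE0 (dvr_valuation hE0) hpi Ei hj.
have [h [h0 oh] hsum] := hNE eE0.
pose G C : rat := (A C + la * (ord C r)%:~R) * (C_E E0 C)%:R.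
have Gge C : prime_divisor Z C -> C <> E0 -> 0 <= G C.
  move=> pC nC; rewrite /G; case: (posnP (C_E E0 C)) => [->|]; first by rewrite mulr0.
  move=> /curve_gt0_below [Q [cQ QC QE0]]; apply: mulr_ge0; last by rewrite ler0n.
  have PC := subset_trans (over_below dE0 ZE0 cQ QE0) QC.
  have [eC|nC'] := pselect (exceptional Z X C).
    by apply: exge; apply/exP; split=> //; exact: over_exceptional.
  apply: addr_ge0; first exact: gN.
  by rewrite mulr_ge0 ?(ltW la0) // ler0z ordr_ge.
have supp f : f != 0 -> exists s : seq (set K), forall C, prime_divisor Z C -> ord C f != 0 -> C \in s.
  move=> f0; have [s _ es] := finite_list (ord_finite dZ f0); exists s => C pC oC; exact/es.
have [sg hsg] := supp g g0; have [sr hsr] := supp r rn0; have [sh hsh] := supp h h0.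
have [sN _ esN] := finite_list QN.1.
pose S := undup (sg ++ sr ++ sh ++ sN); have uS : uniq S by exact: undup_uniq.
have inS C : prime_divisor Z C -> [\/ ord C g != 0, ord C r != 0, ord C h != 0 | N C != 0] -> C \in S.
  move=> pC; rewrite mem_undup !mem_cat => -[/(hsg C pC) ->|/(hsr C pC) ->|/(hsh C pC) ->|n] //; rewrite ?orbT //.
  by have -> : C \in sN; [exact/esN|rewrite !orbT].
pose cond C := `[< prime_divisor Z C /\ C <> E0 >].
have hsum' : 0 = \sum_(C <- S | cond C)
    (N C - N E0 * (ord C h)%:~R) * (C_E E0 C)%:R.
  rewrite (bigfs _ uS) => [|C /asboolP [pC _] nS]; last first.
    have [n1|n1] := eqVneq (N C) 0; last by move: nS; rewrite inS //; constructor 4.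
    have [n2|n2] := eqVneq (ord C h) 0; last by move: nS; rewrite inS //; constructor 3.
    by rewrite n1 n2 mulr0 subrr mul0r.
  rewrite {1}hsum; congr (\sum_(C \in _) _); apply/seteqP; split=> C /=; first by move=> ?; apply/asboolP.
  by move/asboolP.
have deg f : f != 0 -> (forall C, prime_divisor Z C -> ord C f != 0 -> C \in S) ->
    \sum_(C <- S | cond C) ((ord C f)%:~R - (ord E0 f)%:~R * (ord C h)%:~R) *
      (C_E E0 C)%:R = 0 :> rat.
  move=> f0 hf; pose u := f / h ^ ord E0 f.
  have hn0 : h ^ ord E0 f != 0 by rewrite expfz_neq0.
  have u0 : u != 0 by rewrite mulf_neq0 ?invr_eq0.
  have ou C : prime_divisor Z C -> ord C u = ord C f - ord E0 f * ord C h.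
    by move=> pC; have [c hC] := dZ.2 C pC; rewrite (ordM hC) ?invr_eq0 // (ordV hC) // (ordXz hC) // mulrC.
  rewrite -[RHS](degree_zero pE0 hpi hj hprop u0 _ uS).
  - by apply: eq_bigr => C /asboolP [pC _]; rewrite ou // intrB intrM.
  - by rewrite ou // oh mulr1 subrr.
  - move=> C pC; rewrite ou // => nz; have [o1|o1] := eqVneq (ord C f) 0; last exact: hf.
    by apply: inS => //; constructor 3; apply: contraNneq nz => ->; rewrite o1 mulr0 subrr.
have dg := deg g g0 (fun C pC o => inS C pC (Or41 _ _ _ o)).
have dr := deg r rn0 (fun C pC o => inS C pC (Or42 _ _ _ o)).
(* The coefficient at E0 being zero, multiples of div h may be inserted freely; the sum then splits
   into three parts of degree zero on E0. *)
have sum0 : \sum_(C <- S | cond C) G C = 0.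
  pose I C : rat := (C_E E0 C)%:R.
  transitivity (\sum_(C <- S | cond C) ((ord C g)%:~R - (ord E0 g)%:~R * (ord C h)%:~R) * I C +
    m%:R * (\sum_(C <- S | cond C) (N C - N E0 * (ord C h)%:~R) * I C) +
    la * (\sum_(C <- S | cond C) ((ord C r)%:~R - (ord E0 r)%:~R * (ord C h)%:~R) * I C)); last first.
    by rewrite dg dr -hsum' !mulr0 !addr0.
  rewrite !mulr_sumr -!big_split /=; apply: eq_bigr => C _; rewrite /I /G.
  move: ex0; rewrite /A; set cc := (C_E E0 C)%:R => e.
  have -> : ((ord C g)%:~R + m%:R * N C + la * (ord C r)%:~R) * cc =
    ((ord C g)%:~R - (ord E0 g)%:~R * (ord C h)%:~R) * cc + m%:R * ((N C - N E0 * (ord C h)%:~R) * cc) +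
      la * (((ord C r)%:~R - (ord E0 r)%:~R * (ord C h)%:~R) * cc) +
    ((ord E0 g)%:~R + m%:R * N E0 + la * (ord E0 r)%:~R) * ((ord C h)%:~R * cc) by ring.
  by rewrite e mul0r addr0.
have [pC nCex [Q [cQ QC QE0]] cr0 [mPc mCc]] := hcr E0 E0ex.
set C := (cr E0).1 in pC nCex QC mCc.
have PC := subset_trans (over_below dE0 ZE0 cQ QE0) QC.
have nE0 : C <> E0 by move=> e; move: nCex; rewrite e E0ex.
have nexC : ~ exceptional Z X C.
  by move=> eC; move/negP: nCex; apply; apply/exP; split=> //; exact: over_exceptional.
have [c hC] := dZ.2 C pC.
have orC : 0 < ord C r.
  have [a Pa er] := rdiv E0 E0ex.
  have : mideal C r by rewrite er; apply: (midealM (dvr_sr hC)) => //; exact: PC.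
  by move=> /(vge1P hC) [/eqP|]; rewrite ?(negbTE rn0).
have CS : C \in S by apply: inS => //; constructor 2; rewrite gt_eqF.
have pos : 0 < G C.
  rewrite /G mulr_gt0 ?ltr0n //; last first.
    exact: (curve_intersection_gt0 pE0 hpi hj (conj cQ QE0) pC QC nE0).
  by apply: ltr_wpDl; [exact: gN|rewrite mulr_gt0 // ltr0z].
move: sum0; rewrite (big_rem C) //= {1}/cond asboolT //.
have : 0 <= \sum_(y <- rem C S | cond y) G y.
  by apply: sumr_ge0 => F /asboolP [pF nF]; exact: Gge.
by move=> h1 h2; move: (ltr_wpDr h1 pos); rewrite h2 ltxx.
Qed.

End OverPoint.
End Negativity.

End SmoothSurface.

(** * Differentials of a ring with a p-basis *)

Section PBasisOmega.
Variables (O : set K) (x y : K) (sO : is_subring O) (hpb : pbasis hp O x y).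

Section Module.
Variables (M : zmodType) (act : K -> M -> M) (hact : module_over O act).

Lemma act0l u : act 0 u = 0.
Proof. by apply: (addrI (act 0 u)); rewrite -(act_addl hact) ?addr0 //; exact: (sr0 sO). Qed.
Lemma derivation_pX delta c : derivation iota O act delta -> O c -> delta (c ^+ p) = 0.
Proof.
move=> hd Oc; have h n : delta (c ^+ n.+1) = act (n.+1%:R * c ^+ n) (delta c).
  elim: n => [|n IH]; first by rewrite expr1 expr0 mulr1 (act_one hact).
  have Ocn m : O (c ^+ m) by exact: srX.
  rewrite exprS (der_mul hd) // IH -(act_mul hact) //; last first.
    by apply: srM => //; exact: sr_nat.
  rewrite -(act_addl hact) //; [|by apply: srM => //; apply: srM => //; exact: sr_nat].
  by congr (act _ _); rewrite -[in RHS]natr1 exprS; ring.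
by rewrite -(prednK (p_gt0 hp)) h prednK ?(p_gt0 hp) // (pcharf0 hp) mul0r act0l.
Qed.

Lemma derivation_ext delta delta' : derivation iota O act delta -> derivation iota O act delta' ->
  delta x = delta' x -> delta y = delta' y -> forall a, O a -> delta a = delta' a.
Proof.
move=> hd hd' ex ey; have [fb Ox Oy hO] := hpb.
have d1 d : derivation iota O act d -> d 1 = 0.
  by move=> h; rewrite -(rmorph1 iota) (der_base h).
have dN d : derivation iota O act d -> forall a, O a -> d (- a) = - d a.
  move=> h a Oa; apply/eqP; rewrite -addr_eq0 -(der_add h) ?addNr //; last exact: srN.
  by rewrite -(rmorph0 iota) (der_base h).
pose T := [set a | O a /\ delta a = delta' a].
have sT : is_subring T.
  split; first by split; [exact: sr1|rewrite !d1].
  - move=> a b [Oa ea] [Ob eb]; split; first exact: srB.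
    have Onb : O (- b) by exact: srN.
    by rewrite !(der_add hd) // (der_add hd') // (dN _ hd) // (dN _ hd') // ea eb.
  - move=> a b [Oa ea] [Ob eb]; split; first exact: srM.
    by rewrite (der_mul hd) // (der_mul hd') // ea eb.
move=> a Oa; suff [] : T a by [].
have /fspanE [c ec] := fb.1 a; rewrite ec in Oa *; have Oc := hO c Oa.
apply: (sr_sum sT) => ij _; rewrite /pmon; apply: (srM sT).
  by split; [exact: srX|rewrite !derivation_pX].
by apply: (srM sT); apply: (srX sT).
Qed.

End Module.

(** Derivations kill p-th powers, so the values at x and y determine them; d/dx and d/dy, read off
    the p-basis, preserve O and realize all values. *)
Lemma pbasis_omega : Omega_free iota O 2.
Proof.
have [hb Ox Oy hO] := hpb; pose D (l : 'I_2) g := (frx x y l)^-1 * frD hb l g.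
have hD l : isder (D l) by exact: isder_scale (frD_der hb l).
have OD l g : O g -> O (D l g).
  rewrite /D /frx /frD => Og; case: (l == ord0); rewrite mulrC.
    exact: (pbasis_pD1x sO hpb).
  exact: (pbasis_pD2y sO hpb).
exists (frx x y) => [l|M act hact]; first by rewrite /frx; case: ifP.
pose o1 : 'I_2 := lift ord0 ord0.
split=> [m|d d' hd hd' e]; last first.
  by apply: (derivation_ext hact hd hd'); [exact: (e ord0)|exact: (e o1)].
have DD l l' : D l (frx x y l') = (l == l')%:R.
  rewrite /D frD_frx; case: eqP => [->|]; rewrite ?mul0r ?mulr0 // mul1r mulVf //.
  exact: frx_nz hb _.
clearbody D; exists (fun a => act (D ord0 a) (m ord0) + act (D o1 a) (m o1)).
  split.
  - move=> a b Oa Ob; rewrite !(derD (hD _)) !(act_addl hact); try exact: OD.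
    by rewrite addrACA.
  - move=> a b Oa Ob.
    have h l u : act (D l (a * b)) u = act a (act (D l b) u) + act b (act (D l a) u).
      have Da := OD l a Oa; have Db := OD l b Ob.
      have -> : D l (a * b) = a * D l b + b * D l a by rewrite (derM (hD l)); ring.
      by rewrite (act_addl hact) ?(act_mul hact) //; exact: srM.
    rewrite !h !(act_addr hact) //; exact: addrACA.
  - move=> c; have [c' <-] := hperf c.
    by rewrite rmorphXn !(der_pX hp (hD _)) !act0l // addr0.
move=> l; rewrite !DD; case: l => -[|[|//]] hl.
  have -> : Ordinal hl = ord0 by exact: val_inj.
  by rewrite eqxx (act_one hact) (act0l hact) addr0.
have -> : Ordinal hl = o1 by exact: val_inj.
by rewrite eqxx (act_one hact) (act0l hact) add0r.
Qed.

End PBasisOmega.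

(** * Reflexive log forms tested in codimension one *)

Section Sections.
Context {i : nat} {V : lmodType K} (dw : ('I_i -> K) -> V) (hV : Kaehler_forms iota dw).

Lemma reconstructs_exists x y (hb : pframe p hp x y) :
  exists n (A : 'I_n -> 'I_i -> 'I_2), reconstructs hperf hV hb A.
Proof.
move: dw hV; case: i => [|[|[|i']]] dw' hV'.
- by eexists; eexists; exact: reconstruct0.
- by eexists; eexists; exact: reconstruct1.
- by eexists; eexists; exact: reconstruct2.
- by eexists; eexists; exact: reconstruct3.
Qed.

Variables (X : set (set K)) (dX : divisorial iota X) (hdeg : pdegree hp 2).
Variables (S : set (set K)) (hS : S `<=` prime_divisor X) (D : set K -> rat).
Let hX := dX.1.
Let dimX := surface_dim hX hdeg.

Lemma prime_log_smooth F : prime_divisor X F -> log_smooth_at iota X S F.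
Proof.
move=> pF; have [t [s [hF us hpb]]] := prime_adapted hperf dX hdeg pF; have [XF FT Fmax] := pF.
have sF := dvr_sr hF; have t0 := dvr_t0 hF.
split.
  exists 2 => //; exact: (pbasis_omega sF hpb).
exists [:: t].
  have e1 : ideal_gen F [:: t] = principal F t.
    apply/seteqP; split=> z.
      by move=> [a Fa ->]; exists (a ord0); rewrite // big_ord1 mulrC.
    by move=> [a Fa ->]; exists (fun _ => a); rewrite // big_ord1 mulrC.
  rewrite /parameters e1 (dvr_mideal hF); split=> // -[|//] e.
  have : principal F t t by exists 1; [exact: sr1|rewrite mulr1].
  by rewrite e => -[a _]; rewrite big_ord0 => /eqP; rewrite (negbTE t0).
move=> E SE FE; exists t; first exact: mem_head.
have [XE ET _] := hS SE; have [-> |//] := Fmax E XE FE; split=> //.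
by rewrite /ideal_at -(dvr_mideal hF); apply/seteqP; split=> z; [case|move=> mz; split=> //; exact: midealW mz].
Qed.

(** Regular parameters adapted to S form a p-basis, whose log frame stays regular at every prime
    divisor through P. The coordinates of w thus satisfy all order conditions, which is what
    [divisor_stalk] asks for at P. *)
Lemma closed_log_form_stalk P w : closed_point X P -> log_smooth_at iota X S P ->
  (forall F, prime_divisor X F -> P `<=` F -> log_form_stalk dw X S D F w) ->
  log_form_stalk dw X S D P w.
Proof.
move=> cP [[n dn On] [s hs eqs]] hw; have [XP _] := cP.
have n2 : n = 2 by apply: (pdegree_uniq (hp := hp)) => //; apply/(dimension_pdegree hp hperf n hX).
rewrite n2 in On; have [s2 hpb] := smooth_closed_pbasis hperf hX cP hs hdeg On.
have lP := point_local hX XP; have sP := lP.1; have [hb Px Py _] := hpb.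
set x := s`_0 in hpb hb Px; set y := s`_1 in hpb hb Py.
pose e l := `[< exists2 C, S C & local_equation P C (frx x y l) >].
have [m [A hA]] := reconstructs_exists hb.
apply: (frame_log_form_stalk (e := e) hA Px Py) => [l /asboolP //|j].
set z := _ * _; have [->|z0] := eqVneq z 0; first by left.
right=> F pF PF; have [t hF] := dX.2 F pF; have [XF FT Fmax] := pF; have sF := dvr_sr hF.
have [hq eF] := point_sub hX XP XF PF.
pose u l := if e l then 1 else (frx x y l)^-1.
have Pu l g : P g -> P (u l * frD hb l g).
  move=> Pg; rewrite /u /frx /frD; case: (e l); case: (l == ord0); rewrite ?mul1r ?[_^-1 * _]mulrC.
  - exact: (pbasis_pD sP hpb).
  - exact: (pbasis_pD sP hpb).
  - exact: (pbasis_pD1x sP hpb).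
  - exact: (pbasis_pD2y sP hpb).
have Fu l g : F g -> F (u l * frD hb l g).
  by rewrite eF; apply: (der_loc (isder_scale (u l) (frD_der hb l)) sP hq) => g'; exact: Pu.
have Fl l C c : S C -> local_equation F C c -> F (u l * frD hb l c / c).
  move=> SC [FC ec]; have [XC CT _] := hS SC.
  have eC : C = F by have [] := Fmax C XC FC.
  rewrite {C XC CT FC}eC in SC ec.
  have mF : F `&` mideal F = mideal F.
    by apply/seteqP; split=> v; [case|move=> mv; split=> //; exact: midealW mv].
  rewrite /ideal_at mF in ec.
  have [c0 c0s [_ ec0]] := eqs F SC PF.
  have [l0 el0] : exists l0, c0 = frx x y l0.
    move: c0s => /(nthP 0) [n' nn <-]; move: nn; rewrite s2; case: n' => [|[|//]] _.
      by exists ord0.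
    by exists (lift ord0 ord0).
  have e0 : e l0 by apply/asboolP; exists F; rewrite // -el0.
  have mc0 : mideal F c0.
    have : ideal_at P F c0 by rewrite ec0; exists 1; [exact: sr1|rewrite mulr1].
    by case.
  have nz0 : c0 != 0 by rewrite el0; exact: frx_nz hb _.
  have cn0 : c != 0.
    have : principal F c t by rewrite -ec; exact: dvr_mt hF.
    by case=> a _ et; apply: contraNneq (dvr_t0 hF) => c00; rewrite et c00 mul0r.
  have [v Fv ev] : exists2 v, F v & c = c0 * v.
    have : mideal F c by rewrite ec; exists 1; [exact: (sr1 sF)|rewrite mulr1].
    rewrite {1}eF => /(loc_mideal hq) [a [b [[ma Pa] Pb nb ecab]]].
    have : ideal_at P F a by [].
    rewrite ec0 => -[a' Pa' ea]; exists (a' / b); last by rewrite ecab ea mulrA.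
    by rewrite eF; exact: loc_div.
  have [v' Fv' ev'] : principal F c c0 by rewrite -ec.
  have v0 : v != 0 by apply: contraNneq cn0 => v0; rewrite ev v0 mulr0.
  have Fvi : F v^-1.
    have -> : v^-1 = v' by apply: (mulfI v0); rewrite mulfV //; apply: (mulfI nz0); rewrite mulr1 mulrA -ev -ev'.
    exact: Fv'.
  have -> : u l * frD hb l c / c = u l * frD hb l v * v^-1 + u l * (frD hb l c0 / c0).
    rewrite ev (derM (frD_der hb l)); field; by rewrite v0 nz0.
  apply: (srD sF); first by apply: (srM sF) => //; exact: Fu.
  rewrite el0 frD_frx; have [->|ll] := eqVneq l l0; last by rewrite !mul0r mulr0; exact: (sr0 sF).
  rewrite /u e0 mul1r (_ : true%:R = 1) // mul1r divff; [exact: (sr1 sF)|exact: frx_nz hb _].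
have := log_form_stalk_vge hperf hV (A j) pF hF Fu Fl (hw F pF PF); rewrite -/z.
by case=> [/eqP|]; rewrite ?(negbTE z0) // -subr_ge0 opprK.
Qed.

Lemma generic_log_form_stalk w : log_form_stalk dw X S D setT w.
Proof.
have [[c [Xc hc]] _] := dimX; have hc0 := hc 0%N isT; have hc1 := hc 1%N isT.
have pF : prime_divisor X (c 1%N).
  have [e|//|[_ cm]] := point_cases hX dimX (Xc 1%N isT).
    by case: hc1; rewrite e => _ [].
  by have e := cm _ (Xc 0%N isT) hc0.1; case: hc0; rewrite e => _ [].
have [t [s [_ _ [hb _ _ _]]]] := prime_adapted hperf dX hdeg pF.
have [m [A hA]] := reconstructs_exists hb.
apply: (frame_log_form_stalk (e := fun _ => false) hA) => // j.
by right=> F [_ FT _] TF; case: FT; exact: setT_max.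
Qed.

(** Prime divisors are log smooth points, and the conditions at the generic point and at log smooth
    closed points follow from them. The equality of sheaves becomes a comparison divisor by
    divisor. *)
Lemma sections_primes (U : set (set K)) w : U `<=` X ->
  (forall P Q, U P -> X Q -> P `<=` Q -> U Q) ->
  reflexive_log_forms iota dw X S D U w <->
  (forall F, U F -> prime_divisor X F -> log_form_stalk dw X S D F w).
Proof.
move=> UX hU; split=> [hw F UF pF|hw P UP lsP]; first by apply: hw => //; exact: prime_log_smooth.
have XP := UX P UP; have [->|pP|cP] := point_cases hX dimX XP.
- exact: generic_log_form_stalk.
- exact: hw.
- apply: closed_log_form_stalk => // F pF PF; apply: hw => //; have [XF _ _] := pF.
  exact: hU UP XF PF.
Qed.

End Sections.

End CurvesOnSurfaces.

(** * Comparison of the forms on Y and on X *)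

Theorem theorem2 (k K : fieldType) (iota : {rmorphism k -> K}) (p : nat)
    (hp : p \in [pchar k]) (hperf : forall x : k, exists y : k, y ^+ p = x)
    (X : set (set K)) (hX : normal_variety iota X) (hdim : dimension X 2)
    (B : set K -> rat) (hB : Qdivisor X B) (hB0 : effective B)
    (hF : F_pure p X B)
    (D : set K -> int) (hD : Qdivisor X (fun E => (D E)%:~R))
    (Y : set (set K)) (hY : normal_variety iota Y)
    (hf : proper_birational Y X)
    (fD : set K -> rat)
    (hfD : Mumford_pullback iota Y X (fun E => (D E)%:~R) fD)
    (i : nat) (V : lmodType K) (dw : ('I_i -> K) -> V)
    (hV : Kaehler_forms iota dw)
    (U : set (set K)) (hU : Zariski_open X U) (hU0 : U !=set0) :
  reflexive_log_forms iota dw Y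
    (strict_transform Y (floor_components X B) `|` exceptional Y X)
    fD (preimage_open Y U)
  = reflexive_log_forms iota dw X
      (floor_components X B) (fun E => (D E)%:~R) U.
Proof.
have hpK : p \in [pchar K] by rewrite (fmorph_pchar iota).
have [Z [N [[hZ sZ] hZY QN [hND hNE] efD]]] := hfD.
have vX : variety iota X := hX.1; have vY : variety iota Y := hY.1.
have dX := normal_divisorial hX; have dY := normal_divisorial hY.
have hdeg : pdegree hpK 2 by apply/(dimension_pdegree hpK hperf 2 vX).
have hZX := proper_birational_trans hZY hf.
set SX := floor_components X B; set SY := strict_transform Y SX `|` exceptional Y X.
have hSX : SX `<=` prime_divisor X by move=> E [].
have hSY : SY `<=` prime_divisor Y by move=> E [[]|[]].
have UX : U `<=` X := hU.1.
(* Open sets are stable under generization, membership being tested by regularity of finitely many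
   functions. *)
have genU P Q : U P -> X Q -> P `<=` Q -> U Q.
  by move=> UP XQ PQ; have [s hs sU] := hU.2 P UP; apply: sU => // x /hs; exact: PQ.
have genY P Q : preimage_open Y U P -> Y Q -> P `<=` Q -> preimage_open Y U Q.
  move=> [YP [P' UP' dP]] YQ PQ; split=> //; have [Q' XQ' dQ] := hf.1 Q YQ; exists Q' => //.
  apply: (genU P' Q' UP' XQ').
  exact: (sub_center vX (point_local vY YQ) (UX _ UP') XQ' dQ (subset_trans dP.1 PQ)).
have fDN F : prime_divisor Y F -> fD F = N F by move=> pF; rewrite efD /pushforward asboolT.
have YZ F : prime_divisor Y F -> prime_divisor Z F.
  by move=> pF; have [t hF'] := dY.2 F pF; exact: (prime_divisor_lift vY hZ hZY pF hF').
have nexX F Y' : prime_divisor X F -> ~ exceptional Y' X F.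
  by move=> pF [_ h]; have [XF _ _] := pF; apply: (h F XF _ pF); split.
(* A divisor of both X and Y has the same local ring on each, the same coefficient of D, and belongs
   to both boundaries or to neither. *)
have same F w : prime_divisor X F -> prime_divisor Y F ->
    log_form_stalk dw Y SY fD F w <-> log_form_stalk dw X SX (fun E => (D E)%:~R) F w.
  move=> pX pY; have [t [s [hFt us hpb]]] := prime_adapted hperf dX hdeg pX.
  have [hb _ _ _] := hpb; have [n [A hA]] := reconstructs_exists hperf hV hb.
  rewrite (prime_stalkP pY hFt us hpb hSY fD w hA) (prime_stalkP pX hFt us hpb hSX _ w hA).
  have -> : fD F = (D F)%:~R by rewrite fDN // (hND F (YZ F pY) (@nexX F Z pX)).
  suff -> : fru SY F t s = fru SX F t s by [].
  apply/funext => l; rewrite /fru /fre; congr (if _ && _ then _ else _).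
  apply/asboolP/asboolP => [[[]//|e]|SF]; last by left; split.
  by case: (nexX F Y pX).
apply/seteqP; split=> w /= hw.
  (* Restriction from Y to X is a matter of prime divisors of X, all of which are prime divisors of
     Y by properness. *)
  apply/(sections_primes hperf hV dX hdeg hSX _ w UX genU) => F UF pF.
  have [t hFt] := dX.2 F pF; have pY := prime_divisor_lift vX vY hf pF hFt.
  apply/(same F w pF pY).
  have /(sections_primes hperf hV dY hdeg hSY _ w _ genY) h := hw.
  apply: h => //; first by move=> Q [].
  by split; [case: pY|exists F => //; split].
apply/(sections_primes hperf hV dY hdeg hSY _ w _ genY); first by move=> Q [].
have /(sections_primes hperf hV dX hdeg hSX _ w UX genU) {}hw := hw.
move=> F [YF [P UP dP]] pF; have XP := UX P UP.
have [eF|neF] := pselect (exceptional Y X F); last first.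
  have pX := nonexceptional dX vY pF neF; apply/(same F w pX pF); apply: hw => //.
  have [XF _ _] := pX; exact: genU UP XF dP.1.
(* Only exceptional F remain. They are exceptional on the resolution Z as well, where [negativity]
   applies with N F = fD F. *)
have eFZ : exceptional Z X F by split; [exact: YZ|case: eF].
have [P' cP' dP'] := exceptional_center vX hdim hf eF.
have [te hFt] := dY.2 F pF.
have eP : P = P' := center_unique vX (dvr_valuation hFt) XP cP'.1 dP dP'.
rewrite -eP {P' dP' eP} in cP'.
have [te' [se [hFt' us hpb]]] := prime_adapted hperf dY hdeg pF.
have [hb _ _ _] := hpb.
have neg e g : g != 0 -> divisor_stalk X (fun C => (D C * (p ^ e)%N%:Z)%:~R) P g ->
    - ((p ^ e)%N%:R * fD F) <= (ord F g)%:~R :> rat.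
  rewrite (fDN F pF) => g0 hg.
  exact: (negativity hperf hZ sZ hdeg dX hZX cP' QN hND hNE eFZ dP g0 hg).
have [n [A [hA hest]]] := core_estimate hperf hV hb dX hdeg hB0 hB hF cP' hFt' us hpb neg.
have sF := dvr_sr hFt'.
apply/(prime_stalkP pF hFt' us hpb hSY fD w hA) => j.
(* F belongs to the boundary on Y, so every factor [fru] is 1 or the inverse of a unit: here the log
   pole along exceptional divisors is used. *)
apply: (vgeMl hFt').
  apply: (sr_prod sF) => l _; rewrite /fru /fre /frx; case: (A j l == ord0) => /=.
    by rewrite asboolT; [exact: (sr1 sF)|right].
  by case: us.
apply: hest => C pC PC; apply: hw => //; have [XC _ _] := pC.
exact: genU UP XC PC.
Qed.
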